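(* Let $1<p<\infty$ and $|Q|\in L^{p/2}_{\mathrm{loc}}(\Omega)$, and suppose the structural conditions hold with $\gamma,\delta,\psi\in(1,p)$. Assume also that $b,e\in L^{\mathcal B}_{\mathrm{loc}}(\Omega)$ with $\mathcal B>\max\{p'\sigma',\frac{d_0}{p-1}\}$; $h,g\in L^{\mathcal H}_{\mathrm{loc}}(\Omega)$ with $\mathcal H>\frac{d_0}p$, $\mathcal H>\sigma'$; $d,f\in L^{\mathcal D}_{\mathrm{loc}}(\Omega)$ with $\mathcal D>\frac{d_0}p$, $\mathcal D>\sigma'$; and $c\in L^{\mathcal C}_{\mathrm{loc}}(\Omega)$ with $\mathcal C>d_0$ and $\mathcal C>p\sigma'$. Let $r_1:\Omega\to(0,\infty)$ be a function satisfying $r_1\le\min\{R_0,R_1,R_2,1\}$ with the property that given any compact $K\subset\Omega$ there is a positive constant $s_0$ such that $s_0\le r_1(y)\le1$ for every $y\in K$. Then if $(u,\nabla u)\in W^{1,p}_Q(\Omega)$ is a weak solution of $\mathrm{div}(A(x,u,\nabla u))=B(x,u,\nabla u)$ in $\Omega$, $u$ is essentially locally Hölder continuous with respect to $\rho$ in $\Omega$ with exponent $\mu$ that is independent of the weak solution $(u,\nabla u)$; that is, for every compact set $K\subset\Omega$ there are positive constants $C,\mu$, with $\mu$ independent of $(u,\nabla u)$, such that $$\operatorname*{ess\,sup}_{z,x\in K}\frac{|u(z)-u(x)|}{\rho(z,x)^\mu}\le C.$$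
   Context: **Setting.** $\Omega\subset\mathbb{R}^n$ is a bounded domain, $1<p<\infty$, and $Q(x)$ is a measurable, symmetric, nonnegative definite $n\times n$ matrix function on $\Omega$ with $|Q|\in L^{p/2}_{\mathrm{loc}}(\Omega)$. Primes denote dual exponents. $|E|$ is Lebesgue measure, $\fint_E f=\frac1{|E|}\int_E f\,dx$. $Lip_0(U)$ is the set of Lipschitz functions with compact support in $U$. **Quasimetric.** $\rho:\Omega\times\Omega\to[0,\infty)$ is symmetric, $\rho(x,y)=0$ iff $x=y$, and $\rho(x,y)\le\kappa[\rho(x,z)+\rho(y,z)]$ for all $x,y,z$, with a constant $\kappa\ge1$. $B(x,r)=\{y\in\Omega:\rho(x,y)<r\}$. All balls $B(x,r)$ are open in the Euclidean topology, and for every $x\in\Omega$, $|x-y|\to0$ if $\rho(x,y)\to0$. $R_0:\Omega\to(0,\infty)$ is a function such that the Euclidean closure of $B(x,r)$ is contained in $\Omega$ for $0<r<R_0(x)$ (such a function exists). **Doubling.** $(\Omega,\rho,dx)$ is a local homogeneous space: there are constants $C_0,d_0>0$ and $R_1:\Omega\to(0,\infty)$ such that $|B(x,r)|\le C_0(r/t)^{d_0}|B(y,t)|$ whenever $x,y\in\Omega$, $0<t\le r<R_1(x)$ and $B(y,t)\cap B(x,r)\neq\emptyset$. **Sobolev spaces.** For open $U\subset\Omega$, $W^{1,p}_Q(U)$ is the completion of the locally Lipschitz functions on $U$ with finite norm $\|u\|_{W^{1,p}_Q(U)}=(\int_U|u|^p+\int_U|\sqrt Q\nabla u|^p)^{1/p}$,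 identified with the set of pairs $(u,\nabla u)$ ($\nabla u$ denotes the second component, not necessarily determined by $u$) for which there are such functions $u_k$ with $u_k\to u$ in $L^p(U)$ and $\int_U|\sqrt Q(\nabla u_k-\nabla u)|^p\to0$. $(W^{1,p}_Q)_0(U)$ is defined in the same way using Lipschitz functions with compact support in $U$. **Analytic assumptions.** There is $R_2:\Omega\to(0,\infty)$ such that for every ball $B(y,r)$ with $0<r<R_2(y)$ the following hold. (a) Sobolev: with constants $C_1>0$, $\sigma>1$, $\big(\fint_{B(y,r)}|w|^{p\sigma}\big)^{1/(p\sigma)}\le C_1\big[r\big(\fint_{B(y,r)}|\sqrt Q\nabla w|^p\big)^{1/p}+\big(\fint_{B(y,r)}|w|^p\big)^{1/p}\big]$ for all $(w,\nabla w)\in(W^{1,p}_Q)_0(B(y,r))$. (b) Poincaré: with constants $C_2>0$, $\mathfrak{b}\ge1$, $\fint_{B(y,r)}|w-w_{B(y,r)}|\le C_2r\big(\fint_{B(y,\mathfrak{b}r)}|\sqrt Q\nabla w|^p\big)^{1/p}$ for all $(w,\nabla w)\in W^{1,p}_Q(\Omega)$, where $w_{B(y,r)}=\fint_{B(y,r)}w$. (c) Cutoffs: with positive constants $s^*,C_{s^*},\tau,N$, where $p\sigma'<s^*\le\infty$ and $\tau<1$, there are Lipschitz functions $\{\eta_j\}_{j\ge1}$ with $\mathrm{supp}\,\eta_1\subset B(y,r)$, and for all $j$: $0\le\eta_j\le1$, $\eta_j=1$ on $B(y,\tau r)$, $\mathrm{supp}\,\eta_{j+1}\subset\{x\in B(y,r):\eta_j(x)=1\}$,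 and $\big(\fint_{B(y,r)}|\sqrt Q\nabla\eta_j|^{s^*}\big)^{1/s^*}\le C_{s^*}N^j/r$. (d) For some $t\in[1,\infty]$ (independent of the ball) there is $C_3=C_3(B(y,r))>0$ with $\big(\int_{B(y,r)}|\sqrt Q\nabla\eta|^{pt}\big)^{1/(pt)}<\infty$ for all $\eta\in\{\eta_j\}$ and $\big(\int_{B(y,r)}|f|^{pt'}\big)^{1/(pt')}\le C_3\|f\|_{W^{1,p}_Q(\Omega)}$ for all $f\in Lip_{\mathrm{loc}}(\Omega)$ (essential suprema if an exponent is infinite). **Structural conditions** (exponents $\gamma,\psi,\delta>1$). There are a constant $a>1$, nonnegative measurable functions $b,c,d,e,f,g,h$ on $\Omega$ and a vector $\tilde A(x,z,\xi)\in\mathbb{R}^n$ such that for a.e. $x\in\Omega$ and all $(z,\xi)\in\mathbb{R}\times\mathbb{R}^n$: $A(x,z,\xi)=\sqrt{Q(x)}\tilde A(x,z,\xi)$; $\xi\cdot A(x,z,\xi)\ge a^{-1}|\sqrt{Q(x)}\xi|^p-h(x)|z|^\gamma-g(x)$; $|\tilde A(x,z,\xi)|\le a|\sqrt{Q(x)}\xi|^{p-1}+b(x)|z|^{\gamma-1}+e(x)$; $|B(x,z,\xi)|\le c(x)|\sqrt{Q(x)}\xi|^{\psi-1}+d(x)|z|^{\delta-1}+f(x)$. Standing minimal integrability: $c\in L_{\mathrm{loc}}^{\sigma p/(\sigma p-1-\sigma(\psi-1))}(\Omega)$, $e\in L^{p'}_{\mathrm{loc}}(\Omega)$, $f\in L^{(\sigma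 p)'}_{\mathrm{loc}}(\Omega)$, $b\in L_{\mathrm{loc}}^{\sigma p/(\sigma(p-1)-\gamma+1)}(\Omega)$, $d\in L_{\mathrm{loc}}^{p\sigma/(p\sigma-\delta)}(\Omega)$. **Weak solution.** $(u,\nabla u)\in W^{1,p}_Q(\Omega)$ is a weak solution of $\mathrm{div}(A(x,u,\nabla u))=B(x,u,\nabla u)$ in $\Omega$ if $\int_\Omega[\nabla\varphi\cdot A(x,u,\nabla u)+\varphi B(x,u,\nabla u)]\,dx=0$ for every nonnegative $\varphi\in Lip_0(\Omega)$. *)

(* Defs.v *)
From HB Require Import structures.
From mathcomp Require Import all_boot all_order all_algebra.
From mathcomp Require Import all_classical all_reals all_analysis.
From mathcomp Require Import ess_sup_inf.

Set Implicit Arguments.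
Unset Strict Implicit.
Unset Printing Implicit Defensive.

Import Order.TTheory GRing.Theory Num.Def Num.Theory.
Import numFieldNormedType.Exports.

Local Open Scope classical_set_scope.
Local Open Scope ring_scope.

(* Points of R^N, N >= 1, are row vectors 'rV[R]_n.+1. The library norm on them
   is the sup norm: it is used only for the topology, for boundedness and for
   "Lipschitz with some constant", where it may replace the Euclidean norm. *)

Section lebesgue_measure_Rn.
Context {R : realType} {n : nat}.
Local Open Scope ereal_scope.
Implicit Types X : set 'rV[R]_n.+1.

Definition box (ab : 'rV[R]_n.+1 * 'rV[R]_n.+1) : set 'rV[R]_n.+1 :=
  [set x | forall i, (ab.1 ord0 i < x ord0 i <= ab.2 ord0 i)%R].

Definition box_vol (ab : 'rV[R]_n.+1 * 'rV[R]_n.+1) : \bar R :=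
  (\prod_i maxr 0 (ab.2 ord0 i - ab.1 ord0 i))%R%:E.

Definition box_cover X : set (('rV[R]_n.+1 * 'rV[R]_n.+1)^nat) :=
  [set F | X `<=` \bigcup_k box (F k)].

Definition lebesgue_outer X : \bar R :=
  ereal_inf [set \sum_(k <oo) box_vol (F k) | F in box_cover X].

Lemma box_vol_ge0 ab : 0 <= box_vol ab.
Proof. by rewrite lee_fin prodr_ge0// => i _; rewrite le_max lexx. Qed.

Lemma lebesgue_outer_ge0 X : 0 <= lebesgue_outer X.
Proof.
by apply: le_ereal_inf_tmp => x [F _ <-]; apply: nneseries_ge0 => k _ _;
  exact: box_vol_ge0.
Qed.

Lemma lebesgue_outer0 : lebesgue_outer set0 = 0.
Proof.
apply/eqP; rewrite eq_le lebesgue_outer_ge0 andbT.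
apply: ereal_inf_lbound; exists (fun=> (0%R, 0%R)) => //.
apply: eseries0 => k _ _; rewrite /box_vol big_ord_recl /= subrr.
by rewrite /maxr ltxx mul0r.
Qed.

Lemma le_lebesgue_outer : {homo lebesgue_outer : A B / A `<=` B >-> A <= B}.
Proof.
move=> A B AB; apply/ereal_inf_le_tmp => x [F BF <-].
by exists F => //; exact: subset_trans AB BF.
Qed.

Lemma lebesgue_outer_sigma_subadditive : sigma_subadditive lebesgue_outer.
Proof.
move=> A; have [[i ioo]|] := pselect (exists i, lebesgue_outer (A i) = +oo).
  rewrite (eseries_pinfty _ _ ioo) ?leey// => k _.
  by rewrite -ltNye (lt_le_trans _ (lebesgue_outer_ge0 _)).
rewrite -forallNE => Aoo.
suff add2e (e : {posnum R}) :
    lebesgue_outer (\bigcup_k A k) <=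
    \sum_(i <oo) lebesgue_outer (A i) + e%:num%:E.
  by apply/lee_addgt0Pr => _/posnumP[].
rewrite (le_trans _ (epsilon_trick _ _ _))//; last first.
  by move=> k; exact: lebesgue_outer_ge0.
pose P k (F : ('rV[R]_n.+1 * 'rV[R]_n.+1)^nat) := box_cover (A k) F /\
  \sum_(j <oo) box_vol (F j) <=
    lebesgue_outer (A k) + (e%:num / (2 ^ k.+1)%:R)%:E.
have [G PG] : {G : (('rV[R]_n.+1 * 'rV[R]_n.+1)^nat)^nat & forall k, P k (G k)}.
  apply: (@choice _ _ P) => k; rewrite /P /lebesgue_outer.
  set S := (X in ereal_inf X); move infS : (ereal_inf S) => iS.
  case: iS infS => [r Sr|Soo|Soo].
  - have en1 : (0 < e%:num / (2 ^ k.+1)%:R)%R by [].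
    have /(lb_ereal_inf_adherent en1) : ereal_inf S \is a fin_num by rewrite Sr.
    move=> [x [B AnB muBx] xS].
    by exists B; split => //; rewrite muBx -Sr; exact/ltW.
  - by have := Aoo k; rewrite /lebesgue_outer Soo.
  - suff : lbound S 0 by move/le_ereal_inf_tmp; rewrite Soo.
    by move=> /= _ [B AnB <-]; apply: nneseries_ge0 => *; exact: box_vol_ge0.
have muG_ge0 x : 0 <= (box_vol \o uncurry G) x by exact: box_vol_ge0.
apply: (@le_trans _ _ (\esum_(i in setT) (box_vol \o uncurry G) i)).
  rewrite /lebesgue_outer; apply: ereal_inf_lbound => /=.
  have /card_esym/ppcard_eqP[f] := card_nat2.
  exists (uncurry G \o f).
    apply: (@subset_trans _ (\bigcup_k \bigcup_j box (G k j))) => [t [i _]|].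
      by move=> /((PG i).1) -[j _ ?]; exists i => //; exists j.
    move=> t [i _ [j _ Bijt]]; exists (f^-1%FUN (i, j)) => //=.
    by rewrite invK ?inE.
  rewrite -(esum_pred_image (box_vol \o uncurry G) _ xpredT) ?[fun=> _]set_true//.
  by rewrite image_eq.
rewrite (_ : esum _ _ = \sum_(i <oo) \sum_(j <oo ) box_vol (G i j)); last first.
  pose J : nat -> set (nat * nat) := fun i => [set (i, j) | j in setT].
  rewrite (_ : setT = \bigcup_k J k); last first.
    by rewrite predeqE => -[a b]; split => // _; exists a => //; exists b.
  rewrite esum_bigcupT /=; last 2 first.
    - apply/trivIsetP => i j _ _ ij.
      rewrite predeqE => -[k m] /=; split => //= -[] [_] _ [<-{k} _].
      by move=> [m' _] [] /esym/eqP; rewrite (negbTE ij).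
    - by move=> /= [k m]; exact: box_vol_ge0.
  rewrite -(image_id [set: nat]) -fun_true esum_pred_image//; last first.
    by move=> k _; apply: esum_ge0 => *; exact: box_vol_ge0.
  apply: eq_eseriesr => /= j _.
  rewrite -(esum_pred_image (box_vol \o uncurry G) (pair j) predT)//=; first last.
  - by move=> ? ? _ _; exact: (@can_inj _ _ _ snd).
  - by move=> *; exact: box_vol_ge0.
  by congr esum; rewrite predeqE => -[a b]; split; move=> [i _ <-]; exists i.
apply: lee_lim.
- apply: is_cvg_nneseries => k *.
  by apply: nneseries_ge0 => m *; exact: (muG_ge0 (k, m)).
- apply: is_cvg_nneseries => k *; apply: adde_ge0 => //.
  by apply: lebesgue_outer_ge0.
- by near=> k; apply: lee_sum => i _; exact: (PG i).2.
Unshelve. all: by end_near. Qed.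

HB.instance Definition _ := isOuterMeasure.Build R 'rV[R]_n.+1 lebesgue_outer
  lebesgue_outer0 lebesgue_outer_ge0 le_lebesgue_outer
  lebesgue_outer_sigma_subadditive.

End lebesgue_measure_Rn.

Definition leb_outer (R : realType) (n : nat) :
  {outer_measure set 'rV[R]_n.+1 -> \bar R} := @lebesgue_outer R n.

(* R^N with its Lebesgue measurable sets; convertible to 'rV[R]_n.+1 *)
Notation lebT R n := (caratheodory_type (leb_outer R n)).

Definition leb {R : realType} {n : nat} : {measure set (lebT R n) -> \bar R} :=
  leb_outer R n : set (lebT R n) -> \bar R.

Section euclidean.
Context {R : realType} {n : nat}.
Local Notation V := 'rV[R]_n.+1.
Local Notation M := 'M[R]_n.+1.
Implicit Types (u v : V) (S Q : M).

Definition dotv u v : R := \sum_i u ord0 i * v ord0 i.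

Definition enorm v : R := Num.sqrt (dotv v v).

Definition sym_nonneg S : Prop := S^T = S /\ forall v, 0 <= dotv (v *m S) v.

(* The unique symmetric nonnegative definite square root, when Q is symmetric
   and nonnegative definite. Being symmetric, it acts on vectors by v *m S. *)
Definition sqrtmx Q : M := xget 0 [set S | sym_nonneg S /\ S *m S = Q].

Definition opnorm Q : R :=
  sup [set enorm (v *m Q) | v in [set v | enorm v <= 1]].

(* For a locally Lipschitz f, defined a.e. by Rademacher's theorem; the total
   operator 'D takes an irrelevant value where f is not differentiable. *)
Definition grad (f : V -> R) (x : V) : V :=
  \row_i 'D_(delta_mx ord0 i) f x.

Definition tsupp (f : V -> R) : set V := closure [set x | f x != 0].

Definition Lip_loc (U : set V) : set (V -> R) :=
  [set f | [locally [lipschitz f x | x in U]]].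

(* Elements are extended by zero outside U; the extension stays Lipschitz. *)
Definition Lip_0 (U : set V) : set (V -> R) :=
  [set f | [/\ lipschitz f, compact (tsupp f) & tsupp f `<=` U]].

Definition domain (U : set V) : Prop := [/\ open U, connected U & U !=set0].

End euclidean.

Definition dual_exp {R : realType} (p : R) : R := p / (p - 1).

Section norms.
Context {R : realType} {n : nat}.
Local Notation V := 'rV[R]_n.+1.
Implicit Types (E U Omega : set V) (f u : V -> R) (v : V -> V).
Implicit Type Q : V -> 'M[R]_n.+1.

Definition meas_on E f : Prop :=
  measurable_fun (E : set (lebT R n)) (f : lebT R n -> R).

Definition nonneg_meas E f : Prop := meas_on E f /\ forall x, E x -> 0 <= f x.

Definition Lnorm_on E (q : \bar R) f : \bar R :=
  Lnorm (@leb R n) q ((EFin \o f) \_ E).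

Definition L_loc Omega (q : \bar R) f : Prop :=
  meas_on Omega f /\
  forall K, compact K -> K `<=` Omega -> (Lnorm_on K q f < +oo)%E.

Definition avg E f : R :=
  (fine (leb E))^-1 * \int[@leb R n]_(x in (E : set (lebT R n))) f x.

(* the L^q norm on E for the normalized measure dx / |E| *)
Definition Lavg E (q : \bar R) f : \bar R :=
  match q with
  | r%:E => (((fine (leb E))^-1)%:E *
      \int[@leb R n]_(x in (E : set (lebT R n))) (`|f x| `^ r)%:E) `^ r^-1
  | _ => Lnorm_on E q f
  end%E.

Definition Qlen Q v (x : V) : R := enorm (v x *m sqrtmx (Q x)).

Definition WQnorm Q (p : R) U u v : \bar R :=
  ((\int[@leb R n]_(x in (U : set (lebT R n))) (`|u x| `^ p)%:E +
    \int[@leb R n]_(x in (U : set (lebT R n))) (Qlen Q v x `^ p)%:E)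
   `^ p^-1)%E.

(* (u, v) is a limit in the W^{1,p}_Q(U)-norm of pairs (u_k, grad u_k) with
   u_k in the class D *)
Definition WQ_closure (D : set (V -> R)) Q (p : R) U u v : Prop :=
  [/\ meas_on U u, (forall i, meas_on U (fun x => v x ord0 i)) &
   exists u_ : nat -> V -> R,
   [/\ (forall k, D (u_ k)),
       (forall k, (WQnorm Q p U (u_ k) (grad (u_ k)) < +oo)%E),
       Lnorm_on U p%:E (fun x => u_ k x - u x) @[k --> \oo] --> 0%E &
       (\int[@leb R n]_(x in (U : set (lebT R n)))
          (Qlen Q (fun y => grad (u_ k) y - v y) x `^ p)%:E)%E
         @[k --> \oo] --> 0%E]].

Definition WQ Q p U u v : Prop := WQ_closure (Lip_loc U) Q p U u v.

Definition WQ_0 Q p U u v : Prop := WQ_closure (Lip_0 U) Q p U u v.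

End norms.

Section quasimetric.
Context {R : realType} {n : nat}.
Local Notation V := 'rV[R]_n.+1.
Variables (Omega : set V) (rho : V -> V -> R).

Definition quasimetric (kappa : R) : Prop :=
  1 <= kappa /\
  forall x y, Omega x -> Omega y ->
    [/\ 0 <= rho x y, rho x y = rho y x, (rho x y = 0 <-> x = y) &
     forall z, Omega z -> rho x y <= kappa * (rho x z + rho y z)].

Definition qball (x : V) (r : R) : set V := [set y | Omega y /\ rho x y < r].

Definition qballs_open : Prop := forall (x : V) (r : R), Omega x -> open (qball x r).

Definition rho_controls_euclidean : Prop :=
  forall x, Omega x -> forall eps : R, 0 < eps -> exists2 dl : R, 0 < dl &
    forall y, Omega y -> rho x y < dl -> enorm (x - y) < eps.

Definition qballs_inside (R0 : V -> R) : Prop :=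
  forall (x : V) (r : R), Omega x -> 0 < r -> r < R0 x -> closure (qball x r) `<=` Omega.

Definition local_doubling (C0 d0 : R) (R1 : V -> R) : Prop :=
  forall (x y : V) (r t : R), Omega x -> Omega y -> 0 < t -> t <= r -> r < R1 x ->
    (qball y t `&` qball x r) !=set0 ->
    (leb (qball x r) <= (C0 * (r / t) `^ d0)%:E * leb (qball y t))%E.

Variables (Q : V -> 'M[R]_n.+1) (p : R) (R2 : V -> R).

Definition sobolev (C1 sigma : R) : Prop :=
  forall (y : V) (r : R), Omega y -> 0 < r -> r < R2 y ->
  forall w gw, WQ_0 Q p (qball y r) w gw ->
    (Lavg (qball y r) (p * sigma)%:E w <=
     C1%:E * (r%:E * Lavg (qball y r) p%:E (Qlen Q gw) +
              Lavg (qball y r) p%:E w))%E.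

Definition poincare (C2 bfr : R) : Prop :=
  forall (y : V) (r : R), Omega y -> 0 < r -> r < R2 y ->
  forall w gw, WQ Q p Omega w gw ->
    (Lavg (qball y r) 1 (fun x => (w x - avg (qball y r) w)%R) <=
     (C2 * r)%:E * Lavg (qball y (bfr * r)) p%:E (Qlen Q gw))%E.

Definition cutoff_sequence (sstar : \bar R) (Cs tau N : R)
    (y : V) (r : R) (eta : nat -> V -> R) : Prop :=
  tsupp (eta 1) `<=` qball y r /\
  forall j, (1 <= j)%N ->
    [/\ lipschitz (eta j),
        (forall x, 0 <= eta j x <= 1),
        (forall x, qball y (tau * r) x -> eta j x = 1),
        tsupp (eta j.+1) `<=` [set x | qball y r x /\ eta j x = 1] &
        (Lavg (qball y r) sstar (Qlen Q (grad (eta j))) <=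
         (Cs * N ^+ j / r)%:E)%E].

(* The same eta_j serve for the cutoff estimates and for the L^{pt}
   integrability of sqrt(Q) grad(eta_j); t = +oo and t = 1 are allowed, with
   'hoelder_conjugate' exchanging them. *)
Definition cutoffs (sstar : \bar R) (Cs tau N : R) (t : \bar R) : Prop :=
  forall (y : V) (r : R), Omega y -> 0 < r -> r < R2 y ->
    (exists2 eta, cutoff_sequence sstar Cs tau N y r eta &
       forall j, (1 <= j)%N ->
         (Lnorm_on (qball y r) (p%:E * t) (Qlen Q (grad (eta j))) < +oo)%E) /\
    (exists2 C3 : R, 0 < C3 & forall f, Lip_loc Omega f ->
       (Lnorm_on (qball y r) (p%:E * hoelder_conjugate t) f <=
        C3%:E * WQnorm Q p Omega f (grad f))%E).

End quasimetric.

Section equation.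
Context {R : realType} {n : nat}.
Local Notation V := 'rV[R]_n.+1.
Variables (Omega : set V) (Q : V -> 'M[R]_n.+1) (p : R).
Variables (A : V -> R -> V -> V) (B : V -> R -> V -> R).

Definition structural (gam psi del a : R) (At : V -> R -> V -> V)
    (b c d e f g h : V -> R) : Prop :=
  \forall x \ae (@leb R n), Omega x -> forall (z : R) (xi : V),
    [/\ A x z xi = At x z xi *m sqrtmx (Q x),
        a^-1 * enorm (xi *m sqrtmx (Q x)) `^ p - h x * `|z| `^ gam - g x
          <= dotv xi (A x z xi),
        enorm (At x z xi)
          <= a * enorm (xi *m sqrtmx (Q x)) `^ (p - 1)
             + b x * `|z| `^ (gam - 1) + e x &
        `|B x z xi|
          <= c x * enorm (xi *m sqrtmx (Q x)) `^ (psi - 1)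
             + d x * `|z| `^ (del - 1) + f x].

(* No regularity of A and B is assumed beyond the structural bounds, so the
   existence of the integral is part of the definition. *)
Definition weak_solution (u : V -> R) (gu : V -> V) : Prop :=
  WQ Q p Omega u gu /\
  forall phi : V -> R, Lip_0 Omega phi -> (forall x, 0 <= phi x) ->
    let F := fun x : lebT R n =>
      (dotv (grad phi x) (A x (u x) (gu x)) + phi x * B x (u x) (gu x))%:E in
    (@leb R n).-integrable (Omega : set (lebT R n)) F /\
    (\int[@leb R n]_(x in (Omega : set (lebT R n))) F x)%E = 0%E.

End equation.

(* ess sup over (z, x) in K * K of |u(z) - u(x)| / rho(z, x)^mu, for the
   Lebesgue measure of R^{2N}; w = (z, x) is a row vector made of two blocks.
   The diagonal, where the quotient is 0 / 0, is a null set; outside K * K the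
   function is set to 0. *)
Definition ess_holder_seminorm {R : realType} {n : nat}
    (rho : 'rV[R]_n.+1 -> 'rV[R]_n.+1 -> R) (K : set 'rV[R]_n.+1) (mu : R)
    (u : 'rV[R]_n.+1 -> R) : \bar R :=
  ess_sup (@leb R (n + n.+1))
    ((fun w : 'rV[R]_(n.+1 + n.+1) =>
        (`|u (lsubmx w) - u (rsubmx w)| / rho (lsubmx w) (rsubmx w) `^ mu)%:E)
     \_ [set w | K (lsubmx w) /\ K (rsubmx w)]).

(* Main.v *)
(* The equation is used only through two Caccioppoli inequalities, for the truncations (u - k)_+ and for the logarithm
   of the gap M - u to an upper bound; since gamma, delta, psi < p, every lower-order term is dominated by
   Psi (1 + |u|)^p with Psi = 1 + h + g + b^p' + e^p' + c^p + d + f, and Psi lies locally in L^q for some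
   q > max(sigma', d0 / p). De Giorgi's iteration, run on level sets with the given cutoffs and the Sobolev inequality,
   bounds u locally and turns smallness of a superlevel set into a pointwise bound on a smaller ball. The logarithmic
   estimate and the Poincare inequality produce that smallness whenever u stays below the middle of its range on half of
   a ball, so the oscillation of u (or of -u, which solves an equation of the same kind) decreases by a fixed factor
   when the radius does; q > d0 / p and doubling keep the contribution of Psi negligible along this induction. The
   resulting decay on countably many balls gives the Hoelder bound off a null set. Test functions are eta^m G(u_k) with u_k
   locally Lipschitz approximations of u, which avoids any chain rule in the completed Sobolev space. *)

Require Import Defs.
From HB Require Import structures.
From mathcomp Require Import all_boot all_order all_algebra.
From mathcomp Require Import complex.
From mathcomp Require Import all_classical all_reals all_analysis.
From mathcomp Require Import ess_sup_inf measurable_realfun.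
From mathcomp Require Import ring lra.

Set Implicit Arguments.
Unset Strict Implicit.
Unset Printing Implicit Defensive.

Import Order.TTheory GRing.Theory Num.Def Num.Theory.
Import numFieldNormedType.Exports.

Local Open Scope classical_set_scope.
Local Open Scope ring_scope.

(** * Lebesgue measure on R^N *)

(** What shapes the argument: a solution is only known to lie in L^p, so the integrability of Psi (1
    + |u|)^p, without which testing the equation gives nothing, has to be earned. The assumption
    pairing L^{pt} for cutoff gradients with L^{pt'} for functions lets the Sobolev inequality act
    on eta_1 times the positive and negative parts of u; hence u is in L^{p sigma} where eta_1 = 1,
    and all later testing takes place there with eta_2, eta_3 and so on. The exponent q for Psi and
    for the cutoff gradients exceeds sigma', so its conjugate th lies below sigma, and the gap
    between th and sigma is what makes the iteration superlinear. One iteration lemma, scaled by a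
    height H, is used twice: H large gives the local bound, H a small fraction of the oscillation
    gives the decay. There the bound for 1 + |u| and the oscillation enter only through their ratio,
    which is why the starting radius and the exponent do not depend on the solution. Lebesgue
    measure being an outer measure defined by box covers, measurability and null sets are handled by
    covers, rational boxes and translation invariance. *)

Lemma bigcup_countType {S : Type} (I : countType) (P : set I) (F : I -> set S) :
  \bigcup_(i in P) F i = \bigcup_k (if unpickle k is Some i then
     (if `[< P i >] then F i else set0) else set0).
Proof.
apply/seteqP; split => [x [i Pi Fx]|x [k _]].
  by exists (pickle i) => //; rewrite pickleK; case: asboolP.
by case: unpickle => // i; case: asboolP => // Pi Fx; exists i.
Qed.

Lemma bigcup_countType_measurable {d} {S : measurableType d} (I : countType)
    (P : set I) (F : I -> set S) :
  (forall i, P i -> measurable (F i)) -> measurable (\bigcup_(i in P) F i).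
Proof.
move=> mF; rewrite bigcup_countType; apply: bigcup_measurable => k _.
by case: unpickle => // i; case: asboolP => // Pi; exact: mF.
Qed.

Section lebesgue_Rn.
Context {R : realType} {n : nat}.
Local Notation V := 'rV[R]_n.+1.
Local Notation T := (lebT R n).
Local Notation mu := (@leb R n).

Definition upd (i : 'I_n.+1) (c : R) (v : V) : V :=
  \row_j (if j == i then c else v ord0 j).

Lemma box_vol_split (ab : V * V) (i : 'I_n.+1) (c : R) :
  (box_vol (ab.1, upd i (Num.min (ab.2 ord0 i) c) ab.2) +
   box_vol (upd i (Num.max (ab.1 ord0 i) c) ab.1, ab.2))%E = box_vol ab.
Proof.
rewrite /box_vol /= -EFinD; congr EFin.
rewrite [in LHS](bigD1 i)//= [X in _ + X](bigD1 i)//= [in RHS](bigD1 i)//=.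
rewrite !mxE eqxx.
set P := \prod_(j | j != i) maxr 0 (ab.2 ord0 j - ab.1 ord0 j).
have -> : \prod_(j | j != i) maxr 0
  (upd i (minr (ab.2 ord0 i) c) ab.2 ord0 j - ab.1 ord0 j) = P.
  by apply: eq_bigr => j /negPf ji; rewrite mxE ji.
have -> : \prod_(j | j != i) maxr 0
  (ab.2 ord0 j - upd i (maxr (ab.1 ord0 i) c) ab.1 ord0 j) = P.
  by apply: eq_bigr => j /negPf ji; rewrite mxE ji.
rewrite -mulrDl; congr (_ * _).
by rewrite /Num.min /Num.max; repeat case: ifPn; rewrite -?leNgt => *; lra.
Qed.

(** Caratheodory's criterion holds because the hyperplane cuts each box of a cover in two: the
    pieces cover the two parts of [X], and their volumes add up to the old ones. A box missed by the
    hyperplane yields a piece of volume 0. *)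
Lemma measurable_halfspace (i : 'I_n.+1) (c : R) :
  measurable ([set x | x ord0 i <= c] : set T).
Proof.
apply: le_caratheodory_measurable => X /=.
apply: le_ereal_inf_tmp => _ [F XF <-].
pose F1 k := ((F k).1, upd i (Num.min ((F k).2 ord0 i) c) (F k).2).
pose F2 k := (upd i (Num.max ((F k).1 ord0 i) c) (F k).1, (F k).2).
have -> : (\sum_(k <oo) box_vol (F k) =
  \sum_(k <oo) box_vol (F1 k) + \sum_(k <oo) box_vol (F2 k))%E.
  rewrite -nneseriesD; [|by move=> *; exact: box_vol_ge0..].
  by apply: eq_eseriesr => k _; rewrite box_vol_split.
apply: leeD; apply: ereal_inf_lbound.
- exists F1 => // x [/XF[k _ kx] xc]; exists k => // j.
  have /andP[h1 h2] := kx j; rewrite /= mxE; case: eqP => [->|_]; last by rewrite h1 h2.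
  by have /andP[-> h2'] := kx i; rewrite le_min h2' xc.
- exists F2 => // x [/XF[k _ kx] /= /negP xc]; exists k => // j.
  have /andP[h1 h2] := kx j; rewrite /= mxE; case: eqP => [->|_]; last by rewrite h1 h2.
  by have /andP[h1' ->] := kx i; rewrite gt_max h1' ltNge xc.
Qed.

Lemma measurable_coord (i : 'I_n.+1) (D : set T) : measurable D ->
  measurable_fun D (fun x : T => (x : V) ord0 i).
Proof.
move=> mD; apply: (measurability _ (RGenOInfty.measurableE R)) => _ [_ [c ->] <-].
apply: measurableI => //.
rewrite (_ : _ @^-1` _ = ~` [set x : V | x ord0 i <= c]); last first.
  by apply/seteqP; split => x /=; rewrite in_itv /= andbT ltNge => /negP.
exact/measurableC/measurable_halfspace.
Qed.

Lemma measurable_bx (ab : V * V) : measurable (box ab : set T).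
Proof.
rewrite (_ : box ab = \bigcap_(i in [set: 'I_n.+1])
   (([set x : V | x ord0 i <= ab.2 ord0 i]) `&` ~` [set x : V | x ord0 i <= ab.1 ord0 i])).
  apply: fin_bigcap_measurable => // i _.
  by apply: measurableI; [|apply: measurableC]; exact: measurable_halfspace.
apply/seteqP; split => [x h i _|x h i] /=.
  by have /andP[h1 h2] := h i; split => //=; apply/negP; rewrite -ltNge.
by have [/= -> /negP] := h i I; rewrite -ltNge => ->.
Qed.

Definition rbox (q : 'rV[rat]_n.+1 * 'rV[rat]_n.+1) : V * V :=
  (map_mx ratr q.1, map_mx ratr q.2).

(** Rational boxes form a countable base; through them every statement on open sets reduces to
    countably many boxes, whose measurability comes from half-spaces. *)
Lemma rbox_nbhs (x : V) (U : set V) : nbhs x U ->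
  exists q, box (rbox q) x /\ box (rbox q) `<=` U.
Proof.
move=> /nbhs_ballP[e /= e0 eU].
have h i : exists q : rat * rat,
    x ord0 i - e < ratr q.1 < x ord0 i /\ x ord0 i < ratr q.2 < x ord0 i + e.
  have [|q1 /itvP q1h] := @rat_in_itvoo R (x ord0 i - e) (x ord0 i); first lra.
  have [|q2 /itvP q2h] := @rat_in_itvoo R (x ord0 i) (x ord0 i + e); first lra.
  by exists (q1, q2); rewrite /= !q1h !q2h.
have [q qh] := choice h.
exists (\row_i (q i).1, \row_i (q i).2); split => [i|y yh] /=.
  by rewrite !mxE; have [/andP[_ ->] /andP[/ltW -> _]] := qh i.
apply: eU; split=> // i j; rewrite (ord1 i) /ball /= ltr_distl.
have := yh j; rewrite /= !mxE => /andP[h1 h2].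
by have [/andP[h3 h4] /andP[h5 h6]] := qh j; apply/andP; split; lra.
Qed.

Lemma open_rbox (U : set V) : open U ->
  U = \bigcup_(q in [set q | box (rbox q) `<=` U]) box (rbox q).
Proof.
move=> oU; apply/seteqP; split => [x Ux|x [q /= + xq]]; last exact.
have /rbox_nbhs[q [xq qU]] : nbhs x U by apply: open_nbhs_nbhs.
by exists q.
Qed.

Lemma open_measurable_Rn (U : set V) : open U -> measurable (U : set T).
Proof.
move=> /open_rbox ->; apply: bigcup_countType_measurable => q _.
exact: measurable_bx.
Qed.

Lemma closed_measurable_Rn (U : set V) : closed U -> measurable (U : set T).
Proof.
by move=> cU; rewrite -[U]setCK; apply: measurableC; apply: open_measurable_Rn;
  rewrite openC.
Qed.

Lemma compact_measurable_Rn (K : set V) : compact K -> measurable (K : set T).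
Proof. by move=> cK; apply: closed_measurable_Rn; apply: compact_closed. Qed.

Lemma continuous_measurable_Rn (D : set V) (f : V -> R) : open D ->
  (forall x, D x -> {for x, continuous f}) -> meas_on D f.
Proof.
move=> oD cf; rewrite /meas_on.
apply: (measurability _ (RGenOpens.measurableE R)) => _ [_ [a [b ->] <-]].
apply: open_measurable_Rn; rewrite openE => x [Dx fx].
apply: filterI; first exact: open_nbhs_nbhs.
by apply: cf => //; apply: open_nbhs_nbhs; split.
Qed.

Lemma leb_translate (v : V) (E : set V) :
  lebesgue_outer [set x | E (x + v)] = lebesgue_outer E.
Proof.
suff le (w : V) (X : set V) : (lebesgue_outer [set x : V | X (x + w)%R] <= lebesgue_outer X)%E.
  apply/eqP; rewrite eq_le le /=.
  rewrite -[X in (lebesgue_outer X <= _)%E](_ : [set x | [set x | E (x + v)] (x + - v)] = E).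
    exact: le.
  by apply/seteqP; split => x /=; rewrite subrK.
apply: le_ereal_inf_tmp => _ [F XF <-].
apply: ereal_inf_lbound; exists (fun k => ((F k).1 - w, (F k).2 - w)).
  move=> x /XF[k _ kx]; exists k => // i; have := kx i.
  by rewrite /= !mxE => /andP[h1 h2]; apply/andP; split; lra.
apply: eq_eseriesr => k _; rewrite /box_vol /=; congr EFin.
by apply: eq_bigr => i _; rewrite !mxE; congr maxr; lra.
Qed.

Lemma leb_box_le (ab : V * V) : (lebesgue_outer (box ab) <= box_vol ab)%E.
Proof.
pose F (k : nat) : V * V := if k is 0%N then ab else (0, 0).
have -> : box_vol ab = (\sum_(k <oo) box_vol (F k))%E.
  rewrite nneseries_recl//; last by move=> *; exact: box_vol_ge0.
  rewrite eseries0 ?adde0// => k k1 _; rewrite /F; case: k k1 => // k _.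
  by rewrite /box_vol big_ord_recl /= subrr /maxr ltxx mul0r.
by apply: ereal_inf_lbound; exists F => // x abx; exists 0%N.
Qed.

Lemma bounded_box (M : R) : 0 < M -> forall E : set V,
  (forall x, E x -> `|x| <= M) -> E `<=` box (const_mx (- M - 1), const_mx M).
Proof.
move=> M0 E EM x /EM Mx i; rewrite !mxE.
have : `|x ord0 i| <= M.
  by apply: le_trans Mx; rewrite -[`|x|]/(mx_norm x) mx_normrE; apply: (le_bigmax _ _ (ord0, i)).
by rewrite ler_norml => /andP[h1 h2]; apply/andP; split; lra.
Qed.

Lemma bounded_setP (E : set V) : bounded_set E -> exists2 M : R, 0 < M & forall x, E x -> `|x| <= M.
Proof.
move=> [M [Mr Mb]]; exists (Num.max M 0 + 1).
  by rewrite ltr_wpDl// le_max lexx orbT.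
by move=> x Ex; apply: Mb => //; rewrite ltr_pwDr// le_max lexx.
Qed.

Lemma bounded_leb_lty (E : set V) : bounded_set E -> (lebesgue_outer E < +oo)%E.
Proof.
move=> /bounded_setP[M M0 EM].
apply: le_lt_trans (le_lebesgue_outer (bounded_box M0 EM)) _.
by apply: le_lt_trans (leb_box_le _) _; rewrite ltey.
Qed.

Lemma leb_sigma_finite : sigma_finite setT mu.
Proof.
pose F k : set V := box (const_mx (- k.+1%:R - 1), const_mx (k.+1%:R)).
exists F => [|k]; last first.
  by split; [exact: measurable_bx|apply: le_lt_trans (leb_box_le _) _; rewrite ltey].
apply/esym/seteqP; split => // x _; exists (Num.bound `|x|) => //.
apply: (@bounded_box _ _ [set y | `|y| <= (Num.bound `|x|).+1%:R]) => //=.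
by apply/ltW/(lt_trans (archi_boundP _)) => //; rewrite ltr_nat.
Qed.

End lebesgue_Rn.

(** * Partial derivatives of Lipschitz functions *)

Section lipschitz_1d.
Context {R : realType}.
Local Notation lam := (@lebesgue_measure R).

Lemma LS_ocitv (g : cumulative R R) (a b : R) : a <= b ->
  lebesgue_stieltjes_measure g `]a, b]%classic = (g b - g a)%:E.
Proof.
move=> ab; rewrite /lebesgue_stieltjes_measure/= /measure_extension/= measurable_mu_extE/=; last exact: is_ocitv.
by rewrite wlength_itv_bnd.
Qed.

(** The Stieltjes measures of [g] and [h] add up to Lebesgue measure, so that of [g] is absolutely
    continuous. Its Radon-Nikodym density makes [g] locally an indefinite integral, and Lebesgue's
    differentiation theorem applies. *)
Lemma nondecreasing_1lip_derivable_ae (g : cumulative R R) (h : cumulative R R) :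
  (forall x, g x + h x = x) -> {ae lam, forall x, derivable g x 1}.
Proof.
move=> gh.
have le_gl A : measurable A -> (lebesgue_stieltjes_measure g A <= lam A)%E.
  move=> mA.
  rewrite (@lebesgue_measure_unique _ (measure_add (lebesgue_stieltjes_measure g) (lebesgue_stieltjes_measure h)))//.
    by rewrite [leRHS]measure_addE leeDl.
  move=> X [[a b] _ <-]; rewrite [fst _]/= [snd _]/=.
  rewrite [RHS]measure_addE; have [ab|ba] := leP a b; last first.
    by rewrite set_itv_ge ?measure0 ?adde0 // -leNgt bnd_simp ltW.
  rewrite lebesgue_measure_itv/= !LS_ocitv// -EFinD lte_fin.
  case: ifPn => [_|]; first by congr EFin; rewrite -{1}(gh a) -{1}(gh b); lra.
  rewrite -leNgt => ba; have -> : a = b by lra.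
  by rewrite !subrr addr0.
(* Restricting to a bounded interval makes the measure of [g] finite, hence its density integrable
   on half-lines. *)
pose K (k : nat) : R := k.+1%:R.
pose D k : set (measurableTypeR R) := `]- K k, K k]%classic.
have mD k : measurable (D k) by exact: measurable_itv.
have K0 k : 0 < K k by rewrite /K.
have nuoo k : (lebesgue_stieltjes_measure g (D k) < +oo)%E.
  by rewrite LS_ocitv ?ltey//; have := K0 k; lra.
suff H k : {ae lam, forall x, - K k < x < K k -> derivable g x 1}.
  have : {ae lam, forall x, forall k : nat, - K k < x < K k -> derivable g x 1}.
    by apply/ae_foralln => k; exact: H.
  apply: filterS; first exact: (ae_filter_ringOfSetsType lam).
  move=> x /(_ (Num.bound `|x|)); apply.
  have : `|x| < K (Num.bound `|x|).
    by apply: (lt_trans (archi_boundP _)) => //; rewrite ltr_nat.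
  by rewrite ltr_norml.
pose nu : {finite_measure set (measurableTypeR R) -> \bar R} := mfrestr (mD k) (nuoo k).
have nulam : nu `<< lam.
  apply/null_content_dominatesP => A mA lA0; apply/eqP; rewrite eq_le measure_ge0 andbT.
  apply: (@le_trans _ _ (lebesgue_stieltjes_measure g A)).
    by rewrite /nu /= /mfrestr /mrestr; apply: le_measure; rewrite ?inE//; exact: measurableI.
  by rewrite -lA0; exact: le_gl.
have [f [f0 ffin fi fE]] := radon_nikodym_sigma_finite nulam.
pose r (x : R) : R := fine (f x).
have rE : EFin \o r = f by apply/funext => x /=; rewrite fineK.
have ri : lam.-integrable setT (EFin \o r) by rewrite rE.
have rloc : locally_integrable [set: R] r by apply: open_integrable_locally; [exact: openT|].
have := @FTC1Ny _ r _ rloc.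
have riy (y : R) : lam.-integrable `]-oo, y]%classic (EFin \o r).
  by apply: (@integrableS _ _ _ lam setT) => //; exact: measurable_itv.
move=> /(_ riy) /=.
apply: filterS; first exact: (ae_filter_ringOfSetsType lam).
move=> x [dF _] /andP[Kx xK].
have gE : \forall y \near x, \int[lam]_(t in `]-oo, y]) r t + g (- K k) = g y.
  have : nbhs x `]- K k, K k[%classic.
    by apply: open_nbhs_nbhs; split; [exact: interval_open|rewrite /= in_itv/= Kx xK].
  apply: filterS => y; rewrite /= in_itv/= => /andP[Ky yK].
  have : nu `]-oo, y]%classic = (g y - g (- K k))%:E.
    rewrite /nu /= /mfrestr /mrestr -LS_ocitv; last exact: ltW.
    congr (lebesgue_stieltjes_measure g _); apply/seteqP; split => z; rewrite /D /= !in_itv/=.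
      by move=> [-> /andP[-> _]].
    by move=> /andP[-> zy]; split => //=; apply: le_trans zy (ltW yK).
  rewrite fE; last exact: measurable_itv.
  by rewrite /Rintegral -/r -rE => ->; rewrite /= subrK.
pose F (y : R) : R := \int[lam]_(t in `]-oo, y]%classic) r t.
have : derivable (fun y => F y + g (- K k)) x 1.
    by apply: derivableD; [exact: dF|exact: derivable_cst].
exact: near_eq_derivable.
Qed.

(** The functions x/2 + F(x)/(2M) and x/2 - F(x)/(2M) are nondecreasing and add up to x, and F is
    recovered from the first one. *)
Lemma lipschitz_derivable_ae (F : R -> R) (M : R) : 0 < M ->
  (forall x y, `|F x - F y| <= M * `|x - y|) ->
  {ae lam, forall x, derivable F x 1}.
Proof.
move=> M0 FM.
pose gg (s : R) (x : R) : R := 2^-1 * x + (s * (2 * M)^-1) * F x.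
have cF : continuous F.
  move=> x; apply/cvgrPdist_le => e e0; near=> y.
  apply: (le_trans (FM _ _)); rewrite -ler_pdivlMl//.
  near: y; apply: cvgr_dist_le; first exact: cvg_id.
  by rewrite mulr_gt0// invr_gt0.
have cg s : continuous (gg s).
  by move=> x; apply: cvgD; apply: cvgM; [exact: cvg_cst|exact: cvg_id|exact: cvg_cst|exact: cF].
have ndg s : `|s| = 1 -> {homo gg s : x y / x <= y}.
  move=> s1 x y xy; rewrite /gg -subr_ge0.
  have -> : 2^-1 * y + s * (2 * M)^-1 * F y - (2^-1 * x + s * (2 * M)^-1 * F x) =
     (2 * M)^-1 * (M * (y - x) + s * (F y - F x)) by field; rewrite gt_eqF.
  apply: mulr_ge0; first by rewrite invr_ge0 mulr_ge0// ltW.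
  have : `|s * (F y - F x)| <= M * (y - x).
    by rewrite normrM s1 mul1r (le_trans (FM _ _))// ger0_norm// subr_ge0.
  by rewrite ler_norml => /andP[]; lra.
pose g1 := gg 1; pose g2 := gg (-1).
have [n1 n2] : `|1 : R| = 1 /\ `|-1 : R| = 1 by rewrite normrN normr1.
pose c1 := isCumulative.Build R _ R g1 (ndg _ n1) (right_continuousW (cg 1)).
pose c2 := isCumulative.Build R _ R g2 (ndg _ n2) (right_continuousW (cg (-1))).
pose G1 : cumulative R R := HB.pack g1 c1.
pose G2 : cumulative R R := HB.pack g2 c2.
have := @nondecreasing_1lip_derivable_ae G1 G2.
have g12 x : G1 x + G2 x = x.
  by rewrite /G1 /G2 /= /g1 /g2 /gg; field; rewrite gt_eqF.
move=> /(_ g12).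
apply: filterS; first exact: (ae_filter_ringOfSetsType lam).
move=> x; rewrite /= => dg.
have -> : F = (fun y => 2 * M * (g1 y - 2^-1 * y)).
  by apply/funext => y; rewrite /g1 /gg; field; rewrite gt_eqF.
apply: derivableM; first exact: derivable_cst.
apply: derivableB; first exact: dg.
by apply: derivableM; [exact: derivable_cst|exact: derivable_id].
Unshelve. all: by end_near. Qed.

End lipschitz_1d.

Section partial_derivatives.
Context {R : realType} {n : nat}.
Local Notation V := 'rV[R]_n.+1.
Local Notation T := (lebT R n).
Local Notation lam := (@lebesgue_measure R).

(** A copy of [leb] that carries the sigma-finiteness required by Fubini-Tonelli. *)
Definition sfleb : set T -> \bar R := @leb R n.
HB.instance Definition _ := Measure.on sfleb.
HB.instance Definition _ :=
  Measure_isSigmaFinite.Build _ T R sfleb (@leb_sigma_finite R n).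

(** Only the coordinates of [phi] are asked to be measurable, since preimages of arbitrary Lebesgue
    measurable sets under [phi] may fail to be. This suffices: the preimage of an interval under [f]
    is open, hence a countable union of boxes. *)
Lemma measurable_comp_cont {d} {S : measurableType d} (D : set S)
    (phi : S -> V) (f : V -> R) : measurable D ->
  (forall i, measurable_fun D (fun s => phi s ord0 i)) -> continuous f ->
  measurable_fun D (f \o phi).
Proof.
move=> mD mphi cf.
apply: (measurability _ (RGenOpens.measurableE R)) => _ [_ [a [b ->] <-]].
have oU : open (f @^-1` `]a, b[%classic).
  by apply: open_comp => // x _; exact: cf.
rewrite comp_preimage (open_rbox oU) preimage_bigcup setI_bigcupr.
apply: bigcup_countType_measurable => q _.
rewrite (_ : D `&` _ = \bigcap_(i in [set: 'I_n.+1])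
    (D `&` (fun s => phi s ord0 i) @^-1` `](rbox q).1 ord0 i, (rbox q).2 ord0 i]%classic)).
  by apply: fin_bigcap_measurable => // i _; exact: mphi.
apply/seteqP; split => [x [Dx h] i _ /=|x h]; first by split => //; rewrite in_itv; exact: h.
split; first by have [] := h ord0 I.
by move=> i; have [_] := h i I; rewrite /= in_itv.
Qed.

Variables (f : V -> R) (M : R) (e : V).
Hypothesis M0 : 0 < M.
Hypothesis fM : forall x y, `|f x - f y| <= M * `|x - y|.

Let q (h : R) (x : V) : R := h^-1 * (f (h *: e + x) - f x).

Let cf : continuous f.
Proof.
move=> x; apply/(@cvgrPdist_le R R V (nbhs x) (nbhs_filter x)) => eps e0; near=> y.
apply: (le_trans (fM _ _)); rewrite -ler_pdivlMl//.
near: y; apply: cvgr_dist_le; first exact: cvg_id.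
by rewrite mulr_gt0// invr_gt0.
Unshelve. all: by end_near. Qed.

Let cq h : continuous (q h).
Proof.
move=> x; apply: (@continuousM R V (fun=> h^-1) (fun x => f (h *: e + x) - f x) x).
  exact: cst_continuous.
apply: (@continuousB R R^o V (fun x => f (h *: e + x)) f x); last exact: cf.
apply: (@continuous_comp _ _ _ (fun x => h *: e + x) f); last exact: cf.
by apply: (@continuousD R V V (fun=> h *: e) id x); [exact: cst_continuous|exact: cvg_id].
Qed.

(** Differentiability in direction [e] as a Cauchy condition over rational increments: countably
    many conditions on continuous functions of [x], so the set it defines is visibly measurable.
    Continuity of the quotient in a nonzero increment passes from rational to real increments. *)
Let cauchyq (x : V) := forall k : nat, exists m : nat, forall h h' : rat,
  ratr h != 0 :> R -> ratr h' != 0 :> R ->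
  `|ratr h : R| < m.+1%:R^-1 -> `|ratr h' : R| < m.+1%:R^-1 ->
  `|q (ratr h) x - q (ratr h') x| <= k.+1%:R^-1.

Let cauchy_derivable x : cauchyq x -> derivable f x e.
Proof.
move=> C; rewrite /derivable.
have -> : (fun h => h^-1 *: ((f \o shift x) (h *: e) - f x)) = q^~ x by [].
apply/cauchy_cvgP; apply: cauchy_exP => eps e0.
have [k ke] : exists k : nat, k.+1%:R^-1 < eps / 2.
  by have [k] := ltr_add_invr (divr_gt0 e0 (ltr0n R 2)); rewrite add0r; exists k.
have [m mC] := C k.
have m0 : 0 < m.+1%:R^-1 :> R by rewrite invr_gt0.
have [h0 /itvP h0m] := rat_in_itvoo m0.
have h00 : ratr h0 != 0 :> R by rewrite gt_eqF// h0m.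
have h0l : `|ratr h0 : R| < m.+1%:R^-1 by rewrite gtr0_norm h0m.
exists (q (ratr h0) x).
change (\forall y \near 0^', ball (q (ratr h0) x) eps (q y x)).
near=> h.
have hn0 : h != 0 by near: h; exact: nbhs_dnbhs_neq.
have hm : `|h| < m.+1%:R^-1.
  by near: h; apply: dnbhs0_lt.
have cl : {for h, continuous (fun h : R => h *: e + x)}.
  by apply: (@continuousD R V R (fun h : R => h *: e) (fun=> x) h);
    [exact: scalel_continuous|exact: cst_continuous].
have cfl : {for h, continuous (fun h : R => f (h *: e + x))}.
  by apply: (@continuous_comp _ _ _ (fun h : R => h *: e + x) f); [exact: cl|exact: cf].
have cqh : {for h, continuous (q^~ x)}.
  apply: (@continuousM R R (fun h => h^-1) (fun h : R => f (h *: e + x) - f x) h).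
    exact: inv_continuous.
  by apply: (@continuousB R R^o R (fun h : R => f (h *: e + x)) (fun=> f x) h); [exact: cfl|exact: cst_continuous].
have : \forall y \near h, `|q h x - q y x| < eps / 2 /\ y != 0 /\ `|y| < m.+1%:R^-1.
  near=> y; split; [|split]; near: y.
  - by apply: cvgr_dist_lt => //; rewrite divr_gt0.
  - by apply: (cvgr_neq0 h) => //; exact: cvg_id.
  - by apply: (@cvgr_norm_lt _ _ _ (nbhs h) _ id h) => //; exact: cvg_id.
move=> /nbhs_ballP[d /= d0 dh].
have [h' /itvP h'd] : exists h' : rat, ratr h' \in `]h - d, h + d[%R.
  by apply: rat_in_itvoo; lra.
have /dh[qe [y0 ym]] : ball h d (ratr h').
  by rewrite /ball /= ltr_distlC; rewrite !h'd.
have := mC h0 h' h00 y0 h0l ym.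
rewrite /ball /= !ltr_distl !ler_distl => /andP[a1 a2].
move: qe; rewrite ltr_distl => /andP[b1 b2].
move: (q h x) (q (ratr h0) x) (q (ratr h') x) (k.+1%:R^-1) ke a1 a2 b1 b2 => A1 A2 A3 A4 ke a1 a2 b1 b2.
by apply/andP; split; lra.
Unshelve. all: by end_near. Qed.

Let derivable_cauchy x : derivable f x e -> cauchyq x.
Proof.
move=> /cvg_ex[l].
have -> : (fun h => h^-1 *: ((f \o shift x) (h *: e) - f x)) = q^~ x by [].
move=> ql k.
have k0 : 0 < k.+1%:R^-1 / 2 :> R by rewrite divr_gt0// invr_gt0.
have /cvgrPdist_lt /(_ _ k0) := ql.
rewrite near_withinE => /nbhs_ballP[d /= d0 dh].
have [m md] := ltr_add_invr d0; rewrite add0r in md.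
exists m => h h' h0 h'0 hm h'm.
have B (y : R) : y != 0 -> `|y| < m.+1%:R^-1 -> `|l - q y x| < k.+1%:R^-1 / 2.
  move=> y0 ym; apply: dh => //; rewrite /ball /= sub0r normrN.
  exact: lt_trans ym md.
have tri (A1 A2 A3 c : R) : `|A3 - A1| < c / 2 -> `|A3 - A2| < c / 2 -> `|A2 - A1| <= c.
  by rewrite !ltr_distl ler_distl => /andP[? ?] /andP[? ?]; apply/andP; split; lra.
exact: tri (B _ h'0 h'm) (B _ h0 hm).
Qed.

Let measurable_cauchy {d} {S : measurableType d} (phi : S -> V) :
  (forall i, measurable_fun setT (fun s => phi s ord0 i)) ->
  measurable [set s | cauchyq (phi s)].
Proof.
move=> mphi.
pose G k h h' := [set s | `|q (ratr h) (phi s) - q (ratr h') (phi s)| <= k.+1%:R^-1].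
have mG k h h' : measurable (G k h h').
  have mq y : measurable_fun setT (fun s => q y (phi s)).
    exact: (measurable_comp_cont measurableT mphi (@cq y)).
  rewrite -[G _ _ _]setTI; apply: (@emeasurable_fun_infty_c _ _ R _ (fun s => (`|q (ratr h) (phi s) - q (ratr h') (phi s)|)%:E) measurableT _ k.+1%:R^-1%:E).
  by apply/measurable_EFinP; apply: measurableT_comp => //; apply: measurable_funB.
pose ok m (hh : rat * rat) := [/\ ratr hh.1 != 0 :> R, ratr hh.2 != 0 :> R,
  `|ratr hh.1 : R| < m.+1%:R^-1 & `|ratr hh.2 : R| < m.+1%:R^-1].
rewrite (_ : [set s | _] = \bigcap_k \bigcup_m ~` (\bigcup_(hh in ok m) ~` G k hh.1 hh.2)).
  apply: bigcapT_measurable => k; apply: bigcupT_measurable => m.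
  apply: measurableC; apply: bigcup_countType_measurable => hh _.
  exact: measurableC.
apply/seteqP; split => [s C k _|s C k].
  have [m mC] := C k; exists m => // -[[h h'] /= [/= h0 h'0 hm h'm]] []; exact: mC.
have [m _ mC] := C k I; exists m => h h' h0 h'0 hm h'm.
by apply: contrapT => nG; apply: mC; exists (h, h').
Qed.

(** Fubini is applied with an additional real parameter t, to the pairs (t, x) such that the
    derivative fails at x + t e. For fixed x the bad t are null by the one-dimensional result. For
    fixed t the bad x form a translate of the exceptional set [N], so the measure of [N] is
    integrated over the whole line; a zero result forces that measure to vanish. The direction [e]
    need not be a coordinate one. *)
Lemma lipschitz_partial_ae : {ae @leb R n, forall x, derivable f x e}.
Proof.
pose N : set T := ~` [set x | cauchyq x].
have mN : measurable N.
  by apply: measurableC; apply: (@measurable_cauchy _ T id) => i; exact: measurable_coord.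
exists N; split => //; last first.
  by move=> x /= nd C; apply: nd; exact: cauchy_derivable.
pose phi (z : R * T) : V := z.2 + z.1 *: e.
pose P : set (measurableTypeR R * T) := ~` [set z | cauchyq (phi z)].
have mphi i : measurable_fun setT (fun z : measurableTypeR R * T => phi z ord0 i).
  have -> : (fun z : measurableTypeR R * T => phi z ord0 i) =
      (fun z => (z.2 : V) ord0 i + z.1 * e ord0 i).
    by apply/funext => z; rewrite /phi !mxE.
  apply: measurable_funD.
    by apply: (measurableT_comp (@measurable_coord R n i setT measurableT)); exact: measurable_snd.
  by apply: measurable_funM => //; exact: measurable_fst.
have mP : measurable P by apply: measurableC; exact: measurable_cauchy.
have := @indic_fubini_tonelli _ _ (measurableTypeR R) T R lam sfleb P mP.
rewrite indic_fubini_tonelli_FE// indic_fubini_tonelli_GE//.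
rewrite [RHS]integral0_eq; last first.
  move=> x _ /=.
  pose F t := f (x + t *: e).
  have [M' M'0 FM'] : exists2 M' : R, 0 < M' & forall s t, `|F s - F t| <= M' * `|s - t|.
    exists (M * (`|e| + 1)); first by rewrite mulr_gt0// ltr_wpDl.
    move=> s t; apply: (le_trans (fM _ _)).
    rewrite opprD addrACA subrr add0r -scalerBl normrZ -mulrA ler_pM2l//.
    by rewrite mulrC ler_wpM2r// lerDl.
  have [A [mA A0 FA]] := lipschitz_derivable_ae M'0 FM'.
  apply/eqP; rewrite eq_le measure_ge0 andbT -A0; apply: le_measure; rewrite ?inE//.
    exact: measurable_ysection.
  move=> t; rewrite /ysection /= inE => nC; apply: FA => /= dF; apply: nC.
  apply: derivable_cauchy; rewrite /phi /=.
  move: dF; rewrite /derivable /F /=.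
  set a := (fun h => _); set b := (fun h => _); suff -> : a = b by [].
  apply/funext => h; rewrite /a /b /=.
  by rewrite [h *: 1]mulr1 scalerDl addrCA.
rewrite (_ : (fun x => _) = cst (@leb R n N)); last first.
  apply/funext => t /=.
  rewrite /xsection /sfleb /leb /= -(leb_translate (t *: e) N).
  by congr lebesgue_outer; apply/seteqP; split => x; rewrite /= inE.
rewrite integral_cst//= => /eqP; rewrite mule_eq0 => /orP[/eqP//|].
have := @lebesgue_measure_itv R `]-oo, +oo[; rewrite set_itvE /= => ->.
by [].

Qed.

End partial_derivatives.

(** * Null sets of pairs of points *)

Section null_product.
Context {R : realType} {n : nat}.
Local Notation V := 'rV[R]_n.+1.
Local Open Scope ereal_scope.

Definition box_prod (ab cd : V * V) : 'rV[R]_(n + n.+1).+1 * 'rV[R]_(n + n.+1).+1 :=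
  (row_mx ab.1 cd.1 : 'rV[R]_(n.+1 + n.+1), row_mx ab.2 cd.2 : 'rV[R]_(n.+1 + n.+1)).

Let rowl (a c : V) i :
  ((row_mx a c : 'rV[R]_(n.+1 + n.+1)) : 'rV[R]_(n + n.+1).+1) ord0 (@lshift n.+1 n.+1 i) = a ord0 i.
Proof. exact: row_mxEl. Qed.

Let rowr (a c : V) i :
  ((row_mx a c : 'rV[R]_(n.+1 + n.+1)) : 'rV[R]_(n + n.+1).+1) ord0 (@rshift n.+1 n.+1 i) = c ord0 i.
Proof. exact: row_mxEr. Qed.

Lemma box_prod_vol (ab cd : V * V) :
  box_vol (box_prod ab cd) = box_vol ab * box_vol cd.
Proof.
rewrite /box_vol -EFinM; congr EFin.
rewrite (@big_split_ord _ _ _ n.+1 n.+1) /=; congr (_ * _)%R; apply: eq_bigr => i _.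
  by rewrite !rowl.
by rewrite !rowr.
Qed.

(** A cover of [F] of small total volume, multiplied box by box with one fixed box containing [E],
    covers the product with proportionally small volume. No product measure is involved. *)
Lemma lebesgue_outer_setX0 (E F : set V) (M : R) :
  E `<=` box (const_mx (- M), const_mx M)%R -> lebesgue_outer F = 0 ->
  lebesgue_outer ([set w : 'rV[R]_(n.+1 + n.+1) | E (lsubmx w) /\ F (rsubmx w)] :
    set 'rV[R]_(n + n.+1).+1) = 0 /\
  lebesgue_outer ([set w : 'rV[R]_(n.+1 + n.+1) | F (lsubmx w) /\ E (rsubmx w)] :
    set 'rV[R]_(n + n.+1).+1) = 0.
Proof.
move=> EM F0; set b : V * V := (const_mx (- M), const_mx M)%R in EM.
pose c := fine (box_vol b).
have c0 : (0 <= c)%R by rewrite /c fine_ge0// box_vol_ge0.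
have cE : box_vol b = c%:E by [].
have cov (eps : R) : (0 < eps)%R -> exists G : (V * V)^nat, box_cover F G /\
    \sum_(k <oo) box_vol (G k) <= eps%:E.
  move=> e0.
  have Ff : lebesgue_outer F \is a fin_num by rewrite F0.
  have := lb_ereal_inf_adherent e0 Ff.
  move=> [_ [G FG <-]] h; exists G; split => //; apply: ltW.
  by move: h; rewrite -[ereal_inf _]/(lebesgue_outer F) F0 add0e.
have key (X : set 'rV[R]_(n + n.+1).+1) (P : V * V -> _) :
    (forall G, box_cover F G -> X `<=` \bigcup_k box (P (G k))) ->
    (forall ab, box_vol (P ab) = c%:E * box_vol ab) -> lebesgue_outer X = 0.
  move=> XP Pv; apply/eqP; rewrite eq_le lebesgue_outer_ge0 andbT.
  apply/lee_addgt0Pr => e e0; rewrite add0e.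
  (* Division by c + 1 rather than c: the fixed box may have volume 0. *)
  have [G [FG Ge]] := cov (e / (c + 1))%R (divr_gt0 e0 (ltr_wpDl c0 ltr01)).
  apply: (@le_trans _ _ (\sum_(k <oo) box_vol (P (G k)))).
    by apply: ereal_inf_lbound; exists (P \o G) => //; exact: XP.
  under eq_eseriesr do rewrite Pv.
  rewrite nneseriesZl; last by move=> k _; exact: box_vol_ge0.
  apply: (@le_trans _ _ (c%:E * (e / (c + 1))%:E)); first exact: lee_wpmul2l.
  rewrite -EFinM lee_fin mulrCA ger_pMr// ler_pdivrMr ?mul1r ?lerDl//.
  by rewrite ltr_wpDl.
split.
- apply: (key _ (box_prod b)) => [G FG w [/EM Ew /FG[k _ kw]]|ab].
    exists k => // i; rewrite -(@splitK n.+1 n.+1 i); case: (@fintype.split n.+1 n.+1 i) => j /=.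
      by rewrite !rowl; have := Ew j; rewrite !mxE.
    by rewrite !rowr; have := kw j; rewrite !mxE.
  by rewrite box_prod_vol cE.
- apply: (key _ (box_prod^~ b)) => [G FG w [/FG[k _ kw] /EM Ew]|ab].
    exists k => // i; rewrite -(@splitK n.+1 n.+1 i); case: (@fintype.split n.+1 n.+1 i) => j /=.
      by rewrite !rowl; have := kw j; rewrite !mxE.
    by rewrite !rowr; have := Ew j; rewrite !mxE.
  by rewrite box_prod_vol cE muleC.
Qed.

End null_product.

(** * The square root of Q *)

Section matrix_square_root.
Context {R : realType} {n : nat}.
Local Notation V := 'rV[R]_n.+1.
Local Notation M := 'M[R]_n.+1.
Implicit Types (u v w : V) (S Q T : M).

Lemma dotvE u v : dotv u v = (u *m v^T) ord0 ord0.
Proof. by rewrite /dotv mxE; apply: eq_bigr => i _; rewrite mxE. Qed.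

Lemma dotvC u v : dotv u v = dotv v u.
Proof. by apply: eq_bigr => i _; rewrite mulrC. Qed.

Lemma dotvDl u v w : dotv (u + v) w = dotv u w + dotv v w.
Proof. by rewrite !dotvE mulmxDl mxE. Qed.

Lemma dotvDr u v w : dotv w (u + v) = dotv w u + dotv w v.
Proof. by rewrite dotvC dotvDl !(dotvC w). Qed.

Lemma dotvZl a u v : dotv (a *: u) v = a * dotv u v.
Proof. by rewrite !dotvE -scalemxAl mxE. Qed.

Lemma dotvZr a u v : dotv u (a *: v) = a * dotv u v.
Proof. by rewrite dotvC dotvZl dotvC. Qed.

Lemma dotv_ge0 v : 0 <= dotv v v.
Proof. by apply: sumr_ge0 => i _; rewrite -expr2 sqr_ge0. Qed.

Lemma dotv_eq0 v : dotv v v = 0 -> v = 0.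
Proof.
move=> /eqP; rewrite psumr_eq0; last by move=> i _; rewrite -expr2 sqr_ge0.
move=> /allP h; apply/rowP => i; rewrite mxE.
by have := h i; rewrite mem_index_enum => /(_ isT); rewrite mulf_eq0 orbb => /eqP.
Qed.

Lemma dotv_mulmx u v S : dotv (u *m S) v = dotv u (v *m S^T).
Proof. by rewrite !dotvE trmx_mul trmxK mulmxA. Qed.

Lemma dotv_sym u v S : S^T = S -> dotv (u *m S) v = dotv u (v *m S).
Proof. by move=> SS; rewrite dotv_mulmx SS. Qed.

Lemma interpolation (s : seq R) (f : R -> R) : exists p : {poly R}, {in s, forall x, p.[x] = f x}.
Proof.
elim: s => [|y s [p ph]]; first by exists 0.
have [ys|ys] := boolP (y \in s).
  by exists p => x; rewrite inE => /predU1P[->|]; exact: ph.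
pose q := \prod_(a <- s) ('X - a%:P).
have qy : q.[y] != 0 by rewrite -rootE root_prod_XsubC.
exists (p + ((f y - p.[y]) / q.[y])%:P * q) => x; rewrite inE => /predU1P[->|xs].
  by rewrite !hornerE mulfVK// addrC subrK.
have -> : (p + ((f y - p.[y]) / q.[y])%:P * q).[x] = p.[x] + ((f y - p.[y]) / q.[y]) * q.[x].
  by rewrite !hornerE.
have -> : q.[x] = 0 by apply/eqP; rewrite -rootE root_prod_XsubC.
by rewrite mulr0 addr0 ph.
Qed.

Lemma sym_horner Q (p : {poly R}) : Q^T = Q -> (horner_mx Q p)^T = horner_mx Q p.
Proof.
move=> QQ; elim/poly_ind: p => [|p c IH]; first by rewrite rmorph0 trmx0.
rewrite rmorphD rmorphM /= horner_mx_X horner_mx_C linearD /= tr_scalar_mx.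
rewrite trmx_mul IH QQ; congr (_ + _).
have : horner_mx Q ('X * p) = horner_mx Q (p * 'X) by rewrite mulrC.
by rewrite !rmorphM /= horner_mx_X.
Qed.

(** The spectral theorem is applied to Q as a complex hermitian matrix. Its eigenvalues are real,
    and nonnegative because the real and imaginary parts of a row of [P] are real eigenvectors
    unless zero, and not both vanish. A real polynomial in Q interpolating the fourth root on the
    eigenvalues gives a symmetric T with T^4 = Q; the root is T^2, whose form is the squared length
    of v T. Taking a fourth root makes nonnegativity of the square root immediate. *)
Lemma sqrtmx_exists Q : sym_nonneg Q -> exists S, sym_nonneg S /\ S *m S = Q.
Proof.
move=> [QQ Qge].
pose toC := [the {rmorphism R -> complex R} of complex.real_complex R].
pose A := map_mx toC Q.
have Ah : A \is hermsymmx.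
  apply: realsym_hermsym.
    by apply/is_hermitianmxP; rewrite expr0 scale1r map_mx_id// /A map_trmx QQ.
  by apply/mxOverP => i j; rewrite mxE; apply/complex.complex_realP; eexists.
have /hermitian_normalmx /orthomx_spectralP A_eq := Ah.
have dreal := hermitian_spectral_diag_real Ah.
set P := spectralmx A in A_eq; set d := spectral_diag A in A_eq dreal.
have Pu : P \in unitmx by exact: spectral_unit.
clearbody P d.
pose r i := complex.Re (d ord0 i).
have rE i : d ord0 i = toC (r i).
  have /mxOverP /(_ ord0 i) := dreal.
  by move=> /complex.RRe_real /esym.
have PA : P *m A = diag_mx d *m P by have /= := congr1 (mulmx P) A_eq; rewrite !mulmxA (mulmxV Pu) mul1mx.
have PAij i j : \sum_k P i k * toC (Q k j) = toC (r i) * P i j.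
  have := congr1 (fun X : 'M[complex R]_n.+1 => X i j) PA; rewrite mul_diag_mx !mxE -rE => <-.
  by apply: eq_bigr => k _; rewrite /A mxE.
have ReM z (a : R) : complex.Re (z * toC a) = complex.Re z * a.
  by case: z => x y; rewrite /= mulr0 subr0.
have ImM z (a : R) : complex.Im (z * toC a) = complex.Im z * a.
  by case: z => x y; rewrite /= mulr0 add0r.
have ReS (F : 'I_n.+1 -> complex R) : complex.Re (\sum_k F k) = \sum_k complex.Re (F k).
  by apply: (big_morph (@complex.Re R)) => // -[? ?] [? ?].
have ImS (F : 'I_n.+1 -> complex R) : complex.Im (\sum_k F k) = \sum_k complex.Im (F k).
  by apply: (big_morph (@complex.Im R)) => // -[? ?] [? ?].
have eig (x : V) i : x *m Q = r i *: x -> x != 0 -> 0 <= r i.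
  move=> xQ x0; have := Qge x; rewrite xQ dotvZl pmulr_lge0//.
  rewrite lt_neqAle dotv_ge0 andbT eq_sym; apply: contra x0 => /eqP x0.
  by apply/eqP; exact: dotv_eq0.
have r0 i : 0 <= r i.
  pose x : V := \row_k complex.Re (P i k).
  pose y : V := \row_k complex.Im (P i k).
  have xQ : x *m Q = r i *: x.
    apply/rowP => j; rewrite !mxE.
    have := congr1 (@complex.Re R) (PAij i j); rewrite mulrC ReM mulrC => <-.
    by rewrite ReS; apply: eq_bigr => k _; rewrite mxE ReM.
  have yQ : y *m Q = r i *: y.
    apply/rowP => j; rewrite !mxE.
    have := congr1 (@complex.Im R) (PAij i j); rewrite mulrC ImM mulrC => <-.
    by rewrite ImS; apply: eq_bigr => k _; rewrite mxE ImM.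
  have [x0|x0] := eqVneq x 0; last exact: eig xQ x0.
  have [y0|y0] := eqVneq y 0; last exact: eig yQ y0.
  exfalso; have : P *m invmx P = 1%:M by rewrite mulmxV.
  move=> /(congr1 (fun X : 'M[complex R]_n.+1 => X i i)); rewrite !mxE eqxx big1 => [/esym/eqP|k _].
    by rewrite oner_eq0.
  have := congr1 (fun z : V => z ord0 k) x0; have := congr1 (fun z : V => z ord0 k) y0.
  by rewrite !mxE; case: (P i k) => a b /= -> ->; rewrite mul0r.
have [p ph] := interpolation [seq r i | i <- enum 'I_n.+1] (fun x => Num.sqrt (Num.sqrt x)).
pose T := horner_mx Q p.
have TT : T^T = T by exact: sym_horner.
have T4 : T *m T *m (T *m T) = Q.
  have -> : T *m T *m (T *m T) = horner_mx Q (p * p * (p * p)) by rewrite !rmorphM.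
  apply: (@map_mx_inj _ _ toC) => /=.
  rewrite map_horner_mx -/A.
  set q := map_poly _ _.
  have -> : A = invmx P *m diag_mx d *m invmx (invmx P) by rewrite invmxK.
  rewrite horner_mx_uconj; last by rewrite unitmx_inv.
  have -> : horner_mx (diag_mx d) q = diag_mx d; last by [].
  rewrite horner_mx_diag.
  congr diag_mx; apply/rowP => i; rewrite !mxE rE /q horner_map.
  suff -> : (p * p * (p * p)).[r i] = r i by [].
  rewrite !hornerM ph; last by apply: map_f; rewrite mem_enum.
  by rewrite -!expr2 !sqr_sqrtr ?sqrtr_ge0.
exists (T *m T); split=> //; split; first by rewrite trmx_mul TT.
by move=> v; rewrite mulmxA dotv_sym// dotv_ge0.
Qed.

Lemma sqrtmxP Q : sym_nonneg Q -> sym_nonneg (sqrtmx Q) /\ sqrtmx Q *m sqrtmx Q = Q.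
Proof. by move=> /sqrtmx_exists[S SQ]; rewrite /sqrtmx; case: xgetP => // /(_ S). Qed.

(** True for every Q, also outside the nonnegative symmetric ones, because the default value of
    [sqrtmx] is 0. *)
Lemma sqrtmx_sym Q : (sqrtmx Q)^T = sqrtmx Q.
Proof. by rewrite /sqrtmx; case: xgetP => [S _ [[]]|_] //; rewrite trmx0. Qed.

(** Expresses the length by the entries of Q themselves; [Qlen] is thereby measurable without any
    measurability of Q -> [sqrtmx Q]. *)
Lemma enorm_sqrtmx Q v : sym_nonneg Q ->
  enorm (v *m sqrtmx Q) = Num.sqrt (dotv (v *m Q) v).
Proof.
move=> /sqrtmxP[[SS _] SQ]; rewrite /enorm -{3}SQ mulmxA; congr Num.sqrt.
by rewrite [RHS]dotv_sym.
Qed.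

Lemma enorm_ge0 v : 0 <= enorm v. Proof. exact: sqrtr_ge0. Qed.

Lemma sqr_enorm v : enorm v ^+ 2 = dotv v v.
Proof. by rewrite sqr_sqrtr// dotv_ge0. Qed.

Lemma cauchy_schwarz u v : `|dotv u v| <= enorm u * enorm v.
Proof.
rewrite -(ler_pXn2r (ltn0Sn 1)) ?nnegrE ?mulr_ge0 ?enorm_ge0// exprMn !sqr_enorm.
rewrite real_normK ?num_real//.
have [v0|v0] := eqVneq (dotv v v) 0.
  rewrite (dotv_eq0 v0) (_ : dotv u 0 = 0) ?expr0n ?mulr_ge0 ?dotv_ge0//.
  by apply: big1 => i _; rewrite mxE mulr0.
have vp : 0 < dotv v v by rewrite lt_neqAle eq_sym v0 dotv_ge0.
have := dotv_ge0 (dotv v v *: u - dotv u v *: v).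
rewrite -scaleNr dotvDl !dotvDr !dotvZl !dotvZr (dotvC v u).
set a := dotv v v in vp *; set b := dotv u v; set c := dotv u u.
have -> : a * (a * c) + a * (- b * b) + (- b * (a * b) + - b * (- b * a)) = a * (a * c - b ^+ 2) by ring.
by rewrite pmulr_rge0// subr_ge0 mulrC.
Qed.

Lemma enormD u v : enorm (u + v) <= enorm u + enorm v.
Proof.
rewrite -(ler_pXn2r (ltn0Sn 1)) ?nnegrE ?addr_ge0 ?enorm_ge0//.
rewrite sqrrD !sqr_enorm dotvDl !dotvDr (dotvC v u).
have := le_trans (ler_norm _) (cauchy_schwarz u v).
move: (dotv u u) (dotv u v) (dotv v v) (enorm u * enorm v) => a b c d.
by rewrite mulr2n; lra.
Qed.

Lemma enormZ a v : enorm (a *: v) = `|a| * enorm v.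
Proof.
rewrite /enorm dotvZl dotvZr mulrA -expr2 sqrtrM ?sqr_ge0//.
by rewrite sqrtr_sqr.
Qed.

End matrix_square_root.

(** * Measurability and existence of gradients of locally Lipschitz functions *)

Section lipschitz_gradients.
Context {R : realType} {n : nat}.
Local Notation V := 'rV[R]_n.+1.
Local Notation T := (lebT R n).
Local Notation mu := (@leb R n).
Local Notation rb := (@rbox R n).

Lemma meas_onS (E F : set V) (f : V -> R) : measurable (F : set T) ->
  E `<=` F -> meas_on F f -> meas_on E f.
Proof. by move=> mF EF mf; apply: measurable_funS mf. Qed.

(** Rests on the completeness of a Caratheodory measure: all subsets of the null set where the
    functions differ are measurable. *)
Lemma ae_meas_on (E : set V) (f g : V -> R) : measurable (E : set T) ->
  (\forall x \ae mu, E x -> f x = g x) -> meas_on E f -> meas_on E g.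
Proof.
move=> mE fg mf _ Y mY.
have cmpl : measure_is_complete mu.
  exact: (@measure_is_complete_caratheodory R V (leb_outer R n)).
pose D : set T := E `&` [set x | f x != g x].
have nD : mu.-negligible D by apply: (negligibleS _ fg) => x [Ex /eqP fgx] h; exact/fgx/h.
have mD : measurable D by exact: cmpl.
have -> : E `&` g @^-1` Y = ((E `&` f @^-1` Y) `\` D) `|` (D `&` g @^-1` Y).
  apply/seteqP; split => x /=.
    move=> [Ex gY]; have [fgx|fgx] := eqVneq (f x) (g x).
      by left; split; [split=> //; rewrite fgx|move=> [_ /=]; rewrite fgx eqxx].
    by right.
  move=> [[[Ex fY] nDx]|[[Ex _] gY]]//; split => //.
  suff -> : g x = f x by [].
  by apply/eqP; rewrite eq_sym; apply/negPn/negP => fgx; apply: nDx.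
apply: measurableU; first by apply: measurableD => //; exact: mf.
by apply: cmpl; apply: (negligibleS _ nD) => x [].
Qed.

Lemma lipschitzP (f : V -> R) : lipschitz f <->
  exists2 M : R, 0 < M & forall x y, `|f x - f y| <= M * `|x - y|.
Proof.
split=> [[M [Mr h]]|[M M0 h]].
  exists (Num.max M 0 + 1); first by rewrite ltr_wpDl// le_max lexx orbT.
  move=> x y; have := h (Num.max M 0 + 1) _ (x, y) _; apply => //.
  by rewrite ltr_pwDr// le_max lexx.
exists M; split; first exact: num_real.
move=> N MN [x y] _ /=; apply: (le_trans (h x y)).
by rewrite ler_wpM2r// ltW.
Qed.

Lemma lipschitz_continuous (f : V -> R) : lipschitz f -> continuous f.
Proof.
move=> /lipschitzP[M M0 fM] x.
apply/(@cvgrPdist_le R R V (nbhs x) (nbhs_filter x)) => eps e0; near=> y.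
apply: (le_trans (fM _ _)); rewrite -ler_pdivlMl//.
near: y; apply: cvgr_dist_le; first exact: cvg_id.
by rewrite mulr_gt0// invr_gt0.
Unshelve. all: by end_near. Qed.

Lemma Lip_loc_nbhs (U : set V) (f : V -> R) (x : V) : open U -> Lip_loc U f -> U x ->
  exists d M : R, [/\ 0 < d, 0 < M, ball x d `<=` U &
    forall y z, ball x d y -> ball x d z -> `|f y - f z| <= M * `|y - z|].
Proof.
move=> oU fU Ux.
have /nbhs_ballP[d0 /= d00 dU] : nbhs x U by exact: open_nbhs_nbhs.
have [M [Mr h]] := fU (x, x) (conj Ux Ux).
have := h (Num.max M 0 + 1) (ltr_pwDr ltr01 _); rewrite le_max lexx => /(_ isT).
case=> -[A1 A2] /= [/nbhs_ballP[d1 /= d10 dA1] /nbhs_ballP[d2 /= d20 dA2]] sub.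
pose d := Num.min d0 (Num.min d1 d2).
have dd : 0 < d by rewrite !lt_min d00 d10 d20.
exists d, (Num.max M 0 + 1); split => //.
- by rewrite ltr_wpDl// le_max lexx orbT.
- by apply: subset_trans dU; apply: le_ball; rewrite ge_min lexx.
- move=> y z xy xz; have := sub (y, z) => /=; apply.
    split; [apply: dA1|apply: dA2].
      by apply: le_ball xy; rewrite !ge_min lexx orbT.
    by apply: le_ball xz; rewrite !ge_min lexx !orbT.
  by split; apply: dU; [apply: le_ball xy|apply: le_ball xz]; rewrite ge_min lexx.
Qed.

(** Coordinatewise projection onto the closed box. It is 1-Lipschitz for the sup norm, so
    precomposing with it turns a function that is Lipschitz on the box into a globally Lipschitz
    one. *)
Definition clampv (ab : V * V) (x : V) : V :=
  \row_i Num.max (ab.1 ord0 i) (Num.min (ab.2 ord0 i) (x ord0 i)).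

Lemma clampv_lip ab x y : `|clampv ab x - clampv ab y| <= `|x - y|.
Proof.
rewrite -[X in X <= _]/(mx_norm _) mx_normrE; apply: bigmax_le => // -[i j] _ /=.
rewrite !mxE; apply: (@le_trans _ _ `|(x - y) i j|).
  rewrite !mxE (ord1 i) ler_norml.
  have : - `|x ord0 j - y ord0 j| <= x ord0 j - y ord0 j <= `|x ord0 j - y ord0 j|.
    by rewrite -ler_norml.
  move: (x ord0 j) (y ord0 j) (ab.1 ord0 j) (ab.2 ord0 j) => a b c d.
  by rewrite /Num.min /Num.max; repeat case: ifPn; rewrite -?leNgt => *;
   apply/andP; split; lra.
by rewrite -[`|x - y|]/(mx_norm _) mx_normrE; apply: (le_bigmax _ _ (i, j)).
Qed.

Definition obox (ab : V * V) : set V := [set x | forall i, ab.1 ord0 i < x ord0 i < ab.2 ord0 i].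
Definition cbox (ab : V * V) : set V := [set x | forall i, ab.1 ord0 i <= x ord0 i <= ab.2 ord0 i].

Lemma obox_open ab : open (obox ab).
Proof.
rewrite openE => x xab.
exists (fun _ j => `]ab.1 ord0 j, ab.2 ord0 j[%classic) => [i j|y h i].
  rewrite (ord1 i); apply: open_nbhs_nbhs; split; first exact: interval_open.
  by rewrite /= in_itv; exact: xab.
by have := h ord0 i; rewrite /= in_itv.
Qed.

Lemma rbox_nbhs_open (x : V) (U : set V) : nbhs x U ->
  exists q, obox (rb q) x /\ cbox (rb q) `<=` U.
Proof.
move=> /nbhs_ballP[e /= e0 eU].
have h i : exists q : rat * rat,
    x ord0 i - e < ratr q.1 < x ord0 i /\ x ord0 i < ratr q.2 < x ord0 i + e.
  have [|q1 /itvP q1h] := @rat_in_itvoo R (x ord0 i - e) (x ord0 i); first lra.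
  have [|q2 /itvP q2h] := @rat_in_itvoo R (x ord0 i) (x ord0 i + e); first lra.
  by exists (q1, q2); rewrite /= !q1h !q2h.
have [q qh] := choice h.
exists (\row_i (q i).1, \row_i (q i).2); split => [i|y yh] /=.
  by rewrite !mxE; have [/andP[_ ->] /andP[-> _]] := qh i.
apply: eU; split=> // i j; rewrite (ord1 i) /ball /= ltr_distl.
have := yh j; rewrite /= !mxE => /andP[h1 h2].
by have [/andP[h3 h4] /andP[h5 h6]] := qh j; apply/andP; split; lra.
Qed.

Lemma clampv_id ab x : cbox ab x -> clampv ab x = x.
Proof.
move=> xab; apply/rowP => i; rewrite mxE; have /andP[h1 h2] := xab i.
by rewrite (min_idPr h2) (max_idPr h1).
Qed.

Lemma clampv_cbox (ab : V * V) (x : V) : (forall i, ab.1 ord0 i <= ab.2 ord0 i) -> cbox ab (clampv ab x).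
Proof.
move=> h i; rewrite mxE le_max lexx /= ge_max h /= ge_min lexx//.
Qed.

(** On the set of differentiability the derivative is a limit of continuous difference quotients;
    elsewhere, on a null set, its irrelevant value is measurable by completeness. *)
Lemma grad_meas_lip (f : V -> R) (e : V) : lipschitz f ->
  meas_on setT (fun x => 'D_e f x) /\ (\forall x \ae mu, derivable f x e).
Proof.
move=> lf; have [M M0 fM] := (lipschitzP f).1 lf.
have dae := lipschitz_partial_ae e M0 fM; split => //.
have cf := lipschitz_continuous lf.
pose q (k : nat) (x : V) : R := k.+1%:R * (f (k.+1%:R^-1 *: e + x) - f x).
have mq k : meas_on setT (q k).
  apply: continuous_measurable_Rn; first exact: openT.
  move=> x _.
  apply: (@continuousM R V (fun=> k.+1%:R) (fun x => f (k.+1%:R^-1 *: e + x) - f x) x).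
    exact: cst_continuous.
  apply: (@continuousB R R^o V (fun x => f (k.+1%:R^-1 *: e + x)) f x); last exact: cf.
  apply: (@continuous_comp _ _ _ (fun x => k.+1%:R^-1 *: e + x) f); last exact: cf.
  by apply: (@continuousD R V V (fun=> k.+1%:R^-1 *: e) id x); [exact: cst_continuous|exact: cvg_id].
have cmpl : measure_is_complete mu.
  exact: (@measure_is_complete_caratheodory R V (leb_outer R n)).
pose G : set T := [set x | derivable f x e].
have mG : measurable G.
  by rewrite -[G]setCK; apply: measurableC; apply: cmpl; exact: dae.
have mfG : meas_on G (fun x => 'D_e f x).
  apply: (@measurable_fun_cvg _ T R G q) => // [k|x Gx].
    exact: (meas_onS _ _ (mq k)).
  have hk : (fun k : nat => k.+1%:R^-1 : R) @ \oo --> (0 : R)^'.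
    move=> A A0; have A1 : nbhs (0 : R) (fun y => y != 0 -> A y) by exact: A0.
    have [N _ NA] := @cvg_harmonic R _ A1; exists N => // k /NA /=; apply.
    by rewrite /harmonic /= invr_eq0 pnatr_eq0.
  have -> : q^~ x = (fun h : R => h^-1 *: ((f \o shift x) (h *: e) - f x)) \o (fun k => k.+1%:R^-1).
    by apply/funext => k /=; rewrite invrK.
  exact: (cvg_comp _ _ hk Gx).
have mGC := measurableC mG.
rewrite /meas_on -(setUv G); apply/(measurable_funU _ mG mGC); split; first exact: mfG.
move=> _ Y mY; apply: cmpl; apply: (negligibleS _ dae); move=> x [nG _]; exact: nG.
Qed.

(** Near each point of a small open rational box, [f] coincides with its clamped, globally Lipschitz
    version, so derivatives agree there; countably many such boxes cover [U]. *)
Lemma grad_meas_loc (U : set V) (f : V -> R) (e : V) : open U -> Lip_loc U f ->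
  meas_on U (fun x => 'D_e f x) /\ (\forall x \ae mu, U x -> derivable f x e).
Proof.
move=> oU fU.
(* Nonemptiness of the open box puts its endpoints in order, as needed for [clampv] to map into the
   closed box. *)
pose P (q : 'rV[rat]_n.+1 * 'rV[rat]_n.+1) := obox (rb q) !=set0 /\
  exists2 M : R, 0 < M & forall y z : V, cbox (rb q) y -> cbox (rb q) z -> `|f y - f z| <= M * `|y - z|.
have cover : U `<=` \bigcup_(q in P) obox (rb q).
  move=> x Ux; have [d [M [d0 M0 dU fM]]] := Lip_loc_nbhs oU fU Ux.
  have [q [xq qd]] := rbox_nbhs_open (nbhsx_ballx x d d0).
  exists q => //; split; first by exists x.
  by exists M => // y z yq zq; apply: fM; exact: qd.
pose F q := f \o clampv (rb q).
have lF q : P q -> lipschitz (F q).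
  move=> [[x xq] [M M0 fM]]; apply/lipschitzP; exists M => // y z.
  have ab i : (rb q).1 ord0 i <= (rb q).2 ord0 i.
    by have /andP[h1 h2] := xq i; apply/ltW; exact: lt_trans h2.
  apply: (le_trans (fM _ _ (clampv_cbox _ ab) (clampv_cbox _ ab))).
  by rewrite ler_wpM2l ?clampv_lip// ltW.
have nearF q x : obox (rb q) x -> {near x, F q =1 f}.
  move=> xq; have : nbhs x (obox (rb q)) by apply: open_nbhs_nbhs; split=> //; exact: obox_open.
  apply: filterS => y yq; rewrite /F /= clampv_id// => i.
  by have /andP[/ltW -> /ltW ->] := yq i.
have mo q : measurable (obox (rb q) : set T) by apply: open_measurable_Rn; exact: obox_open.
split.
  have mU : meas_on (\bigcup_(q in P) obox (rb q)) (fun x => 'D_e f x).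
    move=> _ Y mY; rewrite setI_bigcupl; apply: bigcup_countType_measurable => q Pq.
    have [mF _] := grad_meas_lip e (lF q Pq).
    have mFo : meas_on (obox (rb q)) (fun x => 'D_e (F q) x).
      exact: (meas_onS _ _ mF).
    have := mFo (mo q) _ mY.
    suff -> : obox (rb q) `&` (fun x => 'D_e (F q) x) @^-1` Y =
      obox (rb q) `&` (fun x => 'D_e f x) @^-1` Y by [].
    by apply/seteqP; split => x [xq /=]; rewrite (near_eq_derive _ (nearF q x xq)).
  apply: (meas_onS _ cover mU).
  by apply: bigcup_countType_measurable => q _; exact: mo.
have : mu.-negligible (\bigcup_k (if unpickle k is Some q then
    (if `[< P q >] then [set x | ~ derivable (F q) x e] else set0) else set0)).
  apply: negligible_bigcup => k; case: unpickle => [q|]; last exact: negligible_set0.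
  by case: asboolP => [Pq|_]; [exact: (grad_meas_lip e (lF q Pq)).2|exact: negligible_set0].
rewrite -bigcup_countType; apply: negligibleS => x /= /not_implyP[Ux nd].
have [q Pq xq] := cover x Ux; exists q; first exact: Pq.
move=> dF; apply: nd.
exact: near_eq_derivable (nearF q x xq) dF.
Qed.

End lipschitz_gradients.

(** * Integrals and averages of nonnegative functions *)

#[global] Instance ae_leb_filter (R : realType) (n : nat) :
  Filter (nbhs (almost_everywhere (@leb R n))) := ae_filter_ringOfSetsType (@leb R n).

Section integrals.
Context {R : realType} {n : nat}.
Local Notation V := 'rV[R]_n.+1.
Local Notation T := (lebT R n).
Local Notation mu := (@leb R n).
Implicit Types (E F : set V) (f g : V -> R).

Lemma mM E f g : meas_on E f -> meas_on E g -> meas_on E (fun x => f x * g x).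
Proof. exact: measurable_funM. Qed.

Lemma mD E f g : meas_on E f -> meas_on E g -> meas_on E (fun x => f x + g x).
Proof. exact: measurable_funD. Qed.

Lemma mN E f : meas_on E f -> meas_on E (fun x => - f x).
Proof. exact: measurable_funN. Qed.

Lemma mcst E (c : R) : meas_on E (fun=> c).
Proof. exact: measurable_cst. Qed.

Lemma mexp E f m : meas_on E f -> meas_on E (fun x => f x ^+ m).
Proof. exact: measurable_funX. Qed.

Lemma mpowR E f (r : R) : meas_on E f -> meas_on E (fun x => f x `^ r).
Proof. by move=> mf; exact: (measurableT_comp (measurable_powR r) mf). Qed.

Lemma mmax E f g : meas_on E f -> meas_on E g -> meas_on E (fun x => Num.max (f x) (g x)).
Proof. exact: measurable_maxr. Qed.

Lemma mabs E f : meas_on E f -> meas_on E (fun x => `|f x|).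
Proof. by move=> mf; exact: (measurableT_comp (@normr_measurable R setT) mf). Qed.

Lemma mcomp E f (G : R -> R) : meas_on E f -> continuous G -> meas_on E (fun x => G (f x)).
Proof. by move=> mf cG; exact: (measurableT_comp (continuous_measurable_fun cG) mf). Qed.

Lemma mind E f (k : R) : measurable (E : set T) -> meas_on E f ->
  meas_on E (fun x => (k < f x)%R%:R).
Proof.
move=> mE mf; have m1 : measurable_fun (E : set T) (fun x => k < f x).
  exact: measurable_fun_ltr (measurable_cst _) mf.
rewrite (_ : (fun _ => _) = fun x => if k < f x then 1 else 0); last first.
  by apply/funext => x; case: (k < f x).
by apply: measurable_fun_if => //; exact: measurable_cst.
Qed.

Lemma msum E (I : Type) (s : seq I) (f : I -> V -> R) :
  (forall i, meas_on E (f i)) -> meas_on E (fun x => \sum_(i <- s) f i x).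
Proof.
move=> mf; elim: s => [|i s IH].
  by rewrite (_ : (fun _ => _) = fun=> 0) //; [exact: mcst|apply/funext => x; rewrite big_nil].
rewrite (_ : (fun _ => _) = fun x => f i x + \sum_(i <- s) f i x); first exact: mD.
by apply/funext => x; rewrite big_cons.
Qed.

End integrals.

Ltac mexact := match goal with H : ?A |- ?B => constr_eq A B; exact H end.

Ltac mfun := first [mexact | lazymatch goal with
| |- meas_on ?E (fun _ => ?c) => exact: (@mcst _ _ E c)
| |- meas_on ?E (fun x => (@?a x + @?b x)%R) => apply: (@mD _ _ E a b); mfun
| |- meas_on ?E (fun x => (@?a x * @?b x)%R) => apply: (@mM _ _ E a b); mfun
| |- meas_on ?E (fun x => (- @?a x)%R) => apply: (@mN _ _ E a); mfun
| |- meas_on ?E (fun x => (@?a x ^+ ?m)%R) => apply: (@mexp _ _ E a m); mfun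
| |- meas_on ?E (fun x => (@?a x `^ ?r)%R) => apply: (@mpowR _ _ E a r); mfun
| |- meas_on ?E (fun x => `|@?a x|%R) => apply: (@mabs _ _ E a); mfun
| |- meas_on ?E (fun x => Num.max (@?a x) (@?b x)) => apply: (@mmax _ _ E a b); mfun
| |- meas_on ?E (fun x => (?k < @?a x)%R%:R) => apply: (@mind _ _ E a k); [try assumption|mfun]
| |- meas_on ?E (fun x => ?f x) => change (meas_on E f); try mexact
| |- _ => idtac
end].

Section integrals.
Context {R : realType} {n : nat}.
Local Notation V := 'rV[R]_n.+1.
Local Notation T := (lebT R n).
Local Notation mu := (@leb R n).
Implicit Types (E F : set V) (f g : V -> R).

Definition Int E f : \bar R := (\int[mu]_(x in (E : set T)) (f x)%:E)%E.

Lemma IntE E f : Int E f = (\int[mu]_(x in (E : set T)) (f x)%:E)%E.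
Proof. by []. Qed.

Lemma mEFin E f : meas_on E f -> measurable_fun (E : set T) (fun x : T => (f x)%:E).
Proof. by move=> mf; apply/measurable_EFinP. Qed.

Lemma Int_ge0 E f : (forall x, E x -> 0 <= f x) -> (0 <= Int E f)%E.
Proof. by move=> f0; apply: integral_ge0 => x Ex; rewrite lee_fin f0. Qed.

Lemma Int_le E f g : measurable (E : set T) -> meas_on E f -> meas_on E g ->
  (forall x, E x -> 0 <= f x) -> (\forall x \ae mu, E x -> f x <= g x) ->
  (Int E f <= Int E g)%E.
Proof.
move=> mE mf mg f0 fg.
(* [g] is known to be nonnegative only almost everywhere, hence the replacement by its positive
   part. *)
have -> : Int E g = Int E (fun x => Num.max 0 (g x)).
  apply: ae_eq_integral; [exact: mE|exact: mEFin| |].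
    by apply: mEFin; apply: mmax; [exact: mcst|exact: mg].
  apply: filterS fg => x fg Ex /=; congr EFin; apply/esym/max_idPr.
  exact: le_trans (f0 _ Ex) (fg Ex).
apply: ae_ge0_le_integral; [exact: mE|by move=> x Ex; rewrite lee_fin f0| | | |].
- exact: mEFin.
- by move=> x Ex; rewrite lee_fin le_max lexx.
- by apply: mEFin; apply: mmax; [exact: mcst|exact: mg].
- apply: filterS fg => x fg Ex /=; rewrite lee_fin.
  by rewrite le_max fg ?orbT.
Qed.

Lemma IntD E f g : measurable (E : set T) -> meas_on E f -> meas_on E g ->
  (forall x, E x -> 0 <= f x) -> (forall x, E x -> 0 <= g x) ->
  Int E (fun x => f x + g x) = (Int E f + Int E g)%E.
Proof.
move=> mE mf mg f0 g0; rewrite /Int -ge0_integralD; last first.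
- exact: mEFin.
- by move=> x Ex; rewrite lee_fin g0.
- exact: mEFin.
- by move=> x Ex; rewrite lee_fin f0.
- exact: mE.
- by [].
Qed.

Lemma IntZ E f (k : R) : measurable (E : set T) -> meas_on E f ->
  (forall x, E x -> 0 <= f x) -> 0 <= k -> Int E (fun x => k * f x) = (k%:E * Int E f)%E.
Proof.
move=> mE mf f0 k0; rewrite /Int -ge0_integralZl; [by []|exact: mE|exact: mEFin| |by rewrite lee_fin].
by move=> x Ex; rewrite lee_fin f0.
Qed.

Lemma Int_cst E (c : R) : measurable (E : set T) -> Int E (fun=> c) = (c%:E * mu E)%E.
Proof. by move=> mE; rewrite /Int -integral_cst. Qed.

Lemma Int_subset E F f : measurable (E : set T) -> measurable (F : set T) ->
  E `<=` F -> meas_on F f -> (forall x, F x -> 0 <= f x) -> (Int E f <= Int F f)%E.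
Proof.
move=> mE mF EF mf f0; apply: ge0_subset_integral; [exact: mE|exact: mF|exact: mEFin| |exact: EF].
by move=> x Fx; rewrite lee_fin f0.
Qed.

Lemma Int_eq_ae E f g : measurable (E : set T) -> meas_on E f -> meas_on E g ->
  (\forall x \ae mu, E x -> f x = g x) -> Int E f = Int E g.
Proof.
move=> mE mf mg fg; apply: ae_eq_integral; [exact: mE|exact: mEFin|exact: mEFin|].
by apply: filterS fg => x fg /fg /= ->.
Qed.

Lemma Int_integrable E f : measurable (E : set T) -> meas_on E f ->
  (forall x, E x -> 0 <= f x) -> (Int E f < +oo)%E ->
  mu.-integrable (E : set T) (fun x : T => (f x)%:E).
Proof.
move=> mE mf f0 foo; apply/integrableP; split; first exact: mEFin.
apply: le_lt_trans foo; rewrite le_eqVlt; apply/orP; left; apply/eqP.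
by apply: eq_integral => x /[!inE] Ex /=; rewrite ger0_norm// f0.
Qed.

Lemma Int_dct E (f_ : nat -> V -> R) f g : measurable (E : set T) ->
  (forall k, meas_on E (f_ k)) -> meas_on E f -> meas_on E g ->
  (forall x, E x -> 0 <= g x) -> (Int E g < +oo)%E ->
  (forall k, \forall x \ae mu, E x -> `|f_ k x| <= g x) ->
  (\forall x \ae mu, E x -> f_ k x @[k --> \oo] --> f x) ->
  Int E (f_ k) @[k --> \oo] --> Int E f.
Proof.
move=> mE mf_ mf mg g0 goo fg cf.
have [] := @dominated_convergence _ _ _ mu E mE (fun k x => (f_ k x)%:E)
  (fun x => (f x)%:E) (fun x => (g x)%:E).
- by move=> k; exact: mEFin.
- exact: mEFin.
- by apply: filterS cf => x cf /cf ?; apply: cvg_EFin => //; exact: nearW.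
- exact: Int_integrable.
- by apply/ae_foralln => k; apply: filterS (fg k) => x h Ex; rewrite lee_fin h.
- by [].
Qed.

Lemma Int_fatou E (f_ : nat -> V -> R) f (c : \bar R) : measurable (E : set T) ->
  (forall k, meas_on E (f_ k)) -> meas_on E f ->
  (forall k x, E x -> 0 <= f_ k x) -> (forall x, E x -> 0 <= f x) ->
  (\forall x \ae mu, E x -> f_ k x @[k --> \oo] --> f x) ->
  (forall k, (Int E (f_ k) <= c)%E) -> (Int E f <= c)%E.
Proof.
move=> mE mf_ mf f_0 f0 cf fc.
have mk k : measurable_fun (E : set T) (fun x : T => (f_ k x)%:E) by exact: mEFin.
have := @fatou _ _ _ mu E mE (fun k x => (f_ k x)%:E) mk.
move=> /(_ (fun k x Ex => f_0 k x Ex)) h.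
apply: (@le_trans _ _ (\int[mu]_(x in (E : set T)) limn_einf (fun k => (f_ k x)%:E)))%E.
  rewrite le_eqVlt; apply/orP; left; apply/eqP.
  apply: ae_eq_integral; [exact: mE|exact: mEFin| |].
    rewrite /limn_einf; apply: measurableT_comp; first exact: oppe_measurable.
    apply: measurable_fun_limn_esup => k.
    by apply: measurableT_comp (mk k); exact: oppe_measurable.
  apply: filterS cf => x cf /cf fx; apply/esym.
  have cfE : (f_ k x)%:E @[k --> \oo] --> (f x)%:E by apply: cvg_EFin fx; exact: nearW.
  by rewrite (cvg_limn_einf_sup cfE).1.
apply: (le_trans h); rewrite limn_einf_lim; apply: lime_le; first exact: is_cvg_einfs.
apply: nearW => k; apply: (le_trans _ (fc k)).
by apply: ereal_inf_lbound; exists k => /=.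
Qed.

Lemma Int_ae0 E f : measurable (E : set T) -> meas_on E f ->
  (forall x, E x -> 0 <= f x) -> (Int E f <= 0)%E -> \forall x \ae mu, E x -> f x = 0.
Proof.
move=> mE mf f0 If.
have I0 : (\int[mu]_(x in (E : set T)) `|(f x)%:E| = 0)%E.
  apply/eqP; rewrite eq_le integral_ge0; last by move=> x _; exact: abse_ge0.
  rewrite andbT; apply: le_trans If; rewrite le_eqVlt; apply/orP; left; apply/eqP.
  by apply: eq_integral => x /[!inE] Ex /=; rewrite ger0_norm// f0.
have /ae_eq_integral_abs := mEFin mf.
move=> /(_ mu mE) [h _]; have := h I0.
by apply: filterS => x + Ex; move=> /(_ Ex)[].
Qed.

Definition L1 E f := [/\ meas_on E f, (forall x, E x -> 0 <= f x) & (Int E f < +oo)%E].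

Lemma L1D E f g : measurable (E : set T) -> L1 E f -> L1 E g -> L1 E (fun x => f x + g x).
Proof.
move=> mE [mf f0 foo] [mg g0 goo]; split; first by mfun.
  by move=> x Ex; rewrite addr_ge0 ?f0 ?g0.
by rewrite IntD; [exact: lte_add_pinfty| | | | |].
Qed.

Lemma L1Z E f (c : R) : measurable (E : set T) -> 0 <= c -> L1 E f -> L1 E (fun x => c * f x).
Proof.
move=> mE c0 [mf f0 foo]; split; first by mfun.
  by move=> x Ex; rewrite mulr_ge0 ?f0.
rewrite IntZ; [|exact: mE|exact: mf|exact: f0|exact: c0].
by apply: lte_mul_pinfty.
Qed.

Lemma L1_le E f g : measurable (E : set T) -> meas_on E f -> (forall x, E x -> 0 <= f x) ->
  (\forall x \ae mu, E x -> f x <= g x) -> L1 E g -> L1 E f.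
Proof.
move=> mE mf f0 fg [mg g0 goo]; split; [exact: mf|exact: f0|].
by apply: le_lt_trans goo; exact: Int_le.
Qed.

Lemma L1_cst E (c : R) : measurable (E : set T) -> 0 <= c -> (mu E < +oo)%E -> L1 E (fun=> c).
Proof.
move=> mE c0 Eoo; split; [by mfun|by []|].
by rewrite Int_cst; [apply: lte_mul_pinfty|exact: mE].
Qed.

Lemma L1S E F f : measurable (E : set T) -> measurable (F : set T) ->
  E `<=` F -> L1 F f -> L1 E f.
Proof.
move=> mE mF EF [mf f0 foo]; split; [exact: meas_onS mf|by move=> x /EF; exact: f0|].
by apply: le_lt_trans foo; exact: Int_subset.
Qed.

Section average.
Variable E : set V.
Hypotheses (mE : measurable (E : set T)) (E0 : (0 < mu E)%E) (Eoo : (mu E < +oo)%E).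

Definition Av f : \bar R := (((fine (mu E))^-1)%:E * Int E f)%E.

Let c0 : 0 < (fine (mu E))^-1.
Proof. by rewrite invr_gt0 fine_gt0// E0 Eoo. Qed.

Lemma AvE f : Av f = (((fine (mu E))^-1)%:E * Int E f)%E.
Proof. by []. Qed.

Lemma Av_Int f (c : R) : (Av f <= c%:E)%E -> (Int E f <= (fine (mu E) * c)%:E)%E.
Proof.
move=> h; have m0 : 0 < fine (mu E) by rewrite -invr_gt0.
have := lee_wpmul2l (ltW m0 : (0 <= (fine (mu E))%:E)%E) h.
by rewrite muleA -EFinM mulfV ?gt_eqF// mul1e -EFinM.
Qed.

Lemma Av_ge0 f : (forall x, E x -> 0 <= f x) -> (0 <= Av f)%E.
Proof. by move=> f0; apply: mule_ge0; [rewrite lee_fin ltW|exact: Int_ge0]. Qed.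

Lemma Av_le f g : meas_on E f -> meas_on E g ->
  (forall x, E x -> 0 <= f x) -> (\forall x \ae mu, E x -> f x <= g x) -> (Av f <= Av g)%E.
Proof.
move=> mf mg f0 fg; apply: lee_wpmul2l; first by rewrite lee_fin ltW.
exact: Int_le.
Qed.

Lemma AvD f g : meas_on E f -> meas_on E g ->
  (forall x, E x -> 0 <= f x) -> (forall x, E x -> 0 <= g x) ->
  Av (fun x => f x + g x) = (Av f + Av g)%E.
Proof.
move=> mf mg f0 g0; rewrite /Av IntD; try by [].
by rewrite ge0_muleDr//; exact: Int_ge0.
Qed.

Lemma AvZ f (k : R) : meas_on E f -> (forall x, E x -> 0 <= f x) -> 0 <= k ->
  Av (fun x => k * f x) = (k%:E * Av f)%E.
Proof. by move=> mf f0 k0; rewrite /Av IntZ; try by []; rewrite muleCA. Qed.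

Lemma Av_cst (c : R) : Av (fun=> c) = c%:E.
Proof.
rewrite /Av Int_cst; last exact: mE.
have -> : mu E = (fine (mu E))%:E by rewrite fineK// ge0_fin_numE// ltW.
by rewrite -!EFinM /= mulrCA mulVf ?mulr1// gt_eqF// -invr_gt0.
Qed.

Lemma Av_lty f : (Int E f < +oo)%E -> (forall x, E x -> 0 <= f x) -> exists2 c : R, 0 <= c & Av f = c%:E.
Proof.
move=> foo f0; have f1 : Int E f \is a fin_num by rewrite ge0_fin_numE// Int_ge0.
exists ((fine (mu E))^-1 * fine (Int E f)); last by rewrite /Av -(fineK f1).
by apply: mulr_ge0; [exact: ltW|rewrite fine_ge0// Int_ge0].
Qed.

(** The numbers x and y are given upper bounds, not the norms themselves. Young's inequality for f/x
    and g/y then involves no division by a possibly zero norm. *)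
Lemma Av_hoelder f g (a b x y : R) : meas_on E f -> meas_on E g ->
  (forall z, E z -> 0 <= f z) -> (forall z, E z -> 0 <= g z) ->
  0 < a -> 0 < b -> a^-1 + b^-1 = 1 -> 0 < x -> 0 < y ->
  (Av (fun z => (f z `^ a)%R) <= (x `^ a)%:E)%E -> (Av (fun z => (g z `^ b)%R) <= (y `^ b)%:E)%E ->
  (Av (fun z => (f z * g z)%R) <= (x * y)%:E)%E.
Proof.
move=> mf mg f0 g0 a0 b0 ab x0 y0 fx gy.
have xa0 : 0 < x `^ a by apply: powR_gt0.
have yb0 : 0 < y `^ b by apply: powR_gt0.
apply: (@le_trans _ _ (Av (fun z => (x * y) / (a * x `^ a) * f z `^ a + (x * y) / (b * y `^ b) * g z `^ b)%R))%E.
  apply: Av_le; [exact: mM| |by move=> z Ez; rewrite mulr_ge0 ?f0 ?g0|].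
    by mfun.
  apply: aeW => z Ez.
  have fz : 0 <= f z / x by rewrite divr_ge0 ?f0// ltW.
  have gz : 0 <= g z / y by rewrite divr_ge0 ?g0// ltW.
  have := conjugate_powR fz gz a0 b0 ab.
  rewrite !powRM ?f0 ?g0 ?invr_ge0 ?(ltW x0) ?(ltW y0)//.
  have inv (w c : R) : 0 < w -> w^-1 `^ c = (w `^ c)^-1.
    by move=> w0; rewrite -powR_inv1 ?ltW// -powRrM mulN1r powRN.
  rewrite !inv// => h; rewrite -(ler_pM2l (mulr_gt0 x0 y0)) in h.
  apply: le_trans (le_trans h _).
    by rewrite le_eqVlt; apply/orP; left; apply/eqP; field; rewrite !gt_eqF.
  by rewrite le_eqVlt; apply/orP; left; apply/eqP; field; rewrite !gt_eqF.
have p1 : 0 <= x * y / (a * x `^ a) by rewrite divr_ge0// ltW// mulr_gt0.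
have p2 : 0 <= x * y / (b * y `^ b) by rewrite divr_ge0// ltW// mulr_gt0.
rewrite AvD; [|by mfun|by mfun
  |by move=> z _; rewrite mulr_ge0// powR_ge0|by move=> z _; rewrite mulr_ge0// powR_ge0].
rewrite !AvZ; [|by mfun|by move=> z _; exact: powR_ge0|by []|by mfun|by move=> z _; exact: powR_ge0|by []].
apply: (@le_trans _ _ ((x * y / (a * x `^ a))%:E * (x `^ a)%:E + (x * y / (b * y `^ b))%:E * (y `^ b)%:E))%E.
  by apply: leeD; apply: lee_wpmul2l; rewrite ?lee_fin.
rewrite -!EFinM -EFinD lee_fin le_eqVlt; apply/orP; left; apply/eqP.
rewrite -[RHS]mulr1 -ab; field; rewrite !gt_eqF//.
Qed.

(** Hoelder's inequality against the constant function 1, the average being normalised. *)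
Lemma Av_jensen f (s t x : R) : meas_on E f -> (forall z, E z -> 0 <= f z) ->
  0 < t -> t <= s -> 0 < x -> (Av (fun z => (f z `^ s)%R) <= (x `^ s)%:E)%E ->
  (Av (fun z => (f z `^ t)%R) <= (x `^ t)%:E)%E.
Proof.
move=> mf f0 t0; rewrite le_eqVlt => /predU1P[-> //|ts] x0 fx.
have s0 := lt_trans t0 ts.
have -> : (fun z => f z `^ t)%R = (fun z => (f z `^ t * 1))%R by apply/funext => z; rewrite mulr1.
rewrite -[(x `^ t)%R]mulr1.
apply: (@Av_hoelder _ _ (s / t) (s / (s - t))).
- exact: mpowR.
- exact: mcst.
- by move=> z _; exact: powR_ge0.
- by [].
- by rewrite divr_gt0.
- by rewrite divr_gt0// subr_gt0.
- by field; rewrite !gt_eqF// subr_gt0.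
- exact: powR_gt0.
- by [].
- rewrite -powRrM (_ : t * (s / t) = s); last by field; rewrite gt_eqF.
  rewrite (_ : (fun z => _) = (fun z => f z `^ s)%R)//.
  by apply/funext => z; rewrite -powRrM mulrCA mulfV ?mulr1 ?gt_eqF.
- by rewrite powR1 Av_cst.
Qed.

End average.
End integrals.
Arguments Av {R n} E f.

#[global] Opaque Int Av.

(** * Approximation in the degenerate Sobolev spaces *)

Section approximation.
Context {R : realType} {n : nat}.
Local Notation V := 'rV[R]_n.+1.
Local Notation T := (lebT R n).
Local Notation mu := (@leb R n).

Lemma powRD_le (p a b : R) : 0 <= p -> 0 <= a -> 0 <= b ->
  (a + b) `^ p <= 2 `^ p * (a `^ p + b `^ p).
Proof.
move=> p0; wlog ab : a b / a <= b => [H a0 b0|a0 b0].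
  have [ab|/ltW ba] := leP a b; first exact: H.
  by rewrite addrC [X in _ * X]addrC; exact: H.
apply: (@le_trans _ _ ((2 * b) `^ p)).
  by apply: ge0_ler_powR; rewrite ?nnegrE//; lra.
by rewrite powRM// ler_wpM2l ?powR_ge0// lerDr powR_ge0.
Qed.

(** The sum of the series has integral at most 1, hence is finite almost everywhere; it dominates
    every term, and the terms of a convergent series tend to 0. This is how norm convergence is
    traded for one integrable majorant. *)
Lemma summable_dominated (E : set V) (g : nat -> V -> R) : measurable (E : set T) ->
  (forall k, meas_on E (g k)) -> (forall k x, E x -> 0 <= g k x) ->
  (forall k, (Int E (g k) <= (1 / (2 ^ k.+1)%:R)%:E)%E) ->
  exists D : V -> R, [/\ meas_on E D, (forall x, 0 <= D x), (Int E D < +oo)%E &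
    \forall x \ae mu, E x -> (forall k, g k x <= D x) /\ g k x @[k --> \oo] --> 0].
Proof.
move=> mE mg g0 gI.
pose S (x : T) : \bar R := (\sum_(0 <= k <oo) (g k x)%:E)%E.
have Sle : (\int[mu]_(x in (E : set T)) S x <= 1)%E.
  rewrite integral_nneseries; [|exact: mE|by move=> k; exact: mEFin|by move=> k x Ex; rewrite lee_fin g0].
  apply: (@le_trans _ _ (\sum_(0 <= k <oo) (0 + (1 / (2 ^ k.+1)%:R)%:E))%E).
    apply: lee_nneseries => k; rewrite -IntE; last by rewrite add0e => _; exact: gI.
    by move=> _ _; apply: Int_ge0 => x Ex; exact: g0.
  have := @epsilon_trick R (fun=> 0%E) 1 xpredT (fun=> lexx _) ler01.
  move=> h; apply: (le_trans h); rewrite eseries0 ?add0e//.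
have S0 x : E x -> (0 <= S x)%E.
  by move=> Ex; apply: nneseries_ge0 => k _ _; rewrite lee_fin g0.
have mS : measurable_fun (E : set T) S.
  have h1 k (x : T) : E x -> k \in xpredT -> (0 <= (g k x)%:E)%E.
    by move=> Ex _; rewrite lee_fin g0.
  have h2 k : k \in xpredT -> measurable_fun (E : set T) (fun x : T => (g k x)%:E).
    by move=> _; exact: mEFin.
  exact: (@ge0_emeasurable_sum _ T R E (fun k (x : T) => (g k x)%:E) xpredT h1 h2).
have iS : mu.-integrable (E : set T) S.
  apply/integrableP; split; first exact: mS.
  apply: le_lt_trans (ltry 1); apply: le_trans Sle; rewrite le_eqVlt; apply/orP; left; apply/eqP.
  by apply: eq_integral => x /[!inE] Ex; rewrite gee0_abs// S0.
have finS := integrable_ae mE iS.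
have mfS : meas_on E (fun x => fine (S x)).
  exact: (measurable_comp measurableT _ (@fine_measurable R setT measurableT) mS).
exists (fun x => `|fine (S x)|); split; [by mfun|by []| |].
  rewrite IntE; apply: le_lt_trans (ltry 1); apply: le_trans Sle.
  apply: ge0_le_integral; [exact: mE|by []|by apply: mEFin; mfun|exact: mS|].
  move=> x Ex; rewrite ger0_norm ?fine_ge0 ?S0//.
  by have := S0 x Ex; case: (S x) => [r| |]//= _; rewrite leey.
apply: filterS finS => x finS Ex; have Sx := finS Ex.
have SE : S x = (fine (S x))%:E by rewrite fineK.
have pos k : (0 <= (g k x)%:E)%E by rewrite lee_fin g0.
split => [k|].
  rewrite ger0_norm ?fine_ge0 ?S0// -lee_fin -SE.
  apply: (@le_trans _ _ (\sum_(0 <= i < k.+1) (g i x)%:E)%E).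
    by rewrite big_nat_recr//= leeDr// sume_ge0.
  by apply: nneseries_lim_ge => i _ _.
have tail : (\sum_(N <= k <oo) (g k x)%:E)%E @[N --> \oo] --> 0%E.
  by apply: (@nneseries_tail_cvg R (fun k => (g k x)%:E) xpredT) => //; rewrite -/(S x) SE ltry.
suff : (g k x)%:E @[k --> \oo] --> (0 : R)%:E by move=> /fine_cvgP[_].
apply: (@squeeze_cvge _ _ _ _ (fun=> 0%E) _ (fun N => (\sum_(N <= k <oo) (g k x)%:E)%E)).
- apply: nearW => N; rewrite pos /=.
  apply: (@le_trans _ _ (\sum_(N <= i < N.+1) (g i x)%:E)%E).
    by rewrite big_nat1.
  by apply: nneseries_lim_ge => i _ _.
- exact: cvg_cst.
- exact: tail.
Qed.

Variables (Omega : set V) (Q : V -> 'M[R]_n.+1) (p : R).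
Hypotheses (mOm : measurable (Omega : set T)) (p1 : 1 < p).
Hypotheses (mQ : forall i j, meas_on Omega (fun x => Q x i j))
  (symQ : forall x, Omega x -> sym_nonneg (Q x)).

Lemma Qlen_ge0 (v : V -> V) x : 0 <= Qlen Q v x.
Proof. exact: enorm_ge0. Qed.

Lemma QlenD (v w : V -> V) x : Qlen Q (fun y => v y + w y) x <= Qlen Q v x + Qlen Q w x.
Proof. by rewrite /Qlen mulmxDl enormD. Qed.

Lemma QlenZ (a : V -> R) (v : V -> V) x : Qlen Q (fun y => a y *: v y) x = `|a x| * Qlen Q v x.
Proof. by rewrite /Qlen -scalemxAl enormZ. Qed.

Lemma Qlen_meas (E : set V) (v : V -> V) : measurable (E : set T) -> E `<=` Omega ->
  (forall i, meas_on E (fun x => v x ord0 i)) -> meas_on E (Qlen Q v).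
Proof.
move=> mE EO mv.
pose q x := \sum_(i <- index_enum 'I_n.+1) (\sum_(j <- index_enum 'I_n.+1) v x ord0 j * Q x j i) * v x ord0 i.
have mq : meas_on E q.
  apply: msum => i; apply: mM; last exact: mv.
  by apply: msum => j; apply: mM; [exact: mv|exact: meas_onS (mQ j i)].
have mqs : meas_on E (fun x => Num.sqrt (q x)).
  exact: (mcomp mq (@sqrt_continuous R)).
apply: (ae_meas_on mE _ mqs).
apply: aeW => x Ex; rewrite /Qlen enorm_sqrtmx; last exact/symQ/EO.
by congr Num.sqrt; apply: eq_bigr => i _; congr (_ * _); rewrite mxE.
Qed.

Let p0 : 0 < p. Proof. exact: lt_trans p1. Qed.

Lemma cvg_powR0 (a : nat -> R) : (forall k, 0 <= a k) -> a k `^ p @[k --> \oo] --> 0 ->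
  a k @[k --> \oo] --> 0.
Proof.
move=> a0 ap; apply/cvgrPdist_lt => e e0.
have ep : 0 < e `^ p by exact: powR_gt0.
have /cvgrPdist_lt /(_ _ ep) := ap.
apply: filterS => k; rewrite !sub0r !normrN !ger0_norm ?powR_ge0//.
apply: contraTlt => ea; rewrite -leNgt.
by apply: ge0_ler_powR; rewrite ?nnegrE// ltW.
Qed.

Lemma powR_triangle (a b : R) : `|b| `^ p <= 2 `^ p * (`|a| `^ p + `|b - a| `^ p).
Proof.
apply: (@le_trans _ _ ((`|a| + `|b - a|) `^ p)); last exact: powRD_le (ltW p0) _ _.
apply: ge0_ler_powR; rewrite ?nnegrE ?addr_ge0//; first exact: ltW.
by rewrite -{1}(subrK a b) addrC ler_normD.
Qed.

Lemma Lnorm_on_powR (E : set V) (f : V -> R) : measurable (E : set T) -> meas_on E f ->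
  (Lnorm_on E p%:E f `^ p)%E = Int E (fun x => (`|f x| `^ p)%R).
Proof.
move=> mE mf; rewrite /Lnorm_on poweR_Lnorm ?gt_eqF// IntE [RHS]integral_mkcond.
apply: eq_integral => x _; rewrite /patch; case: ifPn => _ /=.
  by [].
by rewrite normr0 powR0 ?gt_eqF.
Qed.

Lemma cvge0_lt (a : nat -> \bar R) (e : R) : 0 < e -> a k @[k --> \oo] --> 0%E ->
  \forall k \near \oo, (a k < e%:E)%E.
Proof.
move=> e0 /fine_cvgP[finA /cvgrPdist_lt /(_ _ e0)] ca.
near=> k; have fk : a k \is a fin_num by near: k.
have : `|0 - fine (a k)| < e by near: k.
rewrite sub0r normrN => h; rewrite -(fineK fk) lte_fin.
exact: le_lt_trans (ler_norm _) h.
Unshelve. all: by end_near. Qed.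

(** Approximants converging almost everywhere, values and gradients, under a single integrable
    majorant: every later limit becomes dominated convergence or Fatou. *)
Definition good_approx (u : V -> R) (gu : V -> V) (u_ : nat -> V -> R) (D : V -> R) : Prop :=
  [/\ (forall k, Lip_loc Omega (u_ k)), (forall x, 0 <= D x), L1 Omega D &
   \forall x \ae mu, Omega x ->
     [/\ (forall k, `|u_ k x - u x| `^ p <= D x),
         (forall k, Qlen Q (fun y => grad (u_ k) y - gu y) x `^ p <= D x),
         `|u x| `^ p <= D x /\ Qlen Q gu x `^ p <= D x,
         u_ k x @[k --> \oo] --> u x &
         Qlen Q (fun y => grad (u_ k) y - gu y) x @[k --> \oo] --> 0]].

Hypothesis oOm : open Omega.

Lemma Lip_loc_meas (f : V -> R) : Lip_loc Omega f -> meas_on Omega f.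
Proof.
move=> fL; apply: continuous_measurable_Rn => // x Ox.
have [d [M [d0 M0 dO fM]]] := Lip_loc_nbhs oOm fL Ox.
apply/(@cvgrPdist_le R R V (nbhs x) (nbhs_filter x)) => eps e0; near=> y.
have xy : ball x d y by near: y; exact: nbhsx_ballx.
apply: (le_trans (fM _ _ (ballxx _ d0) xy)); rewrite -ler_pdivlMl//.
near: y; apply: cvgr_dist_le; first exact: cvg_id.
by rewrite mulr_gt0// invr_gt0.
Unshelve. all: by end_near. Qed.

Lemma grad_meas (f : V -> R) i : Lip_loc Omega f -> meas_on Omega (fun x => grad f x ord0 i).
Proof.
move=> fL; rewrite (_ : (fun _ => _) = fun x => 'D_(delta_mx ord0 i) f x).
  exact: (grad_meas_loc _ oOm fL).1.
by apply/funext => x; rewrite mxE.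
Qed.

(** A subsequence whose errors, to the power p, have integrals at most 2^{-j-1} satisfies the
    hypotheses of [summable_dominated]. *)
Lemma WQ_approx (u : V -> R) (gu : V -> V) : WQ Q p Omega u gu ->
  exists u_ D, good_approx u gu u_ D.
Proof.
move=> [mu_ mgu [w [wL wN wu wg]]].
pose Dk k := Qlen Q (fun y => grad (w k) y - gu y).
have mw k : meas_on Omega (w k) by exact: Lip_loc_meas.
have mDk k : meas_on Omega (Dk k).
  apply: Qlen_meas => // i.
  rewrite (_ : (fun _ => _) = fun x => grad (w k) x ord0 i + - gu x ord0 i).
    by apply: mD; [exact: grad_meas|apply: mN; exact: mgu].
  by apply/funext => x; rewrite !mxE.
have mX k : meas_on Omega (Qlen Q (grad (w k))).
  by apply: Qlen_meas => // i; exact: grad_meas.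
have sel j : exists k, (Int Omega (fun x => (`|w k x - u x| `^ p)%R) <= (1 / (2 ^ j.+1)%:R)%:E)%E /\
    (Int Omega (fun x => (Dk k x `^ p)%R) <= (1 / (2 ^ j.+1)%:R)%:E)%E.
  have e0 : 0 < 1 / (2 ^ j.+1)%:R :> R by rewrite divr_gt0// ltr0n expn_gt0.
  have e1 : 0 < (1 / (2 ^ j.+1)%:R) `^ p^-1 :> R by exact: powR_gt0.
  have [N1 _ h1] := cvge0_lt e1 wu.
  have [N2 _ h2] := cvge0_lt e0 wg.
  pose k := maxn N1 N2.
  have k1 := h1 k (leq_maxl _ _); have k2 := h2 k (leq_maxr _ _).
  exists k; split; last by rewrite IntE; exact: ltW k2.
  rewrite -Lnorm_on_powR//; last by apply: mD => //; exact: mN.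
  have -> : (1 / (2 ^ j.+1)%:R)%:E = (((1 / (2 ^ j.+1)%:R) `^ p^-1)%:E `^ p)%E :> \bar R.
    by rewrite poweR_EFin -powRrM mulVf ?gt_eqF// powRr1// ltW.
  apply: gt0_ler_poweR.
  - exact: ltW.
  - by rewrite in_itv /= leey andbT; exact: Lnorm_ge0.
  - by rewrite in_itv /= leey andbT lee_fin ltW.
  - exact: ltW k1.
have [k_ kh] := choice sel.
have [D1 [mD1 D10 D1oo D1h]] := summable_dominated mOm
  (fun j => mpowR p (mabs (mD (mw (k_ j)) (mN mu_)))) (fun j x _ => powR_ge0 _ _) (fun j => (kh j).1).
have [D2 [mD2 D20 D2oo D2h]] := summable_dominated mOm
  (fun j => mpowR p (mDk (k_ j))) (fun j x _ => powR_ge0 _ _) (fun j => (kh j).2).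
pose w0 := w (k_ 0%N).
have w0oo : (Int Omega (fun x => (`|w0 x| `^ p)%R) < +oo)%E /\
    (Int Omega (fun x => (Qlen Q (grad w0) x `^ p)%R) < +oo)%E.
  have := wN (k_ 0%N); rewrite /WQnorm -!IntE -/w0.
  have a0 : (0 <= Int Omega (fun x => (`|w0 x| `^ p)%R))%E by apply: Int_ge0 => x _; exact: powR_ge0.
  have b0 : (0 <= Int Omega (fun x => (Qlen Q (grad w0) x `^ p)%R))%E.
    by apply: Int_ge0 => x _; exact: powR_ge0.
  have pn0 : p^-1 != 0 by rewrite invr_eq0 gt_eqF.
  move: a0 b0; case: (Int Omega _) => [a| |]//; case: (Int Omega _) => [b| |]// _ _.
  - by rewrite !ltry.
  - by move=> /(lty_poweRy pn0); rewrite addey.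
  - by move=> /(lty_poweRy pn0); rewrite addye.
  - by move=> /(lty_poweRy pn0); rewrite addye.
pose c : R := 2 `^ p.
have c0 : 0 <= c by exact: powR_ge0.
(* [D1] and [D2] dominate the errors; the terms in [w0], an approximant of finite norm, dominate u
   and its gradient by the triangle inequality. *)
pose D x := D1 x + D2 x + (c * (`|w0 x| `^ p + D1 x) + c * (Qlen Q (grad w0) x `^ p + D2 x)).
have D0 x : 0 <= D x by rewrite !addr_ge0// mulr_ge0// addr_ge0// powR_ge0.
have m0 : meas_on Omega (fun x => `|w0 x| `^ p) by apply: mpowR; apply: mabs; exact: mw.
have m1 : meas_on Omega (fun x => Qlen Q (grad w0) x `^ p) by apply: mpowR; exact: mX.
exists (fun j => w (k_ j)), D; split.
- by move=> k; exact: wL.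
- by [].
- have L0 : L1 Omega (fun x => `|w0 x| `^ p).
    by split; [exact: m0|by move=> x _; exact: powR_ge0|exact: w0oo.1].
  have L0' : L1 Omega (fun x => Qlen Q (grad w0) x `^ p).
    by split; [exact: m1|by move=> x _; exact: powR_ge0|exact: w0oo.2].
  have LD1 : L1 Omega D1 by [].
  have LD2 : L1 Omega D2 by [].
  by apply: L1D; [exact: mOm|exact: L1D|apply: L1D; [exact: mOm| |];
    apply: L1Z => //; exact: L1D].
- near=> x => Ox.
  have [h1 c1] : (forall j, `|w (k_ j) x - u x| `^ p <= D1 x) /\ `|w (k_ j) x - u x| `^ p @[j --> \oo] --> 0.
    by move: Ox; near: x; exact: D1h.
  have [h2 c2] : (forall j, Dk (k_ j) x `^ p <= D2 x) /\ Dk (k_ j) x `^ p @[j --> \oo] --> 0.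
    by move: Ox; near: x; exact: D2h.
  have g1 : 0 <= c * (`|w0 x| `^ p + D1 x) by rewrite mulr_ge0// addr_ge0// powR_ge0.
  have g2 : 0 <= c * (Qlen Q (grad w0) x `^ p + D2 x) by rewrite mulr_ge0// addr_ge0// powR_ge0.
  have d1 := D10 x; have d2 := D20 x.
  have DE : D x = D1 x + D2 x + (c * (`|w0 x| `^ p + D1 x) + c * (Qlen Q (grad w0) x `^ p + D2 x)) by [].
  move: g1 g2 DE; set G1 := c * (`|w0 x| `^ p + D1 x); set G2 := c * (_ + D2 x) => g1 g2 DE.
  split.
  + by move=> k; apply: (le_trans (h1 k)); lra.
  + by move=> k; apply: (le_trans (h2 k)); lra.
  + split.
      apply: (@le_trans _ _ G1); last by lra.
      apply: (le_trans (powR_triangle (w0 x) (u x))); rewrite ler_wpM2l// lerD2l distrC; exact: h1.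
    apply: (@le_trans _ _ G2); last by lra.
    apply: (@le_trans _ _ (c * (Qlen Q (grad w0) x `^ p + Dk (k_ 0%N) x `^ p))); last first.
      by rewrite ler_wpM2l// lerD2l; exact: h2.
    apply: le_trans (powRD_le (ltW p0) (Qlen_ge0 _ _) (Qlen_ge0 _ _)).
    apply: ge0_ler_powR; rewrite ?nnegrE ?addr_ge0 ?Qlen_ge0//; first exact: ltW.
    have := QlenD (grad w0) (fun y => - 1 *: (grad w0 y - gu y)) x.
    rewrite QlenZ normrN normr1 mul1r; apply: le_trans.
    by rewrite /Qlen scaleN1r opprB addrC subrK.
  + have := cvg_powR0 (fun k => normr_ge0 _) c1; move=> /norm_cvg0P h.
    have -> : (fun k => w (k_ k) x) = (fun k => (w (k_ k) x - u x) + u x).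
      by apply/funext => k; rewrite subrK.
    by rewrite -[X in _ --> X]add0r; apply: cvgD; [exact: h|exact: cvg_cst].
  + exact: cvg_powR0 (fun k => Qlen_ge0 _ _) c2.
Unshelve. all: by end_near. Qed.

End approximation.

(** * Admissible test functions *)

Ltac pos := repeat first [assumption | exact: ler01 | exact: ler0n | exact: powR_ge0
  | exact: normr_ge0 | exact: enorm_ge0 | exact: Qlen_ge0 | apply: addr_ge0 | apply: mulr_ge0 | apply: exprn_ge0 | (apply: ltW; assumption)
  | (rewrite invr_ge0) ].

Section chain_rule.
Context {R : realType} {n : nat}.
Local Notation V := 'rV[R]_n.+1.
Implicit Types (f eta : V -> R) (x e : V) (G g : R -> R).

Lemma is_derive_dir f x e (d : R) :
  is_derive x e f d <-> is_derive (0 : R) 1 (fun h : R => f (h *: e + x)) d.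
Proof.
have E : (fun h : R => h^-1 *: ((f \o shift x) (h *: e) - f x)) =
    (fun h : R => h^-1 *: (((fun h : R => f (h *: e + x)) \o shift 0) (h *: 1) - f (0 *: e + x))).
  by apply/funext => h /=; rewrite scale0r add0r addr0 [h *: 1]mulr1.
split => -[de dv]; split.
- by move: de; rewrite /derivable E.
- by move: dv; rewrite /derive E.
- by move: de; rewrite /derivable E.
- by move: dv; rewrite /derive E.
Qed.

Lemma is_derive_chain f x e (d d' : R) G : is_derive x e f d ->
  is_derive (f x) 1 G d' -> is_derive x e (fun y => G (f y)) (d' * d).
Proof.
move=> /is_derive_dir fd Gd; apply/is_derive_dir.
apply: (@is_derive1_comp R G (fun h : R => f (h *: e + x))) => //.
by rewrite scale0r add0r.
Qed.

Lemma is_derive_expn f x e (d : R) m : is_derive x e f d ->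
  is_derive x e (fun y => f y ^+ m.+1) (m.+1%:R * f x ^+ m * d).
Proof.
move=> fd; apply: (@is_derive_chain f x e d _ (fun t => t ^+ m.+1)) => //.
have h := @is_deriveX R R id m.+1 (f x) 1 1 (is_derive_id _ _).
have E : (id : R -> R) ^+ m.+1 = (fun t : R => t ^+ m.+1).
  by elim: m {h} => [|k IH]; apply/funext => t; [rewrite !expr1|rewrite exprS IH exprS].
rewrite E in h; have -> : m.+1%:R * f x ^+ m = (m.+1%:R * f x ^+ m) *: 1 :> R by rewrite [RHS]mulr1.
exact: h.
Qed.

Lemma grad_prod eta f x G (d' : R) m : (forall i, derivable f x (delta_mx ord0 i)) ->
  (forall i, derivable eta x (delta_mx ord0 i)) -> is_derive (f x) 1 G d' ->
  grad (fun y => eta y ^+ m.+1 * G (f y)) x =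
    (eta x ^+ m.+1 * d') *: grad f x + (m.+1%:R * eta x ^+ m * G (f x)) *: grad eta x.
Proof.
move=> df de Gd; apply/rowP => i; rewrite !mxE.
have h1 := is_derive_chain (derivableP (df i)) Gd.
have h2 := is_derive_expn m (derivableP (de i)).
have [_ ->] := is_deriveM h2 h1.
rewrite /GRing.scale /=; ring.
Qed.

Lemma grad_near0 f x : nbhs x [set y | f y = 0] -> grad f x = 0.
Proof.
move=> f0; apply/rowP => i; rewrite !mxE.
have -> : 'D_(delta_mx ord0 i) f x = 'D_(delta_mx ord0 i) (fun=> 0) x :> R.
  exact: near_eq_derive.
by have [_] := is_derive_cst (0 : R) x (delta_mx ord0 i).
Qed.

Lemma grad_tsupp f x : ~ tsupp f x -> grad f x = 0.
Proof.
move=> xf; apply: grad_near0; apply: contrapT => nf; apply: xf.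
move=> B xB; apply: contrapT => fB; apply: nf.
apply: (@filterS _ _ (nbhs_filter x)) xB => y By /=.
by apply/eqP/negPn/negP => fy; apply: fB; exists y.
Qed.

Lemma tsupp0 f x : ~ tsupp f x -> f x = 0.
Proof.
move=> xf; apply/eqP/negPn/negP => fx; apply: xf; exact: subset_closure.
Qed.

(** A nondecreasing C^1 function with bounded derivative: the Lipschitz bound keeps compositions
    locally Lipschitz, and continuity of g = G' allows the limit inside it. *)
Definition adm G g : Prop := [/\ forall t, is_derive t (1 : R) G (g t), continuous g &
  exists C : R, forall t, 0 <= g t <= C].

Lemma adm_cont G g : adm G g -> continuous G.
Proof.
move=> [dG _ _] t; apply/differentiable_continuous/derivable1_diffP.
by case: (dG t).
Qed.

Lemma adm_lip G g (C : R) : adm G g -> (forall t, 0 <= g t <= C) ->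
  forall s t, `|G s - G t| <= C * `|s - t|.
Proof.
move=> aG GC; have cG := adm_cont aG; case: aG => dG _ _.
have H s t : s < t -> `|G s - G t| <= C * `|s - t|.
  move=> st; have [|c _ ce] := @MVT R G g s t st (fun r _ => dG r).
    by apply: continuous_subspaceT => r; exact: cG.
  rewrite distrC ce normrM distrC ler_wpM2r//.
  by have /andP[h1 h2] := GC c; rewrite ger0_norm.
move=> s t; have [st|ts|->] := ltgtP s t; first exact: H.
  by rewrite distrC [X in _ * X]distrC; exact: H.
by rewrite !subrr normr0 mulr0.
Qed.

Variable Omega : set V.
Hypothesis oOm : open Omega.

Lemma Lip_loc_comp f G (C : R) : (forall s t, `|G s - G t| <= C * `|s - t|) -> 0 <= C ->
  Lip_loc Omega f -> Lip_loc Omega (fun y => G (f y)).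
Proof.
move=> GC C0 fL [x1 x2] Ox.
have [M [Mr h]] := fL (x1, x2) Ox.
exists (C * (Num.max M 0 + 1)); split; first exact: num_real.
move=> N NM.
have := h (Num.max M 0 + 1) (ltr_pwDr ltr01 _); rewrite le_max lexx => /(_ isT).
case=> W W1 W2; exists W; first exact: W1.
move=> [y1 y2] /W2 hy Oy.
apply: (le_trans (GC _ _)).
apply: (@le_trans _ _ (C * ((Num.max M 0 + 1) * `|y1 - y2|))).
  by rewrite ler_wpM2l//; exact: hy.
by rewrite mulrA ler_wpM2r// ltW.
Qed.

(** The local bounds hold near every pair of points, including pairs off the diagonal, so
    compactness of K x K gives one constant; neither convexity of K nor a Lebesgue number is
    involved. *)
Lemma Lip_loc_compact f (K : set V) : Lip_loc Omega f -> compact K -> K `<=` Omega ->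
  exists2 M : R, 0 < M & forall y z, K y -> K z -> `|f y - f z| <= M * `|y - z|.
Proof.
move=> fL cK KO.
have cKK : compact (K `*` K) by exact: compact_setX.
have ncov := (compact_near_coveringP (K `*` K)).1 cKK R (pinfty_nbhs R)
  (fun M z => Omega z.1 -> Omega z.2 -> `|f z.1 - f z.2| <= M * `|z.1 - z.2|) _.
case: ncov.
  move=> [x1 x2] [Kx1 Kx2].
  have [M [Mr h]] := fL (x1, x2) (conj (KO _ Kx1) (KO _ Kx2)).
  have := h (Num.max M 0 + 1) (ltr_pwDr ltr01 _); rewrite le_max lexx => /(_ isT) h1.
  exists ([set z : V * V | Omega z.1 -> Omega z.2 -> `|f z.1 - f z.2| <= (Num.max M 0 + 1) * `|z.1 - z.2|],
    [set N : R | Num.max M 0 + 1 < N]).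
    split; last by exists (Num.max M 0 + 1); split => //; exact: num_real.
    case: h1 => W W1 W2; exists W; first exact: W1.
    by move=> [y1 y2] /W2 hy O1 O2; exact: hy.
  move=> [[y1 y2] N] /= [hy NM] O1 O2; apply: (le_trans (hy O1 O2)).
  by rewrite ler_wpM2r// ltW.
move=> M [Mr h]; pose N := Num.max M 0 + 1.
exists N; first by rewrite /N ltr_wpDl// le_max lexx orbT.
move=> y z Ky Kz; have MN : M < N by rewrite /N ltr_pwDr// le_max lexx.
by apply: (h N MN (y, z)) => //=; exact: KO.
Qed.

Lemma Lip_0_prod (U : set V) eta f G (C C1 : R) m : (forall s t, `|G s - G t| <= C * `|s - t|) -> 0 <= C ->
  (forall t, `|G t| <= C1) -> Lip_loc Omega f -> U `<=` Omega ->
  lipschitz eta -> (forall x, 0 <= eta x <= 1) -> compact (tsupp eta) -> tsupp eta `<=` U ->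
  Lip_0 U (fun y => eta y ^+ m.+1 * G (f y)).
Proof.
move=> GC C0 GC1 fL UO leta eta01 ceta sU.
have [M M0 fM] := Lip_loc_compact fL ceta (subset_trans sU UO).
have /lipschitzP[L L0 eL] := leta.
have C10 : 0 <= C1 by apply: le_trans (GC1 0).
have eX y z : `|eta y ^+ m.+1 - eta z ^+ m.+1| <= m.+1%:R * (L * `|y - z|).
  have /andP[a1 a2] := eta01 y; have /andP[b1 b2] := eta01 z.
  rewrite subrXX normrM mulrC; apply: ler_pM => //.
  apply: (le_trans (ler_norm_sum _ _ _)).
  rewrite -[X in X%:R]card_ord -sumr_const; apply: ler_sum => i _.
  by rewrite normrM !normrX (ger0_norm a1) (ger0_norm b1) mulr_ile1 ?exprn_ge0 ?exprn_ile1.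
have ts : tsupp (fun y => eta y ^+ m.+1 * G (f y)) `<=` tsupp eta.
  apply: closure_subset => y /=; apply: contra_neq => ->.
  by rewrite expr0n /= mul0r.
split; last exact: subset_trans ts sU; last first.
  by apply: subclosed_compact ts => //; exact: closed_closure.
apply/lipschitzP; exists (C1 * (m.+1%:R * L) + C * M + 1).
  by apply: ltr_wpDl => //; pos.
(* [f] is controlled only on the compact support of [eta]. If z lies outside, the difference of the
   values of G carries the factor eta(z) = 0. *)
have H y z : tsupp eta y -> `|eta y ^+ m.+1 * G (f y) - eta z ^+ m.+1 * G (f z)| <= (C1 * (m.+1%:R * L) + C * M + 1) * `|y - z|.
  move=> ty.
  have -> : eta y ^+ m.+1 * G (f y) - eta z ^+ m.+1 * G (f z) =
    (eta y ^+ m.+1 - eta z ^+ m.+1) * G (f y) + eta z ^+ m.+1 * (G (f y) - G (f z)) by ring.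
  apply: (le_trans (ler_normD _ _)).
  have -> : (C1 * (m.+1%:R * L) + C * M + 1) * `|y - z| =
    C1 * (m.+1%:R * (L * `|y - z|)) + (C * M + 1) * `|y - z| by ring.
  apply: lerD.
    by rewrite normrM mulrC; apply: ler_pM.
  have [tz|tz] := pselect (tsupp eta z); last first.
    by rewrite (tsupp0 tz) expr0n /= mul0r normr0; pos.
  apply: (@le_trans _ _ (C * M * `|y - z|)); last by rewrite ler_wpM2r// lerDl.
  have /andP[b1 b2] := eta01 z.
  rewrite normrM -[leRHS]mul1r; apply: ler_pM => //.
    by rewrite normrX ger0_norm// exprn_ile1.
  apply: (le_trans (GC _ _)); rewrite -mulrA ler_wpM2l//; exact: fM.
move=> y z; have [ty|ty] := pselect (tsupp eta y); first exact: H.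
have [tz|tz] := pselect (tsupp eta z).
  by have := H z y tz; rewrite distrC (distrC z y).
by rewrite (tsupp0 ty) (tsupp0 tz) expr0n /= !mul0r subrr normr0; pos.
Qed.

End chain_rule.

(** * Compositions and products in the completed spaces, and the tested equation *)

Section composition.
Context {R : realType} {n : nat}.
Local Notation V := 'rV[R]_n.+1.
Local Notation T := (lebT R n).
Local Notation mu := (@leb R n).
Implicit Types (G g : R -> R).
Variables (Omega : set V) (Q : V -> 'M[R]_n.+1) (p : R).
Hypotheses (oOm : open Omega) (p1 : 1 < p).
Hypotheses (mQ : forall i j, meas_on Omega (fun x => Q x i j))
  (symQ : forall x, Omega x -> sym_nonneg (Q x)).

Let mOm : measurable (Omega : set T). Proof. exact: open_measurable_Rn. Qed.
Let p0 : 0 < p. Proof. exact: lt_trans p1. Qed.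

Let pn0 : p != 0. Proof. by rewrite gt_eqF. Qed.

Lemma powR_cvg0 (s : R) (a : nat -> R) : 0 < s -> (forall k, 0 <= a k) -> a k @[k --> \oo] --> 0 ->
  a k `^ s @[k --> \oo] --> 0.
Proof.
move=> s0 a0 /cvgrPdist_lt ca; apply/cvgrPdist_lt => e e0.
have ep : 0 < e `^ s^-1 by exact: powR_gt0.
have := ca _ ep.
apply: filterS => k; rewrite !sub0r !normrN !ger0_norm ?powR_ge0// => h.
have -> : e = (e `^ s^-1) `^ s by rewrite -powRrM mulVf ?gt_eqF// powRr1// ltW.
by apply: gt0_ltr_powR; rewrite ?nnegrE ?powR_ge0.
Qed.

(** The converse passage to [WQ_approx]: almost everywhere convergence under a majorant [B] gives
    convergence in the Sobolev norm by dominated convergence. *)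
Lemma WQ_closureI (E : set V) (DD : set (V -> R)) (w : V -> R) (gw : V -> V) (w_ : nat -> V -> R) (B : V -> R) :
  open E -> E `<=` Omega -> meas_on E w -> (forall i, meas_on E (fun x => gw x ord0 i)) ->
  (forall k, DD (w_ k)) -> (forall k, Lip_loc Omega (w_ k)) -> L1 E B ->
  (\forall x \ae mu, E x -> forall k,
    [/\ `|w_ k x - w x| `^ p <= B x, Qlen Q (fun y => grad (w_ k) y - gw y) x `^ p <= B x,
        `|w_ k x| `^ p <= B x & Qlen Q (grad (w_ k)) x `^ p <= B x]) ->
  (\forall x \ae mu, E x -> w_ k x @[k --> \oo] --> w x) ->
  (\forall x \ae mu, E x -> Qlen Q (fun y => grad (w_ k) y - gw y) x @[k --> \oo] --> 0) ->
  WQ_closure DD Q p E w gw.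
Proof.
move=> oE EO mw mgw Dw Lw [mB B0 Boo] dom cw cg.
have mE : measurable (E : set T) by exact: open_measurable_Rn.
have mwk k : meas_on E (w_ k) by apply: meas_onS (Lip_loc_meas oOm (Lw k)).
have mgk k i : meas_on E (fun x => grad (w_ k) x ord0 i).
  by apply: meas_onS (grad_meas oOm i (Lw k)).
have mX k : meas_on E (Qlen Q (grad (w_ k))).
  by apply: (Qlen_meas mOm mQ symQ mE EO) => i; exact: mgk.
have mXd k : meas_on E (Qlen Q (fun y => grad (w_ k) y - gw y)).
  apply: (Qlen_meas mOm mQ symQ mE EO) => i.
  rewrite (_ : (fun _ => _) = fun x => grad (w_ k) x ord0 i + - gw x ord0 i).
    by apply: mD; [exact: mgk|apply: mN; exact: mgw].
  by apply/funext => x; rewrite !mxE.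
have fin (f : V -> R) : meas_on E f -> (forall x, 0 <= f x) -> (\forall x \ae mu, E x -> f x <= B x) ->
    (Int E f < +oo)%E.
  by move=> mf f0 fB; apply: le_lt_trans Boo; apply: Int_le => // x _; exact: f0.
have zero (f_ : nat -> V -> R) : (forall k, meas_on E (f_ k)) -> (forall k x, 0 <= f_ k x) ->
    (forall k, \forall x \ae mu, E x -> f_ k x `^ p <= B x) ->
    (\forall x \ae mu, E x -> f_ k x @[k --> \oo] --> 0) ->
    Int E (fun x => (f_ k x `^ p)%R) @[k --> \oo] --> 0%E.
  move=> mf f0 fB fc.
  have -> : (0%E : \bar R) = Int E (fun=> 0) by rewrite Int_cst; [rewrite mul0e|exact: mE].
  apply: (Int_dct (g := B) mE); [| |exact: mB|exact: B0|exact: Boo| |].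
  - by move=> k; mfun; exact: mf.
  - by mfun.
  - move=> k; apply: filterS (fB k) => x h Ex.
    by rewrite ger0_norm ?powR_ge0//; exact: h.
  - by apply: filterS fc => x h Ex; apply: powR_cvg0 => //; exact: h.
split; [exact: mw|exact: mgw|exists w_; split; [exact: Dw| | |]].
- move=> k; rewrite /WQnorm -!IntE.
  have h1 : (Int E (fun x => (`|w_ k x| `^ p)%R) < +oo)%E.
    apply: fin; [by mfun; exact: mwk|by move=> x; exact: powR_ge0|].
    by apply: filterS dom => x h Ex; case: (h Ex k).
  have h2 : (Int E (fun x => (Qlen Q (grad (w_ k)) x `^ p)%R) < +oo)%E.
    apply: fin; [by apply: mpowR; exact: mX|by move=> x; exact: powR_ge0|].
    by apply: filterS dom => x h Ex; case: (h Ex k).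
  have h10 : (0 <= Int E (fun x => (`|w_ k x| `^ p)%R))%E by apply: Int_ge0 => x _; exact: powR_ge0.
  have h20 : (0 <= Int E (fun x => (Qlen Q (grad (w_ k)) x `^ p)%R))%E.
    by apply: Int_ge0 => x _; exact: powR_ge0.
  by apply: poweR_lty; apply: lte_add_pinfty; [exact: h1|exact: h2].
- have -> : (fun k => Lnorm_on E p%:E (fun x => w_ k x - w x)) =
     (fun k => (Int E (fun x => (`|w_ k x - w x| `^ p)%R)) `^ p^-1)%E.
    apply/funext => k; rewrite -Lnorm_on_powR//; last by mfun; exact: mwk.
    by rewrite -poweRrM mulfV ?gt_eqF// poweRe1// Lnorm_ge0.
  have := zero (fun k x => `|w_ k x - w x|).
  move=> /(_ (fun k => mabs (mD (mwk k) (mN mw)))) /(_ (fun k x => normr_ge0 _)) h.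
  have {}h : Int E (fun x => (`|w_ k x - w x| `^ p)%R) @[k --> \oo] --> 0%E.
    apply: h.
      by move=> k; apply: filterS dom => x h Ex; case: (h Ex k).
    apply: filterS cw => x h Ex; apply/norm_cvg0P.
    rewrite -(subrr (w x)); apply: cvgB; [exact: h|exact: cvg_cst].
  apply/fine_cvgP; split.
    have /fine_cvgP[hf _] := h; apply: filterS hf => k; exact: fin_num_poweR.
  have /fine_cvgP[hf hc] := h.
  have c' : (fine (Int E (fun x => (`|w_ k x - w x| `^ p)%R))) `^ p^-1 @[k --> \oo] --> 0.
    apply: powR_cvg0; [by rewrite invr_gt0| |exact: hc].
    by move=> k; apply: fine_ge0; apply: Int_ge0 => x _; exact: powR_ge0.
  apply: cvg_trans c'; apply: near_eq_cvg; apply: filterS hf => k fk /=.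
  by rewrite -(fineK fk).
- under eq_fun do rewrite -IntE.
  apply: zero => //; first by move=> k x; exact: Qlen_ge0.
  by move=> k; apply: filterS dom => x h Ex; case: (h Ex k).
Qed.

Lemma powRD3_le (a b c : R) : 0 <= a -> 0 <= b -> 0 <= c ->
  (a + b + c) `^ p <= 2 `^ p * 2 `^ p * (a `^ p + b `^ p + c `^ p).
Proof.
move=> a0 b0 c0; have h2 : 1 <= 2 `^ p :> R.
  by rewrite -[X in X <= _](powRr0 2) ler_powR ?ltW//; lra.
apply: (le_trans (powRD_le (ltW p0) (addr_ge0 a0 b0) c0)).
rewrite -mulrA ler_wpM2l ?powR_ge0//.
have h := powRD_le (ltW p0) a0 b0.
rewrite [leRHS]mulrDr; apply: lerD => //.
by rewrite ler_peMl ?powR_ge0.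
Qed.

Lemma powR_le3 (d a b c : R) : 0 <= a -> 0 <= b -> 0 <= c -> 0 <= d -> d <= a + b + c ->
  d `^ p <= 2 `^ p * 2 `^ p * (a `^ p + b `^ p + c `^ p).
Proof.
move=> a0 b0 c0 d0 h; apply: le_trans (powRD3_le a0 b0 c0).
by apply: ge0_ler_powR; rewrite ?nnegrE ?(ltW p0) ?addr_ge0.
Qed.

Lemma lipschitz_Lip_loc (f : V -> R) : lipschitz f -> Lip_loc Omega f.
Proof.
move=> [M [Mr fM]] z Oz; exists M; split; first exact: Mr.
by move=> N MN; apply: nearW => y Oy; exact: fM.
Qed.

Lemma grads_derivable_ae (u_ : nat -> V -> R) (eta : V -> R) : (forall k, Lip_loc Omega (u_ k)) ->
  lipschitz eta ->
  \forall x \ae mu, Omega x -> (forall i, derivable eta x (delta_mx ord0 i)) /\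
    forall k i, derivable (u_ k) x (delta_mx ord0 i).
Proof.
move=> uL le.
have eL : Lip_loc Omega eta by exact: lipschitz_Lip_loc.
have h1 : \forall x \ae mu, forall i, Omega x -> derivable eta x (delta_mx ord0 i).
  by apply: filter_forall => i; exact: (grad_meas_loc _ oOm eL).2.
have h2 : \forall x \ae mu, forall k, forall i, Omega x -> derivable (u_ k) x (delta_mx ord0 i).
  by apply/ae_foralln => k; apply: filter_forall => i; exact: (grad_meas_loc _ oOm (uL k)).2.
apply: filterS2 h1 h2 => x h1 h2 Ox; split=> [i|k i]; [exact: h1|exact: h2].
Qed.

Lemma dist_itv (C s t : R) : 0 <= s <= C -> 0 <= t <= C -> `|s - t| <= C.
Proof. by move=> /andP[s1 s2] /andP[t1 t2]; rewrite ler_norml; apply/andP; split; lra. Qed.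

(** The bound C1 on G is required only after multiplication by the gradient length of [eta]. With a
    true cutoff this asks G to be bounded; with eta = 1 it asks nothing, so an unbounded G such as a
    logarithm is allowed. The class [DD] is free in order to serve both [WQ] and [WQ_0]. *)
Lemma WQ_comp (E : set V) (DD : set (V -> R)) (u : V -> R) (gu : V -> V)
  (u_ : nat -> V -> R) (D eta : V -> R) (G g : R -> R) (C1 : R) :
  bounded_set Omega -> open E -> E `<=` Omega ->
  meas_on Omega u -> (forall i, meas_on Omega (fun x => gu x ord0 i)) ->
  good_approx Omega Q p u gu u_ D -> adm G g -> lipschitz eta -> (forall x, 0 <= eta x <= 1) ->
  L1 E (fun x => Qlen Q (grad eta) x `^ p) -> 0 <= C1 ->
  (forall x s t, `|G s - G t| * Qlen Q (grad eta) x <= C1 * Qlen Q (grad eta) x) ->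
  (forall x s, `|G s| * Qlen Q (grad eta) x <= C1 * Qlen Q (grad eta) x) ->
  (forall k, DD (fun y => eta y ^+ 1 * G (u_ k y))) ->
  (forall k, Lip_loc Omega (fun y => eta y ^+ 1 * G (u_ k y))) ->
  WQ_closure DD Q p E (fun y => eta y * G (u y))
    (fun y => (eta y * g (u y)) *: gu y + G (u y) *: grad eta y).
Proof.
move=> bOm oE EO mu_ mgu [uL D0 LD uD] aG le e01 LDe C10 GD GD1 wD wL.
have cG := adm_cont aG; have [dG cg [C GC]] := aG.
have C0 : 0 <= C by have /andP[h1 h2] := GC 0; exact: le_trans h1 h2.
have lipG := adm_lip aG GC.
have mE : measurable (E : set T) by exact: open_measurable_Rn.
have Eoo : (mu (E : set T) < +oo)%E.
  apply: le_lt_trans (bounded_leb_lty bOm); apply: le_measure; rewrite ?inE//.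
have eL : Lip_loc Omega eta by exact: lipschitz_Lip_loc.
pose De := Qlen Q (grad eta).
pose c4 : R := 2 `^ p * 2 `^ p.
have c40 : 0 <= c4 by rewrite mulr_ge0 ?powR_ge0.
(* The constant |G(0)|^p enters through |G(t)| <= |G(0)| + C |t|; it is integrable since Omega is
   bounded. *)
pose B x := c4 * (`|G 0| `^ p + (C `^ p * D x + C `^ p * D x) + C1 `^ p * De x `^ p).
have mue : meas_on E u by exact: meas_onS EO mu_.
have LB : L1 E B.
  have LCD := L1Z mE (powR_ge0 C p) (L1S mE mOm EO LD).
  apply: (L1Z mE c40 (L1D mE _ (L1Z mE (powR_ge0 C1 p) LDe))).
  exact: (L1D mE (L1_cst mE (powR_ge0 `|G 0| p) Eoo) (L1D mE LCD LCD)).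
have dae := grads_derivable_ae uL le.
have grad_wk : \forall x \ae mu, E x -> forall k, grad (fun y => eta y ^+ 1 * G (u_ k y)) x =
    (eta x * g (u_ k x)) *: grad (u_ k) x + G (u_ k x) *: grad eta x.
  apply: filterS dae => x h /EO /h [de du] k.
  rewrite (grad_prod 0 (du k) de (dG (u_ k x))).
  by rewrite expr1 expr0 mulr1 mul1r.
pose qn x v := enorm (v *m sqrtmx (Q x)).
have qnD x v w : qn x (v + w) <= qn x v + qn x w by rewrite /qn mulmxDl enormD.
have qnZ x (c : R) v : qn x (c *: v) = `|c| * qn x v by rewrite /qn -scalemxAl enormZ.
have qn0 x v : 0 <= qn x v by exact: enorm_ge0.
have eC x (t : R) : eta x * g t <= C.
  have /andP[g1 g2] := GC t; have /andP[e1 e2] := e01 x.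
  by apply: le_trans g2; rewrite ler_piMl.
have diff : \forall x \ae mu, E x -> forall k,
    Qlen Q (fun y => grad (fun y => eta y ^+ 1 * G (u_ k y)) y - ((eta y * g (u y)) *: gu y + G (u y) *: grad eta y)) x
    <= C * Qlen Q (fun y => grad (u_ k) y - gu y) x + `|g (u_ k x) - g (u x)| * Qlen Q gu x +
       `|G (u_ k x) - G (u x)| * De x.
  apply: filterS grad_wk => x h /h {}h k.
  rewrite /Qlen h -!/(qn x _).
  have -> : eta x * g (u_ k x) *: grad (u_ k) x + G (u_ k x) *: grad eta x -
     (eta x * g (u x) *: gu x + G (u x) *: grad eta x) =
     (eta x * g (u_ k x)) *: (grad (u_ k) x - gu x) + (eta x * (g (u_ k x) - g (u x))) *: gu x +
     (G (u_ k x) - G (u x)) *: grad eta x.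
    move: (grad eta x) (gu x) (grad (u_ k) x) => v1 v2 v3.
    by apply/rowP => i; rewrite !mxE; ring.
  have /andP[g1 g2] := GC (u_ k x); have /andP[e1 e2] := e01 x.
  apply: (le_trans (qnD _ _ _)); rewrite qnZ; apply: lerD; last by [].
  apply: (le_trans (qnD _ _ _)); rewrite !qnZ; apply: lerD.
    by rewrite ger0_norm ?mulr_ge0// ler_wpM2r.
  by rewrite normrM ler_wpM2r// ger0_norm// ler_piMl.
have pw (d a1 a2 b1 : R) x : 0 <= D x -> 0 <= d -> 0 <= a1 -> 0 <= a2 -> 0 <= b1 ->
    a1 `^ p <= D x -> a2 `^ p <= D x -> (b1 <= `|G 0| \/ b1 <= C1 * De x) -> d <= C * a1 + C * a2 + b1 -> d `^ p <= B x.
  move=> Dx d0 a10 a20 b10 a1D a2D b1h dle.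
  apply: (le_trans (powR_le3 _ _ b10 d0 dle)); try (by rewrite mulr_ge0).
  rewrite /B -/c4 ler_wpM2l// !powRM//.
  have b1p : b1 `^ p <= `|G 0| `^ p + C1 `^ p * De x `^ p.
    case: b1h => h.
      apply: (@le_trans _ _ (`|G 0| `^ p)); last by rewrite lerDl mulr_ge0 ?powR_ge0.
      by apply: ge0_ler_powR; rewrite ?nnegrE// ltW.
    apply: (@le_trans _ _ (C1 `^ p * De x `^ p)); last by rewrite lerDr powR_ge0.
    rewrite -powRM//; last exact: Qlen_ge0.
    by apply: ge0_ler_powR; rewrite ?nnegrE ?mulr_ge0 ?Qlen_ge0// ltW.
  have h1 : C `^ p * a1 `^ p <= C `^ p * D x by rewrite ler_wpM2l ?powR_ge0.
  have h2 : C `^ p * a2 `^ p <= C `^ p * D x by rewrite ler_wpM2l ?powR_ge0.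
  lra.
have mGu : meas_on E (fun x => G (u x)) by exact: mcomp.
have mgu' : meas_on E (fun x => g (u x)) by exact: mcomp.
have meta : meas_on E eta.
  by apply: (meas_onS mOm EO); exact: (Lip_loc_meas oOm eL).
apply: (WQ_closureI (B := B) oE EO _ _ wD wL LB).
- by mfun.
- move=> i; rewrite (_ : (fun _ => _) = fun x => (eta x * g (u x)) * gu x ord0 i + G (u x) * grad eta x ord0 i).
    have m1 : meas_on E (fun x => gu x ord0 i) by apply: (meas_onS mOm EO); exact: mgu.
    have m2 : meas_on E (fun x => grad eta x ord0 i).
      by apply: (meas_onS mOm EO); exact: (grad_meas oOm i eL).
    by mfun.
  by apply/funext => x; rewrite !mxE.
- near=> x => Ex k; have Ox := EO x Ex.
  have [h1 h2 [h3 h4] _ _] : [/\ (forall k, `|u_ k x - u x| `^ p <= D x),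
         (forall k, Qlen Q (fun y => grad (u_ k) y - gu y) x `^ p <= D x),
         `|u x| `^ p <= D x /\ Qlen Q gu x `^ p <= D x,
         u_ k x @[k --> \oo] --> u x &
         Qlen Q (fun y => grad (u_ k) y - gu y) x @[k --> \oo] --> 0].
    by move: Ox; near: x; exact: uD.
  have hd : Qlen Q (fun y => grad (fun y => eta y ^+ 1 * G (u_ k y)) y - ((eta y * g (u y)) *: gu y + G (u y) *: grad eta y)) x
    <= C * Qlen Q (fun y => grad (u_ k) y - gu y) x + `|g (u_ k x) - g (u x)| * Qlen Q gu x +
       `|G (u_ k x) - G (u x)| * De x.
    by move: k; move: Ex; near: x; exact: diff.
  have hg : grad (fun y => eta y ^+ 1 * G (u_ k y)) x =
    (eta x * g (u_ k x)) *: grad (u_ k) x + G (u_ k x) *: grad eta x.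
    by move: k {hd}; move: Ex; near: x; exact: grad_wk.
  have /andP[e1 e2] := e01 x.
  split.
  + apply: (@pw _ `|u_ k x - u x| `|u x| 0 x) => //; first by left.
    rewrite expr1 -mulrBr normrM ger0_norm// addr0.
    apply: (@le_trans _ _ `|G (u_ k x) - G (u x)|); first by rewrite ler_piMl.
    by apply: (le_trans (lipG _ _)); rewrite lerDl mulr_ge0.
  + apply: (@pw _ (Qlen Q (fun y => grad (u_ k) y - gu y) x) (Qlen Q gu x) (C1 * De x) x);
      [exact: D0|exact: Qlen_ge0|exact: Qlen_ge0|exact: Qlen_ge0|by apply: mulr_ge0; [exact: C10|exact: Qlen_ge0]
      |exact: h2|exact: h4|by right|].
    apply: (le_trans hd); apply: lerD; last exact: GD.
    rewrite lerD2l ler_wpM2r ?Qlen_ge0//.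
    exact: dist_itv.
  + apply: (@pw _ `|u_ k x - u x| `|u x| `|G 0| x) => //; first by left.
    rewrite expr1 normrM ger0_norm//.
    apply: (@le_trans _ _ `|G (u_ k x)|); first by rewrite ler_piMl.
    have -> : G (u_ k x) = (G (u_ k x) - G (u x)) + (G (u x) - G 0) + G 0 by ring.
    apply: (le_trans (ler_normD _ _)); rewrite lerD2r.
    apply: (le_trans (ler_normD _ _)); apply: lerD; first exact: lipG.
    by rewrite -[X in _ * `|X|]subr0; exact: lipG.
  + apply: (@pw _ (Qlen Q (fun y => grad (u_ k) y - gu y) x) (Qlen Q gu x) (C1 * De x) x);
      [exact: D0|exact: Qlen_ge0|exact: Qlen_ge0|exact: Qlen_ge0|by apply: mulr_ge0; [exact: C10|exact: Qlen_ge0]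
      |exact: h2|exact: h4|by right|].
    rewrite /Qlen hg -!/(qn x _).
    have /andP[g1 g2] := GC (u_ k x).
    apply: (le_trans (qnD _ _ _)); rewrite !qnZ; apply: lerD; last exact: GD1.
    rewrite ger0_norm ?mulr_ge0// -mulrDr.
    apply: ler_pM => //; first by rewrite mulr_ge0.
    by rewrite -{1}(subrK (gu x) (grad (u_ k) x)); exact: qnD.
- apply: filterS uD => x h Ex; have [_ _ _ c1 _] := h (EO _ Ex).
  under eq_fun do rewrite expr1.
  apply: (@cvgM _ _ _ _ (fun=> eta x) (fun k => G (u_ k x))); first exact: cvg_cst.
  by apply: (continuous_cvg _ _ c1); exact: cG.
- apply: filterS2 uD diff => x h1 h2 Ex; have [_ _ _ c1 c2] := h1 (EO _ Ex).
  have {}h2 := h2 Ex.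
  have nz (f : R -> R) : continuous f -> `|f (u_ k x) - f (u x)| @[k --> \oo] --> 0.
    move=> cf; apply/norm_cvg0P; rewrite -(subrr (f (u x))).
    apply: cvgB; last exact: cvg_cst.
    by apply: (continuous_cvg _ _ c1); exact: cf.
  have up : C * Qlen Q (fun y => grad (u_ k) y - gu y) x +
     `|g (u_ k x) - g (u x)| * Qlen Q gu x + `|G (u_ k x) - G (u x)| * De x @[k --> \oo] --> 0.
    have -> : 0 = C * 0 + 0 * Qlen Q gu x + 0 * De x by rewrite mulr0 !mul0r !addr0.
    apply: cvgD; last by apply: cvgM; [exact: nz|exact: cvg_cst].
    apply: cvgD; last by apply: cvgM; [exact: nz|exact: cvg_cst].
    by apply: cvgM; [exact: cvg_cst|exact: c2].
  apply: (squeeze_cvgr _ (cvg_cst 0) up).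
  by apply: nearW => k; rewrite Qlen_ge0 /=; exact: h2.
Unshelve. all: by end_near. Qed.

Lemma grad_cst (c : R) (x : V) : grad (fun=> c) x = 0.
Proof. by apply/rowP => i; rewrite !mxE derive_cst. Qed.

Lemma enorm0 : enorm (0 : V) = 0.
Proof. by rewrite -(scale0r (0 : V)) enormZ normr0 mul0r. Qed.

Lemma Qlen_grad_tsupp (f : V -> R) x : ~ tsupp f x -> Qlen Q (grad f) x = 0.
Proof. by move=> xf; rewrite /Qlen grad_tsupp// mul0mx enorm0. Qed.

Lemma WQ_comp_adm (u : V -> R) (gu : V -> V) (G g : R -> R) : bounded_set Omega ->
  WQ Q p Omega u gu -> adm G g ->
  WQ Q p Omega (fun y => G (u y)) (fun y => g (u y) *: gu y).
Proof.
move=> bOm uW aG; have [mu_ mgu _] := uW.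
have [u_ [D uD]] := WQ_approx mOm p1 mQ symQ oOm uW.
have [uL D0 LD _] := uD.
have [dG cg [C GC]] := aG.
have C0 : 0 <= C by have /andP[h1 h2] := GC 0; exact: le_trans h1 h2.
have E0 x : Qlen Q (grad (fun=> 1)) x = 0 by rewrite /Qlen grad_cst mul0mx enorm0.
have wL k : Lip_loc Omega (fun y => 1 ^+ 1 * G (u_ k y)).
  rewrite (_ : (fun _ => _) = fun y => G (u_ k y)); last by apply/funext => y; rewrite expr1 mul1r.
  by apply: (Lip_loc_comp (adm_lip aG GC) C0); exact: uL.
have lc : lipschitz (fun _ : V => 1 : R).
  by apply/lipschitzP; exists 1 => // x y; rewrite subrr normr0 mul1r.
have e01 (x : V) : 0 <= (1 : R) <= 1 by rewrite ler01 lexx.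
have LDe : L1 Omega (fun x => Qlen Q (grad (fun=> 1)) x `^ p).
  rewrite (_ : (fun _ => _) = fun=> 0); last by apply/funext => x; rewrite E0 powR0.
  by apply: L1_cst; [exact: mOm|by []|exact: bounded_leb_lty].
have h1 x (s t : R) : `|G s - G t| * Qlen Q (grad (fun=> 1)) x <= 0 * Qlen Q (grad (fun=> 1)) x by rewrite E0 !mulr0.
have h2 x (s : R) : `|G s| * Qlen Q (grad (fun=> 1)) x <= 0 * Qlen Q (grad (fun=> 1)) x by rewrite E0 !mulr0.
have := WQ_comp bOm oOm (fun x h => h) mu_ mgu uD aG lc e01 LDe (lexx 0) h1 h2 wL wL.
congr (WQ_closure _ Q p Omega _ _); apply/funext => y; first by rewrite mul1r.
by rewrite grad_cst scaler0 addr0 mul1r.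
Qed.

Lemma WQ_0_cutoff (E : set V) (u eta : V -> R) (gu : V -> V) (G g : R -> R) (C1 : R) : bounded_set Omega ->
  open E -> E `<=` Omega -> WQ Q p Omega u gu -> adm G g -> (forall t, 0 <= G t <= C1) ->
  lipschitz eta -> (forall x, 0 <= eta x <= 1) -> compact (tsupp eta) -> tsupp eta `<=` E ->
  L1 E (fun x => Qlen Q (grad eta) x `^ p) ->
  WQ_0 Q p E (fun y => eta y * G (u y)) (fun y => (eta y * g (u y)) *: gu y + G (u y) *: grad eta y).
Proof.
move=> bOm oE EO uW aG G1 le e01 cs sE LDe; have [mu_ mgu _] := uW.
have [u_ [D uD]] := WQ_approx mOm p1 mQ symQ oOm uW.
have [uL D0 LD _] := uD.
have [dG cg [C GC]] := aG.
have C0 : 0 <= C by have /andP[h1 h2] := GC 0; exact: le_trans h1 h2.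
have C10 : 0 <= C1 by have /andP[h1 h2] := G1 0; exact: le_trans h1 h2.
have G1' t : `|G t| <= C1 by have /andP[h1 h2] := G1 t; rewrite ger0_norm.
have w0 k : Lip_0 E (fun y => eta y ^+ 1 * G (u_ k y)).
  exact: (Lip_0_prod 0 (adm_lip aG GC) C0 G1' (uL k) EO le e01 cs sE).
apply: (WQ_comp bOm oE EO mu_ mgu uD aG le e01 LDe C10).
- move=> x s t; rewrite ler_wpM2r ?Qlen_ge0//; exact: dist_itv.
- move=> x s; rewrite ler_wpM2r ?Qlen_ge0//.
- exact: w0.
- by move=> k; apply: lipschitz_Lip_loc; have [] := w0 k.
Qed.

Lemma young (s t : R) : 0 <= s -> 0 <= t -> s * t <= s `^ p + t `^ dual_exp p.
Proof.
move=> s0 t0; have p10 : 0 < p - 1 by rewrite subr_gt0.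
have d0 : 0 < dual_exp p by rewrite divr_gt0.
have e : p^-1 + (dual_exp p)^-1 = 1.
  by rewrite /dual_exp; field; rewrite !gt_eqF.
apply: (le_trans (conjugate_powR s0 t0 p0 d0 e)).
have le1 (q : R) : 0 < q -> 0 <= 1 - q -> q <= 1 by move=> _; rewrite subr_ge0.
apply: lerD; rewrite ler_piMr ?powR_ge0//.
  by rewrite invf_le1// ltW.
have pi0 : 0 < p^-1 by rewrite invr_gt0.
lra.
Qed.

Lemma pointwise_sum (c1 c2 c3 XX h0 d1 d2 d3 b1 Ah Dh De Bh : R) :
  c1 * - (Dh * Ah) <= c1 * d1 -> c1 * (XX - h0) <= c1 * d2 -> c2 * - (De * Ah) <= c2 * d3 ->
  c3 * - Bh <= c3 * b1 ->
  c1 * XX <= c1 * (d1 + d2) + c2 * d3 + c3 * b1 + (c1 * h0 + c2 * De * Ah + c3 * Bh + c1 * (Dh * Ah)).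
Proof. by move=> *; nra. Qed.

(** The test function is eta^{m+1} G(u_k), whereas A and B are evaluated at (u, gu). Ellipticity
    therefore applies to gu, and the mismatch between grad u_k and gu is paid by an error that
    vanishes in the limit. [hh], [Ab], [Bb] are whatever bounds the structure provides along this
    solution. *)
Lemma energy_ineq (S : set V) (A : V -> R -> V -> V) (B : V -> R -> V -> R) (a C1 : R)
    (hh Ab Bb eta u : V -> R) (gu : V -> V) (G g : R -> R) m :
  measurable (S : set T) -> S `<=` Omega -> 0 <= a ->
  L1 S hh -> meas_on S Ab -> (forall x, S x -> 0 <= Ab x) -> L1 S (fun x => Ab x `^ dual_exp p) -> L1 S Bb ->
  (\forall x \ae mu, S x -> exists v, [/\ A x (u x) (gu x) = v *m sqrtmx (Q x),
     a^-1 * Qlen Q gu x `^ p - hh x <= dotv (gu x) (A x (u x) (gu x)),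
     enorm v <= Ab x & `|B x (u x) (gu x)| <= Bb x]) ->
  weak_solution Omega Q p A B u gu ->
  adm G g -> (forall t, 0 <= G t <= C1) ->
  lipschitz eta -> (forall x, 0 <= eta x <= 1) -> compact (tsupp eta) -> tsupp eta `<=` S ->
  L1 S (fun x => Qlen Q (grad eta) x `^ p) ->
  (Int S (fun x => (eta x ^+ m.+1 * g (u x) * (a^-1 * Qlen Q gu x `^ p))%R) <=
   Int S (fun x => (eta x ^+ m.+1 * g (u x) * hh x +
     m.+1%:R * eta x ^+ m * G (u x) * Qlen Q (grad eta) x * Ab x + eta x ^+ m.+1 * G (u x) * Bb x)%R))%E.
Proof.
move=> mS SO a0 Lhh mAb Ab0 LAb LBb pt [uW usol] aG G1 le e01 cs sS LDe; have [mu_ mgu _] := uW.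
have [u_ [D uD]] := WQ_approx mOm p1 mQ symQ oOm uW.
have [uL D0 LD uDae] := uD.
have cG := adm_cont aG; have [dG cg [C GC]] := aG.
have C0 : 0 <= C by have /andP[h1 h2] := GC 0; exact: le_trans h1 h2.
have C10 : 0 <= C1 by have /andP[h1 h2] := G1 0; exact: le_trans h1 h2.
have G1' t : `|G t| <= C1 by have /andP[h1 h2] := G1 t; rewrite ger0_norm.
have G0 t : 0 <= G t by have /andP[] := G1 t.
have g0 t : 0 <= g t by have /andP[] := GC t.
have e0 x : 0 <= eta x by have /andP[] := e01 x.
pose phi k y := eta y ^+ m.+1 * G (u_ k y).
have w0 k : Lip_0 Omega (phi k).
  exact: (Lip_0_prod m (adm_lip aG GC) C0 G1' (uL k) (fun x h => h) le e01 cs (subset_trans sS SO)).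
have phi0 k x : 0 <= phi k x.
  by have /andP[h1 _] := e01 x; have /andP[h2 _] := G1 (u_ k x); rewrite mulr_ge0// exprn_ge0.
have Fk := fun k => usol (phi k) (w0 k) (phi0 k).
pose F k x := dotv (grad (phi k) x) (A x (u x) (gu x)) + phi k x * B x (u x) (gu x).
have tsub k x : ~ S x -> F k x = 0.
  move=> nS; have nt : ~ tsupp eta x by move=> /sS.
  have nt' : ~ tsupp (phi k) x.
    move=> h; apply: nt; apply: (closure_subset _ h) => y /=; apply: contra_neq => e.
    by rewrite /phi e expr0n /= mul0r.
  rewrite /F (grad_tsupp nt') (tsupp0 nt') mul0r addr0.
  by rewrite /dotv big1// => i _; rewrite mxE mul0r.
have iFS k : mu.-integrable (S : set T) (fun x : T => (F k x)%:E).
  by apply: (integrableS mOm mS SO); exact: (Fk k).1.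
have F0 k : Int S (F k) = 0%E.
  rewrite -[RHS](Fk k).2 IntE [LHS]integral_mkcond [RHS]integral_mkcond.
  apply: eq_integral => x _; rewrite /patch.
  have [xS|xS] := boolP (x \in S).
    by rewrite ifT//; apply/mem_set/SO/set_mem.
  by case: ifPn => // _; rewrite -/(F k x) tsub// => h; move: xS; rewrite mem_set.
pose X := Qlen Q gu.
pose Dk k := Qlen Q (fun y => grad (u_ k) y - gu y).
pose De := Qlen Q (grad eta).
have X0 x : 0 <= X x by exact: Qlen_ge0.
have Dk0 k x : 0 <= Dk k x by exact: Qlen_ge0.
have De0 x : 0 <= De x by exact: Qlen_ge0.
(* Integrands of the two sides with t in place of u(x). In [r], d stands for the length of
   sqrt(Q)(grad u_k - gu); the last summand is the error. *)
pose P t x := eta x ^+ m.+1 * g t * (a^-1 * X x `^ p).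
pose r t (d : R) x := eta x ^+ m.+1 * g t * hh x + m.+1%:R * eta x ^+ m * G t * De x * Ab x +
  eta x ^+ m.+1 * G t * Bb x + eta x ^+ m.+1 * g t * (d * Ab x).
have dae := grads_derivable_ae uL le.
have [mhh hh0 _] := Lhh; have [mBb Bb0 _] := LBb.
have eL : Lip_loc Omega eta by exact: lipschitz_Lip_loc.
have meta : meas_on S eta by apply: (meas_onS mOm SO); exact: (Lip_loc_meas oOm eL).
have muS : meas_on S u by apply: (meas_onS mOm SO).
have muk k : meas_on S (u_ k) by apply: (meas_onS mOm SO); exact: (Lip_loc_meas oOm (uL k)).
have mguS i : meas_on S (fun x => gu x ord0 i) by apply: (meas_onS mOm SO); exact: mgu.
have mgk k i : meas_on S (fun x => grad (u_ k) x ord0 i).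
  by apply: (meas_onS mOm SO); exact: (grad_meas oOm i (uL k)).
have mX : meas_on S X by exact: (Qlen_meas mOm mQ symQ mS SO).
have mDe : meas_on S De.
  apply: (Qlen_meas mOm mQ symQ mS SO) => i.
  by apply: (meas_onS mOm SO); exact: (grad_meas oOm i eL).
have mDk k : meas_on S (Dk k).
  apply: (Qlen_meas mOm mQ symQ mS SO) => i.
  rewrite (_ : (fun _ => _) = fun x => grad (u_ k) x ord0 i + - gu x ord0 i).
    by apply: mD; [exact: mgk|apply: mN; exact: mguS].
  by apply/funext => x; rewrite !mxE.
have mg (f : V -> R) : meas_on S f -> meas_on S (fun x => g (f x)) by move=> mf; exact: mcomp.
have mG (f : V -> R) : meas_on S f -> meas_on S (fun x => G (f x)) by move=> mf; exact: mcomp.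
have mgk' k := mg _ (muk k). have mGk' k := mG _ (muk k).
have mgu' := mg _ muS. have mGu' := mG _ muS.
have mP k : meas_on S (fun x => P (u_ k x) x) by rewrite /P; mfun; exact: mgk'.
have mr k : meas_on S (fun x => r (u_ k x) (Dk k x) x).
  by rewrite /r; mfun; [exact: mgk'|exact: mGk'|exact: mGk'|exact: mgk'|exact: mDk].
have mP' : meas_on S (fun x => P (u x) x) by rewrite /P; mfun.
have mr' : meas_on S (fun x => r (u x) 0 x) by rewrite /r; mfun.
have pw : \forall x \ae mu, S x -> forall k, P (u_ k x) x <= F k x + r (u_ k x) (Dk k x) x.
  apply: filterS2 pt dae => x h1 h2 Sx k; have [v [vE vge vAb vBb]] := h1 Sx; have [de du] := h2 (SO _ Sx).
  rewrite /F /P /r (grad_prod m (du k) de (dG (u_ k x))).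
  have dA w : - (enorm (w *m sqrtmx (Q x)) * Ab x) <= dotv w (A x (u x) (gu x)).
    rewrite vE -dotv_sym ?sqrtmx_sym//.
    have := cauchy_schwarz (w *m sqrtmx (Q x)) v; rewrite ler_norml => /andP[h _].
    apply: le_trans h; rewrite lerN2; exact: (ler_wpM2l (enorm_ge0 _) vAb).
  have h3 := dA (grad eta x); have h4 := dA (grad (u_ k) x - gu x).
  rewrite dotvDl !dotvZl -{1}(subrK (gu x) (grad (u_ k) x)) dotvDl.
  rewrite -/(Qlen Q (grad eta) x) -/(De x) in h3; rewrite -/(Qlen Q (fun y => grad (u_ k) y - gu y) x) -/(Dk k x) in h4.
  rewrite -/(X x) in vge.
  have vB : - Bb x <= B x (u x) (gu x) by move: vBb; rewrite ler_norml => /andP[].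
  rewrite /phi.
  have E1 := exprn_ge0 m.+1 (e0 x).
  have E2 : 0 <= m.+1%:R * eta x ^+ m by rewrite mulr_ge0// exprn_ge0.
  have q1 := ler_wpM2l (mulr_ge0 E1 (g0 (u_ k x))) h4.
  have q2 := ler_wpM2l (mulr_ge0 E1 (g0 (u_ k x))) vge.
  have q3 := ler_wpM2l (mulr_ge0 E2 (G0 (u_ k x))) h3.
  have q4 := ler_wpM2l (mulr_ge0 E1 (G0 (u_ k x))) vB.
  exact: (pointwise_sum q1 q2 q3 q4).
(* A majorant of [r] independent of k: the products with [Ab] are split by Young's inequality. *)
pose T x := C * hh x + m.+1%:R * C1 * (De x `^ p + Ab x `^ dual_exp p) + C1 * Bb x +
  C * (D x + Ab x `^ dual_exp p).
have LT : L1 S T.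
  have LDS := L1S mS mOm SO LD.
  have m0 : 0 <= m.+1%:R * C1 by rewrite mulr_ge0.
  apply: (L1D mS); last exact: (L1Z mS C0 (L1D mS LDS LAb)).
  apply: (L1D mS); last exact: (L1Z mS C10 LBb).
  by apply: (L1D mS); [exact: (L1Z mS C0 Lhh)|exact: (L1Z mS m0 (L1D mS LDe LAb))].
have [mT T0 Too] := LT.
have r0 t d x : S x -> 0 <= d -> 0 <= r t d x.
  move=> Sx d0; have h1 := Ab0 _ Sx; have h2 := hh0 _ Sx; have h3 := Bb0 _ Sx.
  by rewrite /r !addr_ge0// !mulr_ge0// ?exprn_ge0.
have E1 x k : eta x ^+ k <= 1 by have /andP[h1 h2] := e01 x; rewrite exprn_ile1.
have E0 x k : 0 <= eta x ^+ k by rewrite exprn_ge0.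
have rT t d x : S x -> 0 <= d -> d `^ p <= D x -> r t d x <= T x.
  move=> Sx d0 dD; have h1 := Ab0 _ Sx; have h2 := hh0 _ Sx; have h3 := Bb0 _ Sx.
  have /andP[_ gC] := GC t; have /andP[_ GC1] := G1 t.
  rewrite /r /T; apply: lerD; [apply: lerD; [apply: lerD|]|].
  - rewrite ler_wpM2r// -[leRHS]mul1r; exact: ler_pM.
  - rewrite -[leLHS]mulrA; apply: ler_pM; rewrite ?mulr_ge0//; last exact: young.
    rewrite -[leRHS]mulr1 mulrAC; apply: ler_pM; rewrite ?mulr_ge0//.
    by apply: ler_pM.
  - rewrite ler_wpM2r// -[leRHS]mul1r; exact: ler_pM.
  - apply: ler_pM; rewrite ?mulr_ge0//; first by rewrite -[leRHS]mul1r; exact: ler_pM.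
    by apply: (le_trans (young d0 h1)); rewrite lerD2r.
have rk k : L1 S (fun x => r (u_ k x) (Dk k x) x).
  apply: (L1_le mS (mr k) _ _ LT).
    by move=> x Sx; exact: (r0 _ _ _ Sx (Dk0 k x)).
  by apply: filterS uDae => x h Sx; have [_ h1 _ _ _] := h (SO _ Sx); exact: (rT _ _ _ Sx (Dk0 k x) (h1 k)).
have rle k : (Int S (fun x => P (u_ k x) x) <= Int S (fun x => r (u_ k x) (Dk k x) x))%E.
  have P0 x : S x -> 0 <= P (u_ k x) x.
    by move=> Sx; rewrite /P !mulr_ge0// ?invr_ge0// powR_ge0.
  have [m1 m2 m3] := rk k.
  have iF : measurable_fun (S : set (lebT R n)) (fun x : lebT R n => (F k x)%:E) := measurable_int _ (iFS k).
  have mF : meas_on S (F k) by apply/measurable_EFinP.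
  have mFr : meas_on S (fun x => F k x + r (u_ k x) (Dk k x) x) by mfun.
  apply: (le_trans (Int_le mS (mP k) mFr P0 _)).
    by apply: filterS pw => x h Sx; exact: h.
  rewrite (IntE S (fun x => F k x + _)).
  under eq_integral do rewrite EFinD.
  rewrite (integralD mS (iFS k) (Int_integrable mS m1 m2 m3)).
  by rewrite -!IntE F0 add0e.
have cP : Int S (fun x => P (u_ k x) x) @[k --> \oo] --> Int S (fun x => P (u x) x).
  have LDS := L1S mS mOm SO LD.
  have ai0 : 0 <= C * a^-1 by rewrite mulr_ge0// invr_ge0.
  have [t1 t2 t3] := L1Z mS ai0 LDS.
  apply: (Int_dct mS mP mP' t1 t2 t3).
    move=> k; apply: filterS uDae => x h Sx; have [_ _ [_ h1] _ _] := h (SO _ Sx).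
    have /andP[_ gC] := GC (u_ k x).
    rewrite /P ger0_norm; last by rewrite !mulr_ge0// ?invr_ge0// powR_ge0.
    rewrite -[leRHS]mulrA; apply: ler_pM; rewrite ?mulr_ge0// ?invr_ge0// ?powR_ge0//.
      by rewrite -[leRHS]mul1r; exact: ler_pM.
    by rewrite ler_wpM2l// invr_ge0.
  apply: filterS uDae => x h Sx; have [_ _ _ c1 _] := h (SO _ Sx).
  have cg1 : g (u_ k x) @[k --> \oo] --> g (u x) by apply: (continuous_cvg _ _ c1); exact: cg.
  apply: (cvgM (cvgM (cvg_cst _) cg1) (cvg_cst _)).
have cr : Int S (fun x => r (u_ k x) (Dk k x) x) @[k --> \oo] --> Int S (fun x => r (u x) 0 x).
  apply: (Int_dct mS mr mr' mT T0 Too).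
    move=> k; apply: filterS uDae => x h Sx; have [_ h1 _ _ _] := h (SO _ Sx).
    by rewrite ger0_norm; [exact: (rT _ _ _ Sx (Dk0 k x) (h1 k))|exact: (r0 _ _ _ Sx (Dk0 k x))].
  apply: filterS uDae => x h Sx; have [_ _ _ c1 c2] := h (SO _ Sx).
  have cg1 : g (u_ k x) @[k --> \oo] --> g (u x) by apply: (continuous_cvg _ _ c1); exact: cg.
  have cG1 : G (u_ k x) @[k --> \oo] --> G (u x) by apply: (continuous_cvg _ _ c1); exact: cG.
  apply: (cvgD (cvgD (cvgD _ _) _) _).
  - exact: (cvgM (cvgM (cvg_cst _) cg1) (cvg_cst _)).
  - exact: (cvgM (cvgM (cvgM (cvg_cst _) cG1) (cvg_cst _)) (cvg_cst _)).
  - exact: (cvgM (cvgM (cvg_cst _) cG1) (cvg_cst _)).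
  - exact: (cvgM (cvgM (cvg_cst _) cg1) (cvgM c2 (cvg_cst _))).
have -> : (fun x => eta x ^+ m.+1 * g (u x) * hh x +
     m.+1%:R * eta x ^+ m * G (u x) * Qlen Q (grad eta) x * Ab x + eta x ^+ m.+1 * G (u x) * Bb x) =
  (fun x => r (u x) 0 x) by apply/funext => x; rewrite /r mul0r mulr0 addr0.
by apply: (lee_cvg_to cP cr); apply: nearW => k; exact: rle.
Qed.

End composition.

(** * The truncations and logarithmic functions used in test functions *)

Section admissible.
Context {R : realType}.
Implicit Types (G g : R -> R) (s t : R).

Lemma is_derive_quad (c0 c1 c2 x : R) :
  is_derive x 1 (fun z : R => c0 + c1 * z + c2 * z ^+ 2) (c1 + 2 * c2 * x).
Proof.
apply/is_derive1_caratheodory; exists (fun z => c1 + c2 * (z + x)); split.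
- by move=> z; ring.
- by apply: cvgD; [exact: cvg_cst|apply: cvgM; [exact: cvg_cst|apply: cvgD; [exact: cvg_id|exact: cvg_cst]]].
- by ring.
Qed.

Definition pospart t := Num.max t 0.

Lemma pospart_continuous : continuous pospart.
Proof.
move=> t; apply: (@continuous_max R R (fun z => z) (fun=> 0)); [exact: cvg_id|exact: cvg_cst].
Qed.

(** One C^1 family for both purposes, the square removing the kink of the positive part at 0.
    Coefficients (e, 1, e) give a bounded approximation of the positive part; (c, 1, 0) bend a
    decreasing line so that it stays positive. *)
Definition quot (c0 c1 c2 t : R) := pospart t ^+ 2 / (c0 + c1 * pospart t + c2 * pospart t ^+ 2).
Definition dquot (c0 c1 c2 t : R) :=
  (2 * c0 * pospart t + c1 * pospart t ^+ 2) / (c0 + c1 * pospart t + c2 * pospart t ^+ 2) ^+ 2.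

Section quot.
Variables c0 c1 c2 : R.
Hypotheses (c00 : 0 < c0) (c10 : 0 <= c1) (c20 : 0 <= c2).
Local Notation D s := (c0 + c1 * s + c2 * s ^+ 2).

Lemma pospart_ge0 t : 0 <= pospart t. Proof. by rewrite le_max lexx orbT. Qed.

Lemma pospart_pos t : 0 <= t -> pospart t = t. Proof. by move=> h; apply/max_idPl. Qed.

Lemma pospart_neg t : t <= 0 -> pospart t = 0. Proof. by move=> h; apply/max_idPr. Qed.

Lemma quot_den s : 0 <= s -> 0 < D s.
Proof. by move=> s0; rewrite -addrA ltr_wpDr// addr_ge0// mulr_ge0// exprn_ge0. Qed.

Lemma quot_derive t : is_derive t 1 (quot c0 c1 c2) (dquot c0 c1 c2 t).
Proof.
have [t0|t0|->] := ltgtP t 0.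
- rewrite /dquot (pospart_neg (ltW t0)) expr0n /= !mulr0 addr0 mul0r.
  apply: (@near_eq_is_derive R R R (fun=> 0) _ t 1 0 _ (is_derive_cst (0 : R) t 1)).
  near=> z; have z0 : z < 0 by near: z; exact: lt_nbhsl.
  by rewrite /quot (pospart_neg (ltW z0)) expr0n /= mul0r.
- have Dt : D t != 0 by rewrite gt_eqF// quot_den// ltW.
  have hV := @is_deriveV R (fun z => D z) t (c1 + 2 * c2 * t) 1 Dt (is_derive_quad c0 c1 c2 t).
  have h := @is_deriveM _ _ (fun z : R => 0 + 0 * z + 1 * z ^+ 2) (fun z => (D z)^-1) t 1 _ _ (is_derive_quad 0 0 1 t) hV.
  have e : \forall z \near t, (0 + 0 * z + 1 * z ^+ 2) * (D z)^-1 = quot c0 c1 c2 z.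
    near=> z; have z0 : 0 < z by near: z; exact: lt_nbhsr.
    by rewrite /quot (pospart_pos (ltW z0)) !mul0r !add0r mul1r.
  have := @near_eq_is_derive R R R _ _ t 1 _ e h; congr (is_derive _ _ _ _).
  rewrite /dquot (pospart_pos (ltW t0)) /GRing.scale /=; field; exact: Dt.
- rewrite /dquot (pospart_neg (lexx 0)) expr0n /= !mulr0 addr0 mul0r.
  apply/is_derive1_caratheodory; exists (fun z => pospart z / D (pospart z)); split.
  + move=> z; rewrite /quot (pospart_neg (lexx 0)) expr0n /= mul0r !subr0.
    have [z0|z0] := leP 0 z; first by rewrite (pospart_pos z0); ring.
    by rewrite (pospart_neg (ltW z0)) expr0n /= !mul0r.
  + have cp := @pospart_continuous 0.
    apply: cvgM => //; apply: cvgV.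
      by rewrite gt_eqF// quot_den// pospart_ge0.
    apply: cvgD; first by apply: cvgD; [exact: cvg_cst|apply: cvgM; [exact: cvg_cst|exact: cp]].
    by apply: cvgM; [exact: cvg_cst|exact: (cvgM cp cp)].
  + by rewrite (pospart_neg (lexx 0)) mul0r.
Unshelve. all: by end_near. Qed.

Lemma dquot_continuous : continuous (dquot c0 c1 c2).
Proof.
move=> t; have cp := @pospart_continuous t.
have cD : D (pospart z) @[z --> t] --> D (pospart t).
  apply: cvgD; first by apply: cvgD; [exact: cvg_cst|apply: cvgM; [exact: cvg_cst|exact: cp]].
  by apply: cvgM; [exact: cvg_cst|exact: (cvgM cp cp)].
apply: cvgM.
  apply: cvgD; first by apply: cvgM; [exact: cvg_cst|exact: cp].
  by apply: cvgM; [exact: cvg_cst|exact: (cvgM cp cp)].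
apply: cvgV; first by rewrite expf_neq0// gt_eqF// quot_den// pospart_ge0.
exact: (cvgM cD cD).
Qed.

End quot.

Lemma quot_ge0 (c0 c1 c2 t : R) : 0 < c0 -> 0 <= c1 -> 0 <= c2 -> 0 <= quot c0 c1 c2 t.
Proof.
move=> h0 h1 h2; rewrite divr_ge0 ?exprn_ge0 ?pospart_ge0// ltW// quot_den//.
exact: pospart_ge0.
Qed.

(* bounded admissible approximation of the positive part *)
Definition ptrunc (e t : R) := quot e 1 e t.
Definition dptrunc (e t : R) := dquot e 1 e t.

Section ptrunc.
Variable e : R.
Hypothesis e0 : 0 < e.

Let den t : 0 < e + 1 * pospart t + e * pospart t ^+ 2.
Proof. by apply: quot_den; [exact: e0|exact: ler01|exact: ltW|exact: pospart_ge0]. Qed.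

Lemma ptrunc_le t : ptrunc e t <= pospart t.
Proof.
rewrite /ptrunc /quot ler_pdivrMr//; have := pospart_ge0 t; move: (pospart t) => s s0.
have : 0 <= s * (e + e * s ^+ 2) by rewrite mulr_ge0// addr_ge0 ?(ltW e0)// mulr_ge0 ?exprn_ge0// (ltW e0).
by move=> h; nra.
Qed.

Lemma ptrunc_ge0 t : 0 <= ptrunc e t.
Proof. by apply: quot_ge0; [exact: e0|exact: ler01|exact: ltW]. Qed.

Lemma ptrunc_bound t : ptrunc e t <= e^-1.
Proof.
rewrite /ptrunc /quot ler_pdivrMr//; have := pospart_ge0 t; move: (pospart t) => s s0.
rewrite mulrDr mulKf ?gt_eqF// lerDr mulr_ge0 ?invr_ge0 ?(ltW e0)//.
by rewrite mul1r addr_ge0// ltW.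
Qed.

Lemma dptrunc_ge0 t : 0 <= dptrunc e t.
Proof.
have s0 := pospart_ge0 t; rewrite /dptrunc /dquot divr_ge0 ?exprn_ge0//; last exact: ltW (den t).
by rewrite mul1r addr_ge0 ?exprn_ge0// !mulr_ge0// ltW.
Qed.

Lemma dptrunc_le1 t : dptrunc e t <= (0 < t)%R%:R.
Proof.
have [t0|t0] := ltP 0 t; last first.
  by rewrite /dptrunc /dquot pospart_neg// expr0n /= !mulr0 addr0 mul0r.
rewrite /dptrunc /dquot ler_pdivrMr ?exprn_gt0// (pospart_pos (ltW t0)) mul1r.
have h : 0 <= e * t ^+ 2 by rewrite mulr_ge0 ?exprn_ge0 ?(ltW t0)// ltW.
rewrite !mul1r; apply: (@le_trans _ _ ((e + t) ^+ 2)).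
  by have := sqr_ge0 e; rewrite sqrrD; lra.
by apply: lerXn2r; rewrite ?nnegrE ?addr_ge0 ?(ltW e0) ?(ltW t0) ?lerDl.
Qed.

Lemma adm_ptrunc (k : R) : adm (fun t => ptrunc e (t - k)) (fun t => dptrunc e (t - k)).
Proof.
split; last by exists 1 => t; rewrite dptrunc_ge0 (le_trans (dptrunc_le1 _)) ?lern1 ?leq_b1.
- move=> t.
  have h1 : is_derive t (1 : R) (fun z => z - k) 1.
    apply/is_derive1_caratheodory; exists (fun=> 1); split => //; first by move=> z; ring.
    exact: cvg_cst.
  have h2 := @quot_derive e 1 e e0 ler01 (ltW e0) (t - k).
  have := @is_derive1_comp R (ptrunc e) (fun z => z - k) t _ _ h2 h1.
  by rewrite mulr1.
- move=> t; apply: (@continuous_comp _ _ _ (fun z : R => z - k) (dptrunc e)).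
    by apply: cvgB; [exact: cvg_id|exact: cvg_cst].
  by apply: dquot_continuous; [exact: e0|exact: ler01|exact: ltW].
Qed.

End ptrunc.

Lemma cvg_harm (c : R) : c / k.+1%:R @[k --> \oo] --> 0.
Proof.
rewrite -(mulr0 c); apply: cvgM; first exact: cvg_cst.
exact: cvg_harmonic.
Qed.

Lemma ptrunc_cvg t : ptrunc (1 / k.+1%:R) t @[k --> \oo] --> pospart t.
Proof.
have ce := cvg_harm 1.
have [t0|t0] := leP t 0.
  rewrite pospart_neg//; under eq_fun do rewrite /ptrunc /quot pospart_neg// expr0n /= mul0r.
  exact: cvg_cst.
rewrite /ptrunc /quot (pospart_pos (ltW t0)).
have E : t ^+ 2 / (0 + 1 * t + 0 * t ^+ 2) = t.
  by rewrite mul0r add0r addr0 mul1r expr2 mulfK// gt_eqF.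
rewrite -[X in _ --> X]E; apply: cvgM; first exact: cvg_cst.
apply: cvgV; first by rewrite mul0r add0r addr0 mul1r gt_eqF.
by apply: cvgD; [apply: cvgD; [exact: ce|exact: cvg_cst]|apply: cvgM; [exact: ce|exact: cvg_cst]].
Qed.

Lemma dptrunc_cvg t : dptrunc (1 / k.+1%:R) t @[k --> \oo] --> ((0 < t)%R%:R : R).
Proof.
have ce := cvg_harm 1.
have [t0|t0] := ltP 0 t; last first.
  under eq_fun do rewrite /dptrunc /dquot pospart_neg// expr0n /= !mulr0 addr0 mul0r.
  exact: cvg_cst.
rewrite /dptrunc /dquot (pospart_pos (ltW t0)).
have -> : (true%:R : R) = (2 * 0 * t + 1 * t ^+ 2) / (0 + 1 * t + 0 * t ^+ 2) ^+ 2.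
  by rewrite [LHS](_ : _ = 1)//; field; rewrite gt_eqF.
have cD : 1 / k.+1%:R + 1 * t + 1 / k.+1%:R * t ^+ 2 @[k --> \oo] --> 0 + 1 * t + 0 * t ^+ 2.
  by apply: cvgD; [apply: cvgD; [exact: ce|exact: cvg_cst]|apply: cvgM; [exact: ce|exact: cvg_cst]].
apply: cvgM.
  by apply: cvgD; [apply: cvgM; [apply: cvgM; [exact: cvg_cst|exact: ce]|exact: cvg_cst]|exact: cvg_cst].
apply: cvgV; first by rewrite mul0r add0r addr0 mul1r expf_neq0// gt_eqF.
exact: (cvgM cD cD).
Qed.

(* equals [2 * c + M - t] for [t <= M] and stays above [c] *)
Definition zeta (c M t : R) := 2 * c - (t - M) + quot c 1 0 (t - M).
Definition dzeta (c M t : R) := - 1 + dquot c 1 0 (t - M).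

Section zeta.
Variables c M : R.
Hypothesis c0 : 0 < c.

Lemma zetaE t : t <= M -> zeta c M t = 2 * c + M - t.
Proof.
move=> tM; rewrite /zeta /quot pospart_neg ?subr_le0// expr0n /= mul0r.
by ring.
Qed.

Lemma dzetaE t : t <= M -> dzeta c M t = - 1.
Proof.
by move=> tM; rewrite /dzeta /dquot pospart_neg ?subr_le0// expr0n /= !mulr0 addr0 mul0r addr0.
Qed.

Lemma zeta_ge t : c <= zeta c M t.
Proof.
have [tM|tM] := leP t M; first by rewrite (zetaE tM) -subr_ge0 (_ : _ - c = c + (M - t)); [rewrite addr_ge0 ?subr_ge0 ?(ltW c0)|ring].
have s0 : 0 < t - M by rewrite subr_gt0.
rewrite /zeta /quot (pospart_pos (ltW s0)); move: (t - M) s0 => s s0.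
have d0 : 0 < c + s by rewrite addr_gt0.
have -> : 2 * c - s + s ^+ 2 / (c + 1 * s + 0 * s ^+ 2) = c + c ^+ 2 / (c + s).
  by rewrite mul0r addr0 mul1r; field; rewrite gt_eqF.
by rewrite lerDl divr_ge0 ?exprn_ge0// ltW.
Qed.

Lemma zeta_gt0 t : 0 < zeta c M t.
Proof. exact: lt_le_trans c0 (zeta_ge t). Qed.

Lemma dzeta_bound t : 0 <= - dzeta c M t <= 1.
Proof.
have s0 := pospart_ge0 (t - M).
have d0 := quot_den c0 ler01 (lexx 0) s0.
rewrite /dzeta /dquot; move: (pospart _) s0 d0 => s s0 d0.
rewrite opprD opprK subr_ge0 lerBlDr lerDl divr_ge0 ?exprn_ge0 ?(ltW d0)// ?andbT.
  rewrite ler_pdivrMr ?exprn_gt0// mul0r addr0 !mul1r.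
  by have := sqr_ge0 c; rewrite sqrrD; lra.
by rewrite mul1r addr_ge0 ?exprn_ge0// !mulr_ge0// ltW.
Qed.

Lemma is_derive_subl t : is_derive t (1 : R) (fun z => z - M) 1.
Proof.
apply/is_derive1_caratheodory; exists (fun=> 1); split => //; first by move=> z; ring.
exact: cvg_cst.
Qed.

Lemma zeta_derive t : is_derive t 1 (zeta c M) (dzeta c M t).
Proof.
have h1 := @is_derive1_comp R (quot c 1 0) (fun z => z - M) t _ _
  (quot_derive c0 ler01 (lexx 0) (t - M)) (is_derive_subl t).
have h2 : is_derive t (1 : R) (fun z => 2 * c - (z - M)) (- 1).
  apply/is_derive1_caratheodory; exists (fun=> - 1); split => //; first by move=> z; ring.
  exact: cvg_cst.
have := @is_deriveD R R R _ _ t 1 _ _ h2 h1; congr (is_derive _ _ _ _).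
by rewrite mulr1.
Qed.

Lemma zeta_continuous : continuous (zeta c M).
Proof.
by move=> t; apply/differentiable_continuous/derivable1_diffP; case: (zeta_derive t).
Qed.

Lemma dzeta_continuous : continuous (dzeta c M).
Proof.
move=> t; apply: cvgD; first exact: cvg_cst.
apply: (@continuous_comp _ _ _ (fun z : R => z - M) (dquot c 1 0)).
  by apply: cvgB; [exact: cvg_id|exact: cvg_cst].
by apply: dquot_continuous; [exact: c0|exact: ler01|].
Qed.

(** The function behind the logarithmic estimate: below M its derivative is (p - 1) zeta^{-p}, so
    testing with it controls the p-th power of the gradient of log zeta. *)
Lemma adm_zeta_pow (p : R) : 1 < p ->
  adm (fun t => zeta c M t `^ (1 - p)) (fun t => (p - 1) * zeta c M t `^ (- p) * - dzeta c M t).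
Proof.
move=> p1; have p10 : 0 < p - 1 by rewrite subr_gt0.
split.
- move=> t; have h := @is_derive1_comp R (fun z => z `^ (1 - p)) (zeta c M) t _ _
    (is_derive1_powR (1 - p) (zeta_gt0 t)) (zeta_derive t).
  move: h; congr (is_derive _ _ _ _); rewrite (_ : 1 - p - 1 = - p); last by ring.
  by ring.
- move=> t; apply: cvgM; last by apply: cvgN; exact: dzeta_continuous.
  apply: cvgM; first exact: cvg_cst.
  apply: (@continuous_comp _ _ _ (zeta c M) (fun z => z `^ (- p))); first exact: zeta_continuous.
  apply/differentiable_continuous/derivable1_diffP.
  by case: (is_derive1_powR (- p) (zeta_gt0 t)).
- exists ((p - 1) * c `^ (- p)) => t; have /andP[d0 d1] := dzeta_bound t.
  rewrite !mulr_ge0 ?powR_ge0 ?(ltW p10)//= -[leRHS]mulr1.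
  apply: ler_pM; rewrite ?mulr_ge0 ?powR_ge0 ?(ltW p10)// ler_wpM2l ?(ltW p10)//.
  rewrite !powRN lef_pV2 ?posrE ?powR_gt0//; last exact: zeta_gt0.
  apply: ge0_ler_powR; rewrite ?nnegrE; [lra|exact: ltW|exact: ltW (zeta_gt0 t)|exact: zeta_ge].
Qed.

Lemma zeta_pow_bound (p t : R) : 1 < p -> 0 <= zeta c M t `^ (1 - p) <= c `^ (1 - p).
Proof.
move=> p1; rewrite powR_ge0 /= -[1 - p]opprB !powRN lef_pV2 ?posrE ?powR_gt0//; last exact: zeta_gt0.
apply: ge0_ler_powR; rewrite ?nnegrE; [lra|exact: ltW|exact: ltW (zeta_gt0 t)|exact: zeta_ge].
Qed.

(** Unbounded, but with derivative at most 1/c, so its composition with u stays in the Sobolev space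
    and Poincare's inequality applies to it. *)
Lemma adm_log_zeta (k : R) :
  adm (fun t => k - ln (zeta c M t)) (fun t => - dzeta c M t / zeta c M t).
Proof.
split.
- move=> t; have h1 := @is_derive1_comp R (@ln R) (zeta c M) t _ _
    (is_derive1_ln (zeta_gt0 t)) (zeta_derive t).
  have := @is_deriveB R R R _ _ t 1 _ _ (is_derive_cst k t (1 : R)) h1; congr (is_derive _ _ _ _).
  by rewrite sub0r mulNr mulrC.
- move=> t; apply: cvgM; first by apply: cvgN; exact: dzeta_continuous.
  apply: cvgV; [by rewrite gt_eqF// zeta_gt0|exact: zeta_continuous].
- exists c^-1 => t; have /andP[d0 d1] := dzeta_bound t.
  rewrite divr_ge0 ?(ltW (zeta_gt0 t))//= -[leRHS]mul1r; apply: ler_pM => //.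
    by rewrite invr_ge0 ltW// zeta_gt0.
  by rewrite lef_pV2 ?posrE ?zeta_gt0// zeta_ge.
Qed.

End zeta.
End admissible.

(** * De Giorgi iteration *)

Section degiorgi.
Context {R : realType} {n : nat}.
Local Notation V := 'rV[R]_n.+1.
Local Notation T := (lebT R n).
Local Notation mu := (@leb R n).

Lemma powR_exprn (x s : R) i : 0 <= x -> (x ^+ i) `^ s = (x `^ s) ^+ i.
Proof.
move=> x0; rewrite -(@powR_mulrn _ x i x0) -(@powR_mulrn _ (x `^ s) i (powR_ge0 _ _)).
by rewrite -!powRrM mulrC.
Qed.

Lemma powR_ge1 (x s : R) : 1 <= x -> 0 <= s -> 1 <= x `^ s.
Proof. by move=> x1 s0; rewrite -[leLHS](powRr0 x); exact: ler_powR. Qed.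

Lemma powRK (x s : R) : 0 <= x -> s != 0 -> (x `^ s^-1) `^ s = x.
Proof. by move=> x0 s0; rewrite -powRrM mulVf// powRr1. Qed.

(* the geometric rate [r] and the smallness [de] that make the nonlinear recursion contract *)
Lemma degiorgi_rate (th ka s B la : R) : 0 < ka -> 0 < th -> 1 <= la -> 0 < B ->
  exists de r : R, [/\ 0 < de, 0 < r < 1 &
    forall i, (B * la ^+ i) `^ th * (2 * de * (2 * r) ^+ i) `^ ka = r `^ s].
Proof.
move=> ka0 th0 la1 B0.
have la0 : 0 < la by exact: lt_le_trans la1.
pose r := (la `^ (- th)) `^ ka^-1 / 2.
have r0 : 0 < r by rewrite divr_gt0 ?powR_gt0.
pose de := (r `^ s * B `^ (- th)) `^ ka^-1 / 2.
have k0 : ka != 0 by rewrite gt_eqF.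
exists de, r; split.
- by rewrite divr_gt0 ?powR_gt0// mulr_gt0 ?powR_gt0.
- rewrite r0 /= ltr_pdivrMr// mul1r.
  apply: (@le_lt_trans _ _ 1); last by lra.
  have -> : 1 = 1 `^ ka^-1 :> R by rewrite powR1.
  apply: ge0_ler_powR; rewrite ?nnegrE ?powR_ge0 ?ler01 ?invr_ge0 ?(ltW ka0)//.
  by rewrite -[leRHS](powRr0 la); apply: ler_powR => //; lra.
- move=> i.
  have E1 : 2 * de = (r `^ s * B `^ (- th)) `^ ka^-1 by rewrite /de mulrC divfK.
  have E2 : 2 * r = (la `^ (- th)) `^ ka^-1 by rewrite /r mulrC divfK.
  have h1 : 0 <= r `^ s * B `^ (- th) by rewrite mulr_ge0 ?powR_ge0.
  have F1 := powRK h1 k0; have F2 := powRK (powR_ge0 la (- th)) k0.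
  rewrite -E1 in F1; rewrite -E2 in F2.
  have d0 : 0 <= 2 * de by rewrite E1 powR_ge0.
  have s0 : 0 <= 2 * r by rewrite E2 powR_ge0.
  rewrite (powRM ka d0 (exprn_ge0 i s0)) (powR_exprn ka i s0) F1 F2.
  rewrite (powRM th (ltW B0) (exprn_ge0 i (ltW la0))) (powR_exprn th i (ltW la0)).
  have i1 : B `^ th * B `^ (- th) = 1 by rewrite powRN mulfV// gt_eqF// powR_gt0.
  have i2 : la `^ th * la `^ (- th) = 1 by rewrite powRN mulfV// gt_eqF// powR_gt0.
  have i3 : (la `^ th) ^+ i * (la `^ (- th)) ^+ i = 1 by rewrite -exprMn i2 expr1n.
  have -> : B `^ th * (la `^ th) ^+ i * (r `^ s * B `^ (- th) * (la `^ (- th)) ^+ i) =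
    r `^ s * (B `^ th * B `^ (- th)) * ((la `^ th) ^+ i * (la `^ (- th)) ^+ i) by ring.
  by rewrite i1 i3 !mulr1.
Qed.

(** The equation enters only through the implication combining Caccioppoli and Sobolev for a level k
    and two consecutive cutoffs. Each step bounds the averaged (p th)-norm of v_i = eta_{2i+2} (u -
    k_i)_+ by y_i = H de r^i, a geometric sequence. Hoelder with q and th controls the lower-order
    terms by v_i; the surplus of sg over th then yields a power of y_i higher than the first. All
    constants scale with H, so [ze] depends on neither the functions nor the height. *)
Lemma degiorgi (p th sg q N K P C : R) : 1 < p -> 1 < th -> th < sg -> 0 < q -> q^-1 + th^-1 = 1 ->
  1 <= N -> 0 < K -> 0 < P -> 0 < C ->
  exists2 ze : R, 0 < ze & forall (E E' : set V) (u : V -> R) (eta D : nat -> V -> R) (Psi : V -> R) (k0 H : R),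
    measurable (E : set T) -> measurable (E' : set T) -> E' `<=` E ->
    (0 < mu (E : set T))%E -> (mu (E : set T) < +oo)%E ->
    meas_on E u -> (forall j, meas_on E (eta j)) -> (forall j, meas_on E (D j)) -> meas_on E Psi ->
    (forall j x, 0 <= eta j x <= 1) -> (forall j x, 0 <= D j x) -> (forall x, E x -> 0 <= Psi x) -> 0 < H ->
    (forall j x, (1 <= j)%N -> E x -> eta j.+1 x != 0 \/ D j.+1 x != 0 -> eta j x = 1) ->
    (forall j x, (1 <= j)%N -> E' x -> eta j x = 1) ->
    (forall j, (1 <= j)%N -> (Av E (fun x => (D j x `^ (p * q))%R) <= ((K * N ^+ j) `^ (p * q))%:E)%E) ->
    (Av E (fun x => (Psi x `^ q)%R) <= (P `^ q)%:E)%E ->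
    (forall j k s, (2 <= j)%N -> k0 <= k -> k <= k0 + H -> 0 < s ->
      (Av E (fun x => (eta j x * (k < u x)%R%:R * (Psi x * (H + pospart (u x - k)) `^ p) +
          pospart (u x - k) `^ p * (D j x `^ p + D j.+1 x `^ p) +
          (eta j.+1 x * pospart (u x - k)) `^ p)%R) <= s%:E)%E ->
      (Av E (fun x => ((eta j.+1 x * pospart (u x - k)) `^ (p * sg))%R) <= ((C * s) `^ sg)%:E)%E) ->
    (Av E (fun x => ((eta 2 x * pospart (u x - k0)) `^ (p * th))%R) <= (ze * H `^ (p * th))%:E)%E ->
    \forall x \ae mu, E' x -> u x <= k0 + H.
Proof.
move=> p1 th1 ths q0 qth N1 K0 P0 C0.
have p0 : 0 < p by lra.
have th0 : 0 < th by lra.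
have sg0 : 0 < sg by lra.
have N0 : 0 < N by lra.
(* Sum of the four contributions at step 0: data, the gradients of cutoffs number 3 and 4, and the
   function itself. [la] is the growth per step, 2^p from the halving of level gaps and N^{2p} from
   two further cutoffs. *)
pose B1 := 4 `^ p * P + (K * N ^+ 3) `^ p + (K * N ^+ 4) `^ p + 1.
pose la := 2 `^ p * (N ^+ 2) `^ p.
have B10 : 0 < B1 by rewrite /B1 ltr_wpDl// !addr_ge0 ?mulr_ge0 ?powR_ge0// ltW.
pose b := sg / (sg - th).
have st0 : 0 < sg - th by lra.
have b0 : 0 < b by rewrite divr_gt0.
have p2 : 1 <= 2 `^ p :> R by apply: powR_ge1; lra.
have Np : 1 <= (N ^+ 2) `^ p.
  by apply: powR_ge1; rewrite ?exprn_ege1// ltW.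
have la1 : 1 <= la by rewrite -[leLHS]mulr1; apply: ler_pM.
have pth0 : 0 < p * th by rewrite mulr_gt0.
have [de [r [de0 /andP[r0 r1] rate]]] := @degiorgi_rate th (p * th / b) (p * th) (C * B1) la
  (divr_gt0 pth0 b0) th0 la1 (mulr_gt0 C0 B10).
exists (de `^ (p * th)); first exact: powR_gt0.
move=> E E' u eta D Psi k0 H mE mE' E'E E0 Eoo mu_ meta mDD mPsi e01 D0 Psi0 H0 nest eta1 HD HP HS H1.
(* Levels rise from k0 towards k0 + H. A step uses two cutoffs, number 2i+3 in Caccioppoli's
   inequality and 2i+4 in Sobolev's; both vanish wherever eta_{2i+2} differs from 1. *)
pose kk i : R := k0 + H * (1 - 2^-1 ^+ i).
pose v i x := eta (2 * i + 2)%N x * pospart (u x - kk i).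
have v0 i x : 0 <= v i x by have /andP[h _] := e01 (2 * i + 2)%N x; rewrite mulr_ge0// pospart_ge0.
have mpos k : meas_on E (fun x => pospart (u x - k)).
  apply: (mcomp (G := pospart) (f := fun x => u x - k)); last exact: pospart_continuous.
  by mfun.
have mv i : meas_on E (v i) by apply: mM; [exact: meta|exact: mpos].
have kkle i : k0 <= kk i /\ kk i <= k0 + H.
  have h1 : 0 <= 2^-1 ^+ i :> R by rewrite exprn_ge0.
  have h2 : 2^-1 ^+ i <= 1 :> R by rewrite exprn_ile1//; lra.
  split; first by rewrite lerDl mulr_ge0 ?(ltW H0)// subr_ge0.
  by rewrite lerD2l -[leRHS]mulr1 ler_wpM2l ?(ltW H0)// lerBlDr lerDl.
pose y i := H * (de * r ^+ i).
have y0 i : 0 < y i by rewrite !mulr_gt0// exprn_gt0.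
pose h i := H * 2^-1 ^+ i.+1.
have h0 i : 0 < h i by rewrite mulr_gt0// exprn_gt0// invr_gt0.
have kkS i : kk i.+1 = kk i + h i by rewrite /kk /h exprS; move: (2^-1 ^+ i) => t; field.
have vge i x : E x -> eta (2 * i + 2)%N x = 1 -> kk i.+1 < u x ->
    v i x = u x - kk i /\ h i <= v i x.
  move=> Ex e1 ku; rewrite /v e1 mul1r pospart_pos; last first.
    by have := h0 i; rewrite kkS in ku; lra.
  by split => //; rewrite kkS in ku; lra.
have wle i x : eta (2 * i + 2)%N x = 1 -> pospart (u x - kk i.+1) <= v i x.
  move=> e1; rewrite /v e1 mul1r /pospart ge_max !le_max lexx orbT andbT.
  by rewrite kkS; have := h0 i => hi; apply/orP; left; lra.
have jE i : (2 * i + 3)%N = (2 * i + 2).+1 by rewrite addnS.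
have jE' i : (2 * i.+1 + 2)%N = (2 * i + 3).+1 by rewrite mulnS (addnC 2%N) -addnA -addnS.
have claim i : (Av E (fun x => (v i x `^ (p * th))%R) <= (y i `^ (p * th))%:E)%E.
  elim: i => [|i IH].
    apply: le_trans (le_trans _ H1) _.
      rewrite /v /kk expr0 subrr mulr0 addr0; exact: lexx.
    by rewrite lee_fin /y expr0 mulr1 (powRM _ (ltW H0) (ltW de0)) [leRHS]mulrC.
  pose j := (2 * i + 3)%N; pose k := kk i.+1.
  have N3 : (1 <= j)%N by rewrite /j addnS.
  have e2 x : E x -> eta j x != 0 \/ D j x != 0 -> eta (2 * i + 2)%N x = 1.
    move=> Ex hj; apply: nest => //; first by rewrite addnS.
    by rewrite -jE.
  have e3 x : E x -> eta j.+1 x != 0 \/ D j.+1 x != 0 -> eta (2 * i + 2)%N x = 1.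
    move=> Ex hj; apply: e2 => //; left.
    by rewrite (nest j x N3 Ex hj) oner_eq0.
  have IHp : (Av E (fun x => ((v i x `^ p) `^ th)%R) <= ((y i `^ p) `^ th)%:E)%E.
    by rewrite -powRrM; under eq_fun do rewrite -powRrM.
  have mvp : meas_on E (fun x => v i x `^ p) by exact: mpowR.
  have vp0 x : E x -> 0 <= v i x `^ p by move=> _; exact: powR_ge0.
  have yp0 : 0 < y i `^ p by exact: powR_gt0.
  have A1 : (Av E (fun x => (Psi x * v i x `^ p)%R) <= (P * y i `^ p)%:E)%E.
    exact: (Av_hoelder mE E0 Eoo mPsi mvp Psi0 vp0 q0 th0 qth P0 yp0 HP IHp).
  have KN l : 0 < K * N ^+ l by rewrite mulr_gt0// exprn_gt0.
  have A2 l : (1 <= l)%N -> (Av E (fun x => (D l x `^ p * v i x `^ p)%R) <= ((K * N ^+ l) `^ p * y i `^ p)%:E)%E.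
    move=> l1; have := HD l l1.
    rewrite powRrM; under eq_fun do rewrite powRrM.
    move=> HDl.
    by apply: (Av_hoelder mE E0 Eoo (mpowR p (mDD l)) mvp (fun x _ => powR_ge0 _ _) vp0 q0 th0 qth
      (powR_gt0 p (KN l)) yp0 HDl IHp).
  have A3 : (Av E (fun x => (v i x `^ p)%R) <= (y i `^ p)%:E)%E.
    have pth : p <= p * th by rewrite ler_peMr// ltW.
    exact: (Av_jensen mE E0 Eoo (mv i) (fun x _ => v0 i x) p0 pth (y0 i) IH).
  pose s := y i `^ p * (B1 * la ^+ i).
  have la0 : 0 < la by lra.
  have lai : 1 <= la ^+ i by rewrite exprn_ege1.
  have lai0 : 0 < la ^+ i by lra.
  have s0 : 0 < s by rewrite !mulr_gt0.
  have c2 : 0 <= 2 ^+ (i + 2) :> R by rewrite exprn_ge0.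
  pose ci := (2 ^+ (i + 2)) `^ p : R.
  have ci0 : 0 <= ci by exact: powR_ge0.
  have le1 : (2 `^ p) ^+ i <= la ^+ i.
    by apply: lerXn2r; rewrite ?nnegrE ?powR_ge0 ?(ltW la0)// /la ler_peMr ?powR_ge0.
  have le2 : ((N ^+ 2) `^ p) ^+ i <= la ^+ i.
    by apply: lerXn2r; rewrite ?nnegrE ?powR_ge0 ?(ltW la0)// /la ler_peMl ?powR_ge0.
  have cile : ci <= 4 `^ p * la ^+ i.
    rewrite /ci (_ : 2 ^+ (i + 2) = 4 * 2 ^+ i :> R); last by rewrite exprD; ring.
    by rewrite powRM ?exprn_ge0// powR_exprn// ler_wpM2l ?powR_ge0.
  have KNle l : (K * N ^+ (2 * i + l)) `^ p <= (K * N ^+ l) `^ p * la ^+ i.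
    rewrite (_ : K * N ^+ (2 * i + l) = K * N ^+ l * (N ^+ 2) ^+ i); last first.
      by rewrite exprD exprM; ring.
    rewrite powRM ?exprn_ge0 ?(ltW (KN l)) ?(ltW N0)// powR_exprn ?exprn_ge0 ?(ltW N0)//.
    by rewrite ler_wpM2l ?powR_ge0.
  have mj := meta j; have mj1 := meta j.+1; have mDj := mDD j; have mDj1 := mDD j.+1; have mpk := mpos k.
  have mvi := mv i.
  have intg : (Av E (fun x => (eta j x * (k < u x)%R%:R * (Psi x * (H + pospart (u x - k)) `^ p) +
          pospart (u x - k) `^ p * (D j x `^ p + D j.+1 x `^ p) +
          (eta j.+1 x * pospart (u x - k)) `^ p)%R) <= s%:E)%E.
    apply: (@le_trans _ _ (Av E (fun x => ci * (Psi x * v i x `^ p) +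
      (D j x `^ p * v i x `^ p + D j.+1 x `^ p * v i x `^ p) + v i x `^ p)%R)%E).
      apply: Av_le; [exact: mE|exact: E0|exact: Eoo|by mfun; exact: (mind k mE mu_)|by mfun| |].
        move=> x Ex; have /andP[t1 _] := e01 j x; have := Psi0 x Ex => t2.
        by rewrite !addr_ge0 ?mulr_ge0 ?powR_ge0 ?addr_ge0 ?powR_ge0.
      apply: aeW => x Ex; have /andP[t1 t1'] := e01 j x; have t2 := Psi0 x Ex.
      have w0 := pospart_ge0 (u x - k).
      apply: lerD; [apply: lerD|].
      - have [ej|ej] := eqVneq (eta j x) 0.
          by rewrite ej !mul0r !mulr_ge0 ?powR_ge0.
        have [ku|ku] := ltP k (u x); last by rewrite mulr0 mul0r !mulr_ge0 ?powR_ge0.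
        have [vE hv] := vge i x Ex (e2 x Ex (or_introl ej)) ku.
        rewrite mulr1; apply: (@le_trans _ _ (Psi x * (H + pospart (u x - k)) `^ p)).
          by rewrite ler_piMl// mulr_ge0 ?powR_ge0.
        rewrite mulrCA ler_wpM2l// -(powRM p c2 (v0 i x)).
        apply: ge0_ler_powR; [exact: ltW|by rewrite nnegrE addr_ge0 ?(ltW H0)|by rewrite nnegrE; exact: (mulr_ge0 c2 (v0 i x))|].
        have h1 := wle i x (e2 x Ex (or_introl ej)).
        have h2 : H <= 2 ^+ i.+1 * v i x.
          have -> : H = 2 ^+ i.+1 * h i.
            by rewrite /h mulrCA -exprMn mulfV ?expr1n ?mulr1// pnatr_eq0.
          by rewrite ler_wpM2l ?exprn_ge0.
        have h3 : v i x <= 2 ^+ i.+1 * v i x by rewrite ler_peMl// exprn_ege1// ler1n.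
        rewrite -/k in h1.
        rewrite addn2 exprS -mulrA mulr2n mulrDl mul1r.
        exact: (lerD h2 (le_trans h1 h3)).
      - rewrite mulrDr ![_ * v i x `^ p]mulrC.
        have tm l : (D l x != 0 -> eta (2 * i + 2)%N x = 1) ->
            pospart (u x - k) `^ p * D l x `^ p <= v i x `^ p * D l x `^ p.
          move=> hl; have [->|dl] := eqVneq (D l x) 0; first by rewrite powR0 ?gt_eqF// !mulr0.
          rewrite ler_wpM2r ?powR_ge0//; apply: ge0_ler_powR; [exact: ltW|exact: pospart_ge0|exact: v0|].
          exact: (wle _ _ (hl dl)).
        apply: lerD; apply: tm => dl.
          by apply: e2 => //; right.
        by apply: e3 => //; right.
      - have /andP[t3 t3'] := e01 j.+1 x.
        apply: ge0_ler_powR; [exact: ltW|by rewrite nnegrE mulr_ge0|exact: v0|].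
        have [->|ej] := eqVneq (eta j.+1 x) 0; first by rewrite mul0r.
        apply: (le_trans _ (wle i x (e3 x Ex (or_introl ej)))).
        by rewrite ler_piMl.
    have g1 x : E x -> 0 <= Psi x * v i x `^ p by move=> Ex; rewrite mulr_ge0 ?powR_ge0 ?Psi0.
    have g2 l x : E x -> 0 <= D l x `^ p * v i x `^ p by move=> Ex; rewrite mulr_ge0 ?powR_ge0.
    have m1 : meas_on E (fun x => Psi x * v i x `^ p) by mfun.
    have m2 l : meas_on E (fun x => D l x `^ p * v i x `^ p) by mfun; exact: mDD.
    rewrite (AvD mE (f := fun x => ci * (Psi x * v i x `^ p) + (D j x `^ p * v i x `^ p + D j.+1 x `^ p * v i x `^ p))); last first.
    - by move=> x _; exact: powR_ge0.
    - by move=> x Ex; apply: addr_ge0; [rewrite mulr_ge0 ?g1|apply: addr_ge0; exact: g2].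
    - by mfun.
    - by mfun.
    rewrite (AvD mE (f := fun x => ci * (Psi x * v i x `^ p))); last first.
    - by move=> x Ex; apply: addr_ge0; exact: g2.
    - by move=> x Ex; rewrite mulr_ge0 ?g1.
    - exact: (mD (m2 j) (m2 j.+1)).
    - by mfun.
    rewrite (AvD mE (m2 j) (m2 j.+1) (g2 j) (g2 j.+1)) (AvZ mE m1 g1 ci0).
    apply: (@le_trans _ _ (ci%:E * (P * y i `^ p)%:E + (((K * N ^+ j) `^ p * y i `^ p)%:E + ((K * N ^+ j.+1) `^ p * y i `^ p)%:E) +
      (y i `^ p)%:E)%E).
      apply: leeD; [apply: leeD; [|apply: leeD]|].
      - by apply: lee_wpmul2l; rewrite ?lee_fin.
      - exact: A2.
      - exact: A2.
      - exact: A3.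
    rewrite -EFinM -!EFinD lee_fin /s.
    have q1 : ci * (P * y i `^ p) <= y i `^ p * (4 `^ p * P * la ^+ i).
      have -> : y i `^ p * (4 `^ p * P * la ^+ i) = 4 `^ p * la ^+ i * (P * y i `^ p) by ring.
      by rewrite ler_wpM2r// mulr_ge0 ?(ltW P0)// ltW.
    have q2 l : (K * N ^+ (2 * i + l)) `^ p * y i `^ p <= y i `^ p * ((K * N ^+ l) `^ p * la ^+ i).
      by rewrite mulrC ler_wpM2l// ltW.
    have q3 : y i `^ p <= y i `^ p * la ^+ i by rewrite ler_peMr// ltW.
    have := q2 3%N; have := q2 4%N.
    rewrite -/j (_ : (2 * i + 4)%N = j.+1); last by rewrite /j !addnS.
    rewrite /B1 => q5 q4.
    apply: (le_trans (lerD (lerD q1 (lerD q4 q5)) q3)).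
    by rewrite le_eqVlt; apply/orP; left; apply/eqP; ring.
  have [kl ku] := kkle i.+1.
  have j2 : (2 <= j)%N by rewrite /j !addnS.
  have := HS j k s j2 kl ku s0 intg.
  have vE x : eta j.+1 x * pospart (u x - k) = v i.+1 x by rewrite /v jE'.
  under eq_fun do rewrite vE.
  move=> HSk.
  (* The superlinear gain: where v_{i+1} is nonzero, v_i is at least the level gap h_i, so the
     factor (v_i / h_i)^ka, at least 1, can be inserted. Hoelder with sg/th and its conjugate b
     follows, and ka b = p th brings back the induction hypothesis. *)
  pose ka := p * th / b.
  have ka0 : 0 < ka by rewrite divr_gt0.
  pose x0 := (C * s) `^ th.
  pose y1 := (y i / h i) `^ ka.
  have yh0 : 0 < y i / h i by rewrite divr_gt0.
  have x00 : 0 < x0 by rewrite powR_gt0// mulr_gt0.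
  have y10 : 0 < y1 by rewrite powR_gt0.
  have mv1 := mv i.+1.
  have a0 : 0 < sg / th by rewrite divr_gt0.
  have vh0 x : 0 <= v i x / h i by rewrite divr_ge0// ltW.
  have fin : (Av E (fun x => (v i.+1 x `^ (p * th) * (v i x / h i) `^ ka)%R) <= (x0 * y1)%:E)%E.
    apply: (Av_hoelder mE E0 Eoo (a := sg / th) (b := b)).
    - by mfun.
    - by mfun.
    - by move=> x _; exact: powR_ge0.
    - by move=> x _; exact: powR_ge0.
    - exact: a0.
    - exact: b0.
    - by rewrite /b; field; rewrite !gt_eqF.
    - exact: x00.
    - exact: y10.
    - rewrite /x0 -powRrM (_ : th * (sg / th) = sg); last by field; rewrite gt_eqF.
      have e1 : p * th * (sg / th) = p * sg by field; rewrite gt_eqF.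
      under eq_fun do rewrite -powRrM e1.
      exact: HSk.
    - rewrite /y1 -powRrM (_ : ka * b = p * th); last by rewrite /ka divfK// gt_eqF.
      have hh0 : 0 <= (h i)^-1 by rewrite invr_ge0 ltW.
      rewrite (_ : (fun x => _) = fun x => (h i)^-1 `^ (p * th) * v i x `^ (p * th)); last first.
        apply/funext => x; rewrite -powRrM (_ : ka * b = p * th); last by rewrite /ka divfK// gt_eqF.
        by rewrite powRM// mulrC.
      rewrite (AvZ mE); [|by mfun|by move=> x _; exact: powR_ge0|exact: powR_ge0].
      rewrite (powRM _ (ltW (y0 i)) hh0) [X in (_ <= X%:E)%E]mulrC EFinM; apply: lee_wpmul2l; last exact: IH.
      by rewrite lee_fin powR_ge0.
  apply: le_trans (le_trans _ fin) _.
    apply: Av_le; [exact: mE|exact: E0|exact: Eoo|by mfun|by mfun|by move=> x _; exact: powR_ge0|].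
    apply: aeW => x Ex; have [v1|v1] := eqVneq (v i.+1 x) 0.
      by rewrite v1 powR0 ?gt_eqF// mul0r.
    rewrite ler_peMr ?powR_ge0//; apply: powR_ge1; last exact: ltW.
    have ej : eta j.+1 x != 0.
      by apply: contra_neq v1 => e; rewrite -vE e mul0r.
    have ku' : k < u x.
      rewrite ltNge; apply: contra_neqN v1 => uk; rewrite -vE pospart_neg ?mulr0// subr_le0//.
    have [_ hv] := vge i x Ex (e3 x Ex (or_introl ej)) ku'.
    by rewrite ler_pdivlMr// mul1r.
  rewrite lee_fin le_eqVlt; apply/orP; left; apply/eqP.
  have yS : y i.+1 = y i * r by rewrite /y exprS; ring.
  rewrite yS (powRM _ (ltW (y0 i)) (ltW r0)) -(rate i) /x0 /y1 /s.
  have -> : y i / h i = 2 * de * (2 * r) ^+ i.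
    rewrite /y /h exprMn exprVn exprS; have : 2 ^+ i != 0 :> R by rewrite expf_neq0// pnatr_eq0.
    by move: (2 ^+ i) (r ^+ i) => t1 t2 h1; field; rewrite h1 gt_eqF.
  have -> : C * (y i `^ p * (B1 * la ^+ i)) = y i `^ p * (C * B1 * la ^+ i) by ring.
  rewrite (powRM th) ?powR_ge0//; last by rewrite !mulr_ge0 ?(ltW C0) ?(ltW B10)// ltW.
  by rewrite -powRrM -/ka; ring.
pose W x := pospart (u x - (k0 + H)).
have mW : meas_on E W by exact: mpos.
have mWE : meas_on E' (fun x => W x `^ (p * th)) by apply: (meas_onS mE E'E); exact: mpowR.
have IW i : (Int E' (fun x => (W x `^ (p * th))%R) <= (fine (mu (E : set T)) * y i `^ (p * th))%:E)%E.
  have := Av_Int E0 Eoo (claim i); apply: le_trans.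
  have mvp : meas_on E (fun x => v i x `^ (p * th)) by apply: mpowR; exact: mv.
  apply: le_trans (Int_subset mE' mE E'E mvp (fun x _ => powR_ge0 _ _)).
  apply: Int_le; [exact: mE'|exact: mWE|exact: (meas_onS mE E'E mvp)|by move=> x _; exact: powR_ge0|].
  apply: aeW => x Ex; apply: ge0_ler_powR; rewrite ?nnegrE ?pospart_ge0 ?v0 ?(ltW pth0)//.
  rewrite /v eta1 ?addnS// mul1r /W /pospart ge_max !le_max lexx orbT andbT lerB//.
  by have [] := kkle i.
have W0 : (Int E' (fun x => (W x `^ (p * th))%R) <= 0)%E.
  have cy : (fine (mu (E : set T)) * y i `^ (p * th))%:E @[i --> \oo] --> 0%:E.
    apply: cvg_EFin; first exact: nearW.
    rewrite -(mulr0 (fine (mu (E : set T)))); apply: cvgM; first exact: cvg_cst.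
    apply: powR_cvg0; [exact: pth0|by move=> i; exact: ltW|].
    rewrite -(mulr0 H); apply: cvgM; first exact: cvg_cst.
    rewrite -(mulr0 de); apply: cvgM; first exact: cvg_cst.
    by apply: cvg_expr; rewrite ger0_norm// ltW.
  by apply: (lee_cvg_to (cvg_cst _) cy); apply: nearW.
have := Int_ae0 mE' mWE (fun x _ => powR_ge0 _ _) W0.
apply: filterS => x hx Ex; have /eqP := hx Ex; rewrite powR_eq0 => /andP[/eqP W00 _].
have : u x - (k0 + H) <= W x by rewrite le_max lexx.
by rewrite W00 subr_le0.
Qed.
End degiorgi.

(** * Caccioppoli inequalities *)

Section caccioppoli.
Context {R : realType} {n : nat}.
Local Notation V := 'rV[R]_n.+1.
Local Notation T := (lebT R n).
Local Notation mu := (@leb R n).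

Section scalars.
Variable p : R.
Hypothesis p1 : 1 < p.

Lemma dual_exp_gt0 : 0 < dual_exp p.
Proof. by rewrite divr_gt0 ?subr_gt0// (lt_trans _ p1). Qed.

Lemma dual_expM : (p - 1) * dual_exp p = p.
Proof. by rewrite mulrC divfK// gt_eqF// subr_gt0. Qed.

Lemma six_terms (b e c d f P : R) : 0 <= b -> 0 <= e -> 0 <= c -> 0 <= d -> 0 <= f ->
  b + e + c + d + f + 1 <= P -> [/\ b + e <= P, c <= P, 1 + c + d + f <= P & 0 <= P].
Proof. by move=> *; split; lra. Qed.

Lemma absorb_constants (k x y t c : R) : 0 <= k -> 0 <= x -> 0 <= y -> 0 <= t -> 0 <= c ->
  k + t + c + 1 <= k + x + y + t + c + 1 /\ x + y <= k + x + y + t + c + 1.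
Proof. by move=> *; split; lra. Qed.

Lemma absorb_products (u ka ta ca a KA KB x y : R) : ka + ta + ca + a <= KA -> x + y <= KB ->
  ka + (u + x + (ta + y)) + (u + ca + a) <= u + u + KA + KB.
Proof. by move=> *; lra. Qed.

Lemma young_eps (de : R) : 0 < de -> exists2 C : R, 0 < C &
  forall s t, 0 <= s -> 0 <= t -> s * t <= C * s `^ p + de * t `^ dual_exp p.
Proof.
move=> de0; have q0 := dual_exp_gt0.
pose k := de `^ (dual_exp p)^-1.
have k0 : 0 < k by exact: powR_gt0.
exists (k^-1 `^ p); first by rewrite powR_gt0// invr_gt0.
move=> s t s0 t0.
have -> : s * t = (k^-1 * s) * (k * t) by rewrite mulrACA mulVf ?mul1r// gt_eqF.
apply: le_trans (young p1 _ _) _; rewrite ?mulr_ge0 ?invr_ge0 ?(ltW k0)//.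
by rewrite !powRM ?invr_ge0 ?(ltW k0)// /k powRK ?(ltW de0)// gt_eqF.
Qed.

Lemma powR_ile (x s t : R) : 0 <= x <= 1 -> 0 < s -> s <= t -> x `^ t <= x `^ s.
Proof.
move=> /andP[x0 x1] s0 st; have [->|xn0] := eqVneq x 0.
  by rewrite !powR0 ?gt_eqF// (lt_le_trans s0).
have x0' : 0 < x by rewrite lt_neqAle eq_sym xn0.
rewrite -[t](subrK s) powRD; last by rewrite xn0 implybT.
rewrite ler_piMl ?powR_ge0//.
have -> : 1 = 1 `^ (t - s) :> R by rewrite powR1.
by apply: ge0_ler_powR; rewrite ?nnegrE ?subr_ge0.
Qed.

(** The condition m >= p - 1 says exactly that m p' >= m + 1: after Young's inequality the gradient
    term still carries eta^{m+1} and can be absorbed. *)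
Lemma cutoff_pow (m : nat) (x : R) : p - 1 <= m%:R -> 0 <= x <= 1 ->
  (x ^+ m) `^ dual_exp p <= x ^+ m.+1.
Proof.
move=> pm x01; have /andP[x0 _] := x01.
rewrite -!powR_mulrn// -powRrM; apply: powR_ile => //.
have p10 : 0 < p - 1 by rewrite subr_gt0.
rewrite /dual_exp mulrA ler_pdivlMr// -addn1 natrD.
by move: (m%:R) pm => y pm; lra.
Qed.

(** Young's inequality term by term, for both Caccioppoli inequalities at once. The weight nu and
    the size w abstract the test function: nu is the indicator of u > k with w = (u - k)_+, or nu =
    zeta^{-p} with w = zeta. Z is a common bound of w and Y = 1 + |u| where nu does not vanish. *)
Lemma cacc_pointwise (a ka de : R) (m : nat) : p - 1 <= m%:R -> 1 < a -> 0 <= ka -> 0 < de ->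
  exists2 C : R, 0 < C & forall (et gg GG X cb cc cd ce cf Y Psi nu w Z De : R),
    0 <= et <= 1 -> 0 <= gg -> 0 <= GG -> 0 <= X -> 0 <= cb -> 0 <= cc -> 0 <= cd -> 0 <= ce -> 0 <= cf ->
    0 <= Y -> 0 <= nu -> 0 <= w -> 0 <= De ->
    cb `^ dual_exp p + ce `^ dual_exp p + cc `^ p + cd + cf + 1 <= Psi ->
    gg <= ka * nu -> GG <= nu * w -> (nu != 0 -> w <= Z /\ Y <= Z) ->
    et ^+ m.+1 * gg * (Psi * Y `^ p) + m.+1%:R * et ^+ m * GG * De * (a * X `^ (p - 1) + (cb + ce) * Y `^ (p - 1))
      + et ^+ m.+1 * GG * (cc * X `^ (p - 1) + (cc + cd + cf) * Y `^ (p - 1))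
    <= de * (et ^+ m.+1 * nu * X `^ p) + C * (et * nu * (Psi * Z `^ p) + nu * w `^ p * De `^ p).
Proof.
move=> pm a1 ka0 de0.
have p1' : 1 < p := p1.
have p0 : 0 < p by exact: lt_trans p1'.
have q0 := dual_exp_gt0.
have p10 : 0 < p - 1 by rewrite subr_gt0.
have de20 : 0 < de / 2 by lra.
have [C1 C10 Y1] := young_eps de20.
have [C2 C20 Y2] := young_eps ltr01.
pose c2 : R := m.+1%:R * a.
have a0 : 0 < a by lra.
have m0 : 0 <= m.+1%:R :> R by [].
have c20 : 0 <= c2 by rewrite mulr_ge0// ltW.
pose t2 := 2 `^ dual_exp p : R.
have t20 : 0 <= t2 by exact: powR_ge0.
exists (ka + C1 * c2 `^ p + C2 * m.+1%:R `^ p + t2 + C1 + 1).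
  by rewrite ltr_wpDl// !addr_ge0// ?mulr_ge0 ?powR_ge0// ltW.
move=> et gg GG X cb cc cd ce cf Y Psi nu w Z De et01 gg0 GG0 X0 cb0 cc0 cd0 ce0 cf0 Y0 nu0 w0 De0 PsiE ggle GGle nuZ.
have /andP[et0 et1] := et01.
have cbq := powR_ge0 cb (dual_exp p). have ceq := powR_ge0 ce (dual_exp p). have ccq := powR_ge0 cc p.
have [Psi1 Psi2 Psi3 Psi0] := six_terms cbq ceq ccq cd0 cf0 PsiE.
have E0 k : 0 <= et ^+ k by exact: exprn_ge0.
have E1 : et ^+ m.+1 <= et by rewrite exprS ler_piMr// exprn_ile1.
have Xp := powR_ge0 X (p - 1). have Yp := powR_ge0 Y (p - 1).
have [nuz|nun0] := eqVneq nu 0.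
  have GG00 : GG = 0 by apply/eqP; rewrite eq_le GG0 andbT (le_trans GGle)// nuz mul0r.
  have gg00 : gg = 0 by apply/eqP; rewrite eq_le gg0 andbT (le_trans ggle)// nuz mulr0.
  by rewrite nuz GG00 gg00 !(mulr0, mul0r) !addr0 mulr0.
have [wZ YZ] := nuZ nun0.
have Z0 : 0 <= Z by exact: le_trans wZ.
have wpZ : w `^ p <= Z `^ p by apply: ge0_ler_powR; rewrite ?nnegrE// ltW.
have YpZ : Y `^ p <= Z `^ p by apply: ge0_ler_powR; rewrite ?nnegrE// ltW.
have Yp1Z : Y `^ (p - 1) <= Z `^ (p - 1) by apply: ge0_ler_powR; rewrite ?nnegrE// ltW.
have wD0 : 0 <= w * De by rewrite mulr_ge0.
have pq (x : R) : (x `^ (p - 1)) `^ dual_exp p = x `^ p by rewrite -powRrM dual_expM.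
have Eq := cutoff_pow pm et01.
have wDp : (w * De) `^ p = w `^ p * De `^ p by rewrite powRM.
(* the five products, with the common factor [nu] removed *)
have T1 : et ^+ m.+1 * ka * (Psi * Y `^ p) <= ka * (et * (Psi * Z `^ p)).
  rewrite [_ * ka]mulrC -mulrA ler_wpM2l//; apply: ler_pM; rewrite ?mulr_ge0 ?powR_ge0//.
  by rewrite ler_wpM2l.
have T2 : m.+1%:R * et ^+ m * w * De * (a * X `^ (p - 1)) <= de / 2 * (et ^+ m.+1 * X `^ p) + C1 * c2 `^ p * (w `^ p * De `^ p).
  have -> : m.+1%:R * et ^+ m * w * De * (a * X `^ (p - 1)) = (c2 * (w * De)) * (et ^+ m * X `^ (p - 1)).
    by rewrite /c2; ring.
  apply: (le_trans (Y1 _ _ (mulr_ge0 c20 wD0) (mulr_ge0 (E0 m) Xp))).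
  rewrite (powRM p c20 wD0) wDp (powRM _ (E0 m) Xp) pq addrC; apply: lerD; last by rewrite mulrA.
  by rewrite ler_wpM2l ?(ltW de20)// ler_wpM2r ?powR_ge0.
have T3 : m.+1%:R * et ^+ m * w * De * ((cb + ce) * Y `^ (p - 1)) <=
    t2 * (et * (Psi * Z `^ p)) + C2 * m.+1%:R `^ p * (w `^ p * De `^ p).
  have -> : m.+1%:R * et ^+ m * w * De * ((cb + ce) * Y `^ (p - 1)) = (m.+1%:R * (w * De)) * (et ^+ m * ((cb + ce) * Y `^ (p - 1))).
    by ring.
  have cbe : 0 <= cb + ce by rewrite addr_ge0.
  apply: (le_trans (Y2 _ _ (mulr_ge0 m0 wD0) (mulr_ge0 (E0 m) (mulr_ge0 cbe Yp)))).
  rewrite (powRM p m0 wD0) wDp (powRM _ (E0 m) (mulr_ge0 cbe Yp)) (powRM _ cbe Yp) pq addrC mul1r.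
  apply: lerD; last by rewrite mulrA.
  have h1 := powRD_le (ltW q0) cb0 ce0.
  have h2 : (cb + ce) `^ dual_exp p * Y `^ p <= t2 * (Psi * Z `^ p).
    rewrite mulrA; apply: ler_pM; rewrite ?powR_ge0//.
    by apply: (le_trans h1); rewrite ler_wpM2l.
  rewrite [leRHS]mulrCA; apply: ler_pM; rewrite ?mulr_ge0 ?powR_ge0//.
  exact: le_trans Eq E1.
have T4 : et ^+ m.+1 * w * (cc * X `^ (p - 1)) <= de / 2 * (et ^+ m.+1 * X `^ p) + C1 * (et * (Psi * Z `^ p)).
  have -> : et ^+ m.+1 * w * (cc * X `^ (p - 1)) = et ^+ m.+1 * ((w * cc) * X `^ (p - 1)) by ring.
  apply: (@le_trans _ _ (et ^+ m.+1 * (C1 * (w * cc) `^ p + de / 2 * X `^ p))).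
    rewrite ler_wpM2l//; apply: (le_trans (Y1 _ _ (mulr_ge0 w0 cc0) Xp)).
    by rewrite pq.
  rewrite mulrDr addrC; apply: lerD; first by rewrite mulrCA.
  rewrite mulrCA ler_wpM2l ?(ltW C10)//; apply: ler_pM; rewrite ?powR_ge0//.
  by rewrite powRM// mulrC; apply: ler_pM; rewrite ?powR_ge0.
have T5 : et ^+ m.+1 * w * ((cc + cd + cf) * Y `^ (p - 1)) <= et * (Psi * Z `^ p).
  have -> : et ^+ m.+1 * w * ((cc + cd + cf) * Y `^ (p - 1)) = et ^+ m.+1 * ((cc + cd + cf) * (w * Y `^ (p - 1))) by ring.
  have cdf : 0 <= cc + cd + cf by rewrite !addr_ge0.
  apply: ler_pM; rewrite ?mulr_ge0//; apply: ler_pM; rewrite ?mulr_ge0//.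
    have : cc <= 1 + cc `^ p.
      have [c1|c1] := leP cc 1; first by rewrite (le_trans c1)// lerDl.
      apply: (@le_trans _ _ (cc `^ p)); last by rewrite lerDr.
      by rewrite -[leLHS]powRr1//; apply: ler_powR; exact: ltW.
    by move=> h; apply: le_trans Psi3; rewrite !lerD2r.
  apply: (@le_trans _ _ (Z * Z `^ (p - 1))); first exact: ler_pM.
  rewrite -[X in X * _]powRr1// -powRD ?subrKC//.
  by rewrite (gt_eqF p0).
set A := et * (Psi * Z `^ p) in T1 T2 T3 T4 T5 *.
set B := w `^ p * De `^ p in T2 T3 *.
set U := et ^+ m.+1 * X `^ p in T2 T4 *.
have A0 : 0 <= A by rewrite !mulr_ge0 ?powR_ge0.
have B0 : 0 <= B by rewrite mulr_ge0 ?powR_ge0.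
set K := ka + _ + _ + _ + _ + _.
apply: (@le_trans _ _ (nu * (de * U + K * (A + B)))); last first.
  by rewrite le_eqVlt; apply/orP; left; apply/eqP; rewrite /A /B /U; ring.
apply: (@le_trans _ _ (nu * (et ^+ m.+1 * ka * (Psi * Y `^ p) +
   (m.+1%:R * et ^+ m * w * De * (a * X `^ (p - 1)) + m.+1%:R * et ^+ m * w * De * ((cb + ce) * Y `^ (p - 1))) +
   (et ^+ m.+1 * w * (cc * X `^ (p - 1)) + et ^+ m.+1 * w * ((cc + cd + cf) * Y `^ (p - 1)))))).
  have PY : 0 <= Psi * Y `^ p by rewrite mulr_ge0 ?powR_ge0.
  have u1 : et ^+ m.+1 * gg * (Psi * Y `^ p) <= et ^+ m.+1 * (ka * nu) * (Psi * Y `^ p).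
    by rewrite ler_wpM2r// ler_wpM2l.
  have cbe : 0 <= cb + ce by rewrite addr_ge0.
  have cdf : 0 <= cc + cd + cf by rewrite !addr_ge0.
  have AB0 : 0 <= a * X `^ (p - 1) + (cb + ce) * Y `^ (p - 1) by rewrite addr_ge0// mulr_ge0// ltW.
  have BB0 : 0 <= cc * X `^ (p - 1) + (cc + cd + cf) * Y `^ (p - 1) by rewrite addr_ge0// mulr_ge0.
  have u2 : m.+1%:R * et ^+ m * GG * De * (a * X `^ (p - 1) + (cb + ce) * Y `^ (p - 1)) <=
    m.+1%:R * et ^+ m * (nu * w) * De * (a * X `^ (p - 1) + (cb + ce) * Y `^ (p - 1)).
    by rewrite ler_wpM2r// ler_wpM2r// ler_wpM2l// mulr_ge0.
  have u3 : et ^+ m.+1 * GG * (cc * X `^ (p - 1) + (cc + cd + cf) * Y `^ (p - 1)) <=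
    et ^+ m.+1 * (nu * w) * (cc * X `^ (p - 1) + (cc + cd + cf) * Y `^ (p - 1)).
    by rewrite ler_wpM2r// ler_wpM2l.
  apply: (le_trans (lerD (lerD u1 u2) u3)).
  by rewrite le_eqVlt; apply/orP; left; apply/eqP; ring.
rewrite ler_wpM2l//.
apply: (le_trans (lerD (lerD T1 (lerD T2 T3)) (lerD T4 T5))).
have k1 : 0 <= C1 * c2 `^ p by rewrite mulr_ge0 ?powR_ge0// ltW.
have k2 : 0 <= C2 * m.+1%:R `^ p by rewrite mulr_ge0 ?powR_ge0// ltW.
have C1' := ltW C10.
have [K1 K2] := absorb_constants ka0 k1 k2 t20 C1'.
have hA : ka * A + t2 * A + C1 * A + A <= K * A.
  have -> : ka * A + t2 * A + C1 * A + A = (ka + t2 + C1 + 1) * A by ring.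
  by rewrite ler_wpM2r.
have hB : C1 * c2 `^ p * B + C2 * m.+1%:R `^ p * B <= K * B.
  by rewrite -mulrDl ler_wpM2r.
have -> : de * U + K * (A + B) = de / 2 * U + de / 2 * U + K * A + K * B.
  by field.
exact: absorb_products.
Qed.

End scalars.

Variables (Omega : set V) (Q : V -> 'M[R]_n.+1) (p : R).
Hypotheses (oOm : open Omega) (bOm : bounded_set Omega) (p1 : 1 < p).
Hypotheses (mQ : forall i j, meas_on Omega (fun x => Q x i j))
  (symQ : forall x, Omega x -> sym_nonneg (Q x)).

Let mOm : measurable (Omega : set T). Proof. exact: open_measurable_Rn. Qed.
Let p0 : 0 < p. Proof. exact: lt_trans p1. Qed.

Lemma enormN (v : V) : enorm (- v) = enorm v.
Proof. by rewrite -scaleN1r enormZ normrN normr1 mul1r. Qed.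

(** Shown directly on the approximants, since t -> -t is decreasing and so not of the admissible
    kind. *)
Lemma WQ_opp (u : V -> R) (gu : V -> V) : WQ Q p Omega u gu ->
  WQ Q p Omega (fun x => - u x) (fun x => - gu x).
Proof.
move=> uW; have [mu_ mgu _] := uW.
have [u_ [D [uL D0 LD uD]]] := WQ_approx mOm p1 mQ symQ oOm uW.
have dae : \forall x \ae mu, Omega x -> forall k, grad (fun y => - u_ k y) x = - grad (u_ k) x.
  have h : \forall x \ae mu, forall k, forall i, Omega x -> derivable (u_ k) x (delta_mx ord0 i).
    by apply/ae_foralln => k; apply: filter_forall => i; exact: (grad_meas_loc _ oOm (uL k)).2.
  apply: filterS h => x h Ox k; apply/rowP => i; rewrite !mxE.
  exact: deriveN (h k i Ox).
have wL k : Lip_loc Omega (fun y => - u_ k y).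
  apply: (@Lip_loc_comp _ _ Omega (u_ k) (fun t => - t) 1 _ ler01 (uL k)) => s t.
  by rewrite mul1r -opprD normrN.
pose c := 2 `^ p : R.
have c0 : 0 <= c by exact: powR_ge0.
have c1 : 1 <= c by apply: powR_ge1; [lra|exact: ltW].
have LB : L1 Omega (fun x => c * (D x + D x)) by apply: (L1Z mOm c0 (L1D mOm LD LD)).
have bnd x s t : s `^ p <= D x -> t `^ p <= D x -> 0 <= s -> 0 <= t -> (s + t) `^ p <= c * (D x + D x).
  move=> h1 h2 h3 h4; apply: (le_trans (powRD_le (ltW p0) h3 h4)); rewrite ler_wpM2l//; exact: lerD.
have bnd1 x s : s `^ p <= D x -> s `^ p <= c * (D x + D x).
  move=> h; apply: (le_trans h); have := D0 x => d0.
  by apply: (@le_trans _ _ (1 * (D x + D x))); [rewrite mul1r lerDl|rewrite ler_wpM2r// addr_ge0].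
have Q0 v x : enorm (- v *m sqrtmx (Q x)) = enorm (v *m sqrtmx (Q x)) by rewrite mulNmx enormN.
apply: (WQ_closureI oOm p1 mQ symQ oOm (fun x h => h) _ _ wL wL LB).
- by mfun.
- move=> i; rewrite (_ : (fun _ => _) = fun x => - gu x ord0 i); last by apply/funext => x; rewrite mxE.
  by apply: mN; exact: mgu.
- apply: filterS2 uD dae => x h1 h2 Ox k; have [b1 b2 [b3 b4] _ _] := h1 Ox; have {}h2 := h2 Ox k.
  split.
  + by rewrite -opprD normrN; exact: bnd1.
  + by rewrite /Qlen h2 -opprD Q0; apply: bnd1; exact: b2.
  + rewrite normrN; have := powR_triangle p1 (u x) (u_ k x); move=> h; apply: (le_trans h).
    by rewrite ler_wpM2l//; apply: lerD => //; exact: b1.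
  + rewrite /Qlen h2 Q0.
    have := bnd x _ _ (b2 k) b4 (Qlen_ge0 _ _ _) (Qlen_ge0 _ _ _).
    apply: le_trans; apply: ge0_ler_powR; rewrite ?nnegrE ?addr_ge0 ?Qlen_ge0 ?enorm_ge0 ?(ltW p0)//.
    by rewrite -{1}(subrK (gu x) (grad (u_ k) x)) mulmxDl; exact: enormD.
- apply: filterS uD => x h1 Ox; have [_ _ _ b1 _] := h1 Ox.
  by apply: cvgN.
- apply: filterS2 uD dae => x h1 h2 Ox; have [_ _ _ _ b1] := h1 Ox; have {}h2 := h2 Ox.
  have -> : (fun k => Qlen Q (fun y => grad (fun y => - u_ k y) y - - gu y) x) =
     (fun k => Qlen Q (fun y => grad (u_ k) y - gu y) x).
    by apply/funext => k; rewrite /Qlen h2 -opprD Q0.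
  exact: b1.
Qed.

Variables (a : R) (cb cc cd ce cf cg ch : V -> R).
Hypotheses (a1 : 1 < a) (cb0 : nonneg_meas Omega cb) (cc0 : nonneg_meas Omega cc)
  (cd0 : nonneg_meas Omega cd) (ce0 : nonneg_meas Omega ce) (cf0 : nonneg_meas Omega cf)
  (cg0 : nonneg_meas Omega cg) (ch0 : nonneg_meas Omega ch).

Section opposite.
Variables (gam psi del : R) (A At : V -> R -> V -> V) (B : V -> R -> V -> R).

Lemma structural_opp : structural Omega Q p A B gam psi del a At cb cc cd ce cf cg ch ->
  structural Omega Q p (fun x z xi => - A x (- z) (- xi)) (fun x z xi => - B x (- z) (- xi))
    gam psi del a (fun x z xi => - At x (- z) (- xi)) cb cc cd ce cf cg ch.
Proof.
apply: filterS => x h Ox z xi; have [h1 h2 h3 h4] := h Ox (- z) (- xi).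
move: h1 h2 h3 h4; rewrite mulNmx !enormN !normrN => h1 h2 h3 h4; split => //.
  by rewrite h1 mulNmx.
apply: (le_trans h2); rewrite -[- xi]scaleN1r -[- A _ _ _]scaleN1r dotvZl dotvZr.
by rewrite scaleN1r.
Qed.

Lemma weak_solution_opp (u : V -> R) (gu : V -> V) : weak_solution Omega Q p A B u gu ->
  weak_solution Omega Q p (fun x z xi => - A x (- z) (- xi)) (fun x z xi => - B x (- z) (- xi))
    (fun x => - u x) (fun x => - gu x).
Proof.
move=> [uW us]; split; first exact: WQ_opp.
move=> phi phiL phi0; have [i1 i2] := us phi phiL phi0.
set F := (X in mu.-integrable _ X) in i1; set F' := (fun x : lebT R n => _).
have -> : F' = (fun x => (- 1)%:E * F x)%E.
  apply/funext => x; rewrite /F' /F !opprK -EFinM mulN1r opprD mulrN; congr ((_ - _)%:E).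
  by rewrite -[- A _ _ _]scaleN1r dotvZr mulN1r.
split; first exact: integrableZl.
by rewrite integralZl// i2 mule0.
Qed.
End opposite.

(* [Psi] of the introduction. *)
Definition data x := 1 + ch x + cg x + (cb x `^ dual_exp p + ce x `^ dual_exp p + cc x `^ p + cd x + cf x).

(* All that the regularity theory uses of the equation; stated so that it passes from [u] to [- u]. *)
Definition energy (u : V -> R) (gu : V -> V) := WQ Q p Omega u gu /\
  forall (S : set V) (eta : V -> R) (G g : R -> R) (C1 : R) m,
  measurable (S : set T) -> S `<=` Omega -> L1 S (fun x => data x * (1 + `|u x|) `^ p) ->
  adm G g -> (forall t, 0 <= G t <= C1) ->
  lipschitz eta -> (forall x, 0 <= eta x <= 1) -> compact (tsupp eta) -> tsupp eta `<=` S ->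
  L1 S (fun x => Qlen Q (grad eta) x `^ p) ->
  (Int S (fun x => (eta x ^+ m.+1 * g (u x) * (a^-1 * Qlen Q gu x `^ p))%R) <=
   Int S (fun x => (eta x ^+ m.+1 * g (u x) * (data x * (1 + `|u x|) `^ p) +
     m.+1%:R * eta x ^+ m * G (u x) * Qlen Q (grad eta) x *
       (a * Qlen Q gu x `^ (p - 1) + (cb x + ce x) * (1 + `|u x|) `^ (p - 1)) +
     eta x ^+ m.+1 * G (u x) *
       (cc x * Qlen Q gu x `^ (p - 1) + (cc x + cd x + cf x) * (1 + `|u x|) `^ (p - 1)))%R))%E.

Lemma data_meas : meas_on Omega data.
Proof.
have [m1 _] := cb0; have [m2 _] := cc0; have [m3 _] := cd0; have [m4 _] := ce0; have [m5 _] := cf0.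
by have [m6 _] := cg0; have [m7 _] := ch0; rewrite /data; mfun.
Qed.

Lemma data_ge x : Omega x -> [/\ 1 <= data x, ch x + cg x <= data x &
  cb x `^ dual_exp p + ce x `^ dual_exp p + cc x `^ p + cd x + cf x + 1 <= data x].
Proof.
move=> Ox; have h1 := cb0.2 x Ox; have h2 := cc0.2 x Ox; have h3 := cd0.2 x Ox; have h4 := ce0.2 x Ox.
have h5 := cf0.2 x Ox; have h6 := cg0.2 x Ox; have h7 := ch0.2 x Ox.
have := powR_ge0 (cb x) (dual_exp p); have := powR_ge0 (ce x) (dual_exp p); have := powR_ge0 (cc x) p.
rewrite /data; move: (cb x `^ _) (ce x `^ _) (cc x `^ _) => *; split; lra.
Qed.

(** With Y = 1 + |u| >= 1, a power of |u| with exponent at most p, or at most p - 1, is below Y^p,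
    or Y^{p-1}; this merges all structural terms into [data], [Ab] and [Bb]. *)
Lemma energy_weak (gam psi del : R) (A At : V -> R -> V -> V) (B : V -> R -> V -> R) (u : V -> R) (gu : V -> V) :
  1 < gam < p -> 1 < del < p -> 1 < psi < p ->
  structural Omega Q p A B gam psi del a At cb cc cd ce cf cg ch ->
  weak_solution Omega Q p A B u gu -> energy u gu.
Proof.
move=> /andP[g1 g2] /andP[d1 d2] /andP[s1 s2] st us; have [uW _] := us; split => //.
move=> S eta G g C1 m mS SO LPsi aG G1 le e01 cs sS LDe; have [mu_ mgu _] := uW.
have [u_ [D [_ _ LD uDae]]] := WQ_approx mOm p1 mQ symQ oOm uW.
have [mPsi Psi0 _] := LPsi.
pose X := Qlen Q gu; pose Y x := 1 + `|u x|.
have Y1 x : 1 <= Y x by rewrite lerDl.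
have Y0 x : 0 <= Y x by exact: le_trans (Y1 x).
have mY : meas_on S Y by rewrite /Y; apply: (meas_onS mOm SO); mfun.
have mX : meas_on S X.
  by apply: (Qlen_meas mOm mQ symQ mS SO) => i; apply: (meas_onS mOm SO); exact: mgu.
have m1 := meas_onS mOm SO cb0.1; have m2 := meas_onS mOm SO cc0.1; have m3 := meas_onS mOm SO cd0.1.
have m4 := meas_onS mOm SO ce0.1; have m5 := meas_onS mOm SO cf0.1.
have p10 : 0 < p - 1 by rewrite subr_gt0.
have q0 := dual_exp_gt0 p1.
have X0 x : 0 <= X x by exact: Qlen_ge0.
have LXp : L1 S (fun x => X x `^ p).
  apply: (L1_le mS _ _ _ (L1S mS mOm SO LD)); [by mfun|by move=> x _; exact: powR_ge0|].
  by apply: filterS uDae => x h Sx; have [_ _ [_ h1] _ _] := h (SO _ Sx).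
have Le1 x : Y x `^ (p - 1) <= Y x `^ p by apply: ler_powR => //; rewrite gerBl.
pose Ab x := a * X x `^ (p - 1) + (cb x + ce x) * Y x `^ (p - 1).
pose Bb x := cc x * X x `^ (p - 1) + (cc x + cd x + cf x) * Y x `^ (p - 1).
have mAb : meas_on S Ab by rewrite /Ab; mfun.
have mBb : meas_on S Bb by rewrite /Bb; mfun.
have a0 : 0 <= a by apply: ltW; exact: lt_trans a1.
have Ab0 x : S x -> 0 <= Ab x.
  move=> Sx; have h1 := cb0.2 x (SO _ Sx); have h4 := ce0.2 x (SO _ Sx).
  by rewrite addr_ge0// mulr_ge0 ?powR_ge0// addr_ge0.
have Bb0 x : S x -> 0 <= Bb x.
  move=> Sx; have h2 := cc0.2 x (SO _ Sx); have h3 := cd0.2 x (SO _ Sx); have h4 := cf0.2 x (SO _ Sx).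
  by rewrite addr_ge0// mulr_ge0 ?powR_ge0 ?addr_ge0.
pose t2 := 2 `^ dual_exp p : R.
have t20 : 0 <= t2 by exact: powR_ge0.
have pq (x : R) : (x `^ (p - 1)) `^ dual_exp p = x `^ p by rewrite -powRrM dual_expM.
have LAb : L1 S (fun x => Ab x `^ dual_exp p).
  have ap0 : 0 <= a `^ dual_exp p by exact: powR_ge0.
  apply: (L1_le mS _ _ _ (L1Z mS t20 (L1D mS (L1Z mS ap0 LXp) (L1Z mS t20 LPsi)))).
  - by mfun.
  - by move=> x _; exact: powR_ge0.
  - apply: aeW => x Sx; have h1 := cb0.2 x (SO _ Sx); have h4 := ce0.2 x (SO _ Sx).
    have cbe := addr_ge0 h1 h4.
    apply: (le_trans (powRD_le (ltW q0) _ _)); rewrite ?mulr_ge0 ?powR_ge0//.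
    rewrite ler_wpM2l// powRM ?powR_ge0// powRM ?powR_ge0// !pq lerD2l mulrA ler_wpM2r ?powR_ge0//.
    apply: (le_trans (powRD_le (ltW q0) h1 h4)); rewrite ler_wpM2l//.
    have [_ _ h] := data_ge (SO _ Sx); apply: le_trans h.
    have h2 := cc0.2 x (SO _ Sx); have h3 := cd0.2 x (SO _ Sx); have h5 := cf0.2 x (SO _ Sx).
    by rewrite -!addrA lerD2l lerDl !addr_ge0// powR_ge0.
have cle (x : R) : 0 <= x -> x <= 1 + x `^ p.
  move=> x0; have [c1|c1] := leP x 1; first by rewrite (le_trans c1)// lerDl powR_ge0.
  apply: (@le_trans _ _ (x `^ p)); last by rewrite lerDr.
  by rewrite -[leLHS]powRr1//; apply: ler_powR; exact: ltW.
have LBb : L1 S Bb.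
  apply: (L1_le mS mBb Bb0 _ (L1D mS (L1D mS LPsi LXp) LPsi)).
  apply: aeW => x Sx; have h2 := cc0.2 x (SO _ Sx); have h3 := cd0.2 x (SO _ Sx); have h5 := cf0.2 x (SO _ Sx).
  have [d1' _ dh] := data_ge (SO _ Sx).
  have b0 := powR_ge0 (cb x) (dual_exp p); have e0 := powR_ge0 (ce x) (dual_exp p); have c0 := powR_ge0 (cc x) p.
  have Yp1 : 1 <= Y x `^ p by apply: powR_ge1 => //; exact: ltW.
  have d0 : 0 <= data x by exact: le_trans d1'.
  apply: lerD.
    apply: (le_trans (young p1 h2 (powR_ge0 _ _))); rewrite pq lerD2r.
    apply: (@le_trans _ _ (data x)); last by rewrite ler_peMr.
    apply: le_trans dh; move: (cb x `^ _) (ce x `^ _) (cc x `^ _) b0 e0 c0 => *; lra.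
  apply: ler_pM; rewrite ?addr_ge0 ?powR_ge0//.
  apply: le_trans dh; have := cle _ h2; move: (cb x `^ _) (ce x `^ _) (cc x `^ _) b0 e0 c0 => *; lra.
have pt : \forall x \ae mu, S x -> exists v, [/\ A x (u x) (gu x) = v *m sqrtmx (Q x),
     a^-1 * Qlen Q gu x `^ p - data x * (1 + `|u x|) `^ p <= dotv (gu x) (A x (u x) (gu x)),
     enorm v <= Ab x & `|B x (u x) (gu x)| <= Bb x]; last first.
  exact: (energy_ineq oOm p1 mQ symQ m mS SO a0 LPsi mAb Ab0 LAb LBb pt us aG G1 le e01 cs sS LDe).
apply: filterS st => x h Sx; have [h1 h2 h3 h4] := h (SO _ Sx) (u x) (gu x).
have Ox := SO _ Sx; have [d1' dh _] := data_ge Ox.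
have z1 : `|u x| <= Y x by rewrite lerDr.
have zp (t : R) : 0 <= t -> t <= p -> `|u x| `^ t <= Y x `^ p.
  move=> t0 tp; apply: (@le_trans _ _ (Y x `^ t)); last exact: ler_powR.
  by apply: ge0_ler_powR; rewrite ?nnegrE.
have zp1 (t : R) : 0 <= t -> t <= p - 1 -> `|u x| `^ t <= Y x `^ (p - 1).
  move=> t0 tp; apply: (@le_trans _ _ (Y x `^ t)); last exact: ler_powR.
  by apply: ge0_ler_powR; rewrite ?nnegrE.
have Yp1 : 1 <= Y x `^ (p - 1) by apply: powR_ge1 => //; exact: ltW.
have Yp2 : 1 <= Y x `^ p by apply: powR_ge1 => //; exact: ltW.
have k1 := cb0.2 x Ox; have k2 := cc0.2 x Ox; have k3 := cd0.2 x Ox; have k4 := ce0.2 x Ox.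
have k5 := cf0.2 x Ox; have k6 := cg0.2 x Ox; have k7 := ch0.2 x Ox.
have gam0 : 0 <= gam by apply: ltW; exact: lt_trans g1.
have gam1 : 0 <= gam - 1 by rewrite subr_ge0 ltW.
have del1 : 0 <= del - 1 by rewrite subr_ge0 ltW.
have psi1 : 0 <= psi - 1 by rewrite subr_ge0 ltW.
have r1 : ch x * `|u x| `^ gam <= ch x * Y x `^ p by rewrite ler_wpM2l// zp// ltW.
have r2 : cg x <= cg x * Y x `^ p by rewrite ler_peMr.
have r3 : (ch x + cg x) * Y x `^ p <= data x * Y x `^ p by rewrite ler_wpM2r// powR_ge0.
have r4 : cb x * `|u x| `^ (gam - 1) <= cb x * Y x `^ (p - 1) by rewrite ler_wpM2l// zp1// lerD2r ltW.
have r5 : ce x <= ce x * Y x `^ (p - 1) by rewrite ler_peMr.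
have r6 : cd x * `|u x| `^ (del - 1) <= cd x * Y x `^ (p - 1) by rewrite ler_wpM2l// zp1// lerD2r ltW.
have r7 : cf x <= cf x * Y x `^ (p - 1) by rewrite ler_peMr.
(* The gradient has no lower bound 1, hence the two cases: where X <= 1 the power of Y takes
   over. *)
have r8 : cc x * X x `^ (psi - 1) <= cc x * X x `^ (p - 1) + cc x * Y x `^ (p - 1).
  rewrite -mulrDr ler_wpM2l//; have [x1|x1] := leP (X x) 1.
    apply: (@le_trans _ _ 1); last by rewrite ler_wpDl// powR_ge0.
    have e1 : 1 `^ (psi - 1) = 1 :> R by rewrite powR1.
    rewrite -[leRHS]e1.
    by apply: ge0_ler_powR; rewrite ?nnegrE.
  apply: ler_wpDr; first exact: powR_ge0.
  by apply: ler_powR; [exact: ltW|rewrite lerD2r ltW].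
exists (At x (u x) (gu x)); split.
- exact: h1.
- apply: le_trans h2; rewrite -/(Qlen Q gu x) -/(X x) -addrA lerD2l -opprD lerN2.
  apply: le_trans r3; rewrite mulrDl; exact: lerD.
- apply: (le_trans h3); rewrite /Ab mulrDl -addrA lerD2l; exact: lerD.
- apply: (le_trans h4); rewrite /Bb !mulrDl !addrA.
  apply: lerD => //; apply: lerD => //; exact: r8.
Qed.

Lemma ereal_absorb (x y : \bar R) (c de : R) : (0 <= x)%E -> (x < +oo)%E -> (0 <= y)%E -> 0 < c ->
  0 < de -> ((2 * de)%:E * x <= de%:E * x + c%:E * y)%E -> (x <= (c / de)%:E * y)%E.
Proof.
case: x => [x| |]// x0 _ y0 c0 de0; case: y y0 => [y| |]// y0.
- rewrite -!EFinM -EFinD !lee_fin => h.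
  by rewrite mulrAC ler_pdivlMr//; lra.
- by move=> _; rewrite gt0_muley ?leey// lte_fin divr_gt0.
Qed.

Variable m : nat.
Hypothesis pm : p - 1 <= m%:R.

Definition admissible_cutoff (S : set V) (u eta : V -> R) :=
  [/\ measurable (S : set T), S `<=` Omega, L1 S (fun x => data x * (1 + `|u x|) `^ p) &
   [/\ lipschitz eta, (forall x, 0 <= eta x <= 1), compact (tsupp eta), tsupp eta `<=` S &
   L1 S (fun x => Qlen Q (grad eta) x `^ p)]].

Lemma cutoff_meas (S : set V) (u eta : V -> R) (gu : V -> V) : WQ Q p Omega u gu ->
  admissible_cutoff S u eta ->
  [/\ meas_on S u, meas_on S eta, meas_on S (Qlen Q gu), meas_on S (Qlen Q (grad eta)) & meas_on S data] /\
  L1 S (fun x => Qlen Q gu x `^ p).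
Proof.
move=> uW [mS SO LPsi [le e01 cs sS LDe]]; have [mu_ mgu _] := uW.
have [u_ [D [_ _ LD uDae]]] := WQ_approx mOm p1 mQ symQ oOm uW.
have eL : Lip_loc Omega eta by exact: lipschitz_Lip_loc.
have mX : meas_on S (Qlen Q gu).
  by apply: (Qlen_meas mOm mQ symQ mS SO) => i; apply: (meas_onS mOm SO); exact: mgu.
split; [split|].
- exact: (meas_onS mOm SO mu_).
- by apply: (meas_onS mOm SO); exact: (Lip_loc_meas oOm eL).
- exact: mX.
- apply: (Qlen_meas mOm mQ symQ mS SO) => i.
  by apply: (meas_onS mOm SO); exact: (grad_meas oOm i eL).
- exact: (meas_onS mOm SO data_meas).
- apply: (L1_le mS _ _ _ (L1S mS mOm SO LD)); [by mfun|by move=> x _; exact: powR_ge0|].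
  by apply: filterS uDae => x h Sx; have [_ _ [_ h1] _ _] := h (SO _ Sx).
Qed.

(** The small gradient term stays on the right because its weight nu differs from the weight g(u) on
    the left. Each application first makes the two weights agree, by a limit or by an identity, and
    then absorbs. *)
Lemma cacc_gen (de ka : R) : 0 < de -> 0 <= ka -> exists2 C : R, 0 < C &
  forall (u eta : V -> R) (gu : V -> V) (S : set V) (G g : R -> R) (C1 : R) (nu w Z : V -> R),
  energy u gu -> admissible_cutoff S u eta -> adm G g -> (forall t, 0 <= G t <= C1) ->
  meas_on S nu -> meas_on S w -> meas_on S Z ->
  (forall x, 0 <= nu x) -> (forall x, 0 <= w x) ->
  (\forall x \ae mu, S x -> [/\ g (u x) <= ka * nu x, G (u x) <= nu x * w x &
     nu x != 0 -> w x <= Z x /\ 1 + `|u x| <= Z x]) ->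
  (Int S (fun x => (eta x ^+ m.+1 * g (u x) * Qlen Q gu x `^ p)%R) <=
   Int S (fun x => (de * (eta x ^+ m.+1 * nu x * Qlen Q gu x `^ p) +
     C * (eta x * nu x * (data x * Z x `^ p) + nu x * w x `^ p * Qlen Q (grad eta) x `^ p))%R))%E.
Proof.
move=> de0 ka0; have a0 : 0 < a by exact: lt_trans a1.
have dea0 : 0 < de / a by rewrite divr_gt0.
have [C C0 CP] := cacc_pointwise p1 pm a1 ka0 dea0.
exists (a * C); first by rewrite mulr_gt0.
move=> u eta gu S G g C1 nu w Z [uW en] adc aG G1 mnu mw mZ nu0 w0 pt.
have [[muS meta mX mDe mdat] LXp] := cutoff_meas uW adc.
have [mS SO LPsi [le e01 cs sS LDe]] := adc.
have cG := adm_cont aG; have [dG contg [Cg GC]] := aG.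
have g0 t : 0 <= g t by have /andP[] := GC t.
have G0 t : 0 <= G t by have /andP[] := G1 t.
have e0 x : 0 <= eta x by have /andP[] := e01 x.
have mgu' : meas_on S (fun x => g (u x)) by exact: mcomp.
have mGu' : meas_on S (fun x => G (u x)) by exact: mcomp.
have ai0 : 0 <= a^-1 by rewrite invr_ge0 ltW.
pose P x := eta x ^+ m.+1 * g (u x) * (a^-1 * Qlen Q gu x `^ p).
pose W x := de / a * (eta x ^+ m.+1 * nu x * Qlen Q gu x `^ p) +
     C * (eta x * nu x * (data x * Z x `^ p) + nu x * w x `^ p * Qlen Q (grad eta) x `^ p).
have mP : meas_on S P by rewrite /P; mfun.
have mW : meas_on S W by rewrite /W; mfun.
have P0 x : S x -> 0 <= P x by move=> _; rewrite !mulr_ge0 ?exprn_ge0 ?powR_ge0.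
have dat0 x : S x -> 0 <= data x by move=> Sx; have [h _ _] := data_ge (SO _ Sx); exact: le_trans h.
have W0 x : S x -> 0 <= W x.
  move=> Sx; have h := dat0 _ Sx; rewrite addr_ge0//; first by rewrite !mulr_ge0 ?exprn_ge0 ?powR_ge0// ltW.
  by rewrite mulr_ge0 ?(ltW C0)// addr_ge0// !mulr_ge0 ?powR_ge0.
have PW : (Int S P <= Int S W)%E.
  apply: (le_trans (en S eta G g C1 m mS SO LPsi aG G1 le e01 cs sS LDe)).
  have m1 := meas_onS mOm SO cb0.1; have m2 := meas_onS mOm SO cc0.1; have m3 := meas_onS mOm SO cd0.1.
  have m4 := meas_onS mOm SO ce0.1; have m5 := meas_onS mOm SO cf0.1.
  apply: Int_le; [exact: mS|by mfun|exact: mW| |].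
    move=> x Sx; have Ox := SO _ Sx; have h := dat0 _ Sx.
    have h1 := cb0.2 x Ox; have h2 := cc0.2 x Ox; have h3 := cd0.2 x Ox; have h4 := ce0.2 x Ox.
    have h5 := cf0.2 x Ox.
    have h6 : 0 <= (cb x + ce x) * (1 + `|u x|) `^ (p - 1) by rewrite mulr_ge0 ?addr_ge0 ?powR_ge0.
    have h7 : 0 <= (cc x + cd x + cf x) * (1 + `|u x|) `^ (p - 1) by rewrite mulr_ge0 ?addr_ge0 ?powR_ge0.
    apply: addr_ge0; first apply: addr_ge0.
    - by rewrite !mulr_ge0 ?exprn_ge0 ?powR_ge0.
    - rewrite mulr_ge0 ?addr_ge0 ?h6// ?mulr_ge0 ?exprn_ge0 ?powR_ge0 ?Qlen_ge0// ltW//.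
    - by rewrite mulr_ge0 ?addr_ge0 ?h7// ?mulr_ge0 ?exprn_ge0 ?powR_ge0.
  apply: filterS pt => x pt Sx; have [q1 q2 q3] := pt Sx; have Ox := SO _ Sx.
  have [_ _ dg] := data_ge Ox.
  apply: CP => //; [exact: Qlen_ge0|exact: cb0.2|exact: cc0.2|exact: cd0.2|exact: ce0.2|exact: cf0.2|exact: Qlen_ge0].
have := lee_wpmul2l (ltW a0 : (0 <= a%:E)%E) PW.
rewrite -(IntZ mS mP P0 (ltW a0)) -(IntZ mS mW W0 (ltW a0)).
have an0 : a != 0 by rewrite gt_eqF.
congr (_ <= _)%E; congr Int; apply/funext => x.
  by rewrite /P; field.
by rewrite /W; field.
Qed.

(** Tested with the bounded truncations [ptrunc] of (u - k)_+; Fatou turns their derivatives into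
    the indicator of u > k, after which half of the gradient term is absorbed. The factor [La]
    compares 1 + |u| with H + (u - k)_+ and makes the inequality homogeneous in the height H. *)
Lemma cacc_level : exists2 C : R, 0 < C &
  forall (u eta : V -> R) (gu : V -> V) (S : set V) (k La H : R),
  energy u gu -> admissible_cutoff S u eta -> 1 <= La -> 0 <= H ->
  (\forall x \ae mu, S x -> k < u x -> 1 + `|u x| <= La * (H + pospart (u x - k))) ->
  (Int S (fun x => (eta x ^+ m.+1 * (k < u x)%R%:R * Qlen Q gu x `^ p)%R) <=
   C%:E * Int S (fun x => (eta x * (k < u x)%R%:R * (La `^ p * data x * (H + pospart (u x - k)) `^ p) +
     pospart (u x - k) `^ p * Qlen Q (grad eta) x `^ p)%R))%E.
Proof.
have h2 : 0 < 2^-1 :> R by lra.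
have [C C0 CP] := cacc_gen h2 ler01.
exists (C / 2^-1); first by rewrite divr_gt0.
move=> u eta gu S k La H en adc La1 H0 Yle.
have [uW _] := en; have [[muS meta mX mDe mdat] LXp] := cutoff_meas uW adc.
have [mS SO LPsi [le e01 cs sS LDe]] := adc.
have e0 x : 0 <= eta x by have /andP[] := e01 x.
have La0 : 0 <= La by lra.
pose nu x : R := (k < u x)%R%:R.
pose w x := pospart (u x - k).
pose Z x := La * (H + w x).
have mnu : meas_on S nu by exact: (mind k mS muS).
have mw : meas_on S w.
  apply: (mcomp (G := pospart) (f := fun x => u x - k)); last exact: pospart_continuous.
  by mfun.
have mZ : meas_on S Z by rewrite /Z; mfun.
have nu0 x : 0 <= nu x by exact: ler0n.
have w0 x : 0 <= w x by exact: pospart_ge0.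
have dat0 x : S x -> 0 <= data x by move=> Sx; have [h _ _] := data_ge (SO _ Sx); exact: le_trans h.
pose A x := eta x ^+ m.+1 * nu x * Qlen Q gu x `^ p.
pose B x := eta x * nu x * (La `^ p * data x * (H + w x) `^ p) + w x `^ p * Qlen Q (grad eta) x `^ p.
have mA : meas_on S A by rewrite /A; mfun.
have mB : meas_on S B by rewrite /B; mfun.
have A0 x : S x -> 0 <= A x by move=> _; rewrite !mulr_ge0 ?exprn_ge0 ?powR_ge0.
have B0 x : S x -> 0 <= B x.
  by move=> Sx; have h := dat0 _ Sx; rewrite addr_ge0// !mulr_ge0 ?powR_ge0.
have [_ _ Aoo] : L1 S A.
  apply: (L1_le mS mA A0 _ LXp); apply: aeW => x Sx; rewrite ler_piMl ?powR_ge0//.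
  have /andP[_ e1] := e01 x; rewrite mulr_ile1 ?exprn_ge0 ?exprn_ile1//.
  by rewrite /nu lern1 leq_b1.
have nuw x : nu x * w x = w x.
  rewrite /nu /w; have [ku|ku] := ltP k (u x); first by rewrite mul1r.
  by rewrite mul0r pospart_neg// subr_le0.
pose ep (j : nat) : R := 1 / j.+1%:R.
have ep0 j : 0 < ep j by rewrite divr_gt0.
have bnd j : (Int S (fun x => (eta x ^+ m.+1 * dptrunc (ep j) (u x - k) * Qlen Q gu x `^ p)%R) <=
    Int S (fun x => (2^-1 * A x + C * B x)%R))%E.
  have G1 t : 0 <= ptrunc (ep j) (t - k) <= (ep j)^-1.
    by apply/andP; split; [exact: ptrunc_ge0|exact: ptrunc_bound].
  have := CP u eta gu S _ _ _ nu w Z en adc (adm_ptrunc (ep0 j) k) G1 mnu mw mZ nu0 w0.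
  move=> h; apply: (le_trans (h _)).
    apply: filterS Yle => x Yle Sx; split.
    - by rewrite mul1r; apply: (le_trans (dptrunc_le1 (ep0 j) _)); rewrite subr_gt0.
    - by rewrite nuw; exact: ptrunc_le.
    - rewrite /nu; have [ku _|ku] := ltP k (u x); last by rewrite eqxx.
      split; last exact: Yle.
      by rewrite /Z; apply: (@le_trans _ _ (1 * (H + w x))); [rewrite mul1r lerDr|rewrite ler_wpM2r// addr_ge0].
  rewrite le_eqVlt; apply/orP; left; apply/eqP; congr Int; apply/funext => x.
  rewrite /A /B /Z powRM ?addr_ge0//.
  have -> : nu x * w x `^ p = w x `^ p.
    rewrite /nu /w; have [ku|ku] := ltP k (u x); first by rewrite mul1r.
    by rewrite mul0r pospart_neg ?subr_le0// powR0// gt_eqF.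
  congr (_ + C * (_ + _)); ring.
have mdt j : meas_on S (fun x => dptrunc (ep j) (u x - k)).
  by have [_ c _] := adm_ptrunc (ep0 j) k; exact: (mcomp muS c).
have fat : (Int S A <= Int S (fun x => (2^-1 * A x + C * B x)%R))%E.
  apply: (Int_fatou mS _ mA _ A0 _ bnd).
  - by move=> j; mfun; exact: mdt.
  - move=> j x Sx; apply: mulr_ge0; last exact: powR_ge0.
    by apply: mulr_ge0; [exact: exprn_ge0|exact: dptrunc_ge0].
  - apply: aeW => x Sx; rewrite /A /nu -subr_gt0.
    apply: cvgM; last exact: cvg_cst.
    by apply: cvgM; [exact: cvg_cst|exact: dptrunc_cvg].
have m2A : meas_on S (fun x => 2^-1 * A x) by mfun.
have mCB : meas_on S (fun x => C * B x) by mfun.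
move: fat; rewrite (IntD mS m2A mCB); last first.
- by move=> x Sx; rewrite mulr_ge0 ?(ltW C0)// B0.
- by move=> x Sx; rewrite mulr_ge0 ?A0.
have i1 := IntZ mS mA A0 (ltW h2); have i2 := IntZ mS mB B0 (ltW C0).
have i12 : (Int S (fun x => (2^-1 * A x)%R) + Int S (fun x => (C * B x)%R) =
    2^-1%:E * Int S A + C%:E * Int S B)%E.
  by congr (_ + _)%E; [exact: i1|exact: i2].
rewrite i12 => fat.
apply: ereal_absorb; [exact: (Int_ge0 A0)|exact: Aoo|exact: (Int_ge0 B0)|exact: C0|exact: h2|].
by rewrite mulfV// mul1e.
Qed.

(** With nu = zeta^{-p} and w = zeta one has nu w^p = 1, so the cutoff gradient comes without any
    factor depending on u. The derivative contributes p - 1 on the left, of which half is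
    absorbed. *)
Lemma cacc_log : exists2 C : R, 0 < C &
  forall (u eta : V -> R) (gu : V -> V) (S : set V) (c M L : R),
  energy u gu -> admissible_cutoff S u eta -> 0 < c -> 0 <= L ->
  (\forall x \ae mu, S x -> [/\ u x <= M, zeta c M (u x) <= L & 1 + `|u x| <= L]) ->
  (Int S (fun x => (eta x ^+ m.+1 * zeta c M (u x) `^ (- p) * Qlen Q gu x `^ p)%R) <=
   C%:E * Int S (fun x => (zeta c M (u x) `^ (- p) * (data x * L `^ p) + Qlen Q (grad eta) x `^ p)%R))%E.
Proof.
have p10 : 0 < p - 1 by rewrite subr_gt0.
have h2 : 0 < (p - 1) / 2 by rewrite divr_gt0.
have [C C0 CP] := cacc_gen h2 (ltW p10).
exists (C / ((p - 1) / 2)); first by rewrite divr_gt0.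
move=> u eta gu S c M L en adc c0 L0 Yle.
have [uW _] := en; have [[muS meta mX mDe mdat] LXp] := cutoff_meas uW adc.
have [mS SO LPsi [le e01 cs sS LDe]] := adc.
have e0 x : 0 <= eta x by have /andP[] := e01 x.
have z0 t : 0 < zeta c M t by exact: zeta_gt0.
pose w x := zeta c M (u x).
pose nu x := w x `^ (- p).
have mw : meas_on S w by apply: (mcomp muS); exact: zeta_continuous.
have mnu : meas_on S nu by rewrite /nu; mfun.
have mZ : meas_on S (fun=> L) by mfun.
have nu0 x : 0 <= nu x by exact: powR_ge0.
have wz x : 0 < w x by exact: (z0 (u x)).
have w0 x : 0 <= w x by exact: (ltW (wz x)).
have dat0 x : S x -> 0 <= data x by move=> Sx; have [h _ _] := data_ge (SO _ Sx); exact: le_trans h.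
pose A x := eta x ^+ m.+1 * nu x * Qlen Q gu x `^ p.
pose B x := nu x * (data x * L `^ p) + Qlen Q (grad eta) x `^ p.
have mA : meas_on S A by rewrite /A; mfun.
have mB : meas_on S B by rewrite /B; mfun.
have A0 x : S x -> 0 <= A x by move=> _; rewrite !mulr_ge0 ?exprn_ge0 ?powR_ge0.
have B0 x : S x -> 0 <= B x.
  by move=> Sx; have h := dat0 _ Sx; rewrite addr_ge0 ?powR_ge0// !mulr_ge0 ?powR_ge0.
have nule x : nu x <= c `^ (- p).
  rewrite /nu !powRN lef_pV2 ?posrE ?powR_gt0//.
  by apply: ge0_ler_powR; rewrite ?nnegrE ?w0 ?(ltW c0) ?(ltW p0)//; exact: zeta_ge.
have [_ _ Aoo] : L1 S A.
  apply: (L1_le mS mA A0 _ (L1Z mS (powR_ge0 c (- p)) LXp)); apply: aeW => x Sx.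
  have /andP[_ e1] := e01 x; rewrite /A ler_wpM2r ?powR_ge0// -[leRHS]mul1r.
  by apply: ler_pM; [exact: exprn_ge0|exact: nu0|exact: exprn_ile1|exact: nule].
have G1 t : 0 <= zeta c M t `^ (1 - p) <= c `^ (1 - p) by exact: zeta_pow_bound.
have nuw x : nu x * w x `^ p = 1.
  by rewrite /nu powRN mulVf// gt_eqF// powR_gt0.
have pt : \forall x \ae mu, S x -> [/\
    (p - 1) * zeta c M (u x) `^ (- p) * - dzeta c M (u x) <= (p - 1) * nu x,
    zeta c M (u x) `^ (1 - p) <= nu x * w x & nu x != 0 -> w x <= L /\ 1 + `|u x| <= L].
  apply: filterS Yle => x h Sx; have [h1 h3 h4] := h Sx; split => //.
    have /andP[_ d1] := @dzeta_bound _ c M c0 (u x).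
    by rewrite -[leRHS]mulr1 ler_wpM2l// mulr_ge0 ?powR_ge0// ltW.
  rewrite /nu /w -[X in _ <= _ * X]powRr1; last exact: ltW.
  by rewrite -powRD ?lexx 1?addrC// (gt_eqF (z0 _)) implybT.
have h := CP u eta gu S _ _ _ nu w _ en adc (adm_zeta_pow M c0 p1) G1 mnu mw mZ nu0 w0 pt.
have mzd : meas_on S (fun x => dzeta c M (u x)) by apply: (mcomp muS); exact: dzeta_continuous.
have mz : meas_on S (fun x => zeta c M (u x)) by exact: mw.
have mL : meas_on S (fun x => eta x ^+ m.+1 * ((p - 1) * zeta c M (u x) `^ (- p) * - dzeta c M (u x)) * Qlen Q gu x `^ p).
  by mfun.
have mA1 : meas_on S (fun x => (p - 1) * A x) by mfun.
have eL : Int S (fun x => eta x ^+ m.+1 * ((p - 1) * zeta c M (u x) `^ (- p) * - dzeta c M (u x)) * Qlen Q gu x `^ p)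
    = Int S (fun x => (p - 1) * A x).
  apply: (Int_eq_ae mS mL mA1); apply: filterS Yle => x hx Sx; have [h1 _ _] := hx Sx.
  by rewrite (dzetaE c h1) opprK /A /nu /w; ring.
move: h; rewrite eL.
have -> : (fun x => (p - 1) / 2 * (eta x ^+ m.+1 * nu x * Qlen Q gu x `^ p) +
     C * (eta x * nu x * (data x * L `^ p) + nu x * w x `^ p * Qlen Q (grad eta) x `^ p)) =
  (fun x => (p - 1) / 2 * A x + C * (eta x * nu x * (data x * L `^ p) + Qlen Q (grad eta) x `^ p)).
  by apply/funext => x; rewrite nuw mul1r.
pose B' x := eta x * nu x * (data x * L `^ p) + Qlen Q (grad eta) x `^ p.
have mB' : meas_on S B' by rewrite /B'; mfun.
have B'0 x : S x -> 0 <= B' x.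
  by move=> Sx; have h := dat0 _ Sx; rewrite addr_ge0 ?powR_ge0// !mulr_ge0 ?powR_ge0.
have B'B : (Int S B' <= Int S B)%E.
  apply: (Int_le mS mB' mB B'0); apply: aeW => x Sx; have h := dat0 _ Sx; have /andP[_ e1] := e01 x.
  by rewrite lerD2r -mulrA ler_piMl// !mulr_ge0 ?powR_ge0.
have m2A : meas_on S (fun x => (p - 1) / 2 * A x) by mfun.
have mCB : meas_on S (fun x => C * B' x) by mfun.
rewrite (IntD mS m2A mCB); last first.
- by move=> x Sx; rewrite mulr_ge0 ?(ltW C0)// B'0.
- by move=> x Sx; rewrite mulr_ge0 ?A0// ltW.
have i1 := IntZ mS mA A0 (ltW h2); have i2 := IntZ mS mB' B'0 (ltW C0); have i3 := IntZ mS mA A0 (ltW p10).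
have i12 : (Int S (fun x => ((p - 1) / 2 * A x)%R) + Int S (fun x => (C * B' x)%R) =
    ((p - 1) / 2)%:E * Int S A + C%:E * Int S B')%E.
  by congr (_ + _)%E; [exact: i1|exact: i2].
rewrite i12 i3 => fat.
apply: (@le_trans _ _ ((C / ((p - 1) / 2))%:E * Int S B')%E); last first.
  by apply: lee_wpmul2l => //; rewrite lee_fin divr_ge0 ?(ltW C0)// ltW.
apply: ereal_absorb; [exact: (Int_ge0 A0)|exact: Aoo|exact: (Int_ge0 B'0)|exact: C0|exact: h2|].
by rewrite (_ : 2 * ((p - 1) / 2) = p - 1); [exact: fat|rewrite mulrC divfK].
Qed.

End caccioppoli.

(** * Norms and averages with possibly infinite exponents *)

Section norms.
Context {R : realType} {n : nat}.
Local Notation V := 'rV[R]_n.+1.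
Local Notation T := (lebT R n).
Local Notation mu := (@leb R n).
Implicit Types (E K : set V) (f : V -> R).

Lemma Lnorm_onE E f (r : R) : 0 < r ->
  Lnorm_on E r%:E f = ((Int E (fun x => (`|f x| `^ r)%R)) `^ r^-1)%E.
Proof.
move=> r0; rewrite /Lnorm_on unlock; congr (_ `^ _)%E; rewrite IntE [RHS]integral_mkcond.
apply: eq_integral => x _; rewrite /patch; case: ifPn => _ /=.
  by [].
by rewrite normr0 powR0 ?gt_eqF.
Qed.

Lemma Lnorm_on_fin E f (r : R) : 0 < r -> (Lnorm_on E r%:E f < +oo)%E ->
  (Int E (fun x => (`|f x| `^ r)%R) < +oo)%E.
Proof. by move=> r0; rewrite Lnorm_onE//; apply: lty_poweRy; rewrite invr_eq0 gt_eqF. Qed.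

Lemma Lnorm_on_y E f (c : R) : (0 < mu setT)%E -> (Lnorm_on E +oo f <= c%:E)%E ->
  \forall x \ae mu, E x -> `|f x| <= c.
Proof.
move=> m0; rewrite /Lnorm_on unlock m0 => /ess_supP; apply: filterS => x h Ex.
by move: h; rewrite /= /patch mem_set//= lee_fin.
Qed.

Lemma Lnorm_on_y_fin E f : (0 < mu setT)%E -> (Lnorm_on E +oo f < +oo)%E ->
  exists2 c : R, 0 < c & \forall x \ae mu, E x -> `|f x| <= c.
Proof.
move=> m0 h.
have [c c0 hc] : exists2 c : R, 0 < c & (Lnorm_on E +oo f <= c%:E)%E.
  have : (0 <= Lnorm_on E +oo f)%E by exact: Lnorm_ge0.
  move: h; case: (Lnorm_on _ _ _) => [c| |]// _ c0.
  by exists (c + 1); [rewrite ltr_wpDl|rewrite lee_fin lerDl].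
by exists c => //; exact: Lnorm_on_y hc.
Qed.

Lemma powR_le_add1 (x s r : R) : 0 <= x -> 0 < s -> s <= r -> x `^ s <= 1 + x `^ r.
Proof.
move=> x0 s0 sr; have [x1|x1] := leP x 1.
  apply: (@le_trans _ _ 1); last by rewrite lerDl powR_ge0.
  have e1 : 1 `^ s = 1 :> R by rewrite powR1.
  by rewrite -[leRHS]e1; apply: ge0_ler_powR; rewrite ?nnegrE ?(ltW s0).
by apply: ler_wpDl => //; apply: ler_powR => //; exact: ltW.
Qed.

Lemma L_loc_pow (Omega K : set V) (ex : \bar R) f (s : R) : (0 < mu setT)%E ->
  open Omega -> nonneg_meas Omega f -> L_loc Omega ex f -> 0 < s -> (s%:E <= ex)%E ->
  compact K -> K `<=` Omega -> L1 K (fun x => f x `^ s).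
Proof.
move=> m0 oO [mf f0] [_ Lf] s0 sex cK KO.
have mO : measurable (Omega : set T) by exact: open_measurable_Rn.
have mK : measurable (K : set T) by exact: compact_measurable_Rn.
have Koo : (mu (K : set T) < +oo)%E by apply: bounded_leb_lty; exact: compact_bounded.
have mfK : meas_on K f by exact: (meas_onS mO KO mf).
have mfs : meas_on K (fun x => f x `^ s) by mfun.
have fs0 x : K x -> 0 <= f x `^ s by move=> _; exact: powR_ge0.
have Lc c : 0 <= c -> L1 K (fun=> c) by move=> c0; exact: L1_cst.
have := Lf K cK KO; case: ex sex {Lf} => [r| |]//.
- rewrite lee_fin => sr h; have r0 : 0 < r by exact: lt_le_trans sr.
  have Lr : L1 K (fun x => f x `^ r).
    split; [by mfun|by move=> x _; exact: powR_ge0|].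
    have := Lnorm_on_fin r0 h; apply: le_lt_trans; apply: Int_le; [exact: mK|by mfun|by mfun|by move=> x _; exact: powR_ge0|].
    by apply: aeW => x Kx; rewrite ger0_norm// f0//; exact: KO.
  apply: (L1_le mK mfs fs0 _ (L1D mK (Lc 1 ler01) Lr)).
  by apply: aeW => x Kx; apply: powR_le_add1 => //; exact/f0/KO.
- move=> _ /(Lnorm_on_y_fin m0)[c c0 hc].
  apply: (L1_le mK mfs fs0 _ (Lc (c `^ s) (powR_ge0 _ _))).
  apply: filterS hc => x h Kx; have := h Kx; have fx := f0 x (KO _ Kx); rewrite ger0_norm// => fc.
  by apply: ge0_ler_powR; rewrite ?nnegrE ?(ltW s0)// ltW.
Qed.

Lemma Lavg_Av E f (r : R) : Lavg E r%:E f = ((Av E (fun x => (`|f x| `^ r)%R)) `^ r^-1)%E.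
Proof. by rewrite AvE IntE. Qed.

Lemma poweR_le_inv (x : \bar R) (c r : R) : 0 < r -> 0 <= c -> (0 <= x)%E ->
  (x `^ r^-1 <= c%:E)%E = (x <= (c `^ r)%:E)%E.
Proof.
move=> r0 c0 x0; have rn : r != 0 by rewrite gt_eqF.
case: x x0 => [x| |]//; last by rewrite poweRyr ?invr_eq0// !leye_eq.
rewrite lee_fin => x0; rewrite poweR_EFin !lee_fin; apply/idP/idP => h.
  rewrite -(powRK x0 rn); apply: ge0_ler_powR; rewrite ?nnegrE ?powR_ge0//; exact: ltW.
have -> : c = (c `^ r) `^ r^-1 by rewrite -powRrM mulfV// powRr1.
by apply: ge0_ler_powR; rewrite ?nnegrE ?powR_ge0 ?invr_ge0//; exact: ltW.
Qed.

(** Brings an exponent that may be infinite down to a real one: by Jensen's inequality if finite, by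
    the almost everywhere bound otherwise. *)
Lemma Lavg_bound E f (ex : \bar R) (c s : R) : measurable (E : set T) ->
  (0 < mu (E : set T))%E -> (mu (E : set T) < +oo)%E -> (0 < mu setT)%E -> meas_on E f -> 0 < c -> 0 < s ->
  (s%:E <= ex)%E -> (Lavg E ex f <= c%:E)%E -> (Av E (fun x => (`|f x| `^ s)%R) <= (c `^ s)%:E)%E.
Proof.
move=> mE E0 Eoo m0 mf c0 s0; case: ex => [r| |]//.
- rewrite lee_fin => sr; have r0 : 0 < r by exact: lt_le_trans sr.
  rewrite Lavg_Av poweR_le_inv//; last 2 first.
  + exact: ltW.
  + by apply: (Av_ge0 E0 Eoo) => x _; exact: powR_ge0.
  have mfa : meas_on E (fun x => `|f x|) by mfun.
  exact: (Av_jensen mE E0 Eoo mfa (fun x _ => normr_ge0 _) s0 sr c0).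
- move=> _ /(Lnorm_on_y m0) h.
  rewrite -(Av_cst mE E0 Eoo (c `^ s)); apply: (Av_le mE E0 Eoo); [by mfun|by mfun|by move=> x _; exact: powR_ge0|].
  apply: filterS h => x h Ex; apply: ge0_ler_powR; rewrite ?nnegrE ?(ltW s0) ?(ltW c0)//.
  exact: h.
Qed.

End norms.

(** * Estimates on quasimetric balls *)

Section balls.
Context {R : realType} {n : nat}.
Local Notation V := 'rV[R]_n.+1.
Local Notation T := (lebT R n).
Local Notation mu := (@leb R n).

Variables (Omega : set V) (rho : V -> V -> R) (Q : V -> 'M[R]_n.+1) (p kappa : R) (R2 : V -> R).
Hypotheses (oOm : open Omega) (bOm : bounded_set Omega) (p1 : 1 < p).
Hypotheses (mQ : forall i j, meas_on Omega (fun x => Q x i j))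
  (symQ : forall x, Omega x -> sym_nonneg (Q x)).
Hypotheses (qm : quasimetric Omega rho kappa) (bo : qballs_open Omega rho).
Hypothesis mu_open : forall U : set V, open U -> U !=set0 -> (0 < mu (U : set T))%E.
Local Notation B y r := (qball Omega rho y r).

Let mOm : measurable (Omega : set T). Proof. exact: open_measurable_Rn. Qed.
Let p0 : 0 < p. Proof. exact: lt_trans p1. Qed.
Let pn0 : p != 0. Proof. by rewrite gt_eqF. Qed.
Let musT : (0 < mu setT)%E.
Proof. by apply: mu_open; [exact: openT|exists 0]. Qed.

Lemma cvg_powR (z : nat -> R) (l s : R) : 0 < s -> (forall k, 0 <= z k) -> z k @[k --> \oo] --> l ->
  z k `^ s @[k --> \oo] --> l `^ s.
Proof.
move=> s0 z0 zl; have l0 : 0 <= l by apply: (ler_cvg_to (cvg_cst 0) zl); exact: nearW.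
move: l0; rewrite le_eqVlt => /predU1P[l0|l0].
  by rewrite -l0 powR0 ?gt_eqF//; apply: powR_cvg0 => //; rewrite l0.
have cl : {for l, continuous (fun t : R => t `^ s)}.
  apply/differentiable_continuous/derivable1_diffP.
  by case: (is_derive1_powR s l0).
by apply: (@continuous_cvg _ _ _ \oo _ z (fun t : R => t `^ s) l cl zl).
Qed.

Lemma powR_invr (x s : R) : 0 <= x -> x^-1 `^ s = (x `^ s)^-1.
Proof. by move=> x0; rewrite -powR_inv1// -powRrM mulN1r powRN. Qed.

Lemma bounded_subset (X Y : set V) : X `<=` Y -> bounded_set Y -> bounded_set X.
Proof. by move=> XY [M [Mr h]]; exists M; split => // N MN x /XY; exact: h. Qed.

Lemma qball_center y r : Omega y -> 0 < r -> B y r y.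
Proof. by move=> Oy r0; split => //; have [_ _ [_ ->]] := qm.2 y y Oy Oy. Qed.

Lemma qball_facts y r : Omega y -> 0 < r -> closure (B y r) `<=` Omega ->
  [/\ open (B y r), B y r `<=` Omega, measurable (B y r : set T),
      (0 < mu (B y r : set T))%E /\ (mu (B y r : set T) < +oo)%E & compact (closure (B y r))].
Proof.
move=> Oy r0 cB; have oB : open (B y r) by exact: (@bo y r Oy).
have BO : B y r `<=` Omega by move=> x [].
split.
- exact: oB.
- exact: BO.
- exact: open_measurable_Rn.
- split; first by apply: mu_open => //; exists y; exact: qball_center.
  by apply: bounded_leb_lty; exact: (bounded_subset _ bOm).
- apply: bounded_closed_compact; last exact: closed_closure.
  exact: (bounded_subset _ bOm).
Qed.

Lemma Int_Av (E : set V) (f : V -> R) (c : R) : (0 < mu (E : set T))%E -> (mu (E : set T) < +oo)%E ->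
  (Int E f <= (fine (mu (E : set T)) * c)%:E)%E -> (Av E f <= c%:E)%E.
Proof.
move=> E0 Eoo h; have m0 : 0 < fine (mu (E : set T)) by rewrite fine_gt0// E0 Eoo.
have i0 : (0 <= ((fine (mu (E : set T)))^-1)%:E)%E by rewrite lee_fin invr_ge0 ltW.
have := lee_wpmul2l i0 h; rewrite -AvE => h1; apply: (le_trans h1).
by rewrite -EFinM mulKf// gt_eqF.
Qed.

Variables (C1 sg : R).
Hypotheses (C10 : 0 < C1) (sg1 : 1 < sg) (sob : sobolev Omega rho Q p R2 C1 sg).

Section one_ball.
Variables (y : V) (r : R).
Hypotheses (Oy : Omega y) (r0 : 0 < r) (rR2 : r < R2 y) (cB : closure (B y r) `<=` Omega).
Local Notation By := (B y r).

Let fB := qball_facts Oy r0 cB.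
Let oB : open By. Proof. by have [] := fB. Qed.
Let BO : By `<=` Omega. Proof. by have [] := fB. Qed.
Let mB : measurable (By : set T). Proof. by have [] := fB. Qed.
Let B0 : (0 < mu (By : set T))%E. Proof. by have [_ _ _ []] := fB. Qed.
Let Boo : (mu (By : set T) < +oo)%E. Proof. by have [_ _ _ []] := fB. Qed.

Lemma sobolev_pow (w : V -> R) (gw : V -> V) (s : R) : WQ_0 Q p By w gw -> 0 < s ->
  (Av By (fun x => (`|w x| `^ p)%R) <= s%:E)%E ->
  (Av By (fun x => (r `^ p * Qlen Q gw x `^ p)%R) <= s%:E)%E ->
  (Av By (fun x => (`|w x| `^ (p * sg))%R) <= (((2 * C1) `^ p * s) `^ sg)%:E)%E.
Proof.
move=> wW s0 h1 h2; have [mw mgw _] := wW.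
have mX : meas_on By (Qlen Q gw) by exact: (Qlen_meas mOm mQ symQ mB BO mgw).
have sp0 : 0 <= s `^ p^-1 by exact: powR_ge0.
have psg0 : 0 < p * sg by rewrite mulr_gt0// (lt_trans _ sg1).
have k1 : (Lavg By p%:E w <= (s `^ p^-1)%:E)%E.
  rewrite Lavg_Av poweR_le_inv ?powRK ?(ltW s0)//.
  by apply: (Av_ge0 B0 Boo) => x _; exact: powR_ge0.
have k2 : (r%:E * Lavg By p%:E (Qlen Q gw) <= (s `^ p^-1)%:E)%E.
  have rp0 : 0 < r `^ p by exact: powR_gt0.
  have A0 : (0 <= Av By (fun x => (`|Qlen Q gw x| `^ p)%R))%E.
    by apply: (Av_ge0 B0 Boo) => x _; exact: powR_ge0.
  have e1 : (fun x => `|Qlen Q gw x| `^ p) = (fun x => Qlen Q gw x `^ p).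
    by apply/funext => x; rewrite ger0_norm// Qlen_ge0.
  have k3 : (Lavg By p%:E (Qlen Q gw) <= (r^-1 * s `^ p^-1)%:E)%E.
    rewrite Lavg_Av poweR_le_inv ?mulr_ge0 ?invr_ge0 ?(ltW r0)//.
    rewrite powRM ?invr_ge0 ?(ltW r0)// powRK ?(ltW s0)//.
    move: h2; rewrite (AvZ mB) ?powR_ge0//; [|by mfun|by move=> x _; exact: powR_ge0].
    rewrite -e1 => h2; have ri0 : (0 <= ((r `^ p)^-1)%:E)%E by rewrite lee_fin invr_ge0 ltW.
    have := lee_wpmul2l ri0 h2; rewrite muleA -!EFinM mulVf ?gt_eqF// mul1e.
    by rewrite (powR_invr _ (ltW r0)).
  have := lee_wpmul2l (ltW r0 : (0 <= r%:E)%E) k3.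
  by rewrite -EFinM mulrA mulfV ?gt_eqF// mul1r.
have k4 := @sob y r Oy r0 rR2 w gw wW.
have k5 : (Lavg By (p * sg)%:E w <= (2 * C1 * s `^ p^-1)%:E)%E.
  apply: (le_trans k4).
  have C1e : (0 <= C1%:E)%E by rewrite lee_fin ltW.
  have := lee_wpmul2l C1e (leeD k2 k1).
  by rewrite -EFinD -EFinM (_ : C1 * _ = 2 * C1 * s `^ p^-1); last by ring.
move: k5; rewrite Lavg_Av poweR_le_inv//; last 2 first.
- by rewrite mulr_ge0// mulr_ge0// ltW.
- by apply: (Av_ge0 B0 Boo) => x _; exact: powR_ge0.
by rewrite powRrM powRM ?mulr_ge0 ?(ltW C10)// powRK ?(ltW s0).
Qed.

(** The Sobolev inequality is applied to eta times [ptrunc] of u - k, which is known to lie in the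
    space with zero boundary values; its right-hand side is dominated uniformly and Fatou gives the
    inequality for (u - k)_+ itself. *)
Lemma sobolev_level (u eta : V -> R) (gu : V -> V) (k s : R) : WQ Q p Omega u gu ->
  lipschitz eta -> (forall x, 0 <= eta x <= 1) -> tsupp eta `<=` By ->
  L1 By (fun x => Qlen Q (grad eta) x `^ p) -> 0 < s ->
  (Av By (fun x => ((eta x * pospart (u x - k)) `^ p)%R) <= s%:E)%E ->
  (Av By (fun x => (r `^ p * (2 `^ p * (eta x * (k < u x)%R%:R * Qlen Q gu x `^ p +
     pospart (u x - k) `^ p * Qlen Q (grad eta) x `^ p)))%R) <= s%:E)%E ->
  (Av By (fun x => ((eta x * pospart (u x - k)) `^ (p * sg))%R) <= (((2 * C1) `^ p * s) `^ sg)%:E)%E.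
Proof.
move=> uW le e01 sB LDe s0 h1 h2; have [mu_ mgu _] := uW.
have e0 x : 0 <= eta x by have /andP[] := e01 x.
have cs : compact (tsupp eta).
  apply: bounded_closed_compact; last exact: closed_closure.
  by apply: (bounded_subset _ bOm); exact: (subset_trans sB BO).
have eL : Lip_loc Omega eta by exact: lipschitz_Lip_loc.
have muB := meas_onS mOm BO mu_.
have meB : meas_on By eta by apply: (meas_onS mOm BO); exact: (Lip_loc_meas oOm eL).
have mXB : meas_on By (Qlen Q gu).
  by apply: (Qlen_meas mOm mQ symQ mB BO) => i; apply: (meas_onS mOm BO); exact: mgu.
have mDB : meas_on By (Qlen Q (grad eta)).
  by apply: (Qlen_meas mOm mQ symQ mB BO) => i; apply: (meas_onS mOm BO); exact: (grad_meas oOm i eL).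
pose w x := pospart (u x - k).
have mw : meas_on By w.
  apply: (mcomp (G := pospart) (f := fun x => u x - k)); last exact: pospart_continuous.
  by mfun.
have w0 x : 0 <= w x by exact: pospart_ge0.
have mnu : meas_on By (fun x => (k < u x)%R%:R) by exact: (mind k mB muB).
pose ep (j : nat) : R := 1 / j.+1%:R.
have ep0 j : 0 < ep j by rewrite divr_gt0.
pose G j t := ptrunc (ep j) (t - k).
have mG j : meas_on By (fun x => G j (u x)).
  exact: (mcomp muB (adm_cont (adm_ptrunc (ep0 j) k))).
have Gw j x : 0 <= G j (u x) <= w x by rewrite ptrunc_ge0//= ptrunc_le.
have psg0 : 0 < p * sg by rewrite mulr_gt0// (lt_trans _ sg1).
have bnd j : (Av By (fun x => ((eta x * G j (u x)) `^ (p * sg))%R) <= (((2 * C1) `^ p * s) `^ sg)%:E)%E.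
  have G1 t : 0 <= ptrunc (ep j) (t - k) <= (ep j)^-1.
    by apply/andP; split; [exact: ptrunc_ge0|exact: ptrunc_bound].
  have W := WQ_0_cutoff oOm p1 mQ symQ bOm oB BO uW (adm_ptrunc (ep0 j) k) G1 le e01 cs sB LDe.
  have nE : (fun x => `|eta x * ptrunc (ep j) (u x - k)| `^ (p * sg)) = (fun x => (eta x * G j (u x)) `^ (p * sg)).
    by apply/funext => x; rewrite ger0_norm// mulr_ge0 ?e0// ptrunc_ge0.
  rewrite -nE; apply: (sobolev_pow W s0).
    apply: le_trans h1; apply: (Av_le mB B0 Boo).
    - by mfun; exact: mG.
    - by mfun.
    - by move=> x _; exact: powR_ge0.
    - apply: aeW => x Bx; have /andP[g0 g1] := Gw j x.
      have gg : 0 <= eta x * ptrunc (ep j) (u x - k) by apply: mulr_ge0; [exact: e0|exact: g0].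
      rewrite ger0_norm//; apply: ge0_ler_powR; [exact: ltW|exact: gg|by apply: mulr_ge0; [exact: e0|exact: w0]|].
      by rewrite ler_wpM2l.
  have [_ mgW _] := W.
  apply: le_trans h2; apply: (Av_le mB B0 Boo).
  - have mXW := Qlen_meas mOm mQ symQ mB BO mgW.
    by mfun.
  - by mfun.
  - by move=> x _; apply: mulr_ge0; exact: powR_ge0.
  - apply: aeW => x Bx; rewrite ler_wpM2l ?powR_ge0//.
    have X0 := Qlen_ge0 Q gu x; have D0 := Qlen_ge0 Q (grad eta) x.
    have /andP[_ e1] := e01 x; have ex0 := e0 x.
    have /andP[g0 g1] := Gw j x.
    have dg0 : 0 <= dptrunc (ep j) (u x - k) by exact: dptrunc_ge0.
    have dg1 := dptrunc_le1 (ep0 j) (u x - k); rewrite subr_gt0 in dg1.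
    have nup : ((k < u x)%R%:R : R) `^ p = (k < u x)%R%:R.
      by case: (k < u x); rewrite ?powR1 ?powR0.
    apply: (@le_trans _ _ ((eta x * (k < u x)%R%:R * Qlen Q gu x + w x * Qlen Q (grad eta) x) `^ p)).
      apply: ge0_ler_powR; [exact: ltW|exact: Qlen_ge0| |].
        by rewrite nnegrE addr_ge0// !mulr_ge0.
      rewrite /Qlen; apply: (@le_trans _ _ (enorm (((eta x * dptrunc (ep j) (u x - k)) *: gu x) *m sqrtmx (Q x)) +
          enorm ((ptrunc (ep j) (u x - k) *: grad eta x) *m sqrtmx (Q x)))).
        by rewrite mulmxDl; exact: enormD.
      rewrite -!scalemxAl !enormZ -!/(Qlen _ _ _); apply: lerD.
        rewrite ger0_norm; last by apply: mulr_ge0.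
        by rewrite ler_wpM2r// ler_wpM2l.
      rewrite ger0_norm//; exact: (ler_wpM2r D0 g1).
    apply: (le_trans (powRD_le (ltW p0) _ _)); [by rewrite !mulr_ge0|by rewrite mulr_ge0|].
    rewrite ler_wpM2l ?powR_ge0//; apply: lerD; last by rewrite powRM.
    rewrite powRM ?mulr_ge0// powRM// nup ler_wpM2r ?powR_ge0// ler_wpM2r//.
    rewrite -[leRHS]powRr1//; apply: powR_ile; [exact: e01|exact: ltr01|exact: ltW].
apply: (Int_Av B0 Boo); apply: (Int_fatou (f_ := fun j x => (eta x * G j (u x)) `^ (p * sg)) mB).
- by move=> j; mfun; exact: mG.
- by mfun.
- by move=> j x _; exact: powR_ge0.
- by move=> x _; exact: powR_ge0.
- apply: aeW => x Bx.
  have c1 : eta x * G j (u x) @[j --> \oo] --> eta x * w x.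
    by apply: cvgM; [exact: cvg_cst|exact: ptrunc_cvg].
  by apply: cvg_powR c1 => // j; have /andP[g0 _] := Gw j x; exact: mulr_ge0.
- by move=> j; apply: (Av_Int B0 Boo); exact: bnd.
Qed.

End one_ball.

Variables (dat : V -> R) (en : (V -> R) -> (V -> V) -> Prop) (m : nat).
Hypotheses (mdat : meas_on Omega dat) (dat1 : forall x, Omega x -> 1 <= dat x)
  (en_WQ : forall u gu, en u gu -> WQ Q p Omega u gu).

(** [admissible_cutoff] for an abstract [dat]: in this section the equation is known only through
    [en] and the Caccioppoli inequalities assumed for it. *)
Definition cutoff_on (S : set V) (u eta : V -> R) :=
  [/\ measurable (S : set T), S `<=` Omega, L1 S (fun x => dat x * (1 + `|u x|) `^ p) &
   [/\ lipschitz eta, (forall x, 0 <= eta x <= 1), compact (tsupp eta), tsupp eta `<=` S &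
   L1 S (fun x => Qlen Q (grad eta) x `^ p)]].

Variable Cl : R.
Hypothesis Cl0 : 0 < Cl.
Hypothesis clevel : forall (u eta : V -> R) (gu : V -> V) (S : set V) (k La H : R),
  en u gu -> cutoff_on S u eta -> 1 <= La -> 0 <= H ->
  (\forall x \ae mu, S x -> k < u x -> 1 + `|u x| <= La * (H + pospart (u x - k))) ->
  (Int S (fun x => (eta x ^+ m.+1 * (k < u x)%R%:R * Qlen Q gu x `^ p)%R) <=
   Cl%:E * Int S (fun x => (eta x * (k < u x)%R%:R * (La `^ p * dat x * (H + pospart (u x - k)) `^ p) +
     pospart (u x - k) `^ p * Qlen Q (grad eta) x `^ p)%R))%E.

Variables (tau K N q th : R).
Hypotheses (tau01 : 0 < tau < 1) (K0 : 0 < K) (N1 : 1 <= N) (q0 : 0 < q) (th1 : 1 < th) (ths : th < sg)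
  (qth : q^-1 + th^-1 = 1).

(** The cutoff assumption in scaled form, with the real exponent p q in place of [sstar]. *)
Definition good_cutoff (y : V) (r : R) (eta : nat -> V -> R) :=
  [/\ (forall j, [/\ lipschitz (eta j), forall x, 0 <= eta j x <= 1, tsupp (eta j) `<=` B y r &
        L1 (B y r) (fun x => Qlen Q (grad (eta j)) x `^ p)]),
      (forall j, (1 <= j)%N -> tsupp (eta j.+1) `<=` [set x | B y r x /\ eta j x = 1]),
      (forall j x, (1 <= j)%N -> B y (tau * r) x -> eta j x = 1) &
      (forall j, (1 <= j)%N ->
        (Av (B y r) (fun x => ((r * Qlen Q (grad (eta j)) x) `^ (p * q))%R) <= ((K * N ^+ j) `^ (p * q))%:E)%E)].

(** Here, rather than on the full ball, u is known to be in L^{p sg}; and all cutoffs from eta_2 on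
    are supported here. *)
Definition core (y : V) (r : R) (eta : nat -> V -> R) : set V := [set x | B y r x /\ eta 1%N x = 1].

Definition good_ball (y : V) (r : R) := [/\ Omega y, 0 < r, r < R2 y & closure (B y r) `<=` Omega].

Lemma Int_eq0_out (E F : set V) (f : V -> R) : F `<=` E -> (forall x, E x -> ~ F x -> f x = 0) ->
  Int E f = Int F f.
Proof.
move=> FE f0; rewrite !IntE [LHS]integral_mkcond [RHS]integral_mkcond.
apply: eq_integral => x _; rewrite /patch.
have [xF|xF] := boolP (x \in F); first by rewrite mem_set//; exact/FE/set_mem.
case: ifPn => // xE; rewrite f0//; first exact: set_mem.
by move=> h; move: xF; rewrite mem_set.
Qed.

Lemma core_meas y r eta : good_ball y r -> good_cutoff y r eta -> measurable (core y r eta : set T).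
Proof.
move=> [Oy r0 rR cB] [h _ _ _]; have [oB BO mB _ _] := qball_facts Oy r0 cB.
have [le _ _ _] := h 1%N.
have -> : core y r eta = B y r `&` (eta 1%N @^-1` [set 1]) by [].
apply: measurableI => //; apply: closed_measurable_Rn.
apply: closed_comp; first by move=> x _; exact: lipschitz_continuous.
exact: closed_eq.
Qed.

Lemma qball_sub y r s : r <= s -> B y r `<=` B y s.
Proof. by move=> rs x [Ox h]; split => //; exact: lt_le_trans rs. Qed.

Lemma cutoff_on_core y r eta u j : good_ball y r -> good_cutoff y r eta -> (2 <= j)%N ->
  L1 (core y r eta) (fun x => dat x * (1 + `|u x|) `^ p) -> cutoff_on (core y r eta) u (eta j).
Proof.
move=> gB gc j2 Lu; have mS := core_meas gB gc; have [Oy r0 rR cB] := gB.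
have [oB BO mB _ _] := qball_facts Oy r0 cB.
have SB : core y r eta `<=` B y r by move=> x [].
case: gc => h h2 _ _; have [le e01 sB LDe] := h j.
split; [exact: mS|exact: (subset_trans SB BO)|exact: Lu|split].
- exact: le.
- exact: e01.
- apply: bounded_closed_compact; last exact: closed_closure.
  by apply: (bounded_subset _ bOm); exact: (subset_trans sB BO).
- case: j j2 {le e01 sB LDe} => [//|[//|j]] _ x xs.
  have [Bx e1] := h2 j.+1 isT x xs; split => //.
  elim: j e1 {xs} => [//|j IH] e1; apply: IH.
  by have [] := h2 j.+1 isT x _ => //; apply: subset_closure; rewrite /= e1 oner_eq0.
- exact: (L1S mS mB SB LDe).
Qed.

(** The iteration with Caccioppoli and Sobolev plugged in. It is applied with k0 = 0 and a large H
    to bound u, and with k0 close to the supremum and a small H to lower the supremum. *)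
Lemma sup_bound (P : R) : 0 < P -> exists2 ze : R, 0 < ze &
  forall y r eta u gu (k0 H La : R), good_ball y r -> good_cutoff y r eta -> en u gu ->
  L1 (core y r eta) (fun x => dat x * (1 + `|u x|) `^ p) -> 1 <= La -> 0 < H ->
  (forall k, k0 <= k -> k <= k0 + H -> \forall x \ae mu, core y r eta x -> k < u x -> 1 + `|u x| <= La * (H + pospart (u x - k))) ->
  (Av (B y r) (fun x => ((r `^ p * (La `^ p * dat x)) `^ q)%R) <= (P `^ q)%:E)%E ->
  (Av (B y r) (fun x => ((eta 2%N x * pospart (u x - k0)) `^ (p * th))%R) <= (ze * H `^ (p * th))%:E)%E ->
  \forall x \ae mu, B y (tau * r) x -> u x <= k0 + H.
Proof.
(* (2 C1)^p comes from Sobolev, 2^p from splitting the gradient of eta (u - k)_+, and Cl + 1 from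
   Caccioppoli plus the cutoff gradient. *)
move=> P0; pose C := (2 * C1) `^ p * (2 `^ p * (Cl + 1)).
have C0 : 0 < C by rewrite !mulr_gt0 ?powR_gt0 ?mulr_gt0// addr_gt0.
have [ze ze0 dg] := @degiorgi R n p th sg q N K P C p1 th1 ths q0 qth N1 K0 P0 C0.
exists ze => //.
move=> y r eta u gu k0 H La gB gc ue Lu La1 H0 uLa hP hH.
have mS := core_meas gB gc; have [Oy r0 rR cB] := gB.
have [oB BO mB [B0 Boo] cpB] := qball_facts Oy r0 cB.
have SB : core y r eta `<=` B y r by move=> x [].
have uW := en_WQ ue; have [mu_ mgu _] := uW.
have gc' := gc; case: gc' => h h2 h3 h4.
have /andP[t0 t1] := tau01.
have BtB : B y (tau * r) `<=` B y r by apply: qball_sub; rewrite ger_pMl// ltW.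
have muB := meas_onS mOm BO mu_.
have mdB := meas_onS mOm BO mdat.
have eL j : Lip_loc Omega (eta j) by apply: lipschitz_Lip_loc; case: (h j).
have meB j : meas_on (B y r) (eta j) by apply: (meas_onS mOm BO); exact: (Lip_loc_meas oOm (eL j)).
have mXB : meas_on (B y r) (Qlen Q gu).
  by apply: (Qlen_meas mOm mQ symQ mB BO) => i; apply: (meas_onS mOm BO); exact: mgu.
have mDB j : meas_on (B y r) (Qlen Q (grad (eta j))).
  by apply: (Qlen_meas mOm mQ symQ mB BO) => i; apply: (meas_onS mOm BO); exact: (grad_meas oOm i (eL j)).
have mDr j : meas_on (B y r) (fun x => r * Qlen Q (grad (eta j)) x) by have := mDB j => ?; mfun.
have mPsi : meas_on (B y r) (fun x => r `^ p * (La `^ p * dat x)) by mfun.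
have e01 j x : 0 <= eta j x <= 1 by have [_ e _ _] := h j.
have e0 j x : 0 <= eta j x by have /andP[] := e01 j x.
have D0 j x : 0 <= r * Qlen Q (grad (eta j)) x by rewrite mulr_ge0 ?Qlen_ge0// ltW.
have rp0 : 0 <= r `^ p by exact: powR_ge0.
have dB0 x : B y r x -> 0 <= dat x by move=> /BO/dat1; exact: le_trans.
have Psi0 x : B y r x -> 0 <= r `^ p * (La `^ p * dat x).
  by move=> Bx; rewrite !mulr_ge0 ?powR_ge0 ?dB0.
have La0 : 0 <= La `^ p by exact: powR_ge0.
apply: (dg (B y r) (B y (tau * r)) u eta (fun j x => r * Qlen Q (grad (eta j)) x)
   (fun x => r `^ p * (La `^ p * dat x)) k0 H mB _ BtB B0 Boo muB meB mDr mPsi e01 D0 Psi0 H0 _ _ h4 hP _ hH).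
- by apply: open_measurable_Rn; exact: (@bo y (tau * r) Oy).
- move=> j x j1 Bx hx; have [//|xt] := pselect (tsupp (eta j.+1) x); first by case/h2.
  by case: hx; rewrite ?(tsupp0 xt) ?(Qlen_grad_tsupp _ xt) ?mulr0 eqxx.
- by move=> j x j1; exact: h3.
move=> j k s j2 kk0 kH s0 hs.
pose w x := pospart (u x - k).
have mw : meas_on (B y r) w.
  apply: (mcomp (G := pospart) (f := fun x => u x - k)); last exact: pospart_continuous.
  by mfun.
have w0 x : 0 <= w x by exact: pospart_ge0.
have mnu : meas_on (B y r) (fun x => (k < u x)%R%:R) by exact: (mind k mB muB).
have me1 := meB j; have me2 := meB j.+1; have md1 := mDB j; have md2 := mDB j.+1.
pose A1 x := eta j x * (k < u x)%R%:R * (r `^ p * (La `^ p * dat x) * (H + w x) `^ p).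
pose A2 i x := w x `^ p * (r * Qlen Q (grad (eta i)) x) `^ p.
pose A3 x := (eta j.+1 x * w x) `^ p.
have mA1 : meas_on (B y r) A1 by rewrite /A1; mfun.
have mA2 i : meas_on (B y r) (A2 i) by rewrite /A2; have := mDB i => ?; mfun.
have mA3 : meas_on (B y r) A3 by rewrite /A3; mfun.
have A10 x : B y r x -> 0 <= A1 x.
  by move=> Bx; rewrite /A1 !mulr_ge0 ?powR_ge0 ?dB0.
have A20 i x : B y r x -> 0 <= A2 i x by move=> _; rewrite /A2 mulr_ge0 ?powR_ge0.
have A30 x : B y r x -> 0 <= A3 x by move=> _; exact: powR_ge0.
have IE : (fun x => eta j x * (k < u x)%R%:R * (r `^ p * (La `^ p * dat x) * (H + pospart (u x - k)) `^ p) +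
          pospart (u x - k) `^ p * ((r * Qlen Q (grad (eta j)) x) `^ p + (r * Qlen Q (grad (eta j.+1)) x) `^ p) +
          (eta j.+1 x * pospart (u x - k)) `^ p) = (fun x => A1 x + (A2 j x + A2 j.+1 x) + A3 x).
  by apply/funext => x; rewrite /A1 /A2 /A3 /w mulrDr.
rewrite IE in hs.
have mI : meas_on (B y r) (fun x => A1 x + (A2 j x + A2 j.+1 x) + A3 x).
  by have := mA2 j; have := mA2 j.+1 => ? ?; mfun.
have subI (f : V -> R) : meas_on (B y r) f -> (forall x, B y r x -> 0 <= f x) ->
    (forall x, B y r x -> f x <= A1 x + (A2 j x + A2 j.+1 x) + A3 x) -> (Av (B y r) f <= s%:E)%E.
  by move=> mf f0 fI; apply: le_trans hs; apply: (Av_le mB B0 Boo mf mI f0); apply: aeW.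
have S3 : (Av (B y r) A3 <= s%:E)%E.
  apply: (subI A3 mA3 A30) => x Bx; rewrite lerDr addr_ge0 ?A10// addr_ge0// A20//.
have S2 : (Av (B y r) (A2 j.+1) <= s%:E)%E.
  apply: (subI _ (mA2 _) (A20 _)) => x Bx; have := A10 x Bx; have := A20 j x Bx; have := A30 x Bx.
  by move: (A1 x) (A2 j x) (A2 j.+1 x) (A3 x) => *; lra.
have S1 : (Av (B y r) (fun x => (r `^ p * (eta j x ^+ m.+1 * (k < u x)%R%:R * Qlen Q gu x `^ p))%R) <= (Cl * s)%:E)%E.
  have adj := cutoff_on_core gB gc j2 Lu.
  have cl := clevel ue adj La1 (ltW H0) (uLa k kk0 kH).
  pose f x := eta j x ^+ m.+1 * (k < u x)%R%:R * Qlen Q gu x `^ p.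
  pose g x := eta j x * (k < u x)%R%:R * (La `^ p * dat x * (H + pospart (u x - k)) `^ p) +
     pospart (u x - k) `^ p * Qlen Q (grad (eta j)) x `^ p.
  have mf : meas_on (B y r) f by rewrite /f; mfun.
  have mg : meas_on (B y r) g by rewrite /g; mfun.
  have f0 x : B y r x -> 0 <= f x by move=> _; rewrite /f !mulr_ge0 ?exprn_ge0 ?powR_ge0.
  have g0 x : B y r x -> 0 <= g x.
    by move=> Bx; rewrite /g addr_ge0// !mulr_ge0 ?powR_ge0 ?dB0.
  have fS : Int (B y r) f = Int (core y r eta) f.
    apply: Int_eq0_out => // x Bx nS; rewrite /f.
    have xt : ~ tsupp (eta j) x.
      by case: adj => _ _ _ [_ _ _ sub _] /sub.
    by rewrite (tsupp0 xt) expr0n /= !mul0r.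
  have fg : (Int (B y r) f <= Cl%:E * Int (B y r) g)%E.
    rewrite fS; apply: (le_trans cl); apply: lee_wpmul2l; first by rewrite lee_fin ltW.
    exact: (Int_subset mS mB SB mg g0).
  have fgA : (Av (B y r) f <= Cl%:E * Av (B y r) g)%E.
    rewrite !AvE [X in (_ <= X)%E]muleCA; apply: lee_wpmul2l; last exact: fg.
    by rewrite lee_fin invr_ge0 fine_ge0// ltW.
  rewrite (AvZ mB mf f0 rp0).
  apply: (@le_trans _ _ ((r `^ p)%:E * (Cl%:E * Av (B y r) g))%E).
    by apply: lee_wpmul2l => //; rewrite lee_fin.
  rewrite muleCA EFinM; apply: lee_wpmul2l; first by rewrite lee_fin ltW.
  rewrite -(AvZ mB mg g0 rp0).
  apply: subI.
  + by mfun.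
  + by move=> x Bx; rewrite mulr_ge0// g0.
  + move=> x Bx; have := A20 j.+1 x Bx; have := A30 x Bx.
    have -> : r `^ p * g x = A1 x + A2 j x.
      rewrite /g /A1 /A2 (powRM _ (ltW r0) (Qlen_ge0 _ _ _)) -/(w x); ring.
    by move: (A1 x) (A2 j x) (A2 j.+1 x) (A3 x) => *; lra.
have [le1 e11 sB1 LD1] := h j.+1.
pose s' := 2 `^ p * (Cl + 1) * s.
have p21 : 1 <= 2 `^ p :> R by apply: powR_ge1; [lra|exact: ltW].
have ss' : s <= s'.
  by rewrite /s' ler_peMl ?(ltW s0)// -[leLHS]mulr1; apply: ler_pM => //; rewrite lerDr ltW.
have s'0 : 0 < s' by exact: lt_le_trans ss'.
have -> : C * s = (2 * C1) `^ p * s' by rewrite /C /s'; ring.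
apply: (sobolev_level Oy r0 rR cB uW le1 e11 sB1 LD1 s'0 (k := k)).
  by apply: le_trans S3 _; rewrite lee_fin.
pose f x := r `^ p * (eta j x ^+ m.+1 * (k < u x)%R%:R * Qlen Q gu x `^ p).
have mf : meas_on (B y r) f by rewrite /f; mfun.
have f0 x : B y r x -> 0 <= f x by move=> _; rewrite /f !mulr_ge0 ?exprn_ge0 ?powR_ge0.
apply: (@le_trans _ _ (Av (B y r) (fun x => 2 `^ p * (f x + A2 j.+1 x)))).
  apply: (Av_le mB B0 Boo).
  - by mfun.
  - by have := mA2 j.+1 => ?; mfun.
  - by move=> x Bx; rewrite !mulr_ge0 ?powR_ge0// addr_ge0// !mulr_ge0 ?powR_ge0.
  - apply: aeW => x Bx; rewrite mulrCA ler_wpM2l ?powR_ge0// mulrDr; apply: lerD.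
      rewrite ler_wpM2l// ler_wpM2r ?powR_ge0// ler_wpM2r//.
      (* Where eta_{j+1} is nonzero, eta_j = 1, so the power m + 1 on eta_j loses nothing. *)
      have [->|ej] := eqVneq (eta j.+1 x) 0; first exact: exprn_ge0.
      have xt : tsupp (eta j.+1) x by exact: subset_closure.
      have j1 : (1 <= j)%N by exact: ltnW.
      have [_ ->] := h2 j j1 x xt; rewrite expr1n.
      by have /andP[] := e01 j.+1 x.
    by rewrite /A2 (powRM _ (ltW r0) (Qlen_ge0 _ _ _)) mulrCA.
have mfA : meas_on (B y r) (fun x => f x + A2 j.+1 x) by have := mA2 j.+1 => ?; mfun.
rewrite (AvZ mB mfA) ?powR_ge0//; last by move=> x Bx; rewrite addr_ge0// ?f0// A20.
rewrite (AvD mB mf (mA2 j.+1) f0 (A20 j.+1)).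
have -> : s' = 2 `^ p * (Cl * s + s) by rewrite /s'; ring.
by rewrite EFinM EFinD; apply: lee_wpmul2l; [rewrite lee_fin powR_ge0|exact: leeD].
Qed.

Variables (sstar t : \bar R) (N0 qd : R).
Hypotheses (cut : cutoffs Omega rho Q p R2 sstar K tau N0 t) (N00 : 0 < N0) (N0N : N0 <= N)
  (pqs : ((p * q)%:E <= sstar)%E) (t1 : (1 <= t)%E).
Hypotheses (qqd : q <= qd) (sqd : dual_exp sg <= qd)
  (datq : forall X, compact X -> X `<=` Omega -> L1 X (fun x => dat x `^ qd)).

Let q1 : 1 <= q.
Proof.
have h : q^-1 <= 1.
  have : 0 < th^-1 by rewrite invr_gt0 (lt_trans _ th1).
  by have := qth; move: (q^-1) (th^-1) => x z; lra.
by rewrite -(invrK q) invr_ge1 ?invr_gt0// unitfE invr_eq0 gt_eqF.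
Qed.

Lemma cutoffs_good y r : good_ball y r -> exists eta, good_cutoff y r eta /\
  ((Lnorm_on (B y r) (p%:E * t) (Qlen Q (grad (eta 1%N))) < +oo)%E /\
  exists2 C3 : R, 0 < C3 & forall f, Lip_loc Omega f ->
       (Lnorm_on (B y r) (p%:E * hoelder_conjugate t) f <= C3%:E * WQnorm Q p Omega f (grad f))%E).
Proof.
move=> gB; have [Oy r0 rR cB] := gB; have [oB BO mB [B0 Boo] cpB] := qball_facts Oy r0 cB.
have [[e [ts1 ej] eD] C3h] := cut Oy r0 rR.
(* The assumption concerns j >= 1; index 0 is filled with the zero function so that later statements
   can range over all j. *)
pose eta j : V -> R := if j is 0%N then fun=> 0 else e j.
have ts0 : tsupp (eta 0%N) `<=` B y r.
  move=> x; rewrite /tsupp (_ : [set x | eta 0%N x != 0] = set0) ?closure0//.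
  by apply/seteqP; split => z //=; rewrite eqxx.
have De0 : Qlen Q (grad (eta 0%N)) = fun=> 0.
  by apply/funext => x; rewrite /Qlen grad_cst mul0mx enorm0.
have mD j : (1 <= j)%N -> meas_on (B y r) (Qlen Q (grad (e j))).
  move=> j1; have [le _ _ _ _] := ej j j1.
  apply: (Qlen_meas mOm mQ symQ mB BO) => i; apply: (meas_onS mOm BO).
  by apply: (grad_meas oOm i); exact: lipschitz_Lip_loc.
have aE j : (fun x => `|Qlen Q (grad (e j)) x|) = Qlen Q (grad (e j)).
  by apply/funext => x; rewrite ger0_norm// Qlen_ge0.
have c0 j : 0 < K * N0 ^+ j / r by rewrite divr_gt0// mulr_gt0// exprn_gt0.
have pq0 : 0 < p * q by rewrite mulr_gt0.
have bd j s : (1 <= j)%N -> 0 < s -> s <= p * q ->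
    (Av (B y r) (fun x => (Qlen Q (grad (e j)) x `^ s)%R) <= ((K * N0 ^+ j / r) `^ s)%:E)%E.
  move=> j1 s0 sp; have [_ _ _ _ la] := ej j j1.
  have ss : (s%:E <= sstar)%E by apply: le_trans pqs; rewrite lee_fin.
  have := Lavg_bound mB B0 Boo musT (mD j j1) (c0 j) s0 ss la.
  by under eq_fun do rewrite (congr1 (fun f => f _) (aE j)).
exists eta; split; last by split => //; exact: eD.
split.
- move=> [|j].
    split => //; first by apply/lipschitzP; exists 1 => // x z; rewrite subrr normr0 mul1r.
    + by move=> x; rewrite lexx ler01.
    + rewrite De0 powR0//; apply: L1_cst => //.
  have [le e01 _ ts _] := ej j.+1 isT; split => //.
  + by case: j {le e01 ts} => [//|j]; have [_ _ _ ts _] := ej j.+1 isT; move=> x /ts[].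
  + have h := bd j.+1 p isT p0; have pp : p <= p * q by rewrite ler_peMr// ltW.
    split; [by have := mD j.+1 isT => ?; mfun|by move=> x _; exact: powR_ge0|].
    by apply: le_lt_trans (ltry _); exact: (Av_Int B0 Boo (h pp)).
- by move=> [//|j] _; have [_ _ _ ts _] := ej j.+1 isT.
- by move=> [//|j] x _ Bx; have [_ _ h _ _] := ej j.+1 isT; exact: h.
- move=> [//|j] _; have h := bd j.+1 (p * q) isT pq0 (lexx _).
  have mDj := mD j.+1 isT.
  have -> : (fun x => (r * Qlen Q (grad (eta j.+1)) x) `^ (p * q)) =
    (fun x => r `^ (p * q) * Qlen Q (grad (e j.+1)) x `^ (p * q)).
    by apply/funext => x; rewrite powRM ?Qlen_ge0 ?(ltW r0).
  rewrite (AvZ mB) ?powR_ge0//; [|by mfun|by move=> x _; exact: powR_ge0].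
  have rp0 : (0 <= (r `^ (p * q))%:E)%E by rewrite lee_fin powR_ge0.
  apply: (le_trans (lee_wpmul2l rp0 h)); rewrite -EFinM lee_fin -powRM ?(ltW r0) ?(ltW (c0 _))//.
  rewrite mulrC divfK ?gt_eqF//; apply: ge0_ler_powR; rewrite ?nnegrE ?(ltW pq0)//.
  + by rewrite mulr_ge0 ?exprn_ge0// ltW.
  + by rewrite mulr_ge0 ?exprn_ge0// ltW// (lt_le_trans ltr01).
  + rewrite ler_wpM2l ?(ltW K0)//; apply: lerXn2r; rewrite ?nnegrE// ltW//.
    exact: lt_le_trans ltr01 _.
Qed.

Lemma hoelder_conjugate_fin (s : R) : 1 < s -> hoelder_conjugate s%:E = (dual_exp s)%:E.
Proof.
move=> s1; have s0 : 0 < s by exact: lt_trans s1.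
have n1 : s - 1 != 0 by rewrite gt_eqF// subr_gt0.
by rewrite /hoelder_conjugate /= eqe (gt_eqF s0) /dual_exp -EFinB inver (negbTE n1) -EFinM.
Qed.

(** The approximants u_k are bounded in L^{pt'} on the ball because their Sobolev norms are bounded,
    and the gradient of eta_1 is in L^{pt}. The products have bounded integrals, by Young for finite
    t > 1 and by a supremum bound on one factor for t = 1 or infinite; Fatou concludes. *)
Lemma cutoff_integrable y r eta u gu (C3 : R) : good_ball y r -> good_cutoff y r eta ->
  (Lnorm_on (B y r) (p%:E * t) (Qlen Q (grad (eta 1%N))) < +oo)%E -> 0 < C3 ->
  (forall f, Lip_loc Omega f ->
       (Lnorm_on (B y r) (p%:E * hoelder_conjugate t) f <= C3%:E * WQnorm Q p Omega f (grad f))%E) ->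
  WQ Q p Omega u gu ->
  L1 (B y r) (fun x => `|u x| `^ p * Qlen Q (grad (eta 1%N)) x `^ p).
Proof.
move=> gB gc Lt C30 HC3 uW; have [Oy r0 rR cB] := gB; have [oB BO mB [B0 Boo] cpB] := qball_facts Oy r0 cB.
have [mu_ mgu _] := uW.
have [u_ [D [uL D0 LD uDae]]] := WQ_approx mOm p1 mQ symQ oOm uW.
case: gc => h _ _ _; have [le e01 sB LDe] := h 1%N.
pose De := Qlen Q (grad (eta 1%N)); rewrite -/De in Lt LDe *.
have eL : Lip_loc Omega (eta 1%N) by exact: lipschitz_Lip_loc.
have mDe : meas_on (B y r) De.
  by apply: (Qlen_meas mOm mQ symQ mB BO) => i; apply: (meas_onS mOm BO); exact: (grad_meas oOm i eL).
have De0 x : 0 <= De x by exact: Qlen_ge0.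
have muk k : meas_on (B y r) (u_ k) by apply: (meas_onS mOm BO); exact: (Lip_loc_meas oOm (uL k)).
have muB := meas_onS mOm BO mu_.
have p2 : 0 <= 2 `^ p :> R by exact: powR_ge0.
have [mDD DD0 Doo] : L1 Omega (fun x => 2 `^ p * (D x + D x)) by exact: (L1Z mOm p2 (L1D mOm LD LD)).
have uk1 k : \forall x \ae mu, Omega x -> `|u_ k x| `^ p <= 2 `^ p * (D x + D x).
  apply: filterS uDae => x hx Ox; have [b1 b2 [b3 b4] _ _] := hx Ox.
  apply: (le_trans (powR_triangle p1 (u x) (u_ k x))); rewrite ler_wpM2l//; apply: lerD => //; exact: b1.
have uk2 k : \forall x \ae mu, Omega x -> Qlen Q (grad (u_ k)) x `^ p <= 2 `^ p * (D x + D x).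
  apply: filterS uDae => x hx Ox; have [b1 b2 [b3 b4] _ _] := hx Ox.
  apply: (@le_trans _ _ ((Qlen Q (fun y => grad (u_ k) y - gu y) x + Qlen Q gu x) `^ p)).
    apply: ge0_ler_powR; [exact: ltW|exact: Qlen_ge0|by rewrite nnegrE addr_ge0 ?Qlen_ge0|].
    by rewrite /Qlen -{1}(subrK (gu x) (grad (u_ k) x)) mulmxDl; exact: enormD.
  apply: (le_trans (powRD_le (ltW p0) (Qlen_ge0 _ _ _) (Qlen_ge0 _ _ _))).
  by apply: (ler_wpM2l p2); exact: (lerD (b2 k) b4).
have mukO k : meas_on Omega (u_ k) by exact: (Lip_loc_meas oOm (uL k)).
have mXk k : meas_on Omega (Qlen Q (grad (u_ k))).
  by apply: (Qlen_meas mOm mQ symQ mOm (fun x hx => hx)) => i; exact: (grad_meas oOm i (uL k)).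
pose I := Int Omega (fun x => 2 `^ p * (D x + D x)).
have I1 k : (Int Omega (fun x => (`|u_ k x| `^ p)%R) <= I)%E.
  by apply: Int_le; [exact: mOm|by mfun|exact: mDD|by move=> x _; exact: powR_ge0|exact: uk1].
have I2 k : (Int Omega (fun x => (Qlen Q (grad (u_ k)) x `^ p)%R) <= I)%E.
  apply: Int_le; [exact: mOm|by have := mXk k => ?; mfun|exact: mDD|by move=> x _; exact: powR_ge0|exact: uk2].
have I0 : (0 <= I)%E by exact: Int_ge0.
have Ifin : I = (fine I)%:E by rewrite fineK// ge0_fin_numE.
have W k : (WQnorm Q p Omega (u_ k) (grad (u_ k)) <= ((fine I + fine I) `^ p^-1)%:E)%E.
  rewrite /WQnorm -!IntE -poweR_EFin EFinD -Ifin.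
  have h1 : (0 <= Int Omega (fun x => (`|u_ k x| `^ p)%R) + Int Omega (fun x => (Qlen Q (grad (u_ k)) x `^ p)%R))%E.
    by apply: adde_ge0; apply: Int_ge0 => x _; exact: powR_ge0.
  apply: gt0_ler_poweR; [by rewrite invr_ge0 ltW|by rewrite in_itv /= leey andbT| |exact: leeD].
  by rewrite in_itv /= leey andbT adde_ge0.
pose M1 := C3 * (fine I + fine I) `^ p^-1.
have M10 : 0 <= M1 by rewrite mulr_ge0 ?powR_ge0// ltW.
have HM k : (Lnorm_on (B y r) (p%:E * hoelder_conjugate t) (u_ k) <= M1%:E)%E.
  apply: (le_trans (HC3 _ (uL k))); rewrite /M1 EFinM; apply: lee_wpmul2l; last exact: W.
  by rewrite lee_fin ltW.
have IB k : (Int (B y r) (fun x => (`|u_ k x| `^ p)%R) <= (fine I)%:E)%E.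
  rewrite -Ifin; apply: le_trans (I1 k).
  by apply: (Int_subset mB mOm BO); [by mfun|by move=> x _; exact: powR_ge0].
have mF k : meas_on (B y r) (fun x => `|u_ k x| `^ p * De x `^ p) by mfun.
have F0 k x : 0 <= `|u_ k x| `^ p * De x `^ p by rewrite mulr_ge0 ?powR_ge0.
have [c Hc] : exists c : R, forall k, (Int (B y r) (fun x => (`|u_ k x| `^ p * De x `^ p)%R) <= c%:E)%E.
  move: t1 Lt HM; case: t => [s| |]// s1.
  - move: s1; rewrite lee_fin le_eqVlt => /predU1P[<-|s1].
      rewrite hoelder_conjugate1 mule1 gt0_muley ?lte_fin// => LD1 HM.
      have [mDp Dp0 Dpoo] := LDe.
      have [c c0 ce] := Av_lty B0 Boo Dpoo Dp0.
      have Dpfin : (Int (B y r) (fun x => (De x `^ p)%R) <= (fine (mu (B y r : set T)) * c)%:E)%E.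
        by apply: (Av_Int B0 Boo); rewrite ce.
      exists (M1 `^ p * (fine (mu (B y r : set T)) * c)) => k.
      have hk := Lnorm_on_y musT (HM k).
      apply: (@le_trans _ _ (Int (B y r) (fun x => (M1 `^ p * De x `^ p)%R))).
        apply: Int_le; [exact: mB|exact: mF|by mfun|by move=> x _; exact: F0|].
        apply: filterS hk => x hx Bx; rewrite ler_wpM2r ?powR_ge0//.
        by apply: ge0_ler_powR; rewrite ?nnegrE ?(ltW p0)//; exact: hx.
      rewrite (IntZ mB mDp Dp0) ?powR_ge0// EFinM; apply: lee_wpmul2l => //.
      by rewrite lee_fin powR_ge0.
    rewrite (hoelder_conjugate_fin s1) -!EFinM => LD1 HM.
    have s0 : 0 < s by exact: lt_trans s1.
    have ds0 : 0 < dual_exp s by exact: dual_exp_gt0.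
    have ps0 : 0 < p * s by rewrite mulr_gt0.
    have pd0 : 0 < p * dual_exp s by rewrite mulr_gt0.
    have Dfin := Lnorm_on_fin ps0 LD1.
    have mDs : meas_on (B y r) (fun x => De x `^ (p * s)) by mfun.
    have Ds0 x : B y r x -> 0 <= De x `^ (p * s) by move=> _; exact: powR_ge0.
    have Dfin' : (Int (B y r) (fun x => (De x `^ (p * s))%R) < +oo)%E.
      apply: le_lt_trans Dfin; apply: Int_le; [exact: mB|exact: mDs|by mfun|exact: Ds0|].
      by apply: aeW => x Bx; rewrite ger0_norm.
    have [c c0 ce] := Av_lty B0 Boo Dfin' Ds0.
    have Dpfin : (Int (B y r) (fun x => (De x `^ (p * s))%R) <= (fine (mu (B y r : set T)) * c)%:E)%E.
      by apply: (Av_Int B0 Boo); rewrite ce.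
    exists (fine (mu (B y r : set T)) * c + M1 `^ (p * dual_exp s)) => k.
    have := HM k; rewrite (Lnorm_onE _ _ pd0) poweR_le_inv//; last first.
      by apply: Int_ge0 => x _; exact: powR_ge0.
    move=> hk; rewrite EFinD; apply: le_trans (leeD Dpfin hk).
    rewrite -(IntD mB mDs); [|by mfun|exact: Ds0|by move=> x _; exact: powR_ge0].
    apply: Int_le; [exact: mB|exact: mF|by mfun|by move=> x _; exact: F0|].
    apply: aeW => x Bx; rewrite mulrC (powRrM (De x) p s) (powRrM `|u_ k x| p (dual_exp s)).
    exact: (young s1 (powR_ge0 _ _) (powR_ge0 _ _)).
  - rewrite gt0_muley ?lte_fin// => LD1 _.
    have [c c0 hc] := Lnorm_on_y_fin musT LD1.
    exists (c `^ p * fine I) => k.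
    apply: (@le_trans _ _ (Int (B y r) (fun x => (c `^ p * `|u_ k x| `^ p)%R))).
      apply: Int_le; [exact: mB|exact: mF|by mfun|by move=> x _; exact: F0|].
      apply: filterS hc => x hx Bx; rewrite mulrC ler_wpM2r ?powR_ge0//.
      apply: ge0_ler_powR; rewrite ?nnegrE ?(ltW p0) ?(ltW c0)//.
      by have := hx Bx; rewrite ger0_norm.
    rewrite (IntZ mB); [|by mfun|by move=> x _; exact: powR_ge0|exact: powR_ge0].
    by rewrite EFinM; apply: lee_wpmul2l => //; rewrite lee_fin powR_ge0.
split; [by mfun|by move=> x _; rewrite mulr_ge0 ?powR_ge0|].
apply: (@le_lt_trans _ _ c%:E); last exact: ltry.
apply: (Int_fatou mB mF); [by mfun|by move=> k x _; exact: F0|by move=> x _; rewrite mulr_ge0 ?powR_ge0| |exact: Hc].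
apply: filterS uDae => x hx Bx; have [_ _ _ c1 _] := hx (BO _ Bx).
apply: cvgM; last exact: cvg_cst.
by apply: cvg_powR => //; exact: cvg_norm.
Qed.

Lemma WQ_L1 (u : V -> R) (gu : V -> V) : WQ Q p Omega u gu ->
  L1 Omega (fun x => `|u x| `^ p) /\ L1 Omega (fun x => Qlen Q gu x `^ p).
Proof.
move=> uW; have [mu_ mgu _] := uW.
have [u_ [D [uL D0 LD uDae]]] := WQ_approx mOm p1 mQ symQ oOm uW.
have mX : meas_on Omega (Qlen Q gu) by exact: (Qlen_meas mOm mQ symQ mOm (fun x hx => hx) mgu).
split; apply: (L1_le mOm _ _ _ LD).
- by mfun.
- by move=> x _; exact: powR_ge0.
- by apply: filterS uDae => x hx Ox; have [_ _ [h _] _ _] := hx Ox.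
- by mfun.
- by move=> x _; exact: powR_ge0.
- by apply: filterS uDae => x hx Ox; have [_ _ [_ h] _ _] := hx Ox.
Qed.

(** Sobolev at level 0 with eta_1. The hypothesis on |u|^p times the cutoff gradient is precisely
    what makes its right-hand side finite before any bound on u is available. *)
Lemma half_integrable y r eta u gu : good_ball y r -> good_cutoff y r eta -> WQ Q p Omega u gu ->
  L1 (B y r) (fun x => `|u x| `^ p * Qlen Q (grad (eta 1%N)) x `^ p) ->
  L1 (B y r) (fun x => (eta 1%N x * pospart (u x)) `^ (p * sg)).
Proof.
move=> gB gc uW LuD; have [Oy r0 rR cB] := gB; have [oB BO mB [B0 Boo] cpB] := qball_facts Oy r0 cB.
have [mu_ mgu _] := uW; have [Lu LX] := WQ_L1 uW.
case: gc => h _ _ _; have [le e01 sB LDe] := h 1%N.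
have e0 x : 0 <= eta 1%N x by have /andP[] := e01 x.
have eL : Lip_loc Omega (eta 1%N) by exact: lipschitz_Lip_loc.
have muB := meas_onS mOm BO mu_.
have meB : meas_on (B y r) (eta 1%N) by apply: (meas_onS mOm BO); exact: (Lip_loc_meas oOm eL).
have mXB : meas_on (B y r) (Qlen Q gu).
  by apply: (Qlen_meas mOm mQ symQ mB BO) => i; apply: (meas_onS mOm BO); exact: mgu.
have mDB : meas_on (B y r) (Qlen Q (grad (eta 1%N))).
  by apply: (Qlen_meas mOm mQ symQ mB BO) => i; apply: (meas_onS mOm BO); exact: (grad_meas oOm i eL).
pose w x := pospart (u x - 0).
have mw : meas_on (B y r) w.
  apply: (mcomp (G := pospart) (f := fun x => u x - 0)); last exact: pospart_continuous.
  by mfun.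
have w0 x : 0 <= w x by exact: pospart_ge0.
have wu x : w x <= `|u x|.
  by rewrite /w subr0 /pospart ge_max normr_ge0 ler_norm.
have mnu : meas_on (B y r) (fun x => ((0:R) < u x)%R%:R) by exact: (mind 0 mB muB).
have rp0 : 0 <= r `^ p by exact: powR_ge0.
have p20 : 0 <= 2 `^ p :> R by exact: powR_ge0.
pose f1 x := (eta 1%N x * w x) `^ p.
pose f2 x := r `^ p * (2 `^ p * (eta 1%N x * ((0:R) < u x)%R%:R * Qlen Q gu x `^ p +
     w x `^ p * Qlen Q (grad (eta 1%N)) x `^ p)).
have wpu x : w x `^ p <= `|u x| `^ p.
  by apply: ge0_ler_powR; [exact: ltW|exact: w0|exact: normr_ge0|exact: wu].
have mf1 : meas_on (B y r) f1 by rewrite /f1; mfun.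
have mf2 : meas_on (B y r) f2 by rewrite /f2; mfun.
have f20 x : B y r x -> 0 <= f2 x.
  by move=> _; rewrite /f2 !mulr_ge0// addr_ge0// !mulr_ge0 ?powR_ge0.
have f10 x : B y r x -> 0 <= f1 x by move=> _; exact: powR_ge0.
have L1f1 : L1 (B y r) f1.
  apply: (L1_le mB mf1 f10 _ (L1S mB mOm BO Lu)); apply: aeW => x _.
  apply: le_trans (wpu x); apply: ge0_ler_powR; [exact: ltW|by rewrite nnegrE mulr_ge0|exact: w0|].
  by have /andP[_ e1] := e01 x; rewrite ler_piMl.
have L1f2 : L1 (B y r) f2.
  apply: (L1_le mB mf2 f20 _ (L1Z mB rp0 (L1Z mB p20 (L1D mB (L1S mB mOm BO LX) LuD)))).
  apply: aeW => x _; rewrite ler_wpM2l// ler_wpM2l//; apply: lerD.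
    have /andP[_ e1] := e01 x; rewrite ler_piMl ?powR_ge0// mulr_ile1//.
    by rewrite lern1 leq_b1.
  by rewrite ler_wpM2r ?powR_ge0.
have [c1 c10 e1] := Av_lty B0 Boo (let: And3 _ _ h := L1f1 in h) f10.
have [c2 c20 e2] := Av_lty B0 Boo (let: And3 _ _ h := L1f2 in h) f20.
pose s := c1 + c2 + 1.
have s0 : 0 < s by rewrite /s; lra.
have b1 : (Av (B y r) f1 <= s%:E)%E by rewrite e1 lee_fin /s; lra.
have b2 : (Av (B y r) f2 <= s%:E)%E by rewrite e2 lee_fin /s; lra.
have hh := @sobolev_level y r Oy r0 rR cB u (eta 1%N) gu 0 s uW le e01 sB LDe s0 b1 b2.
have mf : meas_on (B y r) (fun x => (eta 1%N x * pospart (u x - 0)) `^ (p * sg)).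
  by rewrite -/(w _); mfun.
under eq_fun do rewrite -[X in pospart X]subr0.
split; [exact: mf|by move=> x _; exact: powR_ge0|].
by apply: le_lt_trans (ltry _); exact: (Av_Int B0 Boo hh).
Qed.

Hypothesis en_opp : forall u gu, en u gu -> en (fun x => - u x) (fun x => - gu x).

(** Both signs of u together give L^{p sg} where eta_1 = 1. Young with sg and its conjugate then
    handles the product with [dat], as the conjugate is at most [qd] and dat >= 1. *)
Lemma core_L1 y r : good_ball y r -> exists2 eta, good_cutoff y r eta & forall u gu, en u gu ->
  L1 (core y r eta) (fun x => `|u x| `^ (p * sg)) /\ L1 (core y r eta) (fun x => dat x * (1 + `|u x|) `^ p).
Proof.
move=> gB; have [eta [gc [Lt [C3 C30 HC3]]]] := cutoffs_good gB; exists eta => // u gu ue.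
have [Oy r0 rR cB] := gB; have [oB BO mB [B0 Boo] cpB] := qball_facts Oy r0 cB.
have mS := core_meas gB gc.
have SB : core y r eta `<=` B y r by move=> x [].
have uW := en_WQ ue; have uW' := en_WQ (en_opp ue).
have H1 := half_integrable gB gc uW (cutoff_integrable gB gc Lt C30 HC3 uW).
have H2 := half_integrable gB gc uW' (cutoff_integrable gB gc Lt C30 HC3 uW').
have [mu_ _ _] := uW.
have muS : meas_on (core y r eta) u := meas_onS mOm (subset_trans SB BO) mu_.
have psg0 : 0 < p * sg by rewrite mulr_gt0// (lt_trans _ sg1).
have L : L1 (core y r eta) (fun x => `|u x| `^ (p * sg)).
  apply: (L1_le mS _ _ _ (L1S mS mB SB (L1D mB H1 H2))); [by mfun|by move=> x _; exact: powR_ge0|].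
  apply: aeW => x [Bx e1]; rewrite e1 !mul1r.
  have [u0|u0] := leP 0 (u x).
    by rewrite (pospart_pos u0) ger0_norm// lerDl powR_ge0.
  by rewrite (@pospart_pos R (- u x)) ?oppr_ge0 ?(ltW u0)// ltr0_norm// lerDr powR_ge0.
split => //.
have sgd0 := dual_exp_gt0 sg1.
have mdS : meas_on (core y r eta) dat := meas_onS mOm (subset_trans SB BO) mdat.
have Ld : L1 (core y r eta) (fun x => dat x `^ qd).
  have mcB : measurable (closure (B y r) : set T) by exact: compact_measurable_Rn.
  apply: (L1S mS mcB _ (datq cpB cB)); exact: (subset_trans SB (@subset_closure _ _)).
have Soo : (mu (core y r eta : set T) < +oo)%E.
  by apply: le_lt_trans Boo; apply: le_measure; rewrite ?inE.
have c0 : 0 <= 2 `^ (p * sg) :> R by exact: powR_ge0.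
apply: (L1_le mS _ _ _ (L1D mS (L1Z mS c0 (L1D mS (L1_cst mS ler01 Soo) L)) Ld)).
- by mfun.
- by move=> x Sx; rewrite mulr_ge0 ?powR_ge0// (le_trans ler01)// dat1//; exact/BO/SB.
- apply: aeW => x Sx; have d1 := dat1 (BO _ (SB _ Sx)); have d0 := le_trans ler01 d1.
  rewrite mulrC; apply: (le_trans (young sg1 (powR_ge0 _ _) d0)); apply: lerD.
    rewrite -powRrM; have := powRD_le (ltW psg0) ler01 (normr_ge0 (u x)).
    by rewrite powR1.
  exact: ler_powR.
Qed.

Lemma closure_qball_meas y r : good_ball y r -> L1 (B y r) (fun x => dat x `^ qd).
Proof.
move=> [Oy r0 rR cB]; have [oB BO mB [B0 Boo] cpB] := qball_facts Oy r0 cB.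
have mcB : measurable (closure (B y r) : set T) by exact: compact_measurable_Rn.
exact: (L1S mB mcB (@subset_closure _ _) (datq cpB cB)).
Qed.

Lemma loc_bounded_above y r u gu : good_ball y r -> en u gu ->
  exists M : R, \forall x \ae mu, B y (tau * r) x -> u x <= M.
Proof.
move=> gB ue; have [eta gc Lc] := core_L1 gB; have [Lu Ld] := Lc u gu ue.
have [Oy r0 rR cB] := gB; have [oB BO mB [B0 Boo] cpB] := qball_facts Oy r0 cB.
have mS := core_meas gB gc.
have SB : core y r eta `<=` B y r by move=> x [].
have uW := en_WQ ue; have [mu_ _ _] := uW.
have mdB := meas_onS mOm BO mdat.
have muB := meas_onS mOm BO mu_.
have dB0 x : B y r x -> 0 <= dat x by move=> /BO/dat1; exact: le_trans.
have th0 : 0 < th by exact: lt_trans th1.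
have pth0 : 0 < p * th by rewrite mulr_gt0.
pose psi x := (r `^ p * (2 `^ p * dat x)) `^ q.
have mpsi : meas_on (B y r) psi by rewrite /psi; mfun.
have psi0 x : B y r x -> 0 <= psi x by move=> _; exact: powR_ge0.
have Lpsi : L1 (B y r) psi.
  have c0 : 0 <= (r `^ p * 2 `^ p) `^ q by exact: powR_ge0.
  apply: (L1_le mB mpsi psi0 _ (L1Z mB c0 (closure_qball_meas gB))).
  apply: aeW => x Bx; rewrite /psi mulrA powRM ?mulr_ge0 ?powR_ge0 ?dB0//.
  by rewrite ler_wpM2l//; apply: ler_powR => //; exact/dat1/BO.
have [c c0 ce] := Av_lty B0 Boo (let: And3 _ _ h := Lpsi in h) psi0.
pose P := (c + 1) `^ q^-1.
have c10 : 0 < c + 1 by rewrite ltr_wpDl.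
have P0 : 0 < P by exact: powR_gt0.
have [ze ze0 SBd] := sup_bound P0.
pose z x := (eta 2%N x * pospart (u x - 0)) `^ (p * th).
case: (gc) => h h2 _ _; have [le e01 sB LDe] := h 2%N.
have e0 x : 0 <= eta 2%N x by have /andP[] := e01 x.
have eL : Lip_loc Omega (eta 2%N) by exact: lipschitz_Lip_loc.
have meB : meas_on (B y r) (eta 2%N) by apply: (meas_onS mOm BO); exact: (Lip_loc_meas oOm eL).
have mw : meas_on (B y r) (fun x => pospart (u x - 0)).
  apply: (mcomp (G := pospart) (f := fun x => u x - 0)); last exact: pospart_continuous.
  by mfun.
have mz : meas_on (B y r) z by rewrite /z; mfun.
have z0 x : B y r x -> 0 <= z x by move=> _; exact: powR_ge0.
have Iz : (Int (B y r) z < +oo)%E.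
  rewrite (@Int_eq0_out (B y r) (core y r eta) z SB); last first.
    move=> x Bx nS; have xt : ~ tsupp (eta 2%N) x by move/(h2 1%N isT).
    by rewrite /z (tsupp0 xt) mul0r powR0// gt_eqF.
  have Soo : (mu (core y r eta : set T) < +oo)%E.
    by apply: le_lt_trans Boo; apply: le_measure; rewrite ?inE.
  have [_ _ Loo] := L1D mS (L1_cst mS ler01 Soo) Lu.
  apply: le_lt_trans Loo; apply: Int_le; [exact: mS|exact: (meas_onS mB SB mz)| | |].
  - by have muS := meas_onS mB SB muB; mfun.
  - by move=> x _; exact: powR_ge0.
  - apply: aeW => x Sx; have pw0 := pospart_ge0 (u x - 0).
    apply: (@le_trans _ _ (`|u x| `^ (p * th))).
      apply: ge0_ler_powR; [exact: ltW|by rewrite nnegrE mulr_ge0|exact: normr_ge0|].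
      apply: (@le_trans _ _ (pospart (u x - 0))).
        by have /andP[_ e1] := e01 x; rewrite ler_piMl.
      by rewrite subr0 /pospart ge_max normr_ge0 ler_norm.
    by apply: powR_le_add1 => //; rewrite ler_wpM2l ?(ltW p0)// ltW.
have [d d0 de] := Av_lty B0 Boo Iz z0.
(* Large enough for the starting average d to be at most ze H^{p th}; H >= 1 makes 1 + |u| <= 2 (H +
   (u - k)_+) at all levels 0 <= k <= H, hence La = 2. *)
pose H := 1 + (d / ze) `^ (p * th)^-1.
have dz0 : 0 <= d / ze by rewrite divr_ge0// ltW.
have H1 : 1 <= H by rewrite lerDl powR_ge0.
have H0 : 0 < H by exact: lt_le_trans H1.
exists (0 + H).
apply: (SBd y r eta u gu 0 H 2 gB gc ue Ld _ H0).
- by lra.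
- move=> k k0 kH; apply: aeW => x Sx ku.
  rewrite pospart_pos ?subr_ge0 ?(ltW ku)// ger0_norm; last by rewrite (le_trans k0)// ltW.
  by lra.
- rewrite -/(psi _) ce lee_fin /P powRK ?gt_eqF// ?(ltW c10)//; lra.
- rewrite -/(z _) de lee_fin -ler_pdivrMl// mulrC.
  apply: (@le_trans _ _ (((d / ze) `^ (p * th)^-1) `^ (p * th))).
    by rewrite powRK// gt_eqF.
  by apply: ge0_ler_powR; rewrite ?nnegrE ?powR_ge0 ?(ltW pth0) ?(ltW H0)// lerDr.
Qed.

Lemma loc_bounded y r u gu : good_ball y r -> en u gu ->
  exists2 M : R, 0 < M & \forall x \ae mu, B y (tau * r) x -> `|u x| <= M.
Proof.
move=> gB ue; have [M1 h1] := loc_bounded_above gB ue.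
have [M2 h2] := loc_bounded_above gB (en_opp ue).
exists (`|M1| + `|M2| + 1); first by rewrite ltr_wpDl// addr_ge0.
apply: filterS2 h1 h2 => x h1 h2 Bx; have := h1 Bx; have := h2 Bx.
have := ler_norm M1; have := ler_norm M2; have := normr_ge0 M1; have := normr_ge0 M2.
by rewrite ler_norml => *; apply/andP; split; lra.
Qed.

(** * Growth lemma and oscillation decay *)

Variables (C2 bfr C0 d0 Cg : R) (R1 : V -> R).
Hypotheses (C20 : 0 < C2) (bfr1 : 1 <= bfr) (poi : poincare Omega rho Q p R2 C2 bfr).
Hypotheses (C00 : 0 < C0) (d00 : 0 < d0) (doubl : local_doubling Omega rho C0 d0 R1).
Hypothesis Cg0 : 0 < Cg.
Hypothesis clog : forall (u eta : V -> R) (gu : V -> V) (S : set V) (c M L : R),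
  en u gu -> cutoff_on S u eta -> 0 < c -> 0 <= L ->
  (\forall x \ae mu, S x -> [/\ u x <= M, zeta c M (u x) <= L & 1 + `|u x| <= L]) ->
  (Int S (fun x => (eta x ^+ m.+1 * zeta c M (u x) `^ (- p) * Qlen Q gu x `^ p)%R) <=
   Cg%:E * Int S (fun x => (zeta c M (u x) `^ (- p) * (dat x * L `^ p) + Qlen Q (grad eta) x `^ p)%R))%E.

Let tau0 : 0 < tau. Proof. by have /andP[] := tau01. Qed.
Let tau1 : tau < 1. Proof. by have /andP[] := tau01. Qed.

Lemma good_ball_le y r s : good_ball y r -> 0 < s -> s <= r -> good_ball y s.
Proof.
move=> [Oy r0 rR cB] s0 sr; split => //; first exact: le_lt_trans rR.
by apply: subset_trans cB; apply: closure_subset; exact: qball_sub.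
Qed.

Lemma Av_subset (E F : set V) (f : V -> R) (c k : R) : measurable (E : set T) -> measurable (F : set T) ->
  (0 < mu (E : set T))%E -> (0 < mu (F : set T))%E -> (mu (F : set T) < +oo)%E ->
  E `<=` F -> meas_on F f -> (forall x, F x -> 0 <= f x) -> 0 <= k ->
  (mu (F : set T) <= k%:E * mu (E : set T))%E -> (Av F f <= c%:E)%E -> (Av E f <= (k * c)%:E)%E.
Proof.
move=> mE mF E0 F0 Foo EF mf f0 k0 FE Fc.
have EFle : (mu (E : set T) <= mu (F : set T))%E by apply: le_measure; rewrite ?inE.
have Eoo : (mu (E : set T) < +oo)%E by exact: le_lt_trans EFle Foo.
apply: (Int_Av E0 Eoo); apply: (le_trans (Int_subset mE mF EF mf f0)).
apply: (le_trans (Av_Int F0 Foo Fc)).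
have fE : mu (E : set T) = (fine (mu (E : set T)))%:E by rewrite fineK// ge0_fin_numE// ltW.
have fF : mu (F : set T) = (fine (mu (F : set T)))%:E by rewrite fineK// ge0_fin_numE// ltW.
have c0 : 0 <= c.
  by rewrite -lee_fin; apply: le_trans Fc; exact: (Av_ge0 F0 Foo).
move: FE; rewrite fE fF -EFinM !lee_fin => FE.
by rewrite mulrCA mulrA ler_wpM2r.
Qed.

(* Stands in for the John-Nirenberg inequality: applied to the logarithm of the gap to the supremum, it makes the set
   where [u] is close to its supremum small. *)
Lemma mean_oscillation (E : set V) (w f a : V -> R) (mb l C : R) : measurable (E : set T) ->
  (0 < mu (E : set T))%E -> (mu (E : set T) < +oo)%E -> meas_on E w -> meas_on E f -> meas_on E a ->
  (forall x, 0 <= f x <= 1) -> (forall x, 0 <= a x <= 1) -> 0 < l -> 0 <= C ->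
  (\forall x \ae mu, E x -> f x != 0 -> w x <= 0) -> (\forall x \ae mu, E x -> a x != 0 -> l <= w x) ->
  ((2^-1)%:E <= Av E f)%E -> (Av E (fun x => `|w x - mb|%R) <= C%:E)%E ->
  (Av E a <= (4 * C / l)%:E)%E.
Proof.
move=> mE E0 Eoo mw mf ma f01 a01 l0 C00' wf wa fE wC.
have l20 : 0 <= l / 2 by lra.
have mo : meas_on E (fun x => `|w x - mb|) by mfun.
have [ml|ml] := leP (l / 2) mb.
  have h : ((l / 2)%:E * Av E f <= C%:E)%E.
    apply: le_trans wC; rewrite -(AvZ mE mf _ l20); last by move=> x _; have /andP[] := f01 x.
    apply: (Av_le mE E0 Eoo _ mo); [by mfun|by move=> x _; have /andP[h _] := f01 x; rewrite mulr_ge0|].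
    apply: filterS wf => x hx Ex; have /andP[f0 f1] := f01 x.
    have [->|fx] := eqVneq (f x) 0; first by rewrite mulr0.
    have wx := hx Ex fx; apply: (@le_trans _ _ (l / 2)); first by rewrite ler_piMr.
    by rewrite distrC; apply: le_trans (ler_norm _); lra.
  have h2 : l / 4 <= C.
    rewrite -lee_fin; apply: le_trans h.
    have := lee_wpmul2l (l20 : (0 <= (l / 2)%:E)%E) fE; rewrite -EFinM; apply: le_trans.
    by rewrite lee_fin; lra.
  apply: (@le_trans _ _ 1%:E).
    rewrite -(Av_cst mE E0 Eoo 1); apply: (Av_le mE E0 Eoo ma); [by mfun| |].
      by move=> x _; have /andP[] := a01 x.
    by apply: aeW => x _; have /andP[] := a01 x.
  by rewrite lee_fin ler_pdivlMr//; lra.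
have h : ((l / 2)%:E * Av E a <= C%:E)%E.
  apply: le_trans wC; rewrite -(AvZ mE ma _ l20); last by move=> x _; have /andP[] := a01 x.
  apply: (Av_le mE E0 Eoo _ mo); [by mfun|by move=> x _; have /andP[h _] := a01 x; rewrite mulr_ge0|].
  apply: filterS wa => x hx Ex; have /andP[f0 f1] := a01 x.
  have [->|fx] := eqVneq (a x) 0; first by rewrite mulr0.
  have wx := hx Ex fx; apply: (@le_trans _ _ (l / 2)); first by rewrite ler_piMr.
  by apply: le_trans (ler_norm _); lra.
have i0 : (0 <= ((l / 2)^-1)%:E)%E by rewrite lee_fin invr_ge0.
have := lee_wpmul2l i0 h; rewrite muleA -!EFinM mulVf ?mul1e; last by rewrite gt_eqF//; lra.
move=> h1; apply: (le_trans h1); rewrite lee_fin.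
have -> : (l / 2)^-1 * C = 2 * C / l by field; rewrite gt_eqF.
by rewrite ler_pM2r ?invr_gt0//; lra.
Qed.

Lemma growth_bounds (eo om M L v : R) : 0 < eo -> eo <= L / 4 -> 1 <= L -> M <= L -> v <= M -> 1 + `|v| <= L ->
  [/\ eo + M - v <= 3 * L, 1 + `|v| <= 3 * L, eo <= eo + M - v & v - (M - eo) <= 2 * (eo / 2)] /\
  [/\ (v <= M - om / 2 -> eo + om / 2 <= eo + M - v), (M - eo < v -> eo + M - v <= 2 * eo) & eo / 2 <= L].
Proof.
move=> eo0 eoL L1' ML vM vL; have := ler_norm (- v); rewrite normrN => h.
by split; split=> *; lra.
Qed.

(** Growth lemma. With w = log((ep om + om/2) / zeta), w <= 0 on the half of the ball where u <= M -
    om/2, while w is large where u > M - ep om. The logarithmic Caccioppoli and Poincare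
    inequalities bound the mean oscillation of w, so the second set is small; De Giorgi's iteration
    started from it lowers the supremum. The two average conditions say that the data are negligible
    at this scale. *)
Lemma growth : exists2 ep : R, 0 < ep < 4^-1 &
  forall y r u gu (M om L : R), good_ball y r -> r < R1 y -> en u gu -> 0 < om -> om <= L -> 1 <= L -> M <= L ->
  (\forall x \ae mu, B y r x -> u x <= M /\ 1 + `|u x| <= L) ->
  ((2^-1)%:E <= Av (B y (tau * r / bfr)) (fun x => (1 - (M - om / 2 < u x)%R%:R)%R))%E ->
  (Av (B y r) (fun x => ((r `^ p * ((2 * L / (ep * om)) `^ p * dat x)) `^ q)%R) <= 1%:E)%E ->
  (Av (B y (tau * r / bfr)) (fun x => (((tau * r / bfr) `^ p * ((2 * L / (ep * om)) `^ p * dat x)) `^ q)%R) <= 1%:E)%E ->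
  \forall x \ae mu, B y (tau * (tau * r / bfr)) x -> u x <= M - ep * om / 2.
Proof.
have [ze ze0 SBd] := sup_bound ltr01.
have th0 : 0 < th by exact: lt_trans th1.
have pth0 : 0 < p * th by rewrite mulr_gt0.
have b0 : 0 < bfr by exact: lt_le_trans bfr1.
(* [C'] bounds the scaled energy of log zeta near the cutoff (3^p from the data, the rest from
   eta_2), [kd] is the doubling loss between radii r and tau r, [C''] bounds the mean oscillation by
   Poincare, and [La] makes 2^{p th} 4 C''/La equal to ze, the smallness asked by [sup_bound]. *)
pose C' := Cg * (3 `^ p + (K * N ^+ 2) `^ p).
have N0' : 0 < N by exact: lt_le_trans N1.
have C'0 : 0 < C' by rewrite mulr_gt0// addr_gt0// powR_gt0// mulr_gt0// exprn_gt0.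
pose kd := C0 * tau^-1 `^ d0.
have kd0 : 0 < kd by rewrite mulr_gt0// powR_gt0// invr_gt0.
pose C'' := C2 * (tau / bfr) * (kd * C') `^ p^-1.
have C''0 : 0 < C'' by apply: mulr_gt0; [apply: mulr_gt0; [exact: C20|exact: divr_gt0]|exact/powR_gt0/mulr_gt0].
pose La := 2 `^ (p * th) * (4 * C'') / ze.
have La0 : 0 < La by rewrite divr_gt0// mulr_gt0 ?powR_gt0// mulr_gt0.
(* On u > M - ep om, zeta <= 2 ep om; the ratio of ep om + om/2 to it is at least 1/(4 ep) =
   exp(La), so w >= La there. *)
pose ep := expR (- La) / 4.
have ep0 : 0 < ep by rewrite divr_gt0// expR_gt0.
have ep4 : ep < 4^-1.
  by rewrite /ep -[ltRHS]mul1r ltr_pM2r ?invr_gt0// -expR0 ltr_expR oppr_lt0.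
exists ep; first by rewrite ep0.
move=> y r u gu M om L gB rR1 ue om0 omL L1' ML ub half hP hP'.
have [Oy r0 rR cB] := gB; have [oB BO mB [B0 Boo] cpB] := qball_facts Oy r0 cB.
(* Poincare on radius r' involves the gradient on radius bfr r' = tau r, where eta_2 = 1. *)
pose r' := tau * r / bfr; rewrite -/r' in half hP' *.
have r'0 : 0 < r' by rewrite divr_gt0// mulr_gt0.
have br' : bfr * r' = tau * r by rewrite /r' mulrC divfK// gt_eqF.
have r'tr : r' <= tau * r by rewrite -br' ler_peMl// ltW.
have tr : tau * r <= r by rewrite ger_pMl// ltW.
have gB' : good_ball y r' := good_ball_le gB r'0 (le_trans r'tr tr).
have trr0 : 0 < tau * r by rewrite mulr_gt0.
have gBt : good_ball y (tau * r) := good_ball_le gB trr0 tr.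
have [_ _ r'R cB'] := gB'; have [oB' BO' mB' [B'0 B'oo] _] := qball_facts Oy r'0 cB'.
have [_ _ trR cBt] := gBt; have [oBt BOt mBt [Bt0 Btoo] _] := qball_facts Oy trr0 cBt.
have BtB : B y (tau * r) `<=` B y r := qball_sub tr.
have B'B : B y r' `<=` B y r := qball_sub (le_trans r'tr tr).
have uW := en_WQ ue; have [mu_ mgu _] := uW.
have muB := meas_onS mOm BO mu_. have muB' := meas_onS mOm BO' mu_.
have mdB := meas_onS mOm BO mdat.
have dB0 x : B y r x -> 0 <= dat x by move=> /BO/dat1; exact: le_trans.
have mXB : meas_on (B y r) (Qlen Q gu).
  by apply: (Qlen_meas mOm mQ symQ mB BO) => i; apply: (meas_onS mOm BO); exact: mgu.
(* Twofold role: zeta = 2c + M - u below M, and c is the height of the iteration from M - ep om up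
   to M - ep om / 2. *)
pose c := ep * om / 2.
have c0 : 0 < c by rewrite divr_gt0// mulr_gt0.
have eo0 : 0 < ep * om by rewrite mulr_gt0.
have eoL : ep * om <= L / 4.
  apply: (@le_trans _ _ (4^-1 * L)); last by rewrite mulrC.
  by apply: ler_pM => //; exact: ltW.
have zE v : v <= M -> zeta c M v = ep * om + M - v.
  by move=> tM; rewrite zetaE// /c; field.
have gbd v := growth_bounds (v := v) om eo0 eoL L1' ML.
have [eta gc Lc] := core_L1 gB; have [Lu Ld] := Lc u gu ue.
have mS := core_meas gB gc.
have SB : core y r eta `<=` B y r by move=> x [].
have adj := cutoff_on_core gB gc (leqnn 2) Ld.
have logS : (Int (core y r eta) (fun x => (eta 2%N x ^+ m.+1 * zeta c M (u x) `^ (- p) * Qlen Q gu x `^ p)%R) <=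
   Cg%:E * Int (core y r eta) (fun x => (zeta c M (u x) `^ (- p) * (dat x * (3 * L) `^ p) + Qlen Q (grad (eta 2%N)) x `^ p)%R))%E.
  apply: (clog ue adj c0); first by rewrite mulr_ge0// (le_trans ler01).
  apply: filterS ub => x hx /SB/hx[h1 h2]; have [[b1 b2 _ _] _] := gbd _ h1 h2.
  by split; [exact: h1|rewrite (zE _ h1)|].
case: (gc) => ej etaj eta1 HD; have [le e01 sB LDe] := ej 2%N.
have e0 x : 0 <= eta 2%N x by have /andP[] := e01 x.
have eL : Lip_loc Omega (eta 2%N) by exact: lipschitz_Lip_loc.
have meB : meas_on (B y r) (eta 2%N) by apply: (meas_onS mOm BO); exact: (Lip_loc_meas oOm eL).
have mDB : meas_on (B y r) (Qlen Q (grad (eta 2%N))).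
  by apply: (Qlen_meas mOm mQ symQ mB BO) => i; apply: (meas_onS mOm BO); exact: (grad_meas oOm i eL).
have mzB : meas_on (B y r) (fun x => zeta c M (u x)) by apply: (mcomp muB); exact: zeta_continuous.
have z0 v : 0 < zeta c M v by exact: zeta_gt0.
pose f x := eta 2%N x ^+ m.+1 * zeta c M (u x) `^ (- p) * Qlen Q gu x `^ p.
pose g1 x := (ep * om)^-1 `^ p * (dat x * (3 * L) `^ p).
pose g2 x := Qlen Q (grad (eta 2%N)) x `^ p.
have mf : meas_on (B y r) f by rewrite /f; mfun.
have f0 x : B y r x -> 0 <= f x by move=> _; rewrite /f !mulr_ge0 ?exprn_ge0 ?powR_ge0.
have mg1 : meas_on (B y r) g1 by rewrite /g1; mfun.
have mg2 : meas_on (B y r) g2 by rewrite /g2; mfun.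
have g10 x : B y r x -> 0 <= g1 x by move=> Bx; rewrite /g1 !mulr_ge0 ?powR_ge0 ?dB0.
have g20 x : B y r x -> 0 <= g2 x by move=> _; exact: powR_ge0.
have mg12 : meas_on (B y r) (fun x => g1 x + g2 x) by mfun.
have g120 x : B y r x -> 0 <= g1 x + g2 x by move=> Bx; rewrite addr_ge0 ?g10 ?g20.
have fI : (Int (B y r) f <= Cg%:E * Int (B y r) (fun x => (g1 x + g2 x)%R))%E.
  rewrite (@Int_eq0_out (B y r) (core y r eta) f SB); last first.
    move=> x Bx nS; have xt : ~ tsupp (eta 2%N) x by move/(etaj 1%N isT).
    by rewrite /f (tsupp0 xt) expr0n /= !mul0r.
  apply: (le_trans logS); apply: lee_wpmul2l; first by rewrite lee_fin ltW.
  apply: le_trans (Int_subset mS mB SB mg12 g120).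
  have mzS := meas_onS mB SB mzB; have mdS := meas_onS mB SB mdB; have mDS := meas_onS mB SB mDB.
  apply: Int_le; [exact: mS|by mfun|exact: (meas_onS mB SB mg12)| |].
    by move=> x /SB Bx; rewrite addr_ge0 ?powR_ge0// !mulr_ge0 ?powR_ge0 ?dB0.
  apply: filterS ub => x hx /SB Bx; have [h1 h2] := hx Bx.
  rewrite lerD2r ler_wpM2r ?mulr_ge0 ?powR_ge0 ?dB0//.
  rewrite powRN powR_invr ?(ltW eo0)// lef_pV2 ?posrE ?powR_gt0//.
  apply: ge0_ler_powR; rewrite ?nnegrE ?(ltW p0) ?(ltW eo0) ?(ltW (z0 _))//.
  by rewrite (zE _ h1); have [[_ _ b3 _] _] := gbd _ h1 h2.
have rp0 : 0 < r `^ p by exact: powR_gt0.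
have q1' := q1.
have A1 : (Av (B y r) (fun x => (r `^ p * g1 x)%R) <= (3 `^ p)%:E)%E.
  pose h x := r `^ p * ((2 * L / (ep * om)) `^ p * dat x).
  have mh : meas_on (B y r) h by rewrite /h; mfun.
  have h0 x : B y r x -> 0 <= h x by move=> Bx; rewrite /h !mulr_ge0 ?powR_ge0 ?dB0.
  have J : (Av (B y r) (fun x => (h x `^ 1)%R) <= (1 `^ 1)%:E)%E.
    apply: (Av_jensen mB B0 Boo mh h0 ltr01 q1 ltr01).
    by rewrite powR1; exact: hP.
  rewrite powR1 in J.
  have p30 : 0 <= 3 `^ p :> R by exact: powR_ge0.
  apply: (@le_trans _ _ (Av (B y r) (fun x => (3 `^ p * h x `^ 1)%R))).
    apply: (Av_le mB B0 Boo); [by mfun|by mfun|by move=> x Bx; rewrite mulr_ge0 ?(ltW rp0) ?g10|].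
    apply: aeW => x Bx; rewrite powRr1 ?h0// /g1 /h.
    have L0 : 0 <= L by exact: le_trans L1'.
    have i0 : 0 <= (ep * om)^-1 by rewrite invr_ge0 ltW.
    have -> : (3 * L) `^ p = 3 `^ p * L `^ p by rewrite powRM.
    rewrite mulrCA [leRHS]mulrCA.
    have -> : (ep * om)^-1 `^ p * (r `^ p * (dat x * (3 `^ p * L `^ p))) =
      r `^ p * (3 `^ p * ((L * (ep * om)^-1) `^ p * dat x)) by rewrite powRM//; ring.
    rewrite ler_wpM2l ?(ltW rp0)// ler_wpM2l// ler_wpM2r ?dB0//.
    apply: ge0_ler_powR; rewrite ?nnegrE ?(ltW p0) ?mulr_ge0//.
    by rewrite ler_wpM2r// ler_peMl// ler1n.
  rewrite (AvZ mB) //; [|by mfun|by move=> x _; exact: powR_ge0].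
  have := lee_wpmul2l (p30 : (0 <= (3 `^ p)%:E)%E) J; by rewrite mule1.
have A2 : (Av (B y r) (fun x => (r `^ p * g2 x)%R) <= ((K * N ^+ 2) `^ p)%:E)%E.
  have -> : (fun x => r `^ p * g2 x) = (fun x => (r * Qlen Q (grad (eta 2%N)) x) `^ p).
    by apply/funext => x; rewrite (powRM _ (ltW r0) (Qlen_ge0 _ _ _)).
  have mr : meas_on (B y r) (fun x => r * Qlen Q (grad (eta 2%N)) x) by mfun.
  apply: (Av_jensen mB B0 Boo mr _ p0 _ _ (HD 2%N isT)).
  - by move=> x _; rewrite mulr_ge0 ?Qlen_ge0// ltW.
  - by rewrite ler_peMr// ltW.
  - by rewrite mulr_gt0// exprn_gt0.
have Af : (Av (B y r) (fun x => (r `^ p * f x)%R) <= C'%:E)%E.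
  rewrite (AvZ mB mf f0 (ltW rp0)).
  have fAv : (Av (B y r) f <= Cg%:E * Av (B y r) (fun x => (g1 x + g2 x)%R))%E.
    rewrite !AvE [X in (_ <= X)%E]muleCA; apply: lee_wpmul2l; last exact: fI.
    by rewrite lee_fin invr_ge0 fine_ge0// ltW.
  apply: (le_trans (lee_wpmul2l (ltW rp0 : (0 <= (r `^ p)%:E)%E) fAv)).
  rewrite muleCA /C' EFinM; apply: lee_wpmul2l; first by rewrite lee_fin ltW.
  rewrite -(AvZ mB mg12 g120 (ltW rp0)).
  have -> : (fun x => r `^ p * (g1 x + g2 x)) = (fun x => r `^ p * g1 x + r `^ p * g2 x).
    by apply/funext => x; rewrite mulrDr.
  rewrite (AvD mB); [|by mfun|by mfun|by move=> x Bx; rewrite mulr_ge0 ?(ltW rp0) ?g10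
    |by move=> x Bx; rewrite mulr_ge0 ?(ltW rp0) ?g20].
  by rewrite EFinD; exact: leeD.
have dbl : (mu (B y r : set T) <= kd%:E * mu (B y (tau * r) : set T))%E.
  have := @doubl y y r (tau * r) Oy Oy trr0 tr rR1; rewrite /kd.
  have -> : r / (tau * r) = tau^-1 by field; rewrite !gt_eqF.
  apply; exists y; split; exact: qball_center.
have Aft : (Av (B y (tau * r)) (fun x => (r `^ p * f x)%R) <= (kd * C')%:E)%E.
  apply: (Av_subset mBt mB Bt0 B0 Boo BtB _ _ (ltW kd0) dbl Af); first by mfun.
  by move=> x Bx; rewrite mulr_ge0 ?f0// ltW.
pose k := ln (ep * om + om / 2).
have eo20 : 0 < ep * om + om / 2 by rewrite addr_gt0// divr_gt0.
pose w x := k - ln (zeta c M (u x)).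
have wW := WQ_comp_adm oOm p1 mQ symQ bOm uW (adm_log_zeta M c0 k).
have wP := @poi y r' Oy r'0 r'R _ _ wW.
set gw := (fun y => _ *: gu y) in wP; rewrite br' in wP.
have [mw_ mgw _] := wW.
have mwB' : meas_on (B y r') w := meas_onS mOm BO' mw_.
have mXt : meas_on (B y (tau * r)) (Qlen Q gw).
  by apply: (Qlen_meas mOm mQ symQ mBt BOt) => i; apply: (meas_onS mOm BOt); exact: mgw.
have gwf : \forall x \ae mu, B y (tau * r) x -> r `^ p * `|Qlen Q gw x| `^ p <= r `^ p * f x.
  apply: filterS ub => x hx Bx; have [h1 h2] := hx (BtB _ Bx).
  rewrite ler_wpM2l ?(ltW rp0)// ger0_norm ?Qlen_ge0// /f (eta1 2%N x isT Bx) expr1n mul1r.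
  rewrite /gw QlenZ (dzetaE c h1) opprK mul1r ger0_norm ?invr_ge0 ?(ltW (z0 _))//.
  by rewrite powRM ?invr_ge0 ?(ltW (z0 _)) ?Qlen_ge0// (powR_invr _ (ltW (z0 _))) powRN.
have LX : (Lavg (B y (tau * r)) p%:E (Qlen Q gw) <= (r^-1 * (kd * C') `^ p^-1)%:E)%E.
  have kC0 : 0 <= kd * C' by rewrite mulr_ge0// ltW.
  rewrite Lavg_Av poweR_le_inv//; last 2 first.
  - by rewrite mulr_ge0 ?powR_ge0// invr_ge0 ltW.
  - by apply: (Av_ge0 Bt0 Btoo) => x _; exact: powR_ge0.
  have ri00 : 0 <= r^-1 by rewrite invr_ge0 ltW.
  rewrite (powRM p ri00 (powR_ge0 _ _)) (powRK kC0 pn0) (powR_invr p (ltW r0)).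
  have mAX : meas_on (B y (tau * r)) (fun x => `|Qlen Q gw x| `^ p) by mfun.
  have h1 : ((r `^ p)%:E * Av (B y (tau * r)) (fun x => (`|Qlen Q gw x| `^ p)%R) <= (kd * C')%:E)%E.
    rewrite -(AvZ mBt mAX); [|by move=> x _; exact: powR_ge0|exact: ltW].
    apply: le_trans Aft; apply: (Av_le mBt Bt0 Btoo _ _ _ gwf).
    + by mfun.
    + by have mft := meas_onS mB BtB mf; mfun.
    + by move=> x _; rewrite mulr_ge0 ?powR_ge0// ltW.
  have ri0 : (0 <= ((r `^ p)^-1)%:E)%E by rewrite lee_fin invr_ge0 ltW.
  by have := lee_wpmul2l ri0 h1; rewrite muleA -!EFinM mulVf ?gt_eqF// mul1e.
pose mb := avg (B y r') w.
have osc : (Av (B y r') (fun x => `|w x - mb|%R) <= C''%:E)%E.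
  have C2r : (0 <= (C2 * r')%:E)%E by rewrite lee_fin mulr_ge0// ltW.
  have := le_trans wP (lee_wpmul2l C2r LX).
  have -> : ((C2 * r')%:E * (r^-1 * (kd * C') `^ p^-1)%:E = C''%:E)%E.
    by rewrite -EFinM /C'' /r'; congr EFin; field; rewrite !gt_eqF.
  rewrite Lavg_Av poweR_le_inv ?ltr01 ?(ltW C''0)//; last by apply: (Av_ge0 B'0 B'oo) => x _; exact: powR_ge0.
  rewrite powRr1 ?(ltW C''0)//.
  under eq_fun do rewrite (powRr1 (normr_ge0 _)).
  by move=> hh; exact: hh.
pose nf x : R := 1 - (M - om / 2 < u x)%R%:R.
pose na x : R := (M - ep * om < u x)%R%:R.
have mnf : meas_on (B y r') nf.
  by rewrite /nf; have := mind (M - om / 2) mB' muB' => ?; mfun.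
have mna : meas_on (B y r') na by exact: (mind _ mB' muB').
have nf01 x : 0 <= nf x <= 1.
  by rewrite /nf; case: (_ < _); rewrite ?subrr ?subr0 ?lexx ?ler01.
have na01 x : 0 <= na x <= 1 by rewrite ler0n lern1 leq_b1.
have La1 : 0 < La by [].
have Ana : (Av (B y r') na <= (4 * C'' / La)%:E)%E.
  apply: (mean_oscillation mB' B'0 B'oo mwB' mnf mna nf01 na01 La0 (ltW C''0) _ _ half osc).
  - apply: filterS ub => x hx Bx; have [h1 h2] := hx (B'B _ Bx).
    rewrite /nf; case: ltP => [_|ux _]; first by rewrite subrr eqxx.
    rewrite /w subr_le0 /k ler_ln ?posrE// (zE _ h1).
    by have [_ [b5 _ _]] := gbd _ h1 h2; exact: b5.
  - apply: filterS ub => x hx Bx; have [h1 h2] := hx (B'B _ Bx).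
    rewrite /na; case: ltP => [ux _|_]; last by rewrite eqxx.
    rewrite /w /k -ln_div ?posrE// -(expRK La) ler_ln ?posrE ?expR_gt0 ?divr_gt0//.
    rewrite ler_pdivlMr// (zE _ h1).
    have eLa : expR La * (4 * ep) = 1.
      by rewrite /ep [4 * _]mulrC divfK// -expRD subrr expR0.
    have EL0 : 0 < expR La by exact: expR_gt0.
    have h3 : ep * om + M - u x <= 2 * (ep * om) by have [_ [_ b6 _]] := gbd _ h1 h2; exact: b6.
    apply: (le_trans (ler_wpM2l (ltW EL0) h3)).
    have -> : expR La * (2 * (ep * om)) = expR La * (4 * ep) * om / 2 by field.
    by rewrite eLa mul1r lerDr ltW.
have [eta' gc' Lc'] := core_L1 gB'; have [_ Ld'] := Lc' u gu ue.
case: (gc') => ej' etaj' _ _; have [le' e01' sB' LDe'] := ej' 2%N.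
have e0' x : 0 <= eta' 2%N x by have /andP[] := e01' x.
have eL' : Lip_loc Omega (eta' 2%N) by exact: lipschitz_Lip_loc.
have meB' : meas_on (B y r') (eta' 2%N) by apply: (meas_onS mOm BO'); exact: (Lip_loc_meas oOm eL').
have kE : M - ep * om / 2 = M - ep * om + c by rewrite /c; field.
rewrite kE.
have LcE : L / c = 2 * L / (ep * om) by rewrite /c; field; rewrite !gt_eqF.
(* The comparison factor is L/c because 1 + |u| <= L and the height is c. *)
apply: (SBd y r' eta' u gu (M - ep * om) c (L / c) gB' gc' ue Ld' _ c0).
- rewrite ler_pdivlMr// mul1r /c ler_pdivrMr//; apply: (le_trans eoL).
  by rewrite ler_pdivrMr// -mulrA ler_peMr ?(le_trans ler01 L1')// -natrM ler1n.
- move=> k1 k1ge k1le; apply: filterS ub => x hx [Bx _] ku; have [h1 h2] := hx (B'B _ Bx).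
  apply: (le_trans h2); apply: (@le_trans _ _ (L / c * c)); first by rewrite divfK// gt_eqF.
  apply: ler_wpM2l; first by rewrite divr_ge0 ?(le_trans ler01 L1')// ltW.
  by rewrite lerDl pospart_ge0.
- by rewrite LcE powR1; exact: hP'.
have mpw : meas_on (B y r') (fun x => pospart (u x - (M - ep * om))).
  apply: (mcomp (G := pospart) (f := fun x => u x - (M - ep * om))); last exact: pospart_continuous.
  by mfun.
apply: (@le_trans _ _ (Av (B y r') (fun x => ((2 * c) `^ (p * th) * na x)%R))).
  apply: (Av_le mB' B'0 B'oo).
  - by mfun.
  - by mfun.
  - by move=> x _; exact: powR_ge0.
  - apply: filterS ub => x hx Bx; have [h1 h2] := hx (B'B _ Bx).
    rewrite /na; case: ltP => [ux|ux]; last first.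
      by rewrite pospart_neg ?subr_le0// mulr0 powR0 ?mulr0// gt_eqF.
    rewrite mulr1 pospart_pos ?subr_ge0 ?(ltW ux)//.
    have pw0 : 0 <= u x - (M - ep * om) by rewrite subr_ge0 ltW.
    apply: ge0_ler_powR; [exact: ltW|exact: (mulr_ge0 (e0' x) pw0)|exact: (mulr_ge0 (ltW (ltr0Sn R 1)) (ltW c0))|].
    apply: (@le_trans _ _ (u x - (M - ep * om))).
      by have /andP[_ e1] := e01' x; rewrite ler_piMl.
    by have [[_ _ _ b4] _] := gbd _ h1 h2; exact: b4.
have na0 x : B y r' x -> 0 <= na x by move=> _; have /andP[] := na01 x.
rewrite (AvZ mB' mna na0 (powR_ge0 _ _)).
have cc0 : (0 <= ((2 * c) `^ (p * th))%:E)%E by rewrite lee_fin powR_ge0.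
apply: (le_trans (lee_wpmul2l cc0 Ana)); rewrite -EFinM lee_fin.
have c0' := ltW c0.
rewrite powRM// /La le_eqVlt; apply/orP; left; apply/eqP; field.
by rewrite !gt_eqF// powR_gt0.
Qed.

Let ka1 : 1 <= kappa. Proof. exact: qm.1. Qed.
Let ka0 : 0 < kappa. Proof. exact: lt_le_trans ka1. Qed.

Lemma oscillation_start (M v : R) : 0 < M -> `|v| <= M ->
  [/\ - M - 1 <= v <= - M - 1 + 2 * (1 + M), 1 + `|v| <= 2 * (1 + M), 1 <= 2 * (1 + M) & M + 1 <= 2 * (1 + M)].
Proof.
by move=> M0 vM; have := vM; rewrite ler_norml => /andP[h1 h2]; split; [apply/andP; split| | |]; lra.
Qed.

Lemma half_or (a b : R) : a + b = 1 -> 2^-1 <= b \/ 2^-1 <= a.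
Proof. by move=> ab; have [h|h] := leP 2^-1 b; [left|right; lra]. Qed.

Lemma upper_half_opp (mi om v : R) : mi + om - om / 2 < v -> (- mi - om / 2 < - v) = false.
Proof. by move=> h; apply/negbTE; rewrite -leNgt; lra. Qed.

Lemma oscillation_step (mi om ep thx v : R) : om * (1 - ep / 2) <= om * thx ->
  (v <= mi + om - ep * om / 2 -> v <= mi + om * thx) /\ (- v <= - mi - ep * om / 2 -> mi + om - om * thx <= v).
Proof. by move=> h; split => h1; lra. Qed.

(** Compactness for bounds that are local in the centre and stable under enlarging M; quasimetric
    balls serve as neighbourhoods since they are open. *)
Lemma cover_uniform (X : set V) (s : R) (P : R -> V -> Prop) : compact X -> X `<=` Omega -> 0 < s ->
  (forall y0, X y0 -> exists M0, forall M y, M0 <= M -> B y0 s y -> X y -> P M y) ->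
  exists2 M : R, 0 < M & forall y, X y -> P M y.
Proof.
move=> cX XO s0 h.
case: ((compact_near_coveringP X).1 cX R (pinfty_nbhs R) (fun M y => X y -> P M y) _).
  move=> y0 Xy0; have [M0 hM] := h y0 Xy0.
  exists (B y0 s, [set M : R | M0 < M]).
    split; last by exists M0; split => //; exact: num_real.
    apply: open_nbhs_nbhs; split; first exact: (@bo y0 s (XO _ Xy0)).
    exact: (qball_center (XO _ Xy0) s0).
  by move=> [y M] /= [By MM] Xy; apply: (hM M y) => //; exact: ltW.
move=> M [Mr hM]; exists (Num.max M 0 + 1); first by rewrite ltr_wpDl// le_max lexx orbT.
move=> y Xy; apply: (hM (Num.max M 0 + 1)) => //.
by rewrite ltr_pwDr// le_max lexx.
Qed.

Lemma qball_shift y0 y s : Omega y0 -> B y0 s y -> B y s `<=` B y0 (2 * kappa * s).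
Proof.
move=> Oy0 [Oy h1] z [Oz h2]; split => //.
have [_ _ _ tri] := qm.2 y0 z Oy0 Oz; have [_ sym _ _] := qm.2 z y Oz Oy.
apply: (le_lt_trans (tri y Oy)); rewrite sym (_ : 2 * kappa * s = kappa * (s + s)); last by ring.
by rewrite ltr_pM2l// ltrD.
Qed.

Lemma qball_sym y0 y s : Omega y0 -> B y0 s y -> B y s y0.
Proof. by move=> Oy0 [Oy h]; split => //; have [_ <- _ _] := qm.2 y0 y Oy0 Oy. Qed.

(** * Uniform constants over a compact set and decay of the oscillation *)

Section uniform.
Variables (X : set V) (s : R).
Hypotheses (cX : compact X) (XO : X `<=` Omega) (s0 : 0 < s)
  (gX : forall y, X y -> good_ball y s /\ s < R1 y).
(** Chosen so that a ball of radius [s1] centred in B(y0, s1) stays inside B(y0, tau s), where the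
    local bounds at y0 are available. *)
Let s1 := tau * s / (2 * kappa).

Let k20 : 0 < 2 * kappa. Proof. by rewrite mulr_gt0. Qed.
Lemma s1_gt0 : 0 < s1. Proof. by rewrite divr_gt0// mulr_gt0. Qed.
Let s1E : 2 * kappa * s1 = tau * s. Proof. by rewrite /s1 mulrC divfK// gt_eqF. Qed.
Let ts : tau * s <= s. Proof. by rewrite ger_pMl// ltW. Qed.
Lemma s1_le : s1 <= s.
Proof.
rewrite ler_pdivrMr//; apply: (le_trans ts); rewrite ler_peMr ?(ltW s0)//.
by have := ka1; lra.
Qed.

(** Doubling compares B(y, r) with B(y, s). The latter contains a fixed ball about any nearby y0, so
    its measure is bounded below locally, and uniformly by compactness. *)
Lemma meas_lower : exists2 cm : R, 0 < cm & forall y r, X y -> 0 < r -> r <= s ->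
  cm * r `^ d0 <= fine (mu (B y r : set T)).
Proof.
have H y0 : X y0 -> exists M0, forall M y, M0 <= M -> B y0 s1 y -> X y -> (M^-1%:E <= mu (B y s : set T))%E.
  move=> Xy0; have [gy0 _] := gX Xy0; have [Oy0 _ _ _] := gy0.
  have s10 := s1_gt0.
  have gs1 := good_ball_le gy0 s10 s1_le; have [_ _ _ cB1] := gs1.
  have [_ _ mB1 [B10 B1oo] _] := qball_facts Oy0 s10 cB1.
  have fE : mu (B y0 s1 : set T) = (fine (mu (B y0 s1 : set T)))%:E by rewrite fineK// ge0_fin_numE// ltW.
  have f0 : 0 < fine (mu (B y0 s1 : set T)) by rewrite fine_gt0// B10.
  exists (fine (mu (B y0 s1 : set T)))^-1 => M y MM By Xy.
  have [gy _] := gX Xy; have [Oy _ _ cB] := gy.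
  have [_ _ mB _ _] := qball_facts Oy s0 cB.
  apply: (@le_trans _ _ (mu (B y0 s1 : set T))).
    rewrite fE lee_fin -[leRHS]invrK lef_pV2 ?posrE ?invr_gt0//.
    by rewrite (lt_le_trans _ MM)// invr_gt0.
  apply: le_measure; rewrite ?inE//.
  apply: (subset_trans (qball_shift Oy (qball_sym Oy0 By))).
  by rewrite s1E; exact: qball_sub.
have [M M0 hM] := @cover_uniform X s1 (fun M y => (M^-1%:E <= mu (B y s : set T))%E) cX XO s1_gt0 H.
exists (M^-1 / C0 / s `^ d0); first by rewrite !divr_gt0 ?invr_gt0 ?powR_gt0.
move=> y r Xy r0 rs; have [gy sR1] := gX Xy; have [Oy _ _ _] := gy.
have gr := good_ball_le gy r0 rs; have [_ _ _ cBr] := gr.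
have [_ _ mBr [Br0 Broo] _] := qball_facts Oy r0 cBr.
have h1 := hM y Xy.
have h2 : (mu (B y s : set T) <= (C0 * (s / r) `^ d0)%:E * mu (B y r : set T))%E.
  by apply: (@doubl y y s r Oy Oy r0 rs sR1); exists y; split; exact: qball_center.
have fE : mu (B y r : set T) = (fine (mu (B y r : set T)))%:E by rewrite fineK// ge0_fin_numE// ltW.
have := le_trans h1 h2; rewrite fE -EFinM lee_fin powRM ?invr_ge0 ?(ltW s0) ?(ltW r0)//.
rewrite (powR_invr d0 (ltW r0)).
have sd : 0 < s `^ d0 by exact: powR_gt0.
have rd : 0 < r `^ d0 by exact: powR_gt0.
move: (s `^ d0) (r `^ d0) (fine _) sd rd => a b f a0 b0 h.
rewrite /= (_ : M^-1 / C0 / a * b = M^-1 / (C0 * (a / b))); last by field; rewrite !gt_eqF.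
by rewrite ler_pdivrMr ?mulr_gt0 ?invr_gt0// mulrC.
Qed.

Lemma dat_upper : exists2 I : R, 0 < I & forall y r, X y -> 0 < r -> r <= s1 ->
  (Int (B y r) (fun x => (dat x `^ qd)%R) <= I%:E)%E.
Proof.
have H y0 : X y0 -> exists M0, forall M y, M0 <= M -> B y0 s1 y -> X y -> (Int (B y s1) (fun x => (dat x `^ qd)%R) <= M%:E)%E.
  move=> Xy0; have [gy0 _] := gX Xy0; have [Oy0 _ _ cB0] := gy0.
  have [_ BO0 mB0 _ _] := qball_facts Oy0 s0 cB0.
  have [md dd0 doo] := closure_qball_meas gy0.
  exists (fine (Int (B y0 s) (fun x => (dat x `^ qd)%R))) => M y MM By Xy.
  have fE : Int (B y0 s) (fun x => (dat x `^ qd)%R) = (fine (Int (B y0 s) (fun x => (dat x `^ qd)%R)))%:E.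
    by rewrite fineK// ge0_fin_numE// Int_ge0.
  apply: (@le_trans _ _ (Int (B y0 s) (fun x => (dat x `^ qd)%R))); last by rewrite fE lee_fin.
  have [gy _] := gX Xy; have gs1 := good_ball_le gy s1_gt0 s1_le; have [Oy _ _ cB1] := gs1.
  have [_ BO1 mB1 _ _] := qball_facts Oy s1_gt0 cB1.
  apply: (Int_subset mB1 mB0 _ md dd0).
  apply: (subset_trans (qball_shift Oy0 By)).
  by rewrite s1E; exact: qball_sub.
have [M M0 hM] := @cover_uniform X s1 (fun M y => (Int (B y s1) (fun x => (dat x `^ qd)%R) <= M%:E)%E) cX XO s1_gt0 H.
exists M => // y r Xy r0 rs; apply: le_trans (hM y Xy).
have [gy _] := gX Xy; have gs1 := good_ball_le gy s1_gt0 s1_le; have [Oy _ _ cB1] := gs1.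
have gr := good_ball_le gs1 r0 rs; have [_ _ _ cBr] := gr.
have [_ BO1 mB1 _ _] := qball_facts Oy s1_gt0 cB1; have [_ _ mBr _ _] := qball_facts Oy r0 cBr.
have md := meas_onS mOm BO1 mdat.
by apply: (Int_subset mBr mB1 (qball_sub rs)); [by mfun|by move=> x _; exact: powR_ge0].
Qed.

Lemma uniform_bound u gu : en u gu -> exists2 M : R, 0 < M &
  forall y, X y -> \forall x \ae mu, B y s1 x -> `|u x| <= M.
Proof.
move=> ue; apply: (@cover_uniform X s1 (fun M y => \forall x \ae mu, B y s1 x -> `|u x| <= M) cX XO s1_gt0).
move=> y0 Xy0; have [gy0 _] := gX Xy0; have [Oy0 _ _ _] := gy0.
have [M0 M00 h] := loc_bounded gy0 ue.
exists M0 => M y MM By Xy; apply: filterS h => x h Bx; apply: le_trans MM; apply: h.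
by rewrite -s1E; exact: (qball_shift Oy0 By).
Qed.

Hypothesis d0q : d0 < p * qd.

(** Iterated growth lemma. The order of quantifiers carries the independence: the rates come first,
    the starting radius [s2] then depends on the measure and data constants, and the solution with
    its bound M comes last. *)
Lemma osc_decay : exists th' ka' : R, [/\ 0 < th' < 1, 0 < ka' < 1 &
  forall (cm I : R), 0 < cm -> 0 < I ->
    (forall y r, X y -> 0 < r -> r <= s -> cm * r `^ d0 <= fine (mu (B y r : set T))) ->
    (forall y r, X y -> 0 < r -> r <= s1 -> (Int (B y r) (fun x => (dat x `^ qd)%R) <= I%:E)%E) ->
  exists2 s2 : R, 0 < s2 <= s1 & forall u gu (M : R), en u gu -> 0 < M ->
    forall y, X y -> (\forall x \ae mu, B y s1 x -> `|u x| <= M) ->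
    forall i, exists mi : R, \forall x \ae mu, B y (s2 * ka' ^+ i) x -> mi <= u x <= mi + 2 * (1 + M) * th' ^+ i].
Proof.
have [ep /andP[ep0 ep4] gr] := growth.
have b0 : 0 < bfr by exact: lt_le_trans bfr1.
(* One use of [growth] shrinks the radius by tau / bfr for Poincare and again by tau for the
   iteration. *)
pose ka' := tau * (tau / bfr).
have tb1 : tau / bfr <= tau by rewrite ler_pdivrMr// ler_peMr// ltW.
have tb0 : 0 < tau / bfr by rewrite divr_gt0.
have ka'0 : 0 < ka' by rewrite mulr_gt0.
have ka'1 : ka' < 1.
  apply: (le_lt_trans _ tau1); rewrite /ka' ger_pMr//.
  by apply: (le_trans tb1); exact: ltW.
have qd0 : 0 < qd by exact: lt_le_trans qqd.
pose E := p * qd.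
have E0 : 0 < E by rewrite mulr_gt0.
pose be := E - d0.
have be0 : 0 < be by rewrite subr_gt0.
(* The first entry is the contraction from [growth]. The second prevents th'^i from falling faster
   than the data allow: at radius ka'^i the data weigh (ka'^i)^be against (th'^i)^E. *)
pose th' := Num.max (1 - ep / 2) (ka' `^ (be / E)).
have e1 : 1 - ep / 2 < 1 by lra.
have e2 : ka' `^ (be / E) < 1.
  have e3 : 1 `^ (be / E) = 1 :> R by rewrite powR1.
  rewrite -[ltRHS]e3; apply: gt0_ltr_powR; rewrite ?nnegrE ?(ltW ka'0)//.
  by rewrite divr_gt0.
have th'1 : th' < 1 by rewrite /th' gt_max e1 e2.
have th'ep : 1 - ep / 2 <= th' by rewrite le_max lexx.
have th'ka : ka' `^ (be / E) <= th' by rewrite le_max lexx orbT.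
have th'0 : 0 < th' by apply: lt_le_trans th'ep; lra.
exists th', ka'; split; [by rewrite th'0|by rewrite ka'0|].
move=> cm I cm0 I0 hcm hI.
have s10 := s1_gt0.
(* smallness of the starting radius, independent of the solution *)
pose Q0 := (2 / ep) `^ E * (I / cm).
have Q00 : 0 < Q0 by rewrite mulr_gt0 ?powR_gt0 ?divr_gt0.
pose s2 := Num.min s1 (Q0^-1 `^ be^-1).
have s20 : 0 < s2 by rewrite lt_min s10 powR_gt0// invr_gt0.
have s2s1 : s2 <= s1 by rewrite ge_min lexx.
have s2Q : Q0 * s2 `^ be <= 1.
  rewrite -ler_pdivlMl// mulr1; apply: (@le_trans _ _ ((Q0^-1 `^ be^-1) `^ be)).
    by apply: ge0_ler_powR; rewrite ?nnegrE ?powR_ge0 ?(ltW be0) ?(ltW s20)// ge_min lexx orbT.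
  by rewrite powRK ?invr_ge0 ?(ltW Q00)// gt_eqF.
exists s2; first by rewrite s20.
move=> u gu M ue M0 y Xy uM.
have [gy sR1] := gX Xy; have [Oy _ _ _] := gy.
pose L := 2 * (1 + M).
(* With oscillation L th'^i the ratio 2L / (ep om) no longer contains L, hence not M: the smallness
   of the data is the same for all solutions. *)
have small r i : 0 < r -> r <= s2 * ka' ^+ i ->
    (Av (B y r) (fun x => ((r `^ p * ((2 * L / (ep * (L * th' ^+ i))) `^ p * dat x)) `^ q)%R) <= 1%:E)%E.
  move=> r0 rle; have ki : 0 <= ka' ^+ i by rewrite exprn_ge0// ltW.
  have ki1 : ka' ^+ i <= 1 by rewrite exprn_ile1// ltW.
  have rs1 : r <= s1 by apply: (le_trans rle); apply: le_trans s2s1; rewrite ger_pMr.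
  have rs : r <= s := le_trans rs1 s1_le.
  have [_ _ _ cBr] := good_ball_le gy r0 rs.
  have [_ BO mB [B0 Boo] _] := qball_facts Oy r0 cBr.
  have md := meas_onS mOm BO mdat.
  have d00' x : B y r x -> 0 <= dat x by move=> /BO/dat1; exact: le_trans.
  have thi : 0 < th' ^+ i by rewrite exprn_gt0.
  have L0 : 0 < L by rewrite mulr_gt0// addr_gt0.
  pose La := 2 * L / (ep * (L * th' ^+ i)).
  have LaE : La = 2 / ep * (th' ^+ i)^-1 by rewrite /La; field; rewrite !gt_eqF.
  have La0 : 0 < La by rewrite LaE mulr_gt0 ?divr_gt0 ?invr_gt0.
  rewrite -/La.
  have mh : meas_on (B y r) (fun x => r `^ p * (La `^ p * dat x)) by mfun.
  have h0 x : B y r x -> 0 <= r `^ p * (La `^ p * dat x) by move=> Bx; rewrite !mulr_ge0 ?powR_ge0 ?d00'.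
  have q11 : 1 `^ q = 1 :> R by rewrite powR1.
  rewrite -[X in (_ <= X%:E)%E]q11.
  apply: (Av_jensen mB B0 Boo mh h0 q0 qqd ltr01).
  rewrite powR1.
  have mdq : meas_on (B y r) (fun x => dat x `^ qd) by mfun.
  have eqx x : B y r x -> (r `^ p * (La `^ p * dat x)) `^ qd = (r `^ p * La `^ p) `^ qd * dat x `^ qd.
    move=> Bx; rewrite mulrA; apply: powRM; last exact: d00'.
    by apply: mulr_ge0; exact: powR_ge0.
  have -> : Av (B y r) (fun x => ((r `^ p * (La `^ p * dat x)) `^ qd)%R) =
      Av (B y r) (fun x => ((r `^ p * La `^ p) `^ qd * dat x `^ qd)%R).
    apply/eqP; rewrite eq_le; apply/andP; split; apply: (Av_le mB B0 Boo); try (by mfun).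
    - by move=> x _; exact: powR_ge0.
    - by apply: aeW => x Bx; rewrite eqx.
    - by move=> x _; rewrite mulr_ge0 ?powR_ge0.
    - by apply: aeW => x Bx; rewrite eqx.
  rewrite (AvZ mB mdq) ?powR_ge0//; last by move=> x _; exact: powR_ge0.
  have fm0 : 0 < fine (mu (B y r : set T)) by rewrite fine_gt0// B0.
  have rd0 : 0 < r `^ d0 by exact: powR_gt0.
  have hAv : (Av (B y r) (fun x => (dat x `^ qd)%R) <= (I / (cm * r `^ d0))%:E)%E.
    apply: (Int_Av B0 Boo); apply: (le_trans (hI y r Xy r0 rs1)); rewrite lee_fin.
    rewrite mulrC -mulrA ler_peMr ?(ltW I0)//.
    by rewrite mulrC ler_pdivlMr ?mulr_gt0// mul1r; exact: hcm.
  have k0 : (0 <= ((r `^ p * La `^ p) `^ qd)%:E)%E by rewrite lee_fin powR_ge0.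
  apply: (le_trans (lee_wpmul2l k0 hAv)); rewrite -EFinM lee_fin.
  rewrite powRM ?powR_ge0// -!powRrM -/E LaE.
  have -> : r `^ E = r `^ be * r `^ d0.
    have e3 : be + d0 = E by rewrite /be subrK.
    by rewrite -{1}e3 powRD// e3 (gt_eqF E0).
  have ep20 : 0 <= 2 / ep by rewrite divr_ge0// ltW.
  have ti0 : 0 <= (th' ^+ i)^-1 by rewrite invr_ge0 ltW.
  rewrite (powRM E ep20 ti0) (powR_invr E (ltW thi)).
  have -> : r `^ be * r `^ d0 * ((2 / ep) `^ E * ((th' ^+ i) `^ E)^-1) * (I / (cm * r `^ d0)) =
     Q0 * r `^ be / (th' ^+ i) `^ E.
    by rewrite /Q0; field; rewrite !gt_eqF// powR_gt0.
  rewrite ler_pdivrMr ?powR_gt0// mul1r.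
  have rbe : r `^ be <= s2 `^ be * (ka' ^+ i) `^ be.
    rewrite -(powRM be (ltW s20) ki); apply: ge0_ler_powR; rewrite ?nnegrE ?(ltW be0) ?(ltW r0)//.
    by rewrite mulr_ge0// ltW.
  have kth : (ka' ^+ i) `^ be <= (th' ^+ i) `^ E.
    rewrite !powR_exprn ?(ltW ka'0) ?(ltW th'0)//; apply: lerXn2r; rewrite ?nnegrE ?powR_ge0//.
    have -> : be = be / E * E by rewrite divfK// gt_eqF.
    rewrite powRrM; apply: ge0_ler_powR; rewrite ?nnegrE ?powR_ge0 ?(ltW E0) ?(ltW th'0)//.
  apply: (le_trans (ler_wpM2l (ltW Q00) rbe)).
  rewrite mulrA; apply: (@le_trans _ _ (1 * (ka' ^+ i) `^ be)); last by rewrite mul1r.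
  by rewrite ler_wpM2r ?powR_ge0.
have L0 : 0 < L by rewrite mulr_gt0// addr_gt0.
(* The extra bounds keep each enclosing interval within [-M-1, M+1], so its top, and the top of its
   reflection for -u, remain below L as [growth] requires. *)
suff claim i : exists mi : R, [/\ - M - 1 <= mi, mi + L * th' ^+ i <= M + 1 &
    \forall x \ae mu, B y (s2 * ka' ^+ i) x -> mi <= u x <= mi + L * th' ^+ i].
  by move=> i; have [mi [_ _ h]] := claim i; exists mi.
elim: i => [|i [mi [m1 m2 IH]]].
  exists (- M - 1); split; [by []|by rewrite expr0 /L; lra|].
  apply: filterS uM => x h; rewrite expr0 !mulr1 => Bx.
  have : `|u x| <= M by apply: h; exact: (qball_sub s2s1).
  by case/(oscillation_start M0).
pose r := s2 * ka' ^+ i.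
have r0 : 0 < r by rewrite mulr_gt0// exprn_gt0.
have rs2 : r <= s2 by rewrite ger_pMr// exprn_ile1// ltW.
have rs1 : r <= s1 := le_trans rs2 s2s1.
have rs : r <= s := le_trans rs1 s1_le.
have gr_ := good_ball_le gy r0 rs.
pose r' := tau * r / bfr.
have r'0 : 0 < r' by rewrite divr_gt0// mulr_gt0.
have r'r : r' <= r.
  by rewrite /r' mulrAC ger_pMl//; apply: (le_trans tb1); exact: ltW.
have rS : tau * r' = s2 * ka' ^+ i.+1 by rewrite /r' /r /ka' exprS; ring.
pose om := L * th' ^+ i.
have om0 : 0 < om by rewrite mulr_gt0// exprn_gt0.
have omL : om <= L by rewrite ger_pMr// exprn_ile1// ltW.
have omS : L * th' ^+ i.+1 = om * th' by rewrite /om exprSr mulrA.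
have omth : om * (1 - ep / 2) <= om * th' by rewrite ler_wpM2l// ltW.
have omth1 : om * th' <= om by rewrite ger_pMr// ltW.
have rR1 : r < R1 y by exact: le_lt_trans sR1.
have ub : \forall x \ae mu, B y r x -> [/\ mi <= u x, u x <= mi + om & 1 + `|u x| <= L].
  apply: filterS2 IH uM => x h1 h2 Bx; have /andP[h3 h4] := h1 Bx; split => //.
  by have [] := oscillation_start M0 (h2 (qball_sub rs1 Bx)).
have [_ _ _ cB'] := good_ball_le gr_ r'0 r'r.
have [_ BO' mB' [B'0 B'oo] _] := qball_facts Oy r'0 cB'.
have uW := en_WQ ue; have [mu_ _ _] := uW.
have muB' := meas_onS mOm BO' mu_.
have M0' : `|0 : R| <= M by rewrite normr0 ltW.
have [_ _ L1' ML] := oscillation_start M0 M0'.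
pose cc := mi + om - om / 2.
pose chi x : R := (cc < u x)%R%:R.
have mchi : meas_on (B y r') chi by exact: (mind cc mB' muB').
have chi01 x : 0 <= chi x <= 1 by rewrite ler0n lern1 leq_b1.
have m1chi : meas_on (B y r') (fun x => 1 - chi x) by mfun.
have sum1 : (Av (B y r') chi + Av (B y r') (fun x => (1 - chi x)%R) = 1%:E)%E.
  rewrite -(AvD mB' mchi m1chi); last 2 first.
  - by move=> x _; have /andP[] := chi01 x.
  - by move=> x _; have /andP[_ h] := chi01 x; rewrite subr_ge0.
  rewrite -(Av_cst mB' B'0 B'oo 1); congr Av; apply/funext => x; ring.
have half : ((2^-1)%:E <= Av (B y r') (fun x => (1 - chi x)%R))%E \/ ((2^-1)%:E <= Av (B y r') chi)%E.
  have a0 : (0 <= Av (B y r') chi)%E by apply: (Av_ge0 B'0 B'oo) => x _; have /andP[] := chi01 x.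
  have b0' : (0 <= Av (B y r') (fun x => (1 - chi x)%R))%E.
    by apply: (Av_ge0 B'0 B'oo) => x _; have /andP[_ h] := chi01 x; rewrite subr_ge0.
  move: sum1 a0 b0'; case: (Av _ chi) => [a| |]//; case: (Av _ _) => [b| |]//.
  rewrite -EFinD => -[ab]; rewrite !lee_fin => a0 b0'.
  exact: half_or.
have sm1 := small r i r0 (lexx _).
have sm2 := small r' i r'0 r'r.
(* In the first case the top of the interval descends, in the second, through -u, its bottom
   rises. *)
case: half => half.
- have := gr y r u gu (mi + om) om L gr_ rR1 ue om0 omL L1' _ _ half sm1 sm2.
  rewrite -/r' rS => h; exists mi; split => //.
    by rewrite omS; apply: le_trans m2; rewrite lerD2l.
  have /h {}h : mi + om <= L := le_trans m2 ML.
  have {}h : \forall x \ae mu, B y (s2 * ka' ^+ i.+1) x -> u x <= mi + om - ep * om / 2.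
    by apply: h; apply: filterS ub => x hx Bx; have [h1 h2 h3] := hx Bx.
  apply: filterS2 h ub => x h1 h2 Bx.
  have Br : B y r x by move: Bx; rewrite -rS; apply: qball_sub; apply: le_trans r'r; rewrite ger_pMl// ltW.
  have [h3 h4 _] := h2 Br; rewrite h3 /= omS.
  exact: ((oscillation_step _ _ omth).1 (h1 Bx)).
- have half' : ((2^-1)%:E <= Av (B y r') (fun x => (1 - (- mi - om / 2 < - u x)%R%:R)%R))%E.
    apply: (le_trans half); have mnu := mN muB'.
    apply: (Av_le mB' B'0 B'oo mchi).
    + by have := mind (- mi - om / 2) mB' mnu => ?; mfun.
    + by move=> x _; have /andP[] := chi01 x.
    + apply: aeW => x _; rewrite /chi /cc; case: ltP => h1; last by case: (_ < _); rewrite ?subrr ?subr0 ?ler01.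
      by rewrite (upper_half_opp h1) subr0.
  have := gr y r (fun x => - u x) (fun x => - gu x) (- mi) om L gr_ rR1 (en_opp ue) om0 omL L1' _ _ half' sm1 sm2.
  rewrite -/r' rS => h; exists (mi + om - om * th'); split.
  + by apply: (le_trans m1); rewrite -addrA lerDl subr_ge0.
  + by rewrite omS subrK.
  have /h {}h : - mi <= L by apply: le_trans ML; rewrite lerNl opprD.
  have {}h : \forall x \ae mu, B y (s2 * ka' ^+ i.+1) x -> - u x <= - mi - ep * om / 2.
    apply: h; apply: filterS ub => x hx Bx; have [h1 h2 h3] := hx Bx.
    by split; [rewrite lerN2|rewrite normrN].
  apply: filterS2 h ub => x h1 h2 Bx.
  have Br : B y r x by move: Bx; rewrite -rS; apply: qball_sub; apply: le_trans r'r; rewrite ger_pMl// ltW.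
  have [h3 h4 _] := h2 Br; rewrite omS subrK h4 andbT.
  exact: ((oscillation_step _ _ omth).2 (h1 Bx)).
Qed.

End uniform.
End balls.

(** * Hoelder continuity *)

Section null_sets.
Context {R : realType} {n : nat}.
Local Notation V := 'rV[R]_n.+1.
Local Notation T := (lebT R n).
Local Notation mu := (@leb R n).

Lemma outer_null_negligible (X : set V) : lebesgue_outer X = 0%E -> mu.-negligible X.
Proof.
move=> X0; exists X; split => //; apply: le_caratheodory_measurable => Y.
have h1 : (lebesgue_outer (Y `&` X) = 0)%E.
  apply/eqP; rewrite eq_le lebesgue_outer_ge0 andbT -X0.
  by apply: le_lebesgue_outer => x [].
by rewrite /= h1 add0e; apply: le_lebesgue_outer => x [].
Qed.

End null_sets.

Section conclusion.
Context {R : realType} {n : nat}.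
Local Notation V := 'rV[R]_n.+1.
Local Notation T := (lebT R n).
Local Notation mu := (@leb R n).
Local Notation rb := (@rbox R n).

Lemma negligible_outer0 (X : set V) : mu.-negligible X -> lebesgue_outer X = 0%E.
Proof.
move=> [Y [_ Y0 XY]]; apply/eqP; rewrite eq_le lebesgue_outer_ge0 andbT -Y0.
exact: le_lebesgue_outer.
Qed.

Lemma ae_forall_count (I : countType) (P : I -> V -> Prop) :
  (forall i, \forall x \ae mu, P i x) -> \forall x \ae mu, forall i, P i x.
Proof.
move=> h; have : \forall x \ae mu, forall k, if unpickle k is Some i then P i x else True.
  by apply/ae_foralln => k; case: unpickle => [i|]; [exact: h|exact: aeW].
by apply: filterS => x hx i; have := hx (pickle i); rewrite pickleK.
Qed.

(* Spares the computation of the measure of a box: either nonempty open sets have positive measure, or everything is null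
   and the theorem is void. *)
Lemma null_of_open_null (U : set V) : open U -> U !=set0 -> mu (U : set T) = 0%E ->
  lebesgue_outer [set: V] = 0%E.
Proof.
move=> oU [x0 Ux0] U0; apply: negligible_outer0.
have h : \forall x \ae mu, forall q, ~ U (x + (rb q).1).
  apply: ae_forall_count => q; apply: outer_null_negligible.
  rewrite (_ : ~` _ = [set x | U (x + (rb q).1)]); first by rewrite leb_translate.
  by apply/seteqP; split => x /=; [move/contrapT|move=> h /(_ h)].
apply: (negligibleS _ h) => x _ /= hx.
have nb (w : V) : nbhs (x0 - w) [set v | U (w + v)].
  have /nbhs_ballP[e e0 eU] : nbhs x0 U by exact: open_nbhs_nbhs.
  apply/nbhs_ballP; exists e => // v [_ vb]; apply: eU; split => // i j.
  by have := vb i j; rewrite /ball /= !mxE opprD addrA.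
have [q [/= qx cq]] := rbox_nbhs_open (nb x); apply: (hx q); apply: cq => i.
by have /andP[h1 h2] := qx i; rewrite lexx /= ltW// (lt_trans h1).
Qed.

Section holder.
Variables (Omega K : set V) (rho : V -> V -> R) (kappa : R).
Hypotheses (qm : quasimetric Omega rho kappa) (bo : qballs_open Omega rho)
  (cK : compact K) (KO : K `<=` Omega).
Local Notation B y r := (qball Omega rho y r).

Lemma expr_sandwich (ka z : R) : 0 < ka < 1 -> 0 < z <= 1 -> exists i, ka ^+ i.+1 < z <= ka ^+ i.
Proof.
move=> /andP[k0 k1] /andP[z0 z1].
have ex : exists i, ka ^+ i < z.
  have : ka ^+ i @[i --> \oo] --> (0 : R) by apply: cvg_expr; rewrite ger0_norm// ltW.
  move=> /cvgrPdist_lt /(_ z z0)[i _ h]; exists i; have := h i (leqnn i).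
  by rewrite /= sub0r normrN ger0_norm// exprn_ge0// ltW.
case: (ex_minnP ex) => -[|i] hi hm; first by move: hi; rewrite expr0 ltNge z1.
by exists i; rewrite hi /= leNgt; apply/negP => /hm; rewrite ltnn.
Qed.

(** One point of K in each rational box meeting K. The decay estimates hold off a null set depending
    on the centre, so only countably many centres may be used; they are dense for the quasimetric
    because its balls are open. *)
Lemma dense_centers : exists Y : V -> Prop, exists idx : 'rV[rat]_n.+1 * 'rV[rat]_n.+1 -> V, 
  (forall y, Y y -> K y /\ exists q, y = idx q) /\
  forall x r, K x -> 0 < r -> exists2 y, Y y & B x r y.
Proof.
have h q : exists y, (K `&` obox (rb q)) !=set0 -> (K `&` obox (rb q)) y.
  have [[y hy]|ne] := pselect ((K `&` obox (rb q)) !=set0); first by exists y.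
  by exists 0.
have [idx hidx] := choice h.
exists (fun y => K y /\ exists q, y = idx q), idx; split; first by [].
move=> x r Kx r0; have Ox := KO Kx.
have nb : nbhs x (B x r).
  apply: open_nbhs_nbhs; split; first exact: (@bo x r Ox).
  by split => //; have [_ _ [_ ->]] := qm.2 x x Ox Ox.
have [q [qx cq]] := rbox_nbhs_open nb.
have [Kq oq] : (K `&` obox (rb q)) (idx q) by apply: hidx; exists x.
exists (idx q); first by split => //; exists q.
by apply: cq => i; have /andP[h1 h2] := oq i; rewrite !ltW.
Qed.

Variables (s1 s2 th ka : R).
Hypotheses (s20 : 0 < s2) (s21 : s2 <= s1) (th01 : 0 < th < 1) (ka01 : 0 < ka < 1).
(** The exponent for which ka^m = th. *)
Let m := ln th / ln ka.

Lemma holder_exponent_gt0 : 0 < m.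
Proof.
have /andP[t0 t1] := th01; have /andP[k0 k1] := ka01.
rewrite /m -mulrNN -invrN mulr_gt0// ?invr_gt0 oppr_gt0 ln_lt0 ?t0 ?k0//.
Qed.

Lemma holder_exponentE i : (ka ^+ i) `^ m = th ^+ i.
Proof.
have /andP[t0 t1] := th01; have /andP[k0 k1] := ka01.
rewrite powR_exprn ?(ltW k0)//; congr (_ ^+ _).
rewrite /powR (gt_eqF k0) /m divfK ?lnK ?posrE//.
by rewrite lt_eqF// ln_lt0// k0.
Qed.

(** Two good points at distance r lie in a ball of radius 2 kappa r about a countable centre. If
    this radius is at most [s2], the decay at the matching scale applies; otherwise the bound M
    suffices. *)
Lemma holder_of_decay (u : V -> R) (M : R) : 0 < M ->
  (forall y, K y -> \forall x \ae mu, B y s1 x -> `|u x| <= M) ->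
  (forall y, K y -> forall i, exists mi : R, \forall x \ae mu,
     B y (s2 * ka ^+ i) x -> mi <= u x <= mi + 2 * (1 + M) * th ^+ i) ->
  exists2 C : R, 0 < C & (ess_holder_seminorm rho K m u <= C%:E)%E.
Proof.
move=> M0 hM hosc; have /andP[t0 t1] := th01; have /andP[k0 k1] := ka01.
have kap1 : 1 <= kappa := qm.1.
have kap0 : 0 < kappa by exact: lt_le_trans kap1.
have m0 := holder_exponent_gt0.
have [Y [idx [YK Yd]]] := dense_centers.
have hch (yi : V * nat) : exists mi : R, K yi.1 -> \forall x \ae mu,
    B yi.1 (s2 * ka ^+ yi.2) x -> mi <= u x <= mi + 2 * (1 + M) * th ^+ yi.2.
  by have [/hosc/(_ yi.2)[c hc]|] := pselect (K yi.1); [exists c|exists 0].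
have [mi hmi] := choice hch.
pose good x := forall y, Y y -> (B y s1 x -> `|u x| <= M) /\
  forall i, B y (s2 * ka ^+ i) x -> mi (y, i) <= u x <= mi (y, i) + 2 * (1 + M) * th ^+ i.
have aeg : \forall x \ae mu, good x.
  have h1 : \forall x \ae mu, forall q, Y (idx q) -> B (idx q) s1 x -> `|u x| <= M.
    apply: ae_forall_count => q; have [Yq|nY] := pselect (Y (idx q)); last by exact: aeW.
    by apply: filterS (hM _ (YK _ Yq).1) => x hx _.
  have h2 : \forall x \ae mu, forall qi : ('rV[rat]_n.+1 * 'rV[rat]_n.+1) * nat, Y (idx qi.1) ->
      B (idx qi.1) (s2 * ka ^+ qi.2) x ->
      mi (idx qi.1, qi.2) <= u x <= mi (idx qi.1, qi.2) + 2 * (1 + M) * th ^+ qi.2.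
    apply: ae_forall_count => qi; have [Yq|nY] := pselect (Y (idx qi.1)); last by apply: aeW => x /nY.
    by apply: filterS (hmi (idx qi.1, qi.2) (YK _ Yq).1) => x hx _.
  apply: filterS2 h1 h2 => x h1 h2 y Yy; have [_ [q yq]] := YK y Yy; subst y; split; first exact: h1.
  by move=> i; exact: (h2 (q, i)).
have d1 : 0 < 2 * M by exact: mulr_gt0.
have d2 : 0 < 2 * (1 + M) / th by apply: divr_gt0 => //; apply: mulr_gt0 => //; exact: addr_gt0.
have [c10 c20] := (ltW d1, ltW d2).
(* The first summand is for distant pairs, the second for close ones; 1/th is the loss between
   consecutive scales. *)
pose C := (2 * M + 2 * (1 + M) / th) * (2 * kappa / s2) `^ m.
have C0 : 0 < C.
  by apply: mulr_gt0; [exact: addr_gt0|apply: powR_gt0; apply: divr_gt0 => //; exact: mulr_gt0].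
exists C => //.
have pair x z : K x -> K z -> good x -> good z -> `|u x - u z| / rho x z `^ m <= C.
  move=> Kx Kz gx gz; have Ox := KO Kx; have Oz := KO Kz.
  have [rge sym [rz _] tri] := qm.2 x z Ox Oz.
  have [r0|r0] := eqVneq (rho x z) 0.
    by rewrite (rz r0) subrr normr0 mul0r ltW.
  have {rz}r0 : 0 < rho x z by rewrite lt_neqAle eq_sym r0.
  rewrite ler_pdivrMr ?powR_gt0// /C.
  set r := rho x z in r0 rge *.
  have -> : (2 * M + 2 * (1 + M) / th) * (2 * kappa / s2) `^ m * r `^ m =
      (2 * M + 2 * (1 + M) / th) * (2 * kappa * r / s2) `^ m.
    rewrite -mulrA -powRM ?(ltW r0)//; first by congr (_ * _ `^ _); rewrite mulrAC.
    by rewrite divr_ge0 ?mulr_ge0 ?(ltW kap0) ?(ltW s20).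
  (* A centre within r = rho(x, z) of x: by the quasi-triangle inequality z is within 2 kappa r of
     it, as is x. *)
  have [y Yy By] := Yd x r Kx r0; have [Ky _] := YK y Yy; have Oy := KO Ky.
  have [_ syx _ _] := qm.2 x y Ox Oy; have [_ _ _ triy] := qm.2 y z Oy Oz.
  have ryx : rho y x < r by rewrite -syx; exact: By.2.
  have xB : B y (2 * kappa * r) x.
    split => //; apply: (lt_le_trans ryx); rewrite ler_peMl ?(ltW r0)//.
    by rewrite (le_trans kap1)// ler_peMl ?(ltW kap0)// ler1n.
  have zB : B y (2 * kappa * r) z.
    split => //; apply: (le_lt_trans (triy x Ox)); rewrite -sym -/r.
    by rewrite -mulrA mulrCA ltr_pM2l// mulr2n mulrDl mul1r ltrD2r.
  have w0 : 0 < 2 * kappa * r / s2 by rewrite divr_gt0// mulr_gt0// mulr_gt0.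
  have [rs|rs] := leP (2 * kappa * r) s2.
    have w1 : 0 < 2 * kappa * r / s2 <= 1 by rewrite w0 ler_pdivrMr// mul1r.
    have [i /andP[i1 i2]] := expr_sandwich ka01 w1.
    have ri : 2 * kappa * r <= s2 * ka ^+ i by rewrite [leRHS]mulrC -ler_pdivrMr.
    have sub : B y (2 * kappa * r) `<=` B y (s2 * ka ^+ i).
      by move=> v [Ov hv]; split => //; exact: lt_le_trans ri.
    have /andP[a1 a2] := (gx y Yy).2 i (sub x xB); have /andP[b1 b2] := (gz y Yy).2 i (sub z zB).
    have h1 : `|u x - u z| <= 2 * (1 + M) * th ^+ i.
      rewrite ler_norml; apply/andP; split.
        by rewrite lerNl opprB lerBlDr (le_trans b2)// addrC lerD2l.
      by rewrite lerBlDr (le_trans a2)// addrC lerD2l.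
    apply: (le_trans h1).
    have h2 : th ^+ i.+1 <= (2 * kappa * r / s2) `^ m.
      rewrite -holder_exponentE; apply: ge0_ler_powR; rewrite ?nnegrE ?(ltW m0) ?(ltW w0)//.
        by rewrite exprn_ge0// ltW.
      exact: ltW.
    apply: (@le_trans _ _ (2 * (1 + M) / th * th ^+ i.+1)).
      by rewrite exprS mulrA divfK ?gt_eqF.
    apply: (le_trans (ler_wpM2l c20 h2)); rewrite ler_wpM2r ?powR_ge0//.
    by rewrite lerDr.
  have uM v : K v -> good v -> `|u v| <= M.
    move=> Kv gv; have Ov := KO Kv; have [c Yc Bc] := Yd v s2 Kv s20; have [Kc _] := YK c Yc.
    apply: ((gv c Yc).1); split => //; have [_ -> _ _] := qm.2 c v (KO Kc) Ov.
    exact: lt_le_trans Bc.2 s21.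
  have h1 : `|u x - u z| <= 2 * M.
    by rewrite (le_trans (ler_normB _ _))// mulr2n mulrDl mul1r lerD// uM.
  apply: (le_trans h1).
  have h2 : 1 <= (2 * kappa * r / s2) `^ m.
    have e1 : 1 `^ m = 1 :> R by rewrite powR1.
    rewrite -[leLHS]e1; apply: ge0_ler_powR; rewrite ?nnegrE ?(ltW m0) ?(ltW w0)//.
    by rewrite ler_pdivlMr// mul1r ltW.
  rewrite -[leLHS]mulr1; apply: ler_pM => //.
  by rewrite lerDl.
have [M1 M10 KM1] := bounded_setP (compact_bounded cK).
have KB : K `<=` box (const_mx (- (M1 + 1)), const_mx (M1 + 1)).
  move=> x Kx i; have := bounded_box M10 KM1 Kx i; rewrite !mxE => /andP[h1 h2].
  by apply/andP; split; lra.
(* An exceptional pair in K x K has one bad coordinate, so it lies in a product of the bounded K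
   with a null set. *)
have ng : lebesgue_outer (~` good) = 0%E := negligible_outer0 aeg.
have [n1 n2] := lebesgue_outer_setX0 KB ng.
apply/ess_supP.
have nU : (@leb R (n + n.+1)).-negligible (
    ([set w : 'rV[R]_(n.+1 + n.+1) | K (lsubmx w) /\ (~` good) (rsubmx w)] : set 'rV[R]_(n + n.+1).+1) `|`
    ([set w : 'rV[R]_(n.+1 + n.+1) | (~` good) (lsubmx w) /\ K (rsubmx w)] : set 'rV[R]_(n + n.+1).+1)).
  by apply: negligibleU; exact: outer_null_negligible.
apply: (negligibleS _ nU) => w /= nw.
apply: contrapT => /not_orP[/not_andP hl /not_andP hr]; apply: nw.
rewrite /patch; case: ifPn => [|_]; last by rewrite lee_fin ltW.
rewrite inE /= => -[Kl Kr]; rewrite lee_fin; apply: pair => //.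
- by case: hr => // /contrapT.
- by case: hl => // /contrapT.
Qed.

End holder.
End conclusion.

(** * Choice of exponents *)

Section exponents.
Context {R : realType}.
Implicit Types p q s : R.

(** Reduces possibly infinite integrability exponents to real ones while keeping the inequality
    strict. *)
Lemma lt_real_le s (x : \bar R) : (s%:E < x)%E -> exists2 r, s < r & (r%:E <= x)%E.
Proof.
case: x => [x| |]//; first by rewrite lte_fin => sx; exists x.
by move=> _; exists (s + 1); [rewrite ltrDl|rewrite leey].
Qed.

Lemma lt2_real_le s s' (x : \bar R) : (s%:E < x)%E -> (s'%:E < x)%E ->
  exists r, [/\ s < r, s' < r & (r%:E <= x)%E].
Proof.
move=> /lt_real_le[r1 sr1 r1x] /lt_real_le[r2 sr2 r2x].
have [h|h] := leP r1 r2.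
  by exists r2; split => //; exact: lt_le_trans h.
by exists r1; split => //; exact: lt_trans h.
Qed.

Lemma dual_exp_range p q : 1 < p -> dual_exp p < q ->
  [/\ 1 < q, 1 < dual_exp q, dual_exp q < p & q^-1 + (dual_exp q)^-1 = 1].
Proof.
move=> p1; rewrite /dual_exp ltr_pdivrMr ?subr_gt0// => h.
have q1 : 1 < q.
  rewrite ltNge; apply/negP => ql; move: h; apply/negP; rewrite -leNgt.
  apply: (@le_trans _ _ (1 * (p - 1))); last by lra.
  by rewrite ler_wpM2r// subr_ge0 ltW.
have q10 : 0 < q - 1 by rewrite subr_gt0.
split => //.
- by rewrite ltr_pdivlMr//; lra.
- by rewrite ltr_pdivrMr//; lra.
- by rewrite invf_div; field; rewrite gt_eqF// (lt_trans ltr01).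
Qed.
End exponents.

(** * Local integrability of the data, and the case of a vanishing measure *)

Section data_integrability.
Context {R : realType} {n : nat}.
Local Notation V := 'rV[R]_n.+1.
Local Notation T := (lebT R n).
Local Notation mu := (@leb R n).

Lemma L1_powRD (E : set V) (f g : V -> R) (s : R) : measurable (E : set T) -> 0 < s ->
  meas_on E f -> meas_on E g -> (forall x, E x -> 0 <= f x) -> (forall x, E x -> 0 <= g x) ->
  L1 E (fun x => f x `^ s) -> L1 E (fun x => g x `^ s) -> L1 E (fun x => (f x + g x) `^ s).
Proof.
move=> mE s0 mf mg f0 g0 Lf Lg.
apply: (L1_le mE _ _ _ (L1Z mE (powR_ge0 2 s) (L1D mE Lf Lg))); first by mfun.
  by move=> x _; exact: powR_ge0.
apply: aeW => x Ex; have [fx gx] := (f0 x Ex, g0 x Ex).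
wlog fg : f g x {mf mg f0 g0 Lf Lg Ex} fx gx / f x <= g x.
  move=> W; have [h|h] := leP (f x) (g x); first exact: W.
  by rewrite addrC [_ `^ s + _]addrC; apply: W => //; exact: ltW.
have h2 : 0 <= 2 :> R by [].
rewrite -/(2 `^ s * (f x `^ s + g x `^ s)).
apply: (@le_trans _ _ (2 `^ s * g x `^ s)).
  rewrite -(powRM s h2 gx); apply: ge0_ler_powR; rewrite ?nnegrE ?(ltW s0) ?addr_ge0 ?mulr_ge0//.
  by rewrite mulrDl mul1r lerD2r.
by rewrite ler_wpM2l ?powR_ge0// lerDr powR_ge0.
Qed.

Lemma data_L1 (Omega K : set V) (p qd : R) (cb cc cd ce cf cg ch : V -> R) (eB eH eD eC : \bar R) :
  (0 < mu setT)%E -> open Omega -> 1 < p -> 0 < qd ->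
  nonneg_meas Omega cb -> nonneg_meas Omega cc -> nonneg_meas Omega cd -> nonneg_meas Omega ce ->
  nonneg_meas Omega cf -> nonneg_meas Omega cg -> nonneg_meas Omega ch ->
  L_loc Omega eB cb -> L_loc Omega eB ce -> L_loc Omega eH ch -> L_loc Omega eH cg ->
  L_loc Omega eD cd -> L_loc Omega eD cf -> L_loc Omega eC cc ->
  ((dual_exp p * qd)%:E <= eB)%E -> (qd%:E <= eH)%E -> (qd%:E <= eD)%E -> ((p * qd)%:E <= eC)%E ->
  compact K -> K `<=` Omega -> L1 K (fun x => data p cb cc cd ce cf cg ch x `^ qd).
Proof.
move=> m0 oO p1 q0 b0 c0 d0 e0 f0 g0 h0 Lb Le Lh Lg Ld Lf Lc hB hH hD hC cK KO.
have mO : measurable (Omega : set T) by exact: open_measurable_Rn.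
have mK : measurable (K : set T) by exact: compact_measurable_Rn.
have Koo : (mu (K : set T) < +oo)%E by apply: bounded_leb_lty; exact: compact_bounded.
have p0 : 0 < p by exact: lt_trans p1.
have pp := dual_exp_gt0 p1.
have mm w : nonneg_meas Omega w -> meas_on K w by move=> [mw _]; exact: (meas_onS mO KO mw).
have pos w : nonneg_meas Omega w -> forall x, K x -> 0 <= w x by move=> [_ w0] x /KO; exact: w0.
have L w ex s : nonneg_meas Omega w -> L_loc Omega ex w -> 0 < s -> (s%:E <= ex)%E -> L1 K (fun x => w x `^ s).
  by move=> w0 Lw s0 sx; exact: (L_loc_pow m0 oO w0 Lw s0 sx cK KO).
have Lr w ex r : 0 < r -> nonneg_meas Omega w -> L_loc Omega ex w -> ((r * qd)%:E <= ex)%E ->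
    L1 K (fun x => (w x `^ r) `^ qd).
  move=> r0 w0 Lw sx; have := L w ex (r * qd) w0 Lw (mulr_gt0 r0 q0) sx.
  by congr L1; apply/funext => x; rewrite powRrM.
have P (f g : V -> R) : [/\ meas_on K f, (forall x, K x -> 0 <= f x) & L1 K (fun x => f x `^ qd)] ->
   [/\ meas_on K g, (forall x, K x -> 0 <= g x) & L1 K (fun x => g x `^ qd)] ->
   [/\ meas_on K (fun x => f x + g x), (forall x, K x -> 0 <= f x + g x) & L1 K (fun x => (f x + g x) `^ qd)].
  move=> [mf f0' Lf'] [mg g0' Lg']; split; [by mfun|by move=> x Kx; rewrite addr_ge0 ?f0' ?g0'|].
  exact: L1_powRD.
have mb := mm _ b0; have mc := mm _ c0; have me := mm _ e0.
suff [_ _] : [/\ meas_on K (data p cb cc cd ce cf cg ch), (forall x, K x -> 0 <= data p cb cc cd ce cf cg ch x) &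
  L1 K (fun x => data p cb cc cd ce cf cg ch x `^ qd)] by [].
apply: (P _ _ _ _); last first.
  apply: (P _ _ _ _); last by split; [exact: mm|exact: pos|exact: (L _ _ _ f0 Lf q0 hD)].
  apply: (P _ _ _ _); last by split; [exact: mm|exact: pos|exact: (L _ _ _ d0 Ld q0 hD)].
  apply: (P _ _ _ _); last by split; [by mfun|by move=> x _; exact: powR_ge0|exact: (Lr _ _ _ p0 c0 Lc hC)].
  apply: (P _ _ _ _); last by split; [by mfun|by move=> x _; exact: powR_ge0|exact: (Lr _ _ _ pp e0 Le hB)].
  by split; [by mfun|by move=> x _; exact: powR_ge0|exact: (Lr _ _ _ pp b0 Lb hB)].
apply: (P _ _ _ _); last by split; [exact: mm|exact: pos|exact: (L _ _ _ g0 Lg q0 hH)].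
apply: (P _ _ _ _); last by split; [exact: mm|exact: pos|exact: (L _ _ _ h0 Lh q0 hH)].
by split; [by mfun|by move=> x _; exact: ler01|apply: L1_cst; [exact: mK|exact: powR_ge0|exact: Koo]].
Qed.

Lemma ess_holder_null (rho : V -> V -> R) (K : set V) (m : R) (u : V -> R) : compact K ->
  lebesgue_outer [set: V] = 0%E -> (ess_holder_seminorm rho K m u <= 1%:E)%E.
Proof.
move=> cK T0; have [M1 M10 KM1] := bounded_setP (compact_bounded cK).
have KB : K `<=` box (const_mx (- (M1 + 1)), const_mx (M1 + 1)).
  move=> x Kx i; have := bounded_box M10 KM1 Kx i; rewrite !mxE => /andP[h1 h2].
  by apply/andP; split; lra.
have [n1 _] := lebesgue_outer_setX0 KB T0.
apply/ess_supP; apply: (negligibleS _ (outer_null_negligible n1)) => w /= nw; split => //.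
apply: contrapT => nK; apply: nw; rewrite /patch; case: ifPn => [|_]; last by rewrite lee_fin ler01.
by rewrite inE /= => -[].
Qed.

End data_integrability.

Theorem corollary3p12 (R : realType) (n : nat)
  (Omega : set 'rV[R]_n.+1) (p : R) (Q : 'rV[R]_n.+1 -> 'M[R]_n.+1)
  (rho : 'rV[R]_n.+1 -> 'rV[R]_n.+1 -> R) (kappa : R)
  (R0 R1 R2 r1 : 'rV[R]_n.+1 -> R) (C0 d0 : R)
  (C1 sigma C2 bfr : R)
  (sstar : \bar R) (Cs tau N : R) (t : \bar R)
  (A At : 'rV[R]_n.+1 -> R -> 'rV[R]_n.+1 -> 'rV[R]_n.+1)
  (B : 'rV[R]_n.+1 -> R -> 'rV[R]_n.+1 -> R)
  (gam psi del a : R) (b c d e f g h : 'rV[R]_n.+1 -> R)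
  (calB calH calD calC : \bar R) :
  domain Omega -> bounded_set Omega ->
  1 < p ->
  (forall i j, meas_on Omega (fun x => Q x i j)) ->
  (forall x, Omega x -> sym_nonneg (Q x)) ->
  L_loc Omega (p / 2)%:E (fun x => opnorm (Q x)) ->
  quasimetric Omega rho kappa ->
  qballs_open Omega rho ->
  rho_controls_euclidean Omega rho ->
  (forall x, Omega x -> 0 < R0 x) ->
  qballs_inside Omega rho R0 ->
  0 < C0 -> 0 < d0 ->
  (forall x, Omega x -> 0 < R1 x) ->
  local_doubling Omega rho C0 d0 R1 ->
  (forall x, Omega x -> 0 < R2 x) ->
  0 < C1 -> 1 < sigma ->
  sobolev Omega rho Q p R2 C1 sigma ->
  0 < C2 -> 1 <= bfr ->
  poincare Omega rho Q p R2 C2 bfr ->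
  ((p * dual_exp sigma)%:E < sstar)%E ->
  0 < Cs -> 0 < tau < 1 -> 0 < N ->
  (1 <= t)%E ->
  cutoffs Omega rho Q p R2 sstar Cs tau N t ->
  1 < gam < p -> 1 < del < p -> 1 < psi < p ->
  1 < a ->
  nonneg_meas Omega b -> nonneg_meas Omega c -> nonneg_meas Omega d ->
  nonneg_meas Omega e -> nonneg_meas Omega f -> nonneg_meas Omega g ->
  nonneg_meas Omega h ->
  structural Omega Q p A B gam psi del a At b c d e f g h ->
  L_loc Omega (sigma * p / (sigma * p - 1 - sigma * (psi - 1)))%:E c ->
  L_loc Omega (dual_exp p)%:E e ->
  L_loc Omega (dual_exp (sigma * p))%:E f ->
  L_loc Omega (sigma * p / (sigma * (p - 1) - gam + 1))%:E b ->
  L_loc Omega (p * sigma / (p * sigma - del))%:E d ->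
  L_loc Omega calB b -> L_loc Omega calB e ->
  ((maxr (dual_exp p * dual_exp sigma) (d0 / (p - 1)))%:E < calB)%E ->
  L_loc Omega calH h -> L_loc Omega calH g ->
  ((d0 / p)%:E < calH)%E -> ((dual_exp sigma)%:E < calH)%E ->
  L_loc Omega calD d -> L_loc Omega calD f ->
  ((d0 / p)%:E < calD)%E -> ((dual_exp sigma)%:E < calD)%E ->
  L_loc Omega calC c ->
  (d0%:E < calC)%E -> ((p * dual_exp sigma)%:E < calC)%E ->
  (forall x, Omega x ->
     [/\ 0 < r1 x, r1 x <= R0 x, r1 x <= R1 x, r1 x <= R2 x & r1 x <= 1]) ->
  (forall K : set 'rV[R]_n.+1, compact K -> K `<=` Omega ->
     exists2 s0 : R, 0 < s0 & forall y, K y -> s0 <= r1 y <= 1) ->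
  forall K : set 'rV[R]_n.+1, compact K -> K `<=` Omega ->
  exists2 mu : R, 0 < mu &
  forall (u : 'rV[R]_n.+1 -> R) (gu : 'rV[R]_n.+1 -> 'rV[R]_n.+1),
    weak_solution Omega Q p A B u gu ->
  exists2 C : R, 0 < C &
    (ess_holder_seminorm rho K mu u <= C%:E)%E.
Proof.
move=> [oOm _ _] bOm p1 mQ symQ _ qm bo rc R00 ins C00 d00 R10 doubl R20 C10 sg1 sob C20 bfr1 poi
  pss Cs0 tau01 N0 t1 cut gamp delp psip a1 b0 c0 d0' e0 f0 g0 h0 st _ _ _ _ _ Lb Le hB Lh Lg hH1 hH2
  Ld Lf hD1 hD2 Lc hC1 hC2 r1P r1K K cK KO.
have p0 : 0 < p by exact: lt_trans p1.
have p10 : 0 < p - 1 by rewrite subr_gt0.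
have [[U [oU Une U0]]|ntriv] := pselect (exists U : set 'rV[R]_n.+1,
    [/\ open U, U !=set0 & @leb R n (U : set (lebT R n)) = 0%E]).
  exists 1 => // u gu _; exists 1 => //.
  exact: (ess_holder_null _ _ _ cK (null_of_open_null oU Une U0)).
have mu_open (U : set 'rV[R]_n.+1) : open U -> U !=set0 -> (0 < @leb R n (U : set (lebT R n)))%E.
  move=> oU Une; rewrite lt_neqAle measure_ge0 andbT eq_sym; apply/eqP => U0.
  by apply: ntriv; exists U.
have musT : (0 < @leb R n setT)%E by apply: mu_open; [exact: openT|exists 0].
have pp := dual_exp_gt0 p1.
have ppE : d0 / (p - 1) / dual_exp p = d0 / p.
  by rewrite /dual_exp; field; rewrite !gt_eqF.
have [sB sB1 sB2] := lt_real_le hB.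
move: sB1; rewrite gt_max => /andP[sB1 sB3].
have [sH [sH1 sH2 sH3]] := lt2_real_le hH1 hH2.
have [sD [sD1 sD2 sD3]] := lt2_real_le hD1 hD2.
have [sC [sC1 sC2 sC3]] := lt2_real_le hC1 hC2.
have [sS sS1 sS2] := lt_real_le pss.
(* An exponent to which [dat] is locally integrable: b and e enter with power p' and c with power p,
   hence the two quotients. Each strict assumption on the coefficients becomes qd > sigma' together
   with qd > d0 / p. *)
pose qd := Num.min (Num.min (sB / dual_exp p) sH) (Num.min sD (sC / p)).
have qdB : qd <= sB / dual_exp p by rewrite !ge_min lexx.
have qdH : qd <= sH by rewrite !ge_min lexx orbT.
have qdD : qd <= sD by rewrite !ge_min lexx orbT.
have qdC : qd <= sC / p by rewrite !ge_min lexx !orbT.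
have qd1 : dual_exp sigma < qd.
  have hB' : dual_exp sigma < sB / dual_exp p by rewrite ltr_pdivlMr// mulrC.
  have hC' : dual_exp sigma < sC / p by rewrite ltr_pdivlMr// mulrC.
  by rewrite !lt_min hB' sH2 sD2.
have qd2 : d0 / p < qd.
  have hB' : d0 / p < sB / dual_exp p by rewrite -ppE ltr_pdivlMr// divfK// gt_eqF.
  have hC' : d0 / p < sC / p by rewrite ltr_pdivlMr// divfK// gt_eqF.
  by rewrite !lt_min hB' sH1 sD1.
(* Lowered so that p q <= [sstar], which the cutoff gradients need; still above sigma', so its
   conjugate lies strictly between 1 and sigma. *)
pose q := Num.min qd (sS / p).
have q1 : dual_exp sigma < q by rewrite lt_min qd1 ltr_pdivlMr// mulrC.
have qqd : q <= qd by rewrite ge_min lexx.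
have pqs : ((p * q)%:E <= sstar)%E.
  apply: le_trans sS2; rewrite lee_fin mulrC -ler_pdivlMr//.
  by rewrite ge_min lexx orbT.
have [q1' th1 ths qth] := dual_exp_range sg1 q1.
have q0 : 0 < q by exact: lt_trans q1'.
have qd0 : 0 < qd by exact: lt_le_trans qqd.
pose m := Num.bound (p - 1).
have pm : p - 1 <= m%:R by apply: ltW; apply: archi_boundP; exact: ltW.
pose dat := data p b c d e f g h.
pose en1 := energy Omega Q p a b c d e f g h.
(* Symmetrised, so that every estimate proved for u is also available for -u. *)
pose en u gu := en1 u gu /\ en1 (fun x => - u x) (fun x => - gu x).
have mdat : meas_on Omega dat := data_meas p b0 c0 d0' e0 f0 g0 h0.
have dat1 x : Omega x -> 1 <= dat x by move=> Ox; have [] := data_ge p b0 c0 d0' e0 f0 g0 h0 Ox.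
have en_WQ u gu : en u gu -> WQ Q p Omega u gu by move=> [[]].
have en_opp u gu : en u gu -> en (fun x => - u x) (fun x => - gu x).
  move=> [e1 e2]; split; first exact: e2.
  have -> : (fun x => - - u x) = u by apply/funext => x; rewrite opprK.
  by have -> : (fun x => - - gu x) = gu by apply/funext => x; rewrite opprK.
have en_weak u gu : weak_solution Omega Q p A B u gu -> en u gu.
  move=> us; split.
    exact: (energy_weak oOm p1 mQ symQ a1 b0 c0 d0' e0 f0 g0 h0 gamp delp psip st us).
  exact: (energy_weak oOm p1 mQ symQ a1 b0 c0 d0' e0 f0 g0 h0 gamp delp psip
    (structural_opp st) (weak_solution_opp oOm p1 mQ symQ us)).
have [Cl Cl0 clevel1] := cacc_level oOm p1 mQ symQ a1 b0 c0 d0' e0 f0 g0 h0 pm.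
have [Cg Cg0 clog1] := cacc_log oOm p1 mQ symQ a1 b0 c0 d0' e0 f0 g0 h0 pm.
have clevel u eta gu S k La H (eu : en u gu) := @clevel1 u eta gu S k La H eu.1.
have clog u eta gu S k M L (eu : en u gu) := @clog1 u eta gu S k M L eu.1.
have datq X : compact X -> X `<=` Omega -> L1 X (fun x => dat x `^ qd).
  move=> cX XO; apply: (data_L1 musT oOm p1 qd0 b0 c0 d0' e0 f0 g0 h0 Lb Le Lh Lg Ld Lf Lc _ _ _ _ cX XO).
  - by apply: le_trans sB2; rewrite lee_fin mulrC -ler_pdivlMr.
  - by apply: le_trans sH3; rewrite lee_fin.
  - by apply: le_trans sD3; rewrite lee_fin.
  - by apply: le_trans sC3; rewrite lee_fin mulrC -ler_pdivlMr.
(* The iteration wants a growth factor at least 1; enlarging N only weakens the cutoff bounds. *)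
pose N1 := Num.max N 1.
have N11 : 1 <= N1 by rewrite le_max lexx orbT.
have NN1 : N <= N1 by rewrite le_max lexx.
have [s0 s00 s0P] := r1K K cK KO.
(* Strictly below r1 on K, hence below R0, R1 and R2: one radius good for every centre in K. *)
pose s := s0 / 2.
have s_gt0 : 0 < s by rewrite divr_gt0.
have ss0 : s < s0 by rewrite ltr_pdivrMr// ltr_pMr// ltr1n.
have gK y : K y -> good_ball Omega rho R2 y s /\ s < R1 y.
  move=> Ky; have Oy := KO y Ky; have [_ r1R0 r1R1 r1R2 _] := r1P y Oy.
  have /andP[sr _] := s0P y Ky; have sr1 : s < r1 y by exact: lt_le_trans sr.
  split; last exact: lt_le_trans r1R1.
  split => //; first exact: lt_le_trans r1R2.
  by apply: ins => //; exact: lt_le_trans r1R0.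
have d0q : d0 < p * qd by rewrite mulrC -ltr_pdivrMr.
have [th' [ka' [th'01 ka'01 dec]]] := osc_decay oOm bOm p1 mQ symQ qm bo mu_open C10 sg1 sob mdat dat1
  en_WQ Cl0 clevel tau01 Cs0 N11 q0 th1 ths qth cut N0 NN1 pqs t1 qqd (ltW qd1) datq en_opp
  C20 bfr1 poi C00 doubl Cg0 clog s_gt0 gK d0q.
have [cm cm0 hcm] := meas_lower bOm qm bo mu_open tau01 C00 doubl cK KO s_gt0 gK.
have [I I0 hI] := dat_upper oOm bOm qm bo mu_open mdat tau01 datq cK KO s_gt0 gK.
have [s2 /andP[s20 s21] {}dec] := dec cm I cm0 I0 hcm hI.
(* The exponent is fixed before u is introduced, which is the claimed independence. *)
exists (ln th' / ln ka'); first exact: holder_exponent_gt0.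
move=> u gu us; have ue := en_weak u gu us.
have [M M0 hM] := uniform_bound oOm bOm p1 mQ symQ qm bo mu_open C10 sg1 sob mdat dat1
  en_WQ Cl0 clevel tau01 Cs0 N11 q0 th1 ths qth cut N0 NN1 pqs t1 qqd (ltW qd1) datq en_opp
  cK KO s_gt0 gK ue.
apply: (holder_of_decay qm bo cK KO s20 s21 th'01 ka'01 M0 hM).
by move=> y Ky; apply: (dec u gu M ue M0 y Ky); exact: hM.
Qed.
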